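(* Let $\ell\equiv 2\pmod 3$ be a prime, let $K$ be a ramified quadratic extension of $\mathbb{Q}_\ell$, and let $p\neq\ell$ be a prime with $p\ge 5$. Let $E,E'$ be two elliptic curves over $K$, each having a $K$-rational point of order $3$, and each having potentially good reduction with defect $3$. Let $v$ denote the normalized valuation of $K$, and set $r=0$ if $v(\Delta(E))\equiv v(\Delta(E'))\pmod 3$ and $r=1$ otherwise. Suppose that $E[p]$ and $E'[p]$ are isomorphic as $\mathrm{Gal}(\overline{K}/K)$-modules. Then $E[p]$ and $E'[p]$ are symplectically isomorphic if and only if $\left(\frac{\ell}{p}\right)^r=1$. Furthermore, $E[p]$ and $E'[p]$ cannot be both symplectically and anti-symplectically isomorphic.
   Context: For an elliptic curve $E$ over a local field $K$ with potentially good reduction, the defect of $E$ is the degree of the minimal extension of the maximal unramified extension $K^{ur}$ over which $E$ attains good reduction. A Galois-module isomorphism $\phi:E[p]\to E'[p]$ is symplectic if $e'_p(\phi(P),\phi(Q))=e_p(P,Q)$ for all $P,Q$, where $e_p,e'_p$ are the Weil pairings, and anti-symplectic if $e'_p(\phi(P),\phi(Q))=e_p(P,Q)^{s}$ for a fixed quadratic non-residue $s$ modulo $p$. $E[p]$ and $E'[p]$ are called symplectically (resp. anti-symplectically) isomorphic if there exists a symplectic (resp. anti-symplectic) Galois-equivariant isomorphism between them. $\left(\frac{\cdot}{p}\right)$ is the Legendre symbol. *)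

(* Defs.v *)
From mathcomp Require Import all_boot all_order all_algebra all_field.
From Stdlib Require Import ClassicalEpsilon.

Set Implicit Arguments.
Unset Strict Implicit.
Unset Printing Implicit Defensive.

Import Order.TTheory GRing.Theory Num.Theory.

Local Open Scope ring_scope.

(** * Discrete valuations and the field of l-adic numbers *)

(* A discrete valuation is a function [v : F -> int] whose value at 0 is
   irrelevant; [val_ge v n x] is "v(x) >= n" with the convention v(0) = +oo. *)
Definition val_ge (F : fieldType) (v : F -> int) (n : int) (x : F) : Prop :=
  x = 0 \/ n <= v x.

Record normalized_valuation (F : fieldType) (v : F -> int) : Prop := {
  valM : forall x y : F, x != 0 -> y != 0 -> v (x * y) = v x + v y;
  valD : forall (n : int) (x y : F),
    val_ge v n x -> val_ge v n y -> val_ge v n (x + y);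
  val_onto : forall n : int, exists2 x : F, x != 0 & v x = n }.

Definition complete_valuation (F : fieldType) (v : F -> int) : Prop :=
  forall u : nat -> F,
    (forall n : int, exists N : nat, forall i j : nat,
       (N <= i)%N -> (N <= j)%N -> val_ge v n (u i - u j)) ->
    exists a : F, forall n : int, exists N : nat, forall i : nat,
       (N <= i)%N -> val_ge v n (u i - a).

Definition padic_val (l : nat) (q : rat) : int :=
  (logn l `|numq q|%N)%:Z - (logn l `|denq q|%N)%:Z.

(* (F, v) is Q_l with its l-adic valuation, i.e. the completion of Q for the
   l-adic valuation; this determines (F, v) up to a unique isomorphism. *)
Record is_Ql (l : nat) (F : fieldType) (v : F -> int) : Prop := {
  Ql_pchar0 : [pchar F] =i pred0;
  Ql_valuation : normalized_valuation v;
  Ql_padic : forall q : rat, q != 0 -> v (ratr q) = padic_val l q;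
  Ql_dense : forall (x : F) (n : int), exists q : rat, val_ge v n (x - ratr q);
  Ql_complete : complete_valuation v }.

(* [v] is the normalized valuation of [K], [e] is the ramification index. *)
Definition ramified (F : fieldType) (vF : F -> int) (K : fieldExtType F)
    (v : K -> int) : Prop :=
  exists e : nat, (1 < e)%N /\
    forall x : F, x != 0 -> v (x%:A) = e%:Z * vF x.

Definition is_algebraic_closure (K : fieldType) (Kbar : closedFieldType)
    (iota : {rmorphism K -> Kbar}) : Prop :=
  forall z : Kbar, algebraicOver iota z.

(** * Algebraic extensions of K, as subfields of an algebraic closure *)

Record is_subfield (F : fieldType) (L : F -> Prop) : Prop := {
  subfield1 : L 1;
  subfieldB : forall x y : F, L x -> L y -> L (x - y);
  subfieldM : forall x y : F, L x -> L y -> L (x * y);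
  subfieldV : forall x : F, L x -> L x^-1 }.

(* [L : M] = n *)
Definition ext_degree (F : fieldType) (M L : F -> Prop) (n : nat) : Prop :=
  exists b : 'I_n -> F,
    (forall i, L (b i)) /\
    forall x : F, L x -> exists! c : {ffun 'I_n -> F},
      (forall i, M (c i)) /\ x = \sum_(i < n) c i * b i.

Definition is_extension (F : fieldType) (M L : F -> Prop) : Prop :=
  is_subfield L /\ forall x : F, M x -> L x.

Definition is_finite_extension (F : fieldType) (M L : F -> Prop) : Prop :=
  is_extension M L /\ exists n : nat, ext_degree M L n.

Section LocalField.

Variables (K : fieldType) (v : K -> int).
Variables (Kbar : closedFieldType) (iota : {rmorphism K -> Kbar}).

Definition base (z : Kbar) : Prop := exists x : K, z = iota x.

(* The ring of integers of Kbar is the integral closure of that of K; the one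
   of a subfield L is its intersection with L. *)
Definition integral (z : Kbar) : Prop :=
  exists q : {poly K}, [/\ q \is monic,
    forall i : nat, val_ge v 0 q`_i & root (map_poly iota q) z].

Definition integral_unit (z : Kbar) : Prop :=
  [/\ z != 0, integral z & integral z^-1].

(* The ramification index of L over K is 1, i.e. L^* and K^* have the same
   value group.  Separability of the residue extension is not mentioned: it is
   automatic when, as for local fields, the residue field of K is finite. *)
Definition unramified (L : Kbar -> Prop) : Prop :=
  forall z : Kbar, L z -> z != 0 ->
    exists c : K, c != 0 /\ integral_unit (z / iota c).

(* K^ur is the compositum of the finite unramified extensions of K. *)
Definition Kur (z : Kbar) : Prop :=
  forall M : Kbar -> Prop, is_extension base M ->
    (forall L : Kbar -> Prop, is_finite_extension base L -> unramified L ->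
       forall x : Kbar, L x -> M x) ->
    M z.

Definition galois_aut (sigma : {rmorphism Kbar -> Kbar}) : Prop :=
  bijective sigma /\ forall x : K, sigma (iota x) = iota x.

End LocalField.

(** * Weierstrass curves *)

(* y^2 + a1 x y + a3 y = x^3 + a2 x^2 + a4 x + a6 *)
Record weierstrass (R : Type) :=
  Weierstrass { a1 : R; a2 : R; a3 : R; a4 : R; a6 : R }.

Definition map_weierstrass (R S : Type) (f : R -> S) (W : weierstrass R) :
    weierstrass S :=
  Weierstrass (f (a1 W)) (f (a2 W)) (f (a3 W)) (f (a4 W)) (f (a6 W)).

Section Weierstrass.

Variables (F : fieldType).
Implicit Types (W : weierstrass F).

Definition b2 W : F := a1 W ^+ 2 + 4 * a2 W.
Definition b4 W : F := 2 * a4 W + a1 W * a3 W.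
Definition b6 W : F := a3 W ^+ 2 + 4 * a6 W.
Definition b8 W : F :=
  a1 W ^+ 2 * a6 W + 4 * a2 W * a6 W - a1 W * a3 W * a4 W
  + a2 W * a3 W ^+ 2 - a4 W ^+ 2.

Definition disc W : F :=
  - b2 W ^+ 2 * b8 W - 8 * b4 W ^+ 3 - 27 * b6 W ^+ 2
  + 9 * b2 W * b4 W * b6 W.

(* The model obtained by the change of variables
   x = u^2 x' + r, y = u^3 y' + u^2 s x' + t. *)
Definition change_model (u r s t : F) W : weierstrass F :=
  Weierstrass
    ((a1 W + 2 * s) / u)
    ((a2 W - s * a1 W + 3 * r - s ^+ 2) / u ^+ 2)
    ((a3 W + r * a1 W + 2 * t) / u ^+ 3)
    ((a4 W - s * a3 W + 2 * r * a2 W - (t + r * s) * a1 W + 3 * r ^+ 2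
      - 2 * s * t) / u ^+ 4)
    ((a6 W + r * a4 W + r ^+ 2 * a2 W + r ^+ 3 - t * a3 W - t ^+ 2
      - r * t * a1 W) / u ^+ 6).

(* [None] is the point at infinity O. *)
Definition point : Type := option (F * F).

Definition oncurve W (P : point) : Prop :=
  if P is Some (x, y) then
    y ^+ 2 + a1 W * x * y + a3 W * y
    = x ^+ 3 + a2 W * x ^+ 2 + a4 W * x + a6 W
  else True.

(* The chord-tangent law; it is only meaningful for points on the curve. *)
Definition addpt W (P Q : point) : point :=
  match P, Q with
  | None, _ => Q
  | _, None => P
  | Some (x1, y1), Some (x2, y2) =>
    if (x1 == x2) && (y1 + y2 + a1 W * x2 + a3 W == 0) then None
    else
      let lam :=
        if x1 == x2 then
          (3 * x1 ^+ 2 + 2 * a2 W * x1 + a4 W - a1 W * y1)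
          / (2 * y1 + a1 W * x1 + a3 W)
        else (y2 - y1) / (x2 - x1) in
      let x3 := lam ^+ 2 + a1 W * lam - a2 W - x1 - x2 in
      Some (x3, - (y1 + lam * (x3 - x1)) - a1 W * x3 - a3 W)
  end.

Definition mulpt W (n : nat) (P : point) : point := iter n (addpt W P) None.

Definition torsion W (n : nat) (P : point) : Prop :=
  oncurve W P /\ mulpt W n P = None.

Definition has_order W (P : point) (n : nat) : Prop :=
  [/\ oncurve W P, (0 < n)%N, mulpt W n P = None &
      forall m : nat, (0 < m < n)%N -> mulpt W m P <> None].

End Weierstrass.

Record elliptic (F : fieldType) := Elliptic {
  model :> weierstrass F;
  disc_neq0 : disc model != 0 }.

(** * The Weil pairing *)

Section WeilPairing.

Variables (F : closedFieldType) (W : weierstrass F).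

(* In {poly {poly F}} the outer variable 'X stands for x, and the inner one
   'Y = 'X%:P for y. *)
Definition weierstrass_poly : {poly {poly F}} :=
  'Y ^+ 2 + (a1 W)%:P%:P * 'X * 'Y + (a3 W)%:P%:P * 'Y
  - ('X ^+ 3 + (a2 W)%:P%:P * 'X ^+ 2 + (a4 W)%:P%:P * 'X + (a6 W)%:P%:P).

(* Value at an affine point; the value at O is junk. *)
Definition evalpt (f : {poly {poly F}}) (P : point F) : F :=
  if P is Some (x, y) then f.[x, y] else 0.

(* ord_(x,y)(f) >= n, i.e. f is in (X - x, Y - y)^n + (weierstrass_poly). *)
Definition vanishes (f : {poly {poly F}}) (x y : F) (n : nat) : Prop :=
  exists (c : 'I_n.+1 -> {poly {poly F}}) (q : {poly {poly F}}),
    f = \sum_(i < n.+1)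
          c i * ('X - x%:P%:P) ^+ i * ('Y - y%:P%:P) ^+ (n - i)
        + q * weierstrass_poly.

Definition order_at (f : {poly {poly F}}) (x y : F) (n : nat) : Prop :=
  vanishes f x y n /\ ~ vanishes f x y n.+1.

(* div(f) = m (T) - m (O).  A polynomial function has no pole outside O and
   principal divisors have degree 0, so that its orders at the affine points
   determine its divisor. *)
Definition div_eq (f : {poly {poly F}}) (m : nat) (T : point F) : Prop :=
  forall x y : F, oncurve W (Some (x, y)) ->
    order_at f x y (if Some (x, y) == T then m else 0%N).

(* With div(f) = m (T) - m (O) and a rational function g = N / D such that
   f o [m] = g^m, one has e_m(S, T) = g(X + S) / g(X).  Equalities of rational
   functions are stated pointwise, wherever all the functions are defined
   (and points are affine). *)
Definition is_weil_pairing (m : nat) (S T : point F) (z : F) : Prop :=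
  exists f N D : {poly {poly F}},
    [/\ div_eq f m T,
        exists X : point F, [/\ X <> None, oncurve W X & evalpt D X != 0],
        forall X : point F, oncurve W X -> X <> None -> mulpt W m X <> None ->
          evalpt D X != 0 ->
          evalpt f (mulpt W m X) = (evalpt N X / evalpt D X) ^+ m
      & forall X : point F, oncurve W X -> X <> None -> addpt W X S <> None ->
          evalpt D X != 0 -> evalpt D (addpt W X S) != 0 ->
          evalpt N (addpt W X S) / evalpt D (addpt W X S)
          = z * (evalpt N X / evalpt D X)].

Definition weil_pairing (m : nat) (S T : point F) : F :=
  epsilon (inhabits 1) (is_weil_pairing m S T).

End WeilPairing.

(** * Reduction, and isomorphisms of torsion modules *)

Section EllipticOverLocalField.

Variables (K : fieldType) (v : K -> int).
Variables (Kbar : closedFieldType) (iota : {rmorphism K -> Kbar}).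
Implicit Types (E : elliptic K) (L M : Kbar -> Prop).

Definition integral_model (W : weierstrass Kbar) : Prop :=
  [/\ integral v iota (a1 W), integral v iota (a2 W), integral v iota (a3 W),
      integral v iota (a4 W) & integral v iota (a6 W)].

(* Over L, E has an integral Weierstrass model with nonsingular reduction. *)
Definition good_reduction_over E L : Prop :=
  exists u r s t : Kbar,
    [/\ [/\ L u, L r, L s & L t], u != 0,
        integral_model (change_model u r s t (map_weierstrass iota E))
      & integral_unit v iota
          (disc (change_model u r s t (map_weierstrass iota E)))].

Definition potentially_good_reduction E : Prop :=
  exists2 L, is_finite_extension (base iota) L & good_reduction_over E L.

Definition defect E (n : nat) : Prop :=
  exists L,
    [/\ is_extension (Kur v iota) L, good_reduction_over E L,
        forall M, is_finite_extension (Kur v iota) M ->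
          good_reduction_over E M -> forall x, L x -> M x
      & ext_degree (Kur v iota) L n].

Definition points E : weierstrass Kbar := map_weierstrass iota E.

Definition galois_act (sigma : {rmorphism Kbar -> Kbar}) (P : point Kbar) :
    point Kbar :=
  if P is Some (x, y) then Some (sigma x, sigma y) else None.

(* [phi] restricts to an isomorphism E[p] -> E'[p] of Gal(Kbar/K)-modules; its
   values outside E[p] are irrelevant. *)
Record galois_isomorphism E E' (p : nat) (phi : point Kbar -> point Kbar) :
    Prop := {
  galiso_torsion : forall P, torsion (points E) p P ->
    torsion (points E') p (phi P);
  galiso_inj : forall P Q, torsion (points E) p P -> torsion (points E) p Q ->
    phi P = phi Q -> P = Q;
  galiso_surj : forall Q, torsion (points E') p Q ->
    exists2 P, torsion (points E) p P & phi P = Q;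
  galiso_add : forall P Q, torsion (points E) p P -> torsion (points E) p Q ->
    phi (addpt (points E) P Q) = addpt (points E') (phi P) (phi Q);
  galiso_equivariant : forall sigma P, galois_aut iota sigma ->
    torsion (points E) p P ->
    phi (galois_act sigma P) = galois_act sigma (phi P) }.

Definition torsion_isomorphic E E' (p : nat) : Prop :=
  exists phi, galois_isomorphism E E' p phi.

(* e'_p(phi P, phi Q) = e_p(P, Q)^s on E[p] *)
Definition raises_weil_pairing E E' (p s : nat)
    (phi : point Kbar -> point Kbar) : Prop :=
  forall P Q, torsion (points E) p P -> torsion (points E) p Q ->
    weil_pairing (points E') p (phi P) (phi Q)
    = weil_pairing (points E) p P Q ^+ s.

Definition symplectically_isomorphic E E' (p : nat) : Prop :=
  exists2 phi, galois_isomorphism E E' p phi &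
    raises_weil_pairing E E' p 1 phi.

(* [s] is meant to be a quadratic non-residue modulo [p]. *)
Definition anti_symplectically_isomorphic E E' (p s : nat) : Prop :=
  exists2 phi, galois_isomorphism E E' p phi &
    raises_weil_pairing E E' p s phi.

End EllipticOverLocalField.

Definition legendre (a p : nat) : int :=
  if (p %| a)%N then 0
  else if [exists x : 'I_p, (x ^ 2 == a %[mod p])%N] then 1 else -1.

(* Main.v *)
(* With a point of order 3 at the origin, E becomes y^2 + A x y + B y = x^3.  The
   defect being 3, one has v(A^3 / B) > 0 and 3 does not divide v(B), and scaling by
   a cube root alpha of B turns E into a curve that reduces to C : y^2 + y = x^3.
   The Weil pairing is a product of values of chord functions, hence a polynomial
   expression in slopes and coordinates; reduction therefore maps E[p] to C[p]
   bijectively and respects Weil pairings.  On C[p], an automorphism sigma acts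
   through the residue field, twisted by (x, y) -> (z^2 x, y), where z is the
   reduction of sigma(alpha) / alpha.

   As v(disc E) = 4 v(B), the cocycle z' of E' is equal to z when r = 0 and to
   z^2 = z^l when r = 1.  In both cases the l^r-power Frobenius map of C lifts to a
   Galois isomorphism E[p] -> E'[p] that raises the Weil pairing to the power l^r.
   An inertia element J of order 3 and an automorphism tau with tau J = J^2 tau and
   1 + J + J^2 = 0 have only scalars as common commutant on E[p], so that every
   Galois isomorphism raises the Weil pairing to the power l^r a^2 for some a; it
   remains to compare l^r with squares modulo p. *)

From HB Require Import structures.
Require Import Defs.
From mathcomp Require Import all_boot all_order all_algebra all_field ring zify boolp.
From mathcomp Require classical_sets.

Set Implicit Arguments.
Unset Strict Implicit.
Unset Printing Implicit Defensive.

Import Order.TTheory GRing.Theory Num.Theory.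

Local Open Scope ring_scope.

(** * The coordinate ring of a Weierstrass curve *)

(** The pairing of the statement is specified by rational functions and their divisors, so a formula
    for it must be found before anything can be reduced. Let f_T be the product of chord functions
    with divisor p(T) - p(O). Dividing f_T at X by the corresponding product built from -X and taken
    at -T gives a p-th root of f_T o [p]; this, and its behaviour under translation, come from one
    symmetry: the chord function of P and Q takes at -R a value symmetric in P, Q and R. Exponents
    can be compared modulo p only if some value of the pairing differs from 1. This nondegeneracy is
    obtained from the trace g(X) + g(-X) of the p-th root g, without Galois theory of function
    fields. On the arithmetic side, ramification leaves K with the residue field of l elements. The
    residual action of automorphisms is abelian, so a commutator of automorphisms serves as inertia
    element. As l = 2 mod 3, the small residue field has no primitive cube root of unity, whence
    [tau], and all its elements are cubes, which makes the cocycles of two curves comparable. *)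

(* Field-level copies of library lemmas: the instance paths they display are
   the ones [lia] must recognise as equal. *)
Lemma size_polyN_field (F : fieldType) (p : {poly F}) : size (- p) = size p.
Proof. exact: size_polyN. Qed.
Lemma size_polyD_field (F : fieldType) (p q : {poly F}) :
  (size (p + q)%R <= maxn (size p) (size q))%N.
Proof. exact: size_polyD. Qed.
Lemma size_polyM_field (F : fieldType) (p q : {poly F}) :
  p != 0 -> q != 0 -> size (p * q) = (size p + size q).-1.
Proof. exact: size_mul. Qed.
Lemma size_polyMleq_field (F : fieldType) (p q : {poly F}) :
  (size (p * q)%R <= (size p + size q).-1)%N.
Proof. exact: size_polyMleq. Qed.

Definition coordring (F : fieldType) (W : weierstrass F) : Type :=
  ({poly F} * {poly F})%type.

Section CoordinateRing.

Variables (F : fieldType) (W : weierstrass F).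

Definition ycoef : {poly F} := (a1 W)%:P * 'X + (a3 W)%:P.
Definition cubic : {poly F} :=
  'X ^+ 3 + (a2 W)%:P * 'X ^+ 2 + (a4 W)%:P * 'X + (a6 W)%:P.

HB.instance Definition _ := GRing.Zmodule.copy (coordring W)
  ({poly F} * {poly F})%type.

Implicit Types f g h : coordring W.

(* [(a, b)] stands for [a + b y]. *)
Definition cr_mul f g : coordring W :=
  (f.1 * g.1 + f.2 * g.2 * cubic, f.1 * g.2 + f.2 * g.1 - f.2 * g.2 * ycoef).

Definition cr_one : coordring W := (1, 0).

Fact cr_mulA : associative cr_mul.
Proof. by move=> [a b] [c d] [e f]; rewrite /cr_mul /=; congr pair; ring. Qed.

Fact cr_mulC : commutative cr_mul.
Proof. by move=> [a b] [c d]; rewrite /cr_mul /=; congr pair; ring. Qed.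

Fact cr_mul1 : left_id cr_one cr_mul.
Proof. by move=> [a b]; rewrite /cr_mul /=; congr pair; ring. Qed.

Fact cr_mulDl : left_distributive cr_mul +%R.
Proof.
by move=> [a b] [c d] [e f]; rewrite /cr_mul /=; congr pair => /=; ring.
Qed.

Fact cr_one_neq0 : cr_one != 0.
Proof. by apply/eqP=> /(congr1 fst) /= /eqP; rewrite oner_eq0. Qed.

HB.instance Definition _ := GRing.Zmodule_isComNzRing.Build (coordring W)
  cr_mulA cr_mulC cr_mul1 cr_mulDl cr_one_neq0.

Lemma cr_mulE f g : f * g =
  (f.1 * g.1 + f.2 * g.2 * cubic, f.1 * g.2 + f.2 * g.1 - f.2 * g.2 * ycoef).
Proof. by []. Qed.

Definition cr_poly (a : {poly F}) : coordring W := (a, 0).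
Definition cr_y : coordring W := (0, 1).

Fact cr_poly_zmod : zmod_morphism cr_poly.
Proof. by move=> a b; congr pair => /=; ring. Qed.
Fact cr_poly_monoid : monoid_morphism cr_poly.
Proof. by split=> // a b; rewrite cr_mulE /=; congr pair; ring. Qed.
HB.instance Definition _ := GRing.isZmodMorphism.Build _ _ cr_poly cr_poly_zmod.
HB.instance Definition _ := GRing.isMonoidMorphism.Build _ _ cr_poly
  cr_poly_monoid.

Lemma cr_decomp f : f = cr_poly f.1 + cr_poly f.2 * cr_y.
Proof. by case: f => a b; rewrite cr_mulE /=; congr pair => /=; ring. Qed.

Definition cr_conj f : coordring W := (f.1 - f.2 * ycoef, - f.2).

Fact cr_conj_zmod : zmod_morphism cr_conj.
Proof. by move=> [a b] [c d]; congr pair => /=; ring. Qed.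
Fact cr_conj_monoid : monoid_morphism cr_conj.
Proof.
split=> [|[a b] [c d]]; rewrite ?cr_mulE /cr_conj /=.
  by congr pair => /=; ring.
by congr pair => /=; ring.
Qed.
HB.instance Definition _ := GRing.isZmodMorphism.Build _ _ cr_conj cr_conj_zmod.
HB.instance Definition _ := GRing.isMonoidMorphism.Build _ _ cr_conj
  cr_conj_monoid.

Lemma cr_conjK : involutive cr_conj.
Proof. by move=> [a b]; rewrite /cr_conj /=; congr pair => /=; ring. Qed.

Definition cr_norm f : {poly F} :=
  f.1 ^+ 2 - f.1 * f.2 * ycoef - f.2 ^+ 2 * cubic.

Lemma cr_mul_conj f : f * cr_conj f = cr_poly (cr_norm f).
Proof.
by case: f => a b; rewrite cr_mulE /cr_poly /cr_norm /=; congr pair => /=; ring.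
Qed.

Lemma cr_normM f g : cr_norm (f * g) = cr_norm f * cr_norm g.
Proof. by case: f g => [a b] [c d]; rewrite cr_mulE /cr_norm /=; ring. Qed.

Lemma cr_norm_poly a : cr_norm (cr_poly a) = a ^+ 2.
Proof. by rewrite /cr_norm /=; ring. Qed.

Lemma size_cubic : size cubic = 4.
Proof.
rewrite /cubic -!addrA size_polyDl size_polyXn //.
apply: leq_ltn_trans (size_polyD_field _ _) _; rewrite gtn_max.
apply/andP; split.
  rewrite mul_polyC; apply: leq_ltn_trans (size_scale_leq _ _) _.
  by rewrite size_polyXn.
apply: leq_ltn_trans (size_polyD_field _ _) _; rewrite gtn_max.
rewrite mul_polyC (leq_ltn_trans (size_scale_leq _ _)) ?size_polyX //=.
exact: leq_ltn_trans (size_polyC_leq1 _) _.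
Qed.

Lemma monic_cubic : cubic \is monic.
Proof.
rewrite monicE lead_coefE size_cubic /cubic !coefD !coefCM !coefXn !coefX coefC.
by rewrite /= !mulr0 !addr0.
Qed.

Lemma size_ycoef : (size ycoef <= 2)%N.
Proof.
rewrite /ycoef; apply: leq_trans (size_polyD_field _ _) _; rewrite geq_max.
rewrite mul_polyC (leq_trans (size_scale_leq _ _)) ?size_polyX //=.
exact: leq_trans (size_polyC_leq1 _) _.
Qed.

(* The leading coefficient at infinity, where [x] has a pole of order 2 and [y]
   a pole of order 3. *)
Definition cr_top0 f : bool := (f.2 == 0) || (size f.2 + 1 < size f.1)%N.
Definition cr_lc f : F :=
  if cr_top0 f then lead_coef f.1 else lead_coef f.2.

Lemma lead_coefD_lt (p q : {poly F}) : (size q < size p)%N ->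
  lead_coef (p + q) = lead_coef p /\ size (p + q) = size p.
Proof. by move=> h; rewrite lead_coefDl // size_polyDl. Qed.

Lemma cr_lc_polyM (a : {poly F}) g :
  cr_lc (cr_poly a * g) = lead_coef a * cr_lc g.
Proof.
have [->|a0] := eqVneq a 0.
  by rewrite rmorph0 mul0r lead_coef0 mul0r /cr_lc /cr_top0 eqxx /= lead_coef0.
rewrite /cr_lc /cr_top0 cr_mulE /= !mul0r !addr0 subr0 mulf_eq0 (negbTE a0) /=.
have [->|g20] := eqVneq g.2 0; first by rewrite lead_coefM.
have [->|g10] := eqVneq g.1 0.
  by rewrite !mulr0 size_poly0 !ltn0 lead_coefM.
rewrite !size_polyM_field //= -!subn1.
have -> : (size a + size g.2 - 1 + 1 < size a + size g.1 - 1)%N =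
          (size g.2 + 1 < size g.1)%N.
  by move: a0; rewrite -size_poly_gt0 => a0; apply/idP/idP; lia.
by case: ifP; rewrite lead_coefM.
Qed.

(** The terms a and b y have pole orders 2 deg a and 2 deg b + 3 at infinity, of different parity,
    so one of them dominates and leading terms never cancel. The four cases are the choices of
    dominant term in the two factors; when both are y-terms, y^2 is replaced by the monic
    [cubic]. *)
Fact cr_lcM_generic (a b c d : {poly F}) : b != 0 -> d != 0 ->
  (if (a * d + b * c - b * d * ycoef == 0)
      || (size (a * d + b * c - b * d * ycoef)%R + 1 <
          size (a * c + b * d * cubic)%R)%N
   then lead_coef (a * c + b * d * cubic)
   else lead_coef (a * d + b * c - b * d * ycoef))
  = (if (size b + 1 < size a)%N then lead_coef a else lead_coef b) *
    (if (size d + 1 < size c)%N then lead_coef c else lead_coef d).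
Proof.
move=> b0 d0.
have sab : (size (a * c)%R <= (size a + size c).-1)%N := size_polyMleq_field a c.
have sad : (size (a * d)%R <= (size a + size d).-1)%N := size_polyMleq_field a d.
have sbc : (size (b * c)%R <= (size b + size c).-1)%N := size_polyMleq_field b c.
have sbd : size (b * d) = (size b + size d).-1 by rewrite size_polyM_field.
have bd0 : b * d != 0 by rewrite mulf_neq0.
have sb : (0 < size b)%N by rewrite size_poly_gt0.
have sd : (0 < size d)%N by rewrite size_poly_gt0.
have cub0 : cubic != 0 by rewrite -size_poly_gt0 size_cubic.
have sbdc : size (b * d * cubic) = (size b + size d + 2)%N.
  by rewrite size_polyM_field // sbd size_cubic; lia.
have sbde : (size (b * d * ycoef)%R <= (size (b * d)%R + size ycoef).-1)%N :=
  size_polyMleq_field _ _.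
have sye := size_ycoef.
have lbdc : lead_coef (b * d * cubic) = lead_coef b * lead_coef d.
  by rewrite !lead_coefM (monicP monic_cubic) mulr1.
have s2 : (size (a * d + b * c - b * d * ycoef)%R <=
   maxn (size (a * d)%R) (maxn (size (b * c)%R) (size (b * d * ycoef)%R)))%N.
  rewrite -addrA; apply: leq_trans (size_polyD_field _ _) _.
  rewrite geq_max leq_maxl /= (leq_trans (size_polyD_field _ _)) //.
  by rewrite size_polyN_field leq_maxr.
have [sa|sa] := ltnP (size b + 1) (size a);
  have [sc|sc] := ltnP (size d + 1) (size c).
- have a0 : a != 0 by rewrite -size_poly_gt0; lia.
  have c0 : c != 0 by rewrite -size_poly_gt0; lia.
  have sac : size (a * c) = (size a + size c).-1 by rewrite size_polyM_field.
  have [l1 s1] : lead_coef (a * c + b * d * cubic) = lead_coef (a * c) /\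
      size (a * c + b * d * cubic) = size (a * c).
    by apply: lead_coefD_lt; lia.
  by rewrite s1 l1 lead_coefM ifT //; apply/orP; right; lia.
- have a0 : a != 0 by rewrite -size_poly_gt0; lia.
  have sad' : size (a * d) = (size a + size d).-1 by rewrite size_polyM_field.
  have [l1 s1] : lead_coef (a * d + (b * c - b * d * ycoef)) = lead_coef (a * d)
      /\ size (a * d + (b * c - b * d * ycoef)) = size (a * d).
    apply: lead_coefD_lt; apply: leq_ltn_trans (size_polyD_field _ _) _.
    by rewrite size_polyN_field; lia.
  have s3 : (size (a * c + b * d * cubic)%R <= size (a * d)%R + 1)%N.
    by apply: leq_trans (size_polyD_field _ _) _; lia.
  rewrite -!addrA l1 s1 lead_coefM ifF //; apply/norP; split.
    by rewrite -size_poly_eq0 s1; lia.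
  by rewrite -leqNgt.
- have c0 : c != 0 by rewrite -size_poly_gt0; lia.
  have sbc' : size (b * c) = (size b + size c).-1 by rewrite size_polyM_field.
  have [l1 s1] : lead_coef (b * c + (a * d - b * d * ycoef)) = lead_coef (b * c)
      /\ size (b * c + (a * d - b * d * ycoef)) = size (b * c).
    apply: lead_coefD_lt; apply: leq_ltn_trans (size_polyD_field _ _) _.
    by rewrite size_polyN_field; lia.
  have s3 : (size (a * c + b * d * cubic)%R <= size (b * c)%R + 1)%N.
    by apply: leq_trans (size_polyD_field _ _) _; lia.
  rewrite [a * d + _]addrC -!addrA l1 s1 lead_coefM ifF //; apply/norP; split.
    by rewrite -size_poly_eq0 s1; lia.
  by rewrite -leqNgt.
have [l1 s1] : lead_coef (b * d * cubic + a * c) = lead_coef (b * d * cubic) /\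
    size (b * d * cubic + a * c) = size (b * d * cubic).
  by apply: lead_coefD_lt; lia.
by rewrite [a * c + _]addrC s1 l1 lbdc ifT //; apply/orP; right; lia.
Qed.

Lemma cr_lcM f g : cr_lc (f * g) = cr_lc f * cr_lc g.
Proof.
have [f20|f20] := eqVneq f.2 0.
  have -> : f = cr_poly f.1 by case: f f20 => ? ? /= ->.
  by rewrite cr_lc_polyM {2}/cr_lc /cr_top0 eqxx.
have [g20|g20] := eqVneq g.2 0.
  have -> : g = cr_poly g.1 by case: g g20 => ? ? /= ->.
  by rewrite mulrC cr_lc_polyM [in RHS]mulrC {2}/cr_lc /cr_top0 eqxx.
rewrite {2 3}/cr_lc /cr_top0 (negbTE f20) (negbTE g20).
exact: cr_lcM_generic.
Qed.

Lemma cr_lc1 : cr_lc 1 = 1.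
Proof. by rewrite /cr_lc /cr_top0 /= eqxx lead_coef1. Qed.

Lemma cr_lc_poly a : cr_lc (cr_poly a) = lead_coef a.
Proof. by rewrite /cr_lc /cr_top0 /= eqxx. Qed.

Lemma cr_lc_eq0 f : (cr_lc f == 0) = (f == 0).
Proof.
apply/idP/eqP => [|->]; last by rewrite /cr_lc /cr_top0 eqxx /= lead_coef0.
rewrite /cr_lc /cr_top0; case: f => a b /=; have [->|b0] := eqVneq b 0 => /=.
  by rewrite lead_coef_eq0 => /eqP ->.
case: ifP => h; rewrite lead_coef_eq0 => /eqP e0; last by rewrite e0 eqxx in b0.
by rewrite e0 size_poly0 in h.
Qed.

Fact cr_mulf_eq0 f g : f * g = 0 -> (f == 0) || (g == 0).
Proof.
move=> h; have := cr_lcM f g; rewrite h => /esym /eqP e.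
by rewrite -!cr_lc_eq0 -mulf_eq0 (eqP e) cr_lc_eq0.
Qed.

Lemma cr_norm_neq0 f : f != 0 -> cr_norm f != 0.
Proof.
move=> f0; apply/eqP => n0; have := cr_mul_conj f; rewrite n0 rmorph0.
move=> /cr_mulf_eq0; rewrite (negbTE f0) /= => /eqP e.
by rewrite -[f]cr_conjK e rmorph0 eqxx in f0.
Qed.

(** The degree of the norm is the pole order at infinity: even for a function of x alone, odd and at
    least 3 when the y-term dominates. This is the part of Riemann-Roch that makes distinct points
    inequivalent. *)
Lemma size_cr_norm f : size (cr_norm f) <> 2 /\
  (size (cr_norm f) = 1%N -> f.2 = 0 /\ size f.1 = 1%N) /\
  (size (cr_norm f) = 3 -> f.2 = 0).
Proof.
case: f => a b; rewrite /cr_norm /=; have [->|b0] := eqVneq b 0.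
  rewrite mulr0 mul0r !expr2 mul0r mul0r !subr0.
  have [->|a0] := eqVneq a 0; first by rewrite mulr0 size_poly0.
  rewrite size_polyM_field //; split; first lia.
  by split=> // h; split=> //; move: h => /=; lia.
have sb : (0 < size b)%N by rewrite size_poly_gt0.
have cub0 : cubic != 0 by rewrite -size_poly_gt0 size_cubic.
have sbb : size (b ^+ 2 * cubic) = (size b + size b + 2)%N.
  by rewrite size_polyM_field ?expf_neq0 // expr2 size_polyM_field // size_cubic; lia.
have sab : (size (a * b * ycoef)%R <= size a + size b)%N.
  apply: leq_trans (size_polyMleq_field _ _) _; have := size_polyMleq_field a b.
  have := size_ycoef; lia.
have saa : (size (a ^+ 2)%R <= (size a + size a).-1)%N.
  by rewrite expr2 size_polyMleq_field.
have [sa|sa] := ltnP (size b + 1) (size a).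
  have a0 : a != 0 by rewrite -size_poly_gt0; lia.
  have sa2 : size (a ^+ 2) = (size a + size a).-1 by rewrite expr2 size_polyM_field.
  have -> : size (a ^+ 2 - a * b * ycoef - b ^+ 2 * cubic) = size (a ^+ 2).
    rewrite -addrA size_polyDl //; apply: leq_ltn_trans (size_polyD_field _ _) _.
    by rewrite !size_polyN_field; lia.
  by split; [lia | split; lia].
have -> : size (a ^+ 2 - a * b * ycoef - b ^+ 2 * cubic) = size (b ^+ 2 * cubic).
  rewrite addrC size_polyDl ?size_polyN_field //.
  apply: leq_ltn_trans (size_polyD_field _ _) _.
  by rewrite !size_polyN_field; lia.
by split; [lia | split; lia].
Qed.

Definition cr_unit : {pred coordring W} :=
  fun f => (f.2 == 0) && (size f.1 == 1)%N.
Definition cr_inv f : coordring W := if cr_unit f then cr_poly f.1^-1 else f.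

Fact cr_mulVx : {in cr_unit, left_inverse 1 cr_inv *%R}.
Proof.
move=> f; rewrite /cr_inv unfold_in => uf; rewrite ifT //.
case: f uf => a b /andP[/= /eqP -> /size_poly1P[c c0 ->]].
rewrite -[X in _ * X]/(cr_poly c%:P) -rmorphM mulVr ?rmorph1 //.
by rewrite poly_unitE size_polyC c0 /= coefC eqxx unitfE.
Qed.

Fact cr_unitP f g : g * f = 1 -> cr_unit f.
Proof.
move=> /(congr1 cr_norm); rewrite cr_normM -[1 in RHS]/(cr_poly 1) cr_norm_poly.
rewrite expr1n => h.
have n1 : size (cr_norm f) = 1%N.
  have := congr1 (fun p : {poly F} => size p) h.
  rewrite size_poly1 size_polyM_field; last 2 first.
  - by apply/eqP=> e; move: h; rewrite e mul0r => /esym/eqP; rewrite oner_eq0.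
  - by apply/eqP=> e; move: h; rewrite e mulr0 => /esym/eqP; rewrite oner_eq0.
  have: cr_norm f != 0.
    by apply/eqP=> e; move: h; rewrite e mulr0 => /esym/eqP; rewrite oner_eq0.
  have: cr_norm g != 0.
    by apply/eqP=> e; move: h; rewrite e mul0r => /esym/eqP; rewrite oner_eq0.
  rewrite -!size_poly_gt0; lia.
have [_ [/(_ n1) [f20 f1] _]] := size_cr_norm f.
by rewrite /cr_unit f20 f1 !eqxx.
Qed.

Fact cr_invr_out : {in [predC cr_unit], cr_inv =1 id}.
Proof. by move=> f uf; rewrite /cr_inv ifF //; apply: negbTE uf. Qed.

HB.instance Definition _ := GRing.ComNzRing_hasMulInverse.Build (coordring W)
  cr_mulVx cr_unitP cr_invr_out.
HB.instance Definition _ := GRing.ComUnitRing_isIntegral.Build (coordring W)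
  cr_mulf_eq0.

Lemma cr_unit_const f : f \is a GRing.unit ->
  exists2 c, c != 0 & f = cr_poly c%:P.
Proof.
case: f => a b /andP[/= /eqP -> /size_poly1P[c c0 ->]].
by exists c.
Qed.

Definition cr_eval (P : F * F) f : F := f.1.[P.1] + f.2.[P.1] * P.2.

Lemma cr_evalD P f g : cr_eval P (f + g) = cr_eval P f + cr_eval P g.
Proof.
by rewrite /cr_eval -[f + g]/(f.1 + g.1, f.2 + g.2) /= !hornerD; ring.
Qed.
Lemma cr_evalN P f : cr_eval P (- f) = - cr_eval P f.
Proof. by rewrite /cr_eval -[- f]/(- f.1, - f.2) /= !hornerN; ring. Qed.
Lemma cr_evalB P f g : cr_eval P (f - g) = cr_eval P f - cr_eval P g.
Proof. by rewrite cr_evalD cr_evalN. Qed.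
Lemma cr_eval_poly P a : cr_eval P (cr_poly a) = a.[P.1].
Proof. by rewrite /cr_eval /= horner0 mul0r addr0. Qed.
Lemma cr_eval0 P : cr_eval P 0 = 0.
Proof. by rewrite -(rmorph0 cr_poly) cr_eval_poly horner0. Qed.
Lemma cr_eval1 P : cr_eval P 1 = 1.
Proof. by rewrite -(rmorph1 cr_poly) cr_eval_poly hornerC. Qed.
Lemma cr_eval_y P : cr_eval P cr_y = P.2.
Proof. by rewrite /cr_eval /= horner0 hornerC mul1r add0r. Qed.
Lemma cr_evalM P f g : oncurve W (Some P) ->
  cr_eval P (f * g) = cr_eval P f * cr_eval P g.
Proof.
case: P => x y /= h; rewrite /cr_eval cr_mulE /=.
rewrite !(hornerD, hornerN, hornerM, hornerC, hornerX).
have -> : a6 W = y ^+ 2 + a1 W * x * y + a3 W * y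
                 - (x ^+ 3 + a2 W * x ^+ 2 + a4 W * x) by rewrite h; ring.
by ring.
Qed.
Lemma cr_eval_sum P I (r : seq I) (E : I -> coordring W) :
  cr_eval P (\sum_(i <- r) E i) = \sum_(i <- r) cr_eval P (E i).
Proof. exact: (big_morph _ (cr_evalD P) (cr_eval0 P)). Qed.
Lemma cr_evalX P f n : oncurve W (Some P) ->
  cr_eval P (f ^+ n) = cr_eval P f ^+ n.
Proof.
by move=> h; elim: n => [|n IH]; rewrite ?cr_eval1 // !exprS cr_evalM ?IH.
Qed.

End CoordinateRing.

(** * Products of ideals in a commutative ring *)

Section Ideals.

Variable (A : comNzRingType).
Implicit Types (I J K : A -> Prop) (f g : A).

Definition is_ideal I :=
  [/\ I 0, forall f g, I f -> I g -> I (f + g) & forall f g, I g -> I (f * g)].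

(** The intersection of all ideals that contain the products: finite sums of products never have to
    be handled. *)
Definition iprod I J : A -> Prop := fun f =>
  forall K, is_ideal K -> (forall g h, I g -> J h -> K (g * h)) -> K f.

Definition princ f : A -> Prop := fun g => exists q, g = q * f.
Definition gen2 f g : A -> Prop := fun h => exists a b, h = a * f + b * g.

Lemma idealN I f : is_ideal I -> I f -> I (- f).
Proof. by case=> _ _ h If; rewrite -mulN1r; apply: h. Qed.

Lemma idealB I f g : is_ideal I -> I f -> I g -> I (f - g).
Proof. by move=> hI If Ig; case: (hI) => _ hD _; apply: hD => //; apply: idealN. Qed.

Lemma ideal_princ f : is_ideal (princ f).
Proof.
split=> [|g h [a ->] [b ->]|g h [a ->]].
- by exists 0; rewrite mul0r.
- by exists (a + b); rewrite mulrDl.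
- by exists (g * a); rewrite mulrA.
Qed.

Lemma ideal_gen2 f g : is_ideal (gen2 f g).
Proof.
split=> [|h k [a [b ->]] [c [d ->]]|h k [a [b ->]]].
- by exists 0, 0; rewrite !mul0r addr0.
- by exists (a + c), (b + d); ring.
- by exists (h * a), (h * b); ring.
Qed.

Lemma ideal_iprod I J : is_ideal (iprod I J).
Proof.
split=> [K [] //|f g If Ig K hK h|f g Ig K hK h].
  by case: (hK) => _ hD _; apply: hD; [apply: If|apply: Ig].
by case: (hK) => _ _; apply; apply: Ig.
Qed.

Lemma iprod_in I J f g : I f -> J g -> iprod I J (f * g).
Proof. by move=> If Jg K _; apply. Qed.

(** Functional and propositional extensionality turn equivalent ideals into equal ones, so that
    computations with divisors become rewriting with [iprodA] and [iprodC]. *)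
Lemma ideal_ext I J : (forall f, I f <-> J f) -> I = J.
Proof. by move=> h; apply: funext => f; apply: propext. Qed.

Lemma iprodC : commutative iprod.
Proof.
move=> I J; apply: ideal_ext => f; split=> h K hK hIJ; apply: h => // g k;
  by move=> ? ?; rewrite mulrC; apply: hIJ.
Qed.

Lemma iprodA : associative iprod.
Proof.
move=> I J L; apply: ideal_ext => f; split=> h K [K0 KD KM] hK;
  apply: h; try by split.
  move=> g x Ig hx; apply: (hx (fun x => K (g * x))); first split.
  - by rewrite mulr0.
  - by move=> ? ? ? ?; rewrite mulrDr; apply: KD.
  - by move=> ? ? ?; rewrite mulrCA; apply: KM.
  by move=> a b Ja Lb; rewrite mulrA; apply: hK => //; apply: iprod_in.
move=> x g hx Lg; apply: (hx (fun x => K (x * g))); first split.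
- by rewrite mul0r.
- by move=> ? ? ? ?; rewrite mulrDl; apply: KD.
- by move=> ? ? ?; rewrite -mulrA; apply: KM.
by move=> a b Ia Jb; rewrite -mulrA; apply: hK => //; apply: iprod_in.
Qed.

Lemma iprodCA : left_commutative iprod.
Proof. by move=> I J K; rewrite !iprodA [iprod I J]iprodC. Qed.

Lemma iprod_princl f I : is_ideal I ->
  iprod (princ f) I = fun h => exists2 g, I g & h = f * g.
Proof.
case=> I0 ID IM; apply: ideal_ext => h; split.
  move=> hh; apply: (hh (fun h => exists2 g, I g & h = f * g)); first split.
  - by exists 0; [exact: I0 | rewrite mulr0].
  - by move=> _ _ [a Ia ->] [b Ib ->]; exists (a + b); [exact: ID | rewrite mulrDr].
  - by move=> a _ [b Ib ->]; exists (a * b); [exact: IM | rewrite mulrCA].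
  move=> _ b [q ->] Ib; exists (q * b); first exact: IM.
  by rewrite mulrCA mulrA.
by move=> [g Ig ->]; apply: iprod_in => //; exists 1; rewrite mul1r.
Qed.

Lemma princM f g : iprod (princ f) (princ g) = princ (f * g).
Proof.
rewrite iprod_princl; last exact: ideal_princ.
apply: ideal_ext => h; split=> [[_ [q ->] ->]|[q ->]].
  by exists q; rewrite mulrCA.
by exists (q * g); [exists q | rewrite mulrCA].
Qed.

Lemma iprod_gen2 f g h : iprod (princ f) (gen2 g h) = gen2 (f * g) (f * h).
Proof.
rewrite iprod_princl; last exact: ideal_gen2.
apply: ideal_ext => k; split=> [[_ [a [b ->]] ->]|[a [b ->]]].
  by exists a, b; ring.
by exists (a * g + b * h); [exists a, b | ring].
Qed.

Lemma iprod1 I : is_ideal I -> iprod (princ 1) I = I.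
Proof.
move=> hI; rewrite iprod_princl //; apply: ideal_ext => f; split=> [[g Ig ->]|If].
  by rewrite mul1r.
by exists f; rewrite ?mul1r.
Qed.

Lemma gen2C f g : gen2 f g = gen2 g f.
Proof.
by apply: ideal_ext => h; split=> -[a [b ->]]; exists b, a; rewrite addrC.
Qed.

Lemma gen2N f g : gen2 f (- g) = gen2 f g.
Proof.
by apply: ideal_ext => h; split=> -[a [b ->]]; exists a, (- b);
  rewrite ?mulrNN ?mulNr ?mulrN.
Qed.

Definition ipow I n : A -> Prop := iter n (iprod I) (princ 1).

Lemma ideal_ipow I n : is_ideal (ipow I n).
Proof. by case: n => [|n]; [apply: ideal_princ | apply: ideal_iprod]. Qed.

End Ideals.

Lemma iprod_cancel (A : idomainType) (f : A) (I J : A -> Prop) :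
  f != 0 -> is_ideal I -> is_ideal J ->
  iprod (princ f) I = iprod (princ f) J -> I = J.
Proof.
move=> f0 hI hJ; rewrite !iprod_princl // => e; apply: ideal_ext => g.
have e' : (exists2 g', I g' & f * g = f * g') = (exists2 g', J g' & f * g = f * g').
  by have := congr1 (fun S : A -> Prop => S (f * g)) e.
split=> h.
  have [g' Jg /(mulfI f0) ->//] : exists2 g', J g' & f * g = f * g'.
  by rewrite -e'; exists g.
have [g' Ig /(mulfI f0) ->//] : exists2 g', I g' & f * g = f * g'.
by rewrite e'; exists g.
Qed.

(** * Chords, slopes and the third point of intersection *)

Section GroupLaw.

Variables (F : fieldType).

Lemma disc_change_model (W : weierstrass F) (u r s t : F) : u != 0 ->
  disc (change_model u r s t W) * u ^+ 12 = disc W.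
Proof.
move=> u0; rewrite /disc /b2 /b4 /b6 /b8 /change_model /=.
by field.
Qed.

Variable (W : weierstrass F).
Hypothesis (W_disc : disc W != 0).
Implicit Types (P Q R : point F) (p q : F * F).

(** Moving the point to the origin kills [a6], and the two vanishing partial derivatives kill [a3]
    and [a4]; the discriminant of such a model is 0. *)
Lemma nonsingular p : oncurve W (Some p) ->
  2 * p.2 + a1 W * p.1 + a3 W = 0 ->
  3 * p.1 ^+ 2 + 2 * a2 W * p.1 + a4 W - a1 W * p.2 = 0 -> False.
Proof.
case: p => x y /= h e1 e2; move/eqP: W_disc; apply.
have := @disc_change_model W 1 x 0 y (oner_neq0 _).
rewrite expr1n mulr1 => <-.
set W' := change_model _ _ _ _ _.
have h3 : a3 W' = 0 by rewrite /= expr1n divr1 -[RHS]e1; ring.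
have h4 : a4 W' = 0 by rewrite /= expr1n divr1 -[RHS]e2; ring.
have h6 : a6 W' = 0.
  rewrite /=; have -> : a6 W = y ^+ 2 + a1 W * x * y + a3 W * y
                 - (x ^+ 3 + a2 W * x ^+ 2 + a4 W * x) by rewrite h; ring.
  by rewrite expr1n divr1; ring.
by rewrite /disc /b2 /b4 /b6 /b8 h3 h4 h6; ring.
Qed.

Definition negc p : F * F := (p.1, - p.2 - a1 W * p.1 - a3 W).
Definition negpt P : point F := if P is Some p then Some (negc p) else None.

Lemma negcK : involutive negc.
Proof. by case=> x y; rewrite /negc /=; congr pair; ring. Qed.
Lemma negptK : involutive negpt.
Proof. by case=> [p|] //=; rewrite negcK. Qed.

Lemma negpt_oncurve P : oncurve W P -> oncurve W (negpt P).
Proof.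
case: P => [[x y]|] //= h.
have -> : a6 W = y ^+ 2 + a1 W * x * y + a3 W * y
                 - (x ^+ 3 + a2 W * x ^+ 2 + a4 W * x) by rewrite h; ring.
by ring.
Qed.

Definition opposite p q : bool :=
  (p.1 == q.1) && (p.2 + q.2 + a1 W * q.1 + a3 W == 0).

Lemma oppositeP p q : opposite p q = (q == negc p).
Proof.
case: p q => [x y] [x' y']; rewrite /opposite /negc /= -pair_eqE /pair_eq /=.
rewrite [x == _]eq_sym; have [->|//] := eqVneq x' x => /=.
by rewrite -[y' == _]subr_eq0; congr (_ == 0); ring.
Qed.

Definition slope p q : F :=
  if p.1 == q.1 then
    (3 * p.1 ^+ 2 + 2 * a2 W * p.1 + a4 W - a1 W * p.2)
    / (2 * p.2 + a1 W * p.1 + a3 W)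
  else (q.2 - p.2) / (q.1 - p.1).

Definition third p q (lam : F) : F :=
  lam ^+ 2 + a1 W * lam - a2 W - p.1 - q.1.

Lemma addpt0 P : addpt W P None = P.
Proof. by case: P => [[x y]|]. Qed.

Lemma addptE p q : addpt W (Some p) (Some q) =
  if opposite p q then None else
  Some (negc (third p q (slope p q),
    p.2 + slope p q * (third p q (slope p q) - p.1))).
Proof. by case: p q => [x y] [x' y']. Qed.

(* The last equation is the difference of the curve equations at [q] and [p],
   divided by [q.1 - p.1]; it is the tangency condition when [p = q]. *)
Definition chord p q (lam : F) : Prop :=
  [/\ oncurve W (Some p), oncurve W (Some q), q.2 = p.2 + lam * (q.1 - p.1) &
   lam * (p.2 + q.2) + a1 W * (p.2 + lam * q.1) + a3 W * lam =
   p.1 ^+ 2 + p.1 * q.1 + q.1 ^+ 2 + a2 W * (p.1 + q.1) + a4 W].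

Lemma same_x p q : oncurve W (Some p) -> oncurve W (Some q) -> p.1 = q.1 ->
  p = q \/ q = negc p.
Proof.
case: p q => [x y] [x' y'] /= h h' e; subst x'.
have: (y' - y) * (y' - (negc (x, y)).2) = 0.
  rewrite /=; apply: (@addrI _ (a6 W)); rewrite addr0.
  have {1}-> : a6 W = y ^+ 2 + a1 W * x * y + a3 W * y
                 - (x ^+ 3 + a2 W * x ^+ 2 + a4 W * x) by rewrite h; ring.
  have -> : a6 W = y' ^+ 2 + a1 W * x * y' + a3 W * y'
                 - (x ^+ 3 + a2 W * x ^+ 2 + a4 W * x) by rewrite h'; ring.
  by ring.
move/eqP; rewrite mulf_eq0 !subr_eq0 => /orP[/eqP->|/eqP->]; [by left|].
by right.
Qed.

Lemma slope_chord p q : oncurve W (Some p) -> oncurve W (Some q) ->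
  ~~ opposite p q -> chord p q (slope p q).
Proof.
move=> hp hq; have [e|ne] := eqVneq p.1 q.1; last first.
  move=> _; have d0 : q.1 - p.1 != 0 by rewrite subr_eq0 eq_sym.
  have e2 : q.2 = p.2 + slope p q * (q.1 - p.1).
    by rewrite /slope (negbTE ne); field.
  split=> //; apply: (mulfI d0); move: hp hq e2 {d0 ne}; move: (slope p q) => lam.
  case: p q => [x y] [x' y'] /= h h' e2; rewrite e2 in h' *.
  apply: (@addrI _ (a6 W)).
  have {1}-> : a6 W = y ^+ 2 + a1 W * x * y + a3 W * y
                 - (x ^+ 3 + a2 W * x ^+ 2 + a4 W * x) by rewrite h; ring.
  have -> : a6 W = (y + lam * (x' - x)) ^+ 2 + a1 W * x' * (y + lam * (x' - x))
                 + a3 W * (y + lam * (x' - x))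
                 - (x' ^+ 3 + a2 W * x' ^+ 2 + a4 W * x') by rewrite h'; ring.
  by ring.
case: (same_x hp hq e) => [<-|->]; rewrite oppositeP ?eqxx // => ne.
have d0 : 2 * p.2 + a1 W * p.1 + a3 W != 0.
  apply: contra ne => /eqP e0; apply/eqP; case: (p) e0 => x y /= e0.
  by rewrite /negc /=; congr pair; rewrite -[RHS]addr0 -e0; ring.
split=> //; first by rewrite subrr mulr0 addr0.
by rewrite /slope eqxx; field.
Qed.

Lemma chord_third p q lam : chord p q lam ->
  let x := third p q lam in oncurve W (Some (x, p.2 + lam * (x - p.1))).
Proof.
case: p q => [x y] [x' y'] [/= h h' -> /= e]; rewrite /third /=.
have e4 : a4 W = lam * (y + (y + lam * (x' - x))) + a1 W * (y + lam * x')
  + a3 W * lam - (x ^+ 2 + x * x' + x' ^+ 2 + a2 W * (x + x')) by rewrite e; ring.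
have -> : a6 W = y ^+ 2 + a1 W * x * y + a3 W * y
                 - (x ^+ 3 + a2 W * x ^+ 2 + a4 W * x) by rewrite h; ring.
by rewrite e4; ring.
Qed.

Lemma addpt_oncurve P Q : oncurve W P -> oncurve W Q -> oncurve W (addpt W P Q).
Proof.
case: P Q => [p|] [q|] hp hq //; first last.
  by case: p hp.
rewrite addptE; case: ifPn => // /(slope_chord hp hq)/chord_third.
by move/negpt_oncurve.
Qed.

Definition cr_line p (lam : F) : coordring W :=
  (- (p.2%:P + lam%:P * ('X - p.1%:P)), 1).
Definition cr_vert (x : F) : coordring W := cr_poly W ('X - x%:P).

End GroupLaw.

Lemma poly_root_decomp (F : fieldType) (p : {poly F}) (c : F) :
  exists q, p = p.[c]%:P + q * ('X - c%:P).
Proof.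
have /factor_theorem[q e] : root (p - p.[c]%:P) c.
  by rewrite rootE hornerD hornerN hornerC subrr.
by exists q; rewrite -e addrC subrK.
Qed.

(** * Maximal ideals of points and ideals of lines *)

Section PointIdeals.

Variables (F : fieldType) (W : weierstrass F).
Hypothesis (W_disc : disc W != 0).
Implicit Types (P Q R : point F) (p q : F * F) (f g : coordring W).

Lemma cr_ext f g : f.1 = g.1 -> f.2 = g.2 -> f = g.
Proof. by case: f g => [a b] [c d] /= -> ->. Qed.

Definition pt_ideal P : coordring W -> Prop :=
  if P is Some p then fun f => cr_eval p f = 0 else fun _ => True.

Local Notation mI := pt_ideal.

Lemma mI_None : mI None = princ 1.
Proof. by apply: ideal_ext => f; split=> // _; exists f; rewrite mulr1. Qed.

Lemma ideal_mI P : oncurve W P -> is_ideal (mI P).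
Proof.
case: P => [p|] hp; split=> //=; first exact: cr_eval0.
  by move=> f g; rewrite cr_evalD => -> ->; rewrite addr0.
by move=> f g h; rewrite cr_evalM // h mulr0.
Qed.

Lemma eval_vert p x : cr_eval p (cr_vert W x) = p.1 - x.
Proof. by rewrite cr_eval_poly !hornerE. Qed.

Lemma eval_line p q lam :
  cr_eval q (cr_line W p lam) = q.2 - (p.2 + lam * (q.1 - p.1)).
Proof. by rewrite /cr_eval /= !hornerE addrC. Qed.

(** Since the y-coefficient of [f] is an invertible constant, subtracting a multiple of [f] removes
    the y-part of any function vanishing at p; the polynomial in x that remains has the root
    x(p). *)
Lemma mI_gen2 p f k : oncurve W (Some p) -> f.2 = k%:P -> k != 0 ->
  cr_eval p f = 0 -> mI (Some p) = gen2 (cr_vert W p.1) f.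
Proof.
move=> hp f2 k0 fp; apply: ideal_ext => g; split=> /=; last first.
  by move=> [a [b ->]]; rewrite cr_evalD !cr_evalM // fp eval_vert subrr !mulr0 addr0.
move=> gp; have [q1 e1] := poly_root_decomp (g.1 - g.2 * (k^-1)%:P * f.1) p.1.
exists (cr_poly W q1), (cr_poly W (g.2 * (k^-1)%:P)).
have ev0 : (g.1 - g.2 * (k^-1)%:P * f.1).[p.1] = 0.
  have -> : (g.1 - g.2 * (k^-1)%:P * f.1).[p.1] =
            cr_eval p g - g.2.[p.1] * k^-1 * cr_eval p f.
    by rewrite /cr_eval f2 !hornerE; field.
  by rewrite fp gp mulr0 subr0.
rewrite ev0 add0r in e1.
have kk : (k^-1)%:P * k%:P = 1 :> {poly F} by rewrite -polyCM mulVf.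
apply: cr_ext; rewrite /cr_vert !cr_mulE /=.
  by rewrite !mul0r !addr0 -e1 subrK.
by rewrite f2 !mul0r !mulr0 !addr0 !add0r !subr0 -mulrA kk mulr1 ?oppr0 ?add0r.
Qed.

Lemma mI_line p q lam : oncurve W (Some q) -> q.2 = p.2 + lam * (q.1 - p.1) ->
  mI (Some q) = gen2 (cr_vert W q.1) (cr_line W p lam).
Proof.
move=> hq e; apply: (@mI_gen2 q _ 1) => //; rewrite ?oner_eq0 //.
by rewrite eval_line e subrr.
Qed.

Definition tangent_num p : F :=
  3 * p.1 ^+ 2 + 2 * a2 W * p.1 + a4 W - a1 W * p.2.
Definition tangent_den p : F := 2 * p.2 + a1 W * p.1 + a3 W.

(* The curve equation expanded at the point [p]. *)
Lemma cr_taylor p : oncurve W (Some p) ->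
  let u := cr_vert W p.1 in let v := cr_line W p 0 in
  cr_poly W (tangent_den p)%:P * v + v * v + cr_poly W (a1 W)%:P * u * v =
  cr_poly W (tangent_num p)%:P * u
  + u * u * cr_poly W ('X + (2 * p.1 + a2 W)%:P).
Proof.
case: p => x y /= h.
have e6 : (a6 W)%:P = (y ^+ 2 + a1 W * x * y + a3 W * y
                 - (x ^+ 3 + a2 W * x ^+ 2 + a4 W * x))%:P :> {poly F}.
  by congr (_%:P); rewrite h; ring.
rewrite /cr_vert /tangent_den /tangent_num; apply: cr_ext;
  rewrite !(cr_mulE, =^~ surjective_pairing) /=;
  rewrite /cr_mul /cubic /ycoef /= ?e6; ring.
Qed.

Lemma eval_conj p f : cr_eval p (cr_conj f) = cr_eval (negc W p) f.
Proof.
by rewrite /cr_eval /cr_conj /ycoef /= !(hornerD, hornerN, hornerM, hornerC, hornerX); ring.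
Qed.

End PointIdeals.
Arguments pt_ideal {F} W P f.

Section LineIdeals.

Variables (F : fieldType) (W : weierstrass F).
Hypothesis (W_disc : disc W != 0).
Implicit Types (P Q R : point F) (p q : F * F) (f g : coordring W).
Local Notation mI := (pt_ideal W).
Local Notation vert := (cr_vert W).
Local Notation line := (cr_line W).
Local Notation const c := (cr_poly W c%:P).

Lemma line_shift p q lam mu : q.2 = p.2 + lam * (q.1 - p.1) ->
  line q mu = line p lam - const (mu - lam) * vert q.1.
Proof.
move=> e; rewrite /cr_vert -rmorphM; apply: cr_ext => /=; last by rewrite subr0.
rewrite /cr_line /= e; ring.
Qed.

Lemma line_shift0 p lam mu :
  line p lam = line p mu - const (lam - mu) * vert p.1.
Proof. by apply: line_shift; rewrite subrr mulr0 addr0. Qed.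

Lemma const_cancel c f : c != 0 -> const c^-1 * (const c * f) = f.
Proof. by move=> c0; rewrite mulrA -rmorphM -polyCM mulVf // mul1r. Qed.

Lemma vertB x y : vert x - vert y = const (y - x).
Proof. by rewrite /cr_vert -rmorphB; congr cr_poly; rewrite polyCB; ring. Qed.

(** The Mumford representation of the divisor (p) + (q). The point is that the line lies in the
    product ideal: for distinct abscissas x(p) - x(q) times the line is a combination of products,
    and for a tangent [cr_taylor] expresses [tangent_den] times the line by products of functions
    vanishing at p. *)
Lemma mumford p q lam : chord W p q lam ->
  p.1 != q.1 \/ p = q /\ tangent_den W p != 0 ->
  iprod (mI (Some p)) (mI (Some q)) = gen2 (vert p.1 * vert q.1) (line p lam).
Proof.
move=> [hp hq e t] ndeg.
have mp : mI (Some p) = gen2 (vert p.1) (line p lam).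
  by apply: mI_line => //; rewrite subrr mulr0 addr0.
have mq : mI (Some q) = gen2 (vert q.1) (line p lam) by apply: mI_line.
have lp : mI (Some p) (line p lam) by rewrite /= eval_line subrr mulr0 addr0 subrr.
have lq : mI (Some q) (line p lam) by rewrite /= eval_line e subrr.
have vp : mI (Some p) (vert p.1) by rewrite /= eval_vert subrr.
have vq : mI (Some q) (vert q.1) by rewrite /= eval_vert subrr.
apply: ideal_ext => f; split.
  apply; first exact: ideal_gen2.
  rewrite mp mq => _ _ [a [b ->]] [c [d ->]].
  exists (a * c), (a * vert p.1 * d + b * c * vert q.1 + b * d * line p lam).
  by ring.
move=> [a [b ->]]; have hI := ideal_iprod (mI (Some p)) (mI (Some q)).
have [_ ID IM] := hI; have IB f g := @idealB _ _ f g hI.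
apply: (ID); apply: (IM); first exact: iprod_in.
case: ndeg => [ne|[epq d0]].
  rewrite -[line p lam](@const_cancel (p.1 - q.1)) ?subr_eq0 //; apply: (IM).
  rewrite -vertB mulrBl; apply: (IB); last exact: iprod_in.
  by rewrite mulrC; apply: iprod_in.
subst q; rewrite -[line p lam](const_cancel _ d0); apply: (IM).
have el : line p lam = line p 0 - const lam * vert p.1.
  by rewrite (line_shift0 p lam 0) subr0.
have v0 : mI (Some p) (line p 0) by rewrite /= eval_line mul0r addr0 subrr.
have et : tangent_num W p = lam * tangent_den W p.
  rewrite /tangent_num /tangent_den; apply/eqP; rewrite -subr_eq0; apply/eqP.
  rewrite -[RHS](subrr (lam * (p.2 + p.2) + a1 W * (p.2 + lam * p.1) + a3 W * lam)).
  by rewrite {1}t; ring.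
have := cr_taylor hp; rewrite /= et polyCM rmorphM => tay.
have -> : const (tangent_den W p) * line p lam =
   cr_poly W ('X + (2 * p.1 + a2 W)%:P) * (vert p.1 * vert p.1)
   - (line p 0 * line p 0 + const (a1 W) * (vert p.1 * line p 0)).
  have e2 : const (tangent_den W p) * line p 0 =
     const lam * const (tangent_den W p) * vert p.1
     + vert p.1 * vert p.1 * cr_poly W ('X + (2 * p.1 + a2 W)%:P)
     - line p 0 * line p 0 - const (a1 W) * vert p.1 * line p 0.
    by rewrite -tay; ring.
  by rewrite el mulrBr e2; ring.
apply: (IB); first by apply: (IM); apply: iprod_in.
apply: (ID); first exact: iprod_in.
by apply: (IM); apply: iprod_in.
Qed.

(** Eliminating y between line and curve leaves a cubic in x whose roots are the three abscissas;
    the sign is that of [cubic] in [cr_norm]. *)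
Lemma norm_line p q lam : chord W p q lam ->
  line p lam * cr_conj (line p lam) =
  - (vert p.1 * vert q.1 * vert (third W p q lam)).
Proof.
rewrite cr_mul_conj /cr_vert -!rmorphM -rmorphN => -[hp hq e t]; congr cr_poly.
have e4 : a4 W = lam * (p.2 + q.2) + a1 W * (p.2 + lam * q.1)
  + a3 W * lam - (p.1 ^+ 2 + p.1 * q.1 + q.1 ^+ 2 + a2 W * (p.1 + q.1)).
  by rewrite t; ring.
move: hp e e4 {t hq}; case: p q => [x y] [x' y'] /= h -> e4.
have e6 : (a6 W) = (y ^+ 2 + a1 W * x * y + a3 W * y
                 - (x ^+ 3 + a2 W * x ^+ 2 + a4 W * x)).
  by rewrite h; ring.
rewrite /cr_norm /cubic /ycoef /third /= e6 e4; ring.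
Qed.

Lemma vert_neq0 x : vert x != 0.
Proof.
rewrite -cr_lc_eq0 /cr_vert cr_lc_poly (monicP (monicXsubC x)).
exact: oner_neq0.
Qed.

Lemma line_neq0 p lam : line p lam != 0.
Proof.
by apply/eqP => /(congr1 (fun f => f.2)) /= /eqP; rewrite oner_eq0.
Qed.

(** By [cr_taylor] the horizontal lines through p and -p multiply to a multiple of x - x(p).
    Conversely, [tangent_den] times x - x(p) is a combination of products; when p has order 2 this
    constant vanishes, and [tangent_num], nonzero by [nonsingular], takes its place. *)
Lemma vert_ideal_aff p : oncurve W (Some p) ->
  iprod (mI (Some p)) (mI (Some (negc W p))) = princ (vert p.1).
Proof.
move=> hp; have hn : oncurve W (Some (negc W p)) by apply: (negpt_oncurve (P := Some p)).
have mp : mI (Some p) = gen2 (vert p.1) (line p 0).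
  by apply: mI_line => //; rewrite mul0r addr0.
have mn : mI (Some (negc W p)) = gen2 (vert p.1) (line (negc W p) 0).
  by apply: mI_line; rewrite // mul0r addr0.
have en : line (negc W p) 0 = line p 0 + const (tangent_den W p).
  apply: cr_ext; rewrite /= ?addr0 // /tangent_den polyC0 !mul0r !addr0.
  rewrite !(polyCB, polyCN, polyCD, polyCM); ring.
have tay := cr_taylor hp; rewrite /= in tay.
apply: ideal_ext => f; split.
  apply; first exact: ideal_princ.
  rewrite mp mn => _ _ [a [b ->]] [c [d ->]].
  have e2 : line p 0 * line (negc W p) 0 = vert p.1 * (const (tangent_num W p)
      + vert p.1 * cr_poly W ('X + (2 * p.1 + a2 W)%:P) - const (a1 W) * line p 0).
    rewrite en mulrDr; have -> : line p 0 * line p 0 = const (tangent_num W p) * vert p.1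
      + vert p.1 * vert p.1 * cr_poly W ('X + (2 * p.1 + a2 W)%:P) -
      const (tangent_den W p) * line p 0 - const (a1 W) * vert p.1 * line p 0.
      by rewrite -tay; ring.
    by ring.
  exists (a * c * vert p.1 + a * d * line (negc W p) 0 + b * c * line p 0 +
     b * d * (const (tangent_num W p)
      + vert p.1 * cr_poly W ('X + (2 * p.1 + a2 W)%:P) - const (a1 W) * line p 0)).
  transitivity (a * c * vert p.1 * vert p.1 + a * d * line (negc W p) 0 * vert p.1 +
    b * c * line p 0 * vert p.1 + b * d * (line p 0 * line (negc W p) 0)).
    by ring.
  by rewrite e2; ring.
move=> [g ->]; have hI := ideal_iprod (mI (Some p)) (mI (Some (negc W p))).
have [_ ID IM] := hI; have IB f g := @idealB _ _ f g hI.
apply: (IM).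
have vp : mI (Some p) (vert p.1) by rewrite /= eval_vert subrr.
have vn : mI (Some (negc W p)) (vert p.1) by rewrite /= eval_vert subrr.
have lp : mI (Some p) (line p 0) by rewrite /= eval_line mul0r addr0 subrr.
have ln : mI (Some (negc W p)) (line (negc W p) 0).
  by rewrite /= eval_line mul0r addr0 subrr.
have [d0|d0] := eqVneq (tangent_den W p) 0; last first.
  rewrite -[vert _](const_cancel _ d0); apply: (IM).
  have -> : const (tangent_den W p) * vert p.1 =
     vert p.1 * line (negc W p) 0 - line p 0 * vert p.1 by rewrite en; ring.
  by apply: (IB); apply: iprod_in.
have n0 : tangent_num W p != 0.
  by apply/eqP => n0; apply: (nonsingular W_disc hp).
rewrite -[vert _](const_cancel _ n0); apply: (IM).
rewrite d0 polyC0 rmorph0 addr0 in en; rewrite d0 polyC0 rmorph0 mul0r add0r in tay.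
rewrite en in ln.
have -> : const (tangent_num W p) * vert p.1 = line p 0 * line p 0
   + const (a1 W) * (vert p.1 * line p 0)
   - cr_poly W ('X + (2 * p.1 + a2 W)%:P) * (vert p.1 * vert p.1).
  by rewrite mulrA tay; ring.
apply: (IB).
  by apply: (ID); [|apply: (IM)]; apply: iprod_in.
by apply: (IM); apply: iprod_in.
Qed.

Definition lin P Q : coordring W :=
  match P, Q with
  | None, None => 1
  | None, Some q => vert q.1
  | Some p, None => vert p.1
  | Some p, Some q => if opposite W p q then vert p.1 else line p (slope W p q)
  end.
Definition vertp P : coordring W := if P is Some p then vert p.1 else 1.

Lemma vertp_neq0 P : vertp P != 0.
Proof. by case: P => [p|] /=; rewrite ?vert_neq0 ?oner_neq0. Qed.

Lemma lin_neq0 P Q : lin P Q != 0.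
Proof.
case: P Q => [p|] [q|] //=; rewrite ?vert_neq0 ?oner_neq0 //.
by case: ifP; rewrite ?vert_neq0 ?line_neq0.
Qed.

Lemma vertp_ideal P : oncurve W P -> iprod (mI P) (mI (negpt W P)) = princ (vertp P).
Proof.
case: P => [p|] hp; first exact: vert_ideal_aff.
by rewrite /= -/(mI None) mI_None iprod1 //; apply: ideal_princ.
Qed.

Lemma lin_ideal P Q : oncurve W P -> oncurve W Q ->
  iprod (mI P) (iprod (mI Q) (mI (negpt W (addpt W P Q)))) = princ (lin P Q).
Proof.
case: P Q => [p|] [q|] hp hq; last first.
- by rewrite /= -/(mI None) mI_None !iprod1 //; apply: ideal_princ.
- rewrite [mI None]mI_None iprod1; last exact: ideal_iprod.
  exact: (vertp_ideal hq).
- rewrite addpt0 [mI None]mI_None iprod1; first exact: (vertp_ideal hp).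
  by apply: ideal_mI; apply: (negpt_oncurve hp).
rewrite addptE /lin; case: ifPn => [|nopp].
  rewrite oppositeP => /eqP ->; rewrite [mI (negpt _ None)]mI_None.
  rewrite [iprod _ (princ 1)]iprodC iprod1; first exact: (vertp_ideal hp).
  by apply: ideal_mI; apply: (negpt_oncurve hp).
have ch := slope_chord hp hq nopp; move: (slope W p q) ch nopp => lam ch nopp.
have h3 := chord_third ch; move: h3; set x3 := third _ _ _ _ => h3.
rewrite /= negcK.
set r := (x3, _).
have nd : p.1 != q.1 \/ p = q /\ tangent_den W p != 0.
  have [e|] := eqVneq p.1 q.1; [right|by left].
  case: (same_x hp hq e) => e'; last by rewrite oppositeP e' eqxx in nopp.
  subst q; split=> //; apply: contra nopp => /eqP d0; rewrite /opposite eqxx /=.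
  by rewrite -d0 /tangent_den; apply/eqP; ring.
have hn : oncurve W (Some (negc W r)) by apply: (negpt_oncurve (P := Some r)).
rewrite iprodA (mumford ch nd).
(* Multiplied by x - x3, the Mumford generators become the line times the generators of the ideal of
   the reflected point, by [norm_line]; that ideal and the ideal of the third point multiply back to
   x - x3. *)
apply: (iprod_cancel (vert_neq0 x3)); try exact: ideal_iprod.
  exact: ideal_princ.
rewrite iprodA iprod_gen2.
have mr : mI (Some (negc W r)) = gen2 (vert x3) (cr_conj (line p lam)).
  apply: (@mI_gen2 _ _ _ _ (-1)) => //=; first by rewrite polyCN.
    by rewrite oppr_eq0 oner_eq0.
  by rewrite eval_conj negcK eval_line subrr.
have -> : gen2 (vert x3 * (vert p.1 * vert q.1)) (vert x3 * line p lam) =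
   iprod (princ (line p lam)) (mI (Some (negc W r))).
  rewrite mr iprod_gen2 (norm_line ch) gen2N gen2C.
  by congr gen2; rewrite -/x3; ring.
rewrite -iprodA [iprod (mI _) _]iprodC (vertp_ideal (P := Some r)) //.
by rewrite iprodC.
Qed.

End LineIdeals.

(** Used by [ip_ac], which proves equalities of products of ideals up to order: each factor of the
    right side is brought to the front on the left and removed. *)
Ltac ip_front y :=
  repeat match goal with
  | |- ?L = _ => match L with
     | context [iprod ?x (iprod y ?z)] => rewrite [in LHS](iprodCA x y z)
     | context [iprod ?x y] => rewrite [in LHS](iprodC x y)
     end
  end.
Ltac ip_ac :=
  rewrite -?iprodA;
  repeat match goal with
  | |- ?x = ?x => reflexivity
  | |- _ = iprod ?y _ => ip_front y; congr (iprod _ _)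
  end.

(** * The group law *)

Section PointGroup.

Variables (F : fieldType) (W : weierstrass F).
Hypothesis (W_disc : disc W != 0).
Implicit Types (P Q R : point F) (p q : F * F) (f g : coordring W).
Local Notation mI := (pt_ideal W).
Local Notation const c := (cr_poly W c%:P).
Local Notation neg := (negpt W).
Local Notation add := (addpt W).

Lemma princ_eq (f g : coordring W) : g != 0 -> princ f = princ g ->
  exists2 k, k != 0 & f = const k * g.
Proof.
move=> g0 e.
have [a ea] : princ g f by rewrite -e; exists 1; rewrite mul1r.
have [b eb] : princ f g by rewrite e; exists 1; rewrite mul1r.
have ba : b * a = 1 by apply: (mulIf g0); rewrite mul1r -mulrA -ea -eb.
have /cr_unit_const[k k0 ek] : a \is a GRing.unit.
  by apply/unitrP; exists b; split=> //; rewrite mulrC.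
by exists k; rewrite // -ek.
Qed.

Definition conj_ideal (I : coordring W -> Prop) := fun f => I (cr_conj f).

Lemma conj_iprod (I J : coordring W -> Prop) :
  conj_ideal (iprod I J) = iprod (conj_ideal I) (conj_ideal J).
Proof.
have sub I' J' f : iprod I' J' f -> iprod (conj_ideal I') (conj_ideal J') (cr_conj f).
  move=> h; apply: (h (fun g => iprod (conj_ideal I') (conj_ideal J') (cr_conj g))).
    have [K0 KD KM] := ideal_iprod (conj_ideal I') (conj_ideal J').
    by split=> [|a b|a b]; rewrite ?rmorph0 ?rmorphD ?rmorphM; auto.
  by move=> a b Ia Jb; rewrite rmorphM; apply: iprod_in; rewrite /conj_ideal cr_conjK.
have inv I' : conj_ideal (conj_ideal I') = I'.
  by apply: ideal_ext => f; rewrite /conj_ideal cr_conjK.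
apply: ideal_ext => f; split=> h; first by rewrite -[f]cr_conjK; apply: sub.
by have := sub _ _ _ h; rewrite !inv.
Qed.

Lemma conj_princ f : conj_ideal (princ f) = princ (cr_conj f).
Proof.
apply: ideal_ext => g; split=> -[q e]; exists (cr_conj q).
  by rewrite -[g]cr_conjK -rmorphM; congr (cr_conj _).
by rewrite e -[f in RHS]cr_conjK -rmorphM.
Qed.

Lemma conj_pt P : conj_ideal (mI P) = mI (neg P).
Proof.
case: P => [p|] //; apply: ideal_ext => f.
by rewrite /conj_ideal /= eval_conj.
Qed.

Lemma pt_ideal_inj P Q : oncurve W P -> oncurve W Q -> mI P = mI Q -> P = Q.
Proof.
case: P Q => [p|] [q|] // hp hq e; last 2 first.
- have : pt_ideal W (Some p) 1 by rewrite e.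
  by rewrite /= cr_eval1 => /eqP; rewrite oner_eq0.
- have : pt_ideal W (Some q) 1 by rewrite -e.
  by rewrite /= cr_eval1 => /eqP; rewrite oner_eq0.
have h1 : pt_ideal W (Some q) (cr_vert W p.1) by rewrite -e /= eval_vert subrr.
have h2 : pt_ideal W (Some q) (cr_line W p 0).
  by rewrite -e /= eval_line mul0r addr0 subrr.
move: h1 h2 => /=; rewrite eval_vert eval_line mul0r addr0.
move=> /eqP; rewrite subr_eq0 => /eqP e1 /eqP; rewrite subr_eq0 => /eqP e2.
by rewrite [p]surjective_pairing -e1 -e2 -surjective_pairing.
Qed.

(* A function whose divisor is [P + (-Q)] has a norm of degree at most 2, which
   forces it to be a polynomial in [x]. *)
Lemma ideal_class_inj P Q (c d : coordring W) :
  oncurve W P -> oncurve W Q -> c != 0 -> d != 0 ->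
  iprod (princ c) (mI P) = iprod (princ d) (mI Q) -> P = Q.
Proof.
move=> hP hQ c0 d0 e.
have hP' := negpt_oncurve hP; have hQ' := negpt_oncurve hQ.
have e1 : iprod (princ c) (iprod (mI P) (mI (neg Q))) = princ (d * vertp W Q).
  by rewrite iprodA e -iprodA vertp_ideal // princM.
have [h Jh eh] : exists2 h, iprod (mI P) (mI (neg Q)) h & d * vertp W Q = c * h.
  have : princ (d * vertp W Q) (d * vertp W Q) by exists 1; rewrite mul1r.
  by rewrite -e1 iprod_princl; last exact: ideal_iprod.
have h0 : h != 0.
  apply/eqP => h0; move/eqP: eh; rewrite h0 mulr0 mulf_eq0 (negbTE d0) /=.
  by rewrite (negbTE (vertp_neq0 _ _)).
have eJ : princ h = iprod (mI P) (mI (neg Q)).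
  apply: (iprod_cancel c0); first exact: ideal_princ.
    exact: ideal_iprod.
  by rewrite princM -eh e1.
have en : princ (h * cr_conj h) = princ (vertp W P * vertp W Q).
  rewrite -princM -conj_princ eJ conj_iprod !conj_pt negptK.
  rewrite -[iprod (iprod (mI P) _) _]iprodA [iprod (mI (neg Q)) _]iprodC.
  rewrite -iprodA [iprod (mI Q) _]vertp_ideal // iprodA vertp_ideal //.
  by rewrite princM.
have vv0 : vertp W P * vertp W Q != 0 by rewrite mulf_neq0 // vertp_neq0.
have [k k0 ek] := princ_eq vv0 en.
have Jh0 : forall p, P = Some p -> cr_eval p h = 0.
  move=> p eP; have : mI P h; last by rewrite eP.
  apply: Jh; first exact: ideal_mI.
  by move=> a b Pa _; have [_ _ IM] := ideal_mI hP; rewrite mulrC; apply: IM.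
have Jh1 : forall q, Q = Some q -> cr_eval (negc W q) h = 0.
  move=> q eQ; have : mI (neg Q) h; last by rewrite eQ.
  apply: Jh; first exact: ideal_mI.
  by move=> a b _ Pb; have [_ _ IM] := ideal_mI hQ'; apply: IM.
rewrite cr_mul_conj in ek.
have [s2 [_ s3]] := size_cr_norm h.
have nE : cr_norm h = k *: ((vertp W P).1 * (vertp W Q).1).
  have := congr1 fst ek; rewrite /= !mul0r !addr0 => ->.
  by rewrite mul_polyC; case: (P) (Q) => [?|] [?|] /=; rewrite ?mul0r ?addr0.
case eP: P Q hQ hQ' Jh1 nE eJ {e1 en vv0 e eh ek Jh} hP hP' => [p|] [q|] // hQ hQ' Jh1 nE eJ hP hP'.
- have sn : size (cr_norm h) = 3.
    by rewrite nE size_scale // size_mul ?polyXsubC_eq0 // !size_XsubC.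
  have h2 := s3 sn.
  have e3 : (h.1 ^+ 2) = k *: (('X - p.1%:P) * ('X - q.1%:P)).
    by move: nE; rewrite /cr_norm h2 mulr0 mul0r expr0n mul0r !subr0.
  have sh : size h.1 = 2.
    have : size (h.1 ^+ 2) = 3 by rewrite e3 -sn nE.
    have h10 : h.1 != 0 by apply: contraNneq h0 => h1; apply/eqP/cr_ext.
    have sz n : ((n + n).-1 = 3 -> n = 2)%N by lia.
    by rewrite expr2 size_mul // => /sz.
  have r1 : h.1.[p.1] = 0 by have := Jh0 _ eP; rewrite /cr_eval h2 horner0 mul0r addr0.
  have r2 : h.1.[q.1] = 0.
    by have := Jh1 _ erefl; rewrite /cr_eval h2 horner0 mul0r addr0.
  have ex : p.1 = q.1.
    apply/eqP; apply/negPn/negP => ne.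
    have : (size [:: p.1; q.1] < size h.1)%N.
      apply: max_poly_roots => /=.
      - by rewrite -size_poly_gt0 sh.
      - by rewrite !rootE r1 r2 eqxx.
      - by rewrite inE ne.
    by rewrite sh.
  have [->//|eq] := same_x hP hQ ex.
  (* In the remaining case q = -p, so that h has divisor 2(p), while as a multiple of x - x(p) it
     has divisor (p) + (-p). Cancelling gives p = -p = q. *)
  have hv : princ h = princ (cr_vert W p.1).
    have [a ea] := factor_theorem _ _ (introT eqP r1).
    have sa : size a = 1%N.
      have a0 : a != 0.
        by apply/eqP => a0; move: sh; rewrite ea a0 mul0r size_poly0.
      have sz n : ((n + 2).-1 = 2 -> n = 1)%N by lia.
      by move: sh; rewrite ea size_Mmonic ?monicXsubC // size_XsubC => /sz.
    have /size_poly1P[u u0 eu] : size a == 1%N by apply/eqP.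
    have -> : h = const u * cr_vert W p.1.
      apply: cr_ext; rewrite /cr_vert /= ?h2 ?mul0r ?mulr0 ?addr0 ?subr0 //.
      by rewrite ea eu.
    apply: ideal_ext => g; split=> -[b ->].
      by exists (b * const u); rewrite mulrA.
    exists (b * const u^-1); rewrite mulrA -[b * _ * _]mulrA -rmorphM -polyCM.
    by rewrite mulVf // mulr1.
  rewrite hv eq /= negcK -vert_ideal_aff // in eJ.
  have : mI (neg (Some p)) = mI (Some p).
    apply: (iprod_cancel (vert_neq0 W p.1)).
    - by apply: ideal_mI; apply: negpt_oncurve.
    - exact: ideal_mI.
    by rewrite -vert_ideal_aff // {1}eJ -iprodA [RHS]iprodC.
  by move/pt_ideal_inj => <- //=; rewrite -?eq // ?negcK.
- by case: s2; rewrite nE mulr1 size_scale // size_XsubC.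
by case: s2; rewrite nE mul1r size_scale // size_XsubC.
Qed.

Lemma addptN P : oncurve W P -> add P (neg P) = None.
Proof.
by case: P => [p|] // hp; rewrite /neg addptE oppositeP eqxx.
Qed.

(** Multiplication by the ideal of -(P + Q) makes the common factors principal, so that
    [ideal_class_inj] applies. *)
Lemma sum_unique P Q R S (c d : coordring W) :
  oncurve W P -> oncurve W Q -> oncurve W R -> oncurve W S -> c != 0 -> d != 0 ->
  iprod (princ c) (iprod (mI P) (iprod (mI Q) (mI R))) =
  iprod (princ d) (iprod (mI P) (iprod (mI Q) (mI S))) -> R = S.
Proof.
move=> hP hQ hR hS c0 d0 e.
have hPQ := negpt_oncurve (addpt_oncurve hP hQ).
set N := negpt W (addpt W P Q) in hPQ.
apply: (@ideal_class_inj _ _ (c * lin W P Q) (d * lin W P Q)) => //.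
- by rewrite mulf_neq0 // lin_neq0.
- by rewrite mulf_neq0 // lin_neq0.
rewrite -!princM -(lin_ideal W_disc hP hQ) -/N.
have AC I J : iprod (iprod I (iprod (mI P) (iprod (mI Q) (mI N)))) J =
   iprod (mI N) (iprod I (iprod (mI P) (iprod (mI Q) J))).
  by ip_ac.
by rewrite !AC e.
Qed.

Lemma addptC P Q : oncurve W P -> oncurve W Q -> add P Q = add Q P.
Proof.
move=> hP hQ; apply: (can_inj (negptK W)).
have h1 := negpt_oncurve (addpt_oncurve hP hQ).
have h2 := negpt_oncurve (addpt_oncurve hQ hP).
apply: (@sum_unique P Q _ _ (lin W Q P) (lin W P Q)); rewrite ?lin_neq0 //.
rewrite -(lin_ideal W_disc hQ hP) -(lin_ideal W_disc hP hQ).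
set N1 := neg _; set N2 := neg _; by ip_ac.
Qed.

(** Both bracketings have the class of (P)(Q)(R): for each of them this product times the ideal of
    minus the sum becomes, after multiplication by one vertical function, principal with a product
    of two chord functions as generator. *)
Lemma addptA P Q R : oncurve W P -> oncurve W Q -> oncurve W R ->
  add P (add Q R) = add (add P Q) R.
Proof.
move=> hP hQ hR; apply: (can_inj (negptK W)).
have hPQ := addpt_oncurve hP hQ; have hQR := addpt_oncurve hQ hR.
have h1 := negpt_oncurve (addpt_oncurve hP hQR).
have h2 := negpt_oncurve (addpt_oncurve hPQ hR).
set Z1 := neg _ in h1 *; set Z2 := neg _ in h2 *.
pose L1 := lin W Q R * lin W P (add Q R); pose L2 := lin W P Q * lin W (add P Q) R.
have e1 : iprod (princ (vertp W (add Q R)))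
    (iprod (iprod (mI P) (iprod (mI Q) (mI R))) (mI Z1)) = princ L1.
  rewrite -princM -!lin_ideal // -vertp_ideal // -/Z1.
  by set M1 := mI (neg _); ip_ac.
have e2 : iprod (princ (vertp W (add P Q)))
    (iprod (iprod (mI P) (iprod (mI Q) (mI R))) (mI Z2)) = princ L2.
  rewrite -princM -!lin_ideal // -vertp_ideal // -/Z2.
  by set M1 := mI (neg _); ip_ac.
have l10 : L1 != 0 by rewrite mulf_neq0 // lin_neq0.
have l20 : L2 != 0 by rewrite mulf_neq0 // lin_neq0.
move: L1 L2 e1 e2 l10 l20 => L1 L2 e1 e2 l10 l20.
apply: (@ideal_class_inj _ _ (L2 * vertp W (add Q R)) (L1 * vertp W (add P Q))) => //.
- by rewrite mulf_neq0 // vertp_neq0.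
- by rewrite mulf_neq0 // vertp_neq0.
rewrite -!princM -e1 -e2.
set V1 := princ _; set V2 := princ _; set M := iprod _ (iprod _ _).
by ip_ac.
Qed.

End PointGroup.

(** * The abelian group of points *)

Section EllipticPoints.

Variables (F : fieldType) (E : elliptic F).

Definition oncurveb (P : point F) : bool :=
  if P is Some (x, y) then
    y ^+ 2 + a1 E * x * y + a3 E * y == x ^+ 3 + a2 E * x ^+ 2 + a4 E * x + a6 E
  else true.

Lemma oncurveP P : reflect (oncurve E P) (oncurveb P).
Proof. by case: P => [[x y]|] /=; [apply: eqP | apply: ReflectT]. Qed.

Record ept := Ept { eptval :> point F; _ : oncurveb eptval }.
HB.instance Definition _ := [isSub for eptval].
HB.instance Definition _ := [Choice of ept by <:].

Lemma ept_oncurve (P : ept) : oncurve E P.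
Proof. by apply/oncurveP; case: P. Qed.

Definition mkept (P : point F) (h : oncurve E P) : ept := Ept (introT (oncurveP P) h).

Definition ept0 : ept := @mkept None I.
Definition eptN (P : ept) : ept := mkept (negpt_oncurve (ept_oncurve P)).
Definition eptD (P Q : ept) : ept :=
  mkept (addpt_oncurve (ept_oncurve P) (ept_oncurve Q)).

Fact eptA : associative eptD.
Proof.
by move=> P Q R; apply: val_inj => /=; apply: addptA; rewrite ?disc_neq0 //;
  apply: ept_oncurve.
Qed.
Fact eptC : commutative eptD.
Proof.
by move=> P Q; apply: val_inj => /=; apply: addptC; rewrite ?disc_neq0 //;
  apply: ept_oncurve.
Qed.
Fact ept0D : left_id ept0 eptD.
Proof. by move=> P; apply: val_inj. Qed.
Fact eptND : left_inverse ept0 eptN eptD.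
Proof.
move=> P; rewrite eptC; apply: val_inj => /=; apply: addptN; apply: ept_oncurve.
Qed.

HB.instance Definition _ := GRing.isZmodule.Build ept eptA eptC ept0D eptND.

Lemma eptDE (P Q : ept) : val (P + Q) = addpt E (val P) (val Q).
Proof. by []. Qed.
Lemma eptNE (P : ept) : val (- P) = negpt E (val P).
Proof. by []. Qed.
Lemma ept0E : val (0 : ept) = None.
Proof. by []. Qed.
Lemma mulptE n (P : ept) : mulpt E n (val P) = val (P *+ n).
Proof. by elim: n => [|n IH]; rewrite ?mulr0n // mulrS eptDE -IH. Qed.

End EllipticPoints.

(** * Chord functions and their cocycle relations *)

Section ChordFunctions.

Variables (F : fieldType) (E : elliptic F).
Implicit Types (P Q R X : ept E) (p q : F * F).
Local Notation W := (model E).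
Let W_disc : disc W != 0 := disc_neq0 E.

Definition xc P : F := if val P is Some p then p.1 else 0.
Definition yc P : F := if val P is Some p then p.2 else 0.
Definition pc P : F * F := (xc P, yc P).

Lemma val_neq0 P : P != 0 -> val P = Some (pc P).
Proof.
rewrite /pc /xc /yc; case: P => -[[x y]|] h //= /eqP[].
Qed.

Lemma pc_oncurve P : P != 0 -> oncurve W (Some (pc P)).
Proof. by move/val_neq0 <-; apply: ept_oncurve. Qed.

Lemma pcN P : P != 0 -> pc (- P) = negc W (pc P).
Proof. by move=> /val_neq0 e; rewrite {1}/pc /xc /yc eptNE e. Qed.

Lemma xcN P : xc (- P) = xc P.
Proof. by rewrite /xc eptNE; case: (val P). Qed.

Lemma pc_inj P Q : P != 0 -> Q != 0 -> pc P = pc Q -> P = Q.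
Proof. by move=> /val_neq0 e /val_neq0 e' h; apply: val_inj; rewrite e e' h. Qed.

Lemma xc_eq P Q : P != 0 -> Q != 0 -> xc P = xc Q -> P = Q \/ P = - Q.
Proof.
move=> P0 Q0 e; have := same_x (pc_oncurve Q0) (pc_oncurve P0) (esym e).
case=> h; [left|right]; apply: pc_inj => //; rewrite ?oppr_eq0 //.
by rewrite pcN.
Qed.

Lemma xc_neq P Q : P != 0 -> Q != 0 -> P - Q != 0 -> P + Q != 0 -> xc P != xc Q.
Proof.
move=> P0 Q0 h1 h2; apply/eqP => /(xc_eq P0 Q0)[] e; subst P.
  by rewrite subrr eqxx in h1.
by rewrite addNr eqxx in h2.
Qed.

Lemma opposite_add P Q : P != 0 -> Q != 0 ->
  opposite W (pc P) (pc Q) = (P + Q == 0).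
Proof.
move=> P0 Q0; rewrite oppositeP -pcN // addrC addr_eq0.
by apply/eqP/eqP => [/pc_inj -> //|-> //]; rewrite oppr_eq0.
Qed.

Definition sl P Q : F := slope W (pc P) (pc Q).

Lemma slC P Q : P != 0 -> Q != 0 -> P + Q != 0 -> sl P Q = sl Q P.
Proof.
move=> P0 Q0 PQ; rewrite /sl /slope [(pc Q).1 == _]eq_sym.
case: eqVneq => [/(xc_eq P0 Q0)[->//|e]|ne].
  by rewrite e addNr eqxx in PQ.
have d1 : (pc P).1 - (pc Q).1 != 0 by rewrite subr_eq0.
have d2 : (pc Q).1 - (pc P).1 != 0 by rewrite subr_eq0 eq_sym.
by field; rewrite ?d1 ?d2.
Qed.

Lemma sl_chord P Q : P != 0 -> Q != 0 -> P + Q != 0 ->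
  chord W (pc P) (pc Q) (sl P Q).
Proof.
move=> P0 Q0 PQ; apply: slope_chord; rewrite ?opposite_add //; exact: pc_oncurve.
Qed.

Lemma pcD P Q : P != 0 -> Q != 0 -> P + Q != 0 ->
  pc (P + Q) = negc W (third W (pc P) (pc Q) (sl P Q),
    yc P + sl P Q * (third W (pc P) (pc Q) (sl P Q) - xc P)).
Proof.
move=> P0 Q0 PQ; rewrite {1}/pc /xc /yc eptDE (val_neq0 P0) (val_neq0 Q0).
by rewrite addptE opposite_add // (negbTE PQ).
Qed.

Definition linp P Q := lin W (val P) (val Q).
Definition vtp P := vertp W (val P).

Lemma linpE P Q : P != 0 -> Q != 0 -> P + Q != 0 ->
  linp P Q = cr_line W (pc P) (sl P Q).
Proof.
move=> P0 Q0 PQ; rewrite /linp (val_neq0 P0) (val_neq0 Q0) /=.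
by rewrite opposite_add // (negbTE PQ).
Qed.

Lemma linpN P : linp P (- P) = vtp P.
Proof.
rewrite /linp /vtp; have [->|P0] := eqVneq P 0; first by [].
have N0 : - P != 0 by rewrite oppr_eq0.
by rewrite (val_neq0 N0) (val_neq0 P0) /= opposite_add // subrr eqxx.
Qed.

Lemma linp0 P : linp P 0 = vtp P.
Proof. by rewrite /linp /vtp; case: (val P). Qed.
Lemma vtpE P : P != 0 -> vtp P = cr_vert W (xc P).
Proof. by move=> P0; rewrite /vtp (val_neq0 P0). Qed.

Lemma lc_vert x : cr_lc (cr_vert W x) = 1.
Proof. by rewrite /cr_vert cr_lc_poly (monicP (monicXsubC x)). Qed.

Lemma lc_line p lam : cr_lc (cr_line W p lam) = 1.
Proof.
rewrite /cr_lc /cr_top0 /= oner_eq0 size_poly1 /= ifF ?lead_coef1 //.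
apply/negbTE; rewrite -leqNgt size_polyN (leq_trans (size_polyD _ _)) //.
rewrite geq_max (leq_trans (size_polyC_leq1 _)) //= mul_polyC.
by rewrite (leq_trans (size_scale_leq _ _)) // size_XsubC.
Qed.

Lemma lc_linp P Q : cr_lc (linp P Q) = 1.
Proof.
rewrite /linp; case: (val P) (val Q) => [p|] [q|] /=; rewrite ?lc_vert ?cr_lc1 //.
by case: ifP; rewrite ?lc_vert ?lc_line.
Qed.

Lemma lc_vtp P : cr_lc (vtp P) = 1.
Proof. by rewrite /vtp; case: (val P) => [p|]; rewrite ?lc_vert ?cr_lc1. Qed.

Lemma princ_lc (f g : coordring W) : g != 0 -> princ f = princ g ->
  cr_lc f = cr_lc g -> f = g.
Proof.
move=> g0 /(princ_eq g0)[k k0 ->]; rewrite cr_lcM cr_lc_poly lead_coefC.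
move/eqP; rewrite -subr_eq0 -{2}[cr_lc g]mul1r -mulrBl mulf_eq0 cr_lc_eq0.
by rewrite (negbTE g0) orbF subr_eq0 => /eqP ->; rewrite polyC1 rmorph1 mul1r.
Qed.

Local Notation mI P := (pt_ideal W (val P)).

Lemma linp_ideal P Q :
  princ (linp P Q) = iprod (mI P) (iprod (mI Q) (mI (- (P + Q)))).
Proof. by rewrite eptNE eptDE lin_ideal //; apply: ept_oncurve. Qed.

Lemma vtp_ideal P : princ (vtp P) = iprod (mI P) (mI (- P)).
Proof. by rewrite eptNE vertp_ideal //; apply: ept_oncurve. Qed.

Lemma linpC P Q : linp P Q = linp Q P.
Proof.
apply: princ_lc; rewrite ?lin_neq0 ?lc_linp // !linp_ideal addrC.
by ip_ac.
Qed.

(* Both sides have divisor [P + Q + R + ...] and leading coefficient 1. *)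
Lemma linp_cocycle P Q R :
  linp P Q * linp (P + Q) R * vtp (Q + R) = linp Q R * linp P (Q + R) * vtp (P + Q).
Proof.
apply: princ_lc; rewrite ?mulf_neq0 ?lin_neq0 ?vertp_neq0 ?cr_lcM ?lc_linp ?lc_vtp //.
have e : P + (Q + R) = P + Q + R by rewrite addrA.
rewrite -!princM !linp_ideal !vtp_ideal e.
by ip_ac.
Qed.

Lemma linear_factor_eq (a b x c d y : F) :
  (a%:P * 'X + b%:P) * ('X - x%:P) = (c%:P * 'X + d%:P) * ('X - y%:P) -> a = c.
Proof.
have e (u v z : F) : (u%:P * 'X + v%:P) * ('X - z%:P) =
    u *: 'X^2 + (v - u * z) *: 'X - (v * z)%:P :> {poly F}.
  rewrite -!mul_polyC !(polyCB, polyCM); ring.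
rewrite !e => /(congr1 (fun r : {poly F} => r`_2)).
by rewrite !(coefD, coefN, coefZ, coefXn, coefX, coefC) /= !mulr1 !mulr0 !subr0 !addr0.
Qed.

(* The second coefficients at infinity of the two sides of [linp_cocycle]. *)
Lemma sl_cocycle P Q R : P != 0 -> Q != 0 -> R != 0 ->
  P + Q != 0 -> Q + R != 0 -> P + Q + R != 0 ->
  sl P Q + sl (P + Q) R = sl Q R + sl P (Q + R).
Proof.
move=> P0 Q0 R0 PQ QR PQR; have := linp_cocycle P Q R.
rewrite !linpE // ?addrA // !vtpE // => /(congr1 (fun f => f.2)).
rewrite /cr_vert !cr_mulE /= !mulr0 !mul0r !mul1r !mulr1 !add0r !subr0.
set l1 := sl P Q; set l2 := sl (P + Q) R; set l3 := sl Q R; set l4 := sl P (Q + R).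
have e (m n x y z t : F) : - (y%:P + m%:P * ('X - x%:P)) - (t%:P + n%:P * ('X - z%:P)) - ycoef W =
   (- (m + n + a1 W))%:P * 'X + (- y + m * x - t + n * z - a3 W)%:P :> {poly F}.
  by rewrite /ycoef !(polyCD, polyCM, polyCN, polyCB); ring.
rewrite ?e => /linear_factor_eq /oppr_inj /addIr //.
Qed.

(** The value at -R of the chord function of P and Q, as [Cf_tau] shows; its symmetry in Q and R is
    the cocycle relation of slopes. *)
Definition tau P Q R : F := - (sl P Q + sl (P + Q) R + a1 W).

Lemma tau_swap P Q R : P != 0 -> Q != 0 -> R != 0 -> P + Q != 0 -> P + R != 0 ->
  P + Q + R != 0 -> tau P Q R = tau P R Q.
Proof.
move=> P0 Q0 R0 PQ PR PQR; have QP : Q + P != 0 by rewrite addrC.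
have QPR : Q + P + R != 0 by rewrite [Q + P]addrC.
have PRQ : Q + (P + R) != 0 by rewrite addrA.
have e := sl_cocycle Q0 P0 R0 QP PR QPR.
by rewrite /tau slC // [P + Q]addrC e [sl Q _]slC // addrC.
Qed.

(* Evaluation extended to the point at infinity by the leading coefficient. *)
Definition evp X (f : coordring W) : F :=
  if val X is Some p then cr_eval p f else cr_lc f.

Lemma evpM X f g : evp X (f * g) = evp X f * evp X g.
Proof.
rewrite /evp; have : oncurve W (val X) := ept_oncurve X; case: (val X) => [p|] h.
  by rewrite cr_evalM.
by rewrite cr_lcM.
Qed.

Lemma evpE X f : X != 0 -> evp X f = cr_eval (pc X) f.
Proof. by rewrite /evp => /val_neq0 ->. Qed.
Lemma evp0 f : evp 0 f = cr_lc f.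
Proof. by []. Qed.

(** Ensures that [vtp P] does not vanish at X: at infinity its value is its leading coefficient 1,
    and for P = O it is the constant 1. *)
Definition off P X : bool := [|| X == 0, P == 0 | xc X != xc P].

Lemma evp_vtp P X : off P X -> evp X (vtp P) != 0.
Proof.
rewrite /off; have [->|X0] := eqVneq X 0.
  by rewrite evp0 lc_vtp oner_neq0.
have [->|P0] /= := eqVneq P 0; rewrite evpE //.
  by rewrite /vtp /= cr_eval1 oner_neq0.
by rewrite vtpE // eval_vert subr_eq0.
Qed.

Lemma off_neq P X : P - X != 0 -> P + X != 0 -> off P X.
Proof.
move=> h1 h2; rewrite /off; case: eqVneq => //= X0; case: eqVneq => //= P0.
have d : X - P != 0 by rewrite -oppr_eq0 opprB.
by rewrite xc_neq // addrC.
Qed.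

(** The function with divisor (P) + (Q) - (P + Q) - (O) and leading coefficient 1 at infinity. *)
Definition Cf P Q X : F := evp X (linp P Q) / evp X (vtp (P + Q)).

Lemma CfC P Q X : Cf P Q X = Cf Q P X.
Proof. by rewrite /Cf linpC addrC. Qed.

Lemma Cf_at0 P Q : Cf P Q 0 = 1.
Proof. by rewrite /Cf !evp0 lc_linp lc_vtp divr1. Qed.

Lemma Cf0 P X : off P X -> Cf P 0 X = 1.
Proof. by move=> h; rewrite /Cf linp0 addr0 divff // evp_vtp. Qed.

Lemma CfN P X : X != 0 -> P != 0 -> Cf P (- P) X = xc X - xc P.
Proof.
move=> X0 P0; rewrite /Cf linpN subrr vtpE // !evpE // eval_vert.
by rewrite /vtp /= cr_eval1 divr1.
Qed.

Lemma Cf_cocycle P Q R X : off (P + Q) X -> off (Q + R) X -> off (P + Q + R) X ->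
  Cf P Q X * Cf (P + Q) R X = Cf Q R X * Cf P (Q + R) X.
Proof.
move=> /evp_vtp h1 /evp_vtp h2 /evp_vtp h3; rewrite /Cf addrA.
have := congr1 (evp X) (linp_cocycle P Q R); rewrite !evpM.
move: h1 h2 h3; move: (evp X (vtp (P + Q))) (evp X (vtp (Q + R))).
move=> a b a0 b0 c0 e.
transitivity (evp X (linp P Q) * evp X (linp (P + Q) R) * b / (a * b * evp X (vtp (P + Q + R)))).
  by field; rewrite a0 b0 c0.
by rewrite e; field; rewrite a0 b0 c0.
Qed.

Lemma Cf_tau P Q R : P != 0 -> Q != 0 -> R != 0 -> P + Q != 0 -> xc R != xc (P + Q) ->
  Cf P Q (- R) = tau P Q R.
Proof.
move=> P0 Q0 R0 PQ ne; rewrite /Cf linpE // vtpE // !evpE ?oppr_eq0 //.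
rewrite eval_vert eval_line pcN //=; rewrite /tau /sl /(slope _ (pc (P + Q))) /=.
have := pcD P0 Q0 PQ; rewrite -/(sl P Q); move: (sl P Q) => lam.
rewrite [xc (P + Q) == _]eq_sym (negbTE ne).
have d0 : xc R - xc (P + Q) != 0 by rewrite subr_eq0.
case; set x3 := third _ _ _ _ => ex ey; rewrite -ex in ey d0 *.
by rewrite ey; field.
Qed.

(** The reason for evaluating at opposites throughout: subscript and argument can then be
    exchanged. *)
Lemma Cf_swap P Q R : P != 0 -> Q != 0 -> R != 0 -> P + Q != 0 -> P + R != 0 ->
  P + Q + R != 0 -> R - (P + Q) != 0 -> Q - (P + R) != 0 ->
  Cf P Q (- R) = Cf P R (- Q).
Proof.
move=> P0 Q0 R0 PQ PR PQR n1 n2.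
rewrite !Cf_tau //; first exact: tau_swap.
  by apply: xc_neq => //; rewrite addrA [Q + P]addrC.
by apply: xc_neq => //; rewrite addrC.
Qed.

Lemma Cf_neq0 P Q X : P != 0 -> Q != 0 -> X != 0 ->
  xc X != xc P -> xc X != xc Q -> off (P + Q) X -> Cf P Q X != 0.
Proof.
move=> P0 Q0 X0 h1 h2 h3; rewrite /Cf mulf_neq0 ?invr_neq0 ?evp_vtp //.
have [e|PQ] := eqVneq (P + Q) 0.
  by rewrite -(subr0 Q) -e opprD addrCA subrr addr0 linpN vtpE // evpE // eval_vert subr_eq0.
rewrite linpE // evpE //; have := norm_line (sl_chord P0 Q0 PQ).
have oX := pc_oncurve X0.
move=> /(congr1 (cr_eval (pc X))); rewrite cr_evalM // cr_evalN.
rewrite !(cr_evalM _ _ oX) !eval_vert => e; apply: contraTneq isT => e0.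
move/eqP: e; rewrite e0 mul0r eq_sym oppr_eq0 !mulf_eq0 !subr_eq0 (negbTE h1) (negbTE h2) /=.
have := pcD P0 Q0 PQ => -[/= <- _]; move: h3.
by rewrite /off (negbTE X0) (negbTE PQ) /= => /negbTE ->.
Qed.

(** Reflection changes a slope m into -m - a1 and the function y into -y - a1 x - a3, whence the
    sign. *)
Lemma CfNN P Q X : P != 0 -> Q != 0 -> X != 0 -> P + Q != 0 ->
  Cf (- P) (- Q) (- X) = - Cf P Q X.
Proof.
move=> P0 Q0 X0 PQ.
have P0' : - P != 0 by rewrite oppr_eq0. have Q0' : - Q != 0 by rewrite oppr_eq0.
have X0' : - X != 0 by rewrite oppr_eq0.
have PQ' : - P - Q != 0 by rewrite -opprD oppr_eq0.
rewrite /Cf !linpE // !vtpE // !evpE // !eval_vert -mulNr -opprD xcN.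
have -> : (pc (- X)).1 = (pc X).1 by rewrite pcN.
congr (_ / _); rewrite !eval_line !pcN //=.
have -> : sl (- P) (- Q) = - sl P Q - a1 W.
  rewrite /sl !pcN // /slope /=; case: eqVneq => [/(xc_eq P0 Q0)[e|e]|ne].
  - have d0 : 2 * yc P + a1 W * xc P + a3 W != 0.
      rewrite -e in PQ; rewrite -opposite_add // /opposite eqxx /= in PQ.
      by apply: contra PQ => /eqP <-; apply/eqP; ring.
    have d1 : 2 * (- yc P - a1 W * xc P - a3 W) + a1 W * xc P + a3 W != 0.
      by rewrite -oppr_eq0; apply: contra d0 => /eqP <-; apply/eqP; ring.
    by field; rewrite d0 d1.
  - by rewrite e addNr eqxx in PQ.
  by field; rewrite subr_eq0 eq_sym.
by ring.
Qed.

End ChordFunctions.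

(* The square-zero extension of [int] by an abelian group [G]: it turns [ring]
   into a decision procedure for the identities of [G]. *)
Definition sqzero (G : zmodType) : Type := (int * G)%type.

(** * The Weil pairing as a product of chord functions *)

Section SquareZero.
Variable G : zmodType.
HB.instance Definition _ := GRing.Zmodule.copy (sqzero G) (int * G)%type.
Definition sqzero_mul (x y : sqzero G) : sqzero G :=
  (x.1 * y.1, y.2 *~ x.1 + x.2 *~ y.1).
Definition sqzero_one : sqzero G := (1, 0).
Fact sqzero_mulA : associative sqzero_mul.
Proof.
move=> [a x] [b y] [c z]; rewrite /sqzero_mul /= mulrA; congr pair.
by rewrite !mulrzDl -!mulrzA [b * a]mulrC [c * a]mulrC addrA.
Qed.
Fact sqzero_mulC : commutative sqzero_mul.
Proof. by move=> [a x] [b y]; rewrite /sqzero_mul /= mulrC addrC. Qed.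
Fact sqzero_mul1 : left_id sqzero_one sqzero_mul.
Proof. by move=> [a x]; rewrite /sqzero_mul /= mul1r mul0rz addr0 mulr1z. Qed.
Fact sqzero_mulDl : left_distributive sqzero_mul +%R.
Proof.
move=> [a x] [b y] [c z]; rewrite /sqzero_mul /= mulrDl; congr pair.
by rewrite /= mulrzDr mulrzDl addrACA.
Qed.
Fact sqzero_neq0 : sqzero_one != 0.
Proof. by []. Qed.
HB.instance Definition _ := GRing.Zmodule_isComNzRing.Build (sqzero G)
  sqzero_mulA sqzero_mulC sqzero_mul1 sqzero_mulDl sqzero_neq0.
Definition sqzero_in (x : G) : sqzero G := (0, x).
Fact sqzero_in_zmod : zmod_morphism sqzero_in.
Proof. by move=> x y; congr pair => /=; rewrite subr0. Qed.
HB.instance Definition _ := GRing.isZmodMorphism.Build _ _ sqzero_in sqzero_in_zmod.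
Lemma sqzero_in_inj : injective sqzero_in.
Proof. by move=> x y []. Qed.
Lemma neq0_eq (x y : G) : y != 0 -> x = y -> x != 0.
Proof. by move=> h ->. Qed.
Lemma neq0_opp (x y : G) : y != 0 -> x = - y -> x != 0.
Proof. by move=> h ->; rewrite oppr_eq0. Qed.
End SquareZero.

Ltac zmod := apply: sqzero_in_inj; ring.

(** Closes a nonvanishing goal by a hypothesis that agrees with it up to sign in the group. *)
Ltac nz := match goal with
  | H : is_true (?y != 0) |- is_true (?x != 0) =>
    solve [ exact: H | apply: (neq0_eq H); zmod | apply: (neq0_opp H); zmod ]
  end.

(** * Torsion, independence and generic points in an abelian group *)

Section Torsion.

Variables (G : zmodType) (p : nat).
Implicit Types (P Q X v : G).

Definition tor P : Prop := P *+ p = 0.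

Lemma tor0 : tor 0. Proof. exact: mul0rn. Qed.
Lemma torD P Q : tor P -> tor Q -> tor (P + Q).
Proof. by rewrite /tor mulrnDl => -> ->; rewrite addr0. Qed.
Lemma torN P : tor P -> tor (- P).
Proof. by rewrite /tor mulNrn => ->; rewrite oppr0. Qed.
Lemma torMn P n : tor P -> tor (P *+ n).
Proof. by rewrite /tor mulrnAC => ->; rewrite mul0rn. Qed.

Lemma tor_mod P n : tor P -> P *+ n = P *+ (n %% p).
Proof.
move=> h; rewrite {1}(divn_eq n p) mulrnDr mulnC mulrnA.
by rewrite (h : P *+ p = 0) mul0rn add0r.
Qed.

Hypothesis p_prime : prime p.

Lemma tor_mul_neq0 P n : tor P -> P != 0 -> ~~ (p %| n)%N -> P *+ n != 0.
Proof.
move=> hP P0 hn; apply: contra P0 => /eqP e.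
have p0 := prime_gt0 p_prime.
have n0 : (0 < n)%N by case: n hn {e} => //; rewrite dvdn0.
have [u v e1 _] := egcdnP p n0.
have := congr1 (fun k => P *+ k) e1; rewrite mulrnDr mulnC !mulrnA e mul0rn.
rewrite mulrnAC (hP : P *+ p = 0) mul0rn add0r gcdnC.
by rewrite (eqP (_ : coprime p n)) ?prime_coprime // => /esym/eqP.
Qed.

(** Stable under sign and under translation by p-torsion; it keeps X, ..., pX away from all
    p-torsion points, so that no chord function met below degenerates. *)
Definition generic X : Prop := forall j, (0 < j <= p)%N -> X *+ j *+ p != 0.

Lemma generic_add X v j : generic X -> tor v -> (j <= p)%N -> (j = 0%N -> v != 0) ->
  v + X *+ j != 0.
Proof.
move=> gX hv hj h0; have [e|j0] := posnP j; first by rewrite e addr0; apply: h0.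
apply/eqP=> e; have := gX j; rewrite j0 hj => /(_ isT)/eqP; apply.
by move: (congr1 (fun Q => Q *+ p) e); rewrite mulrnDl (hv : v *+ p = 0) add0r mul0rn.
Qed.

Lemma generic_neq0 X j : generic X -> (0 < j <= p)%N -> X *+ j != 0.
Proof.
move=> gX /andP[j0 jp]; have := @generic_add X 0 j gX tor0 jp.
by rewrite add0r; apply=> e; rewrite e in j0.
Qed.

Lemma genericN X : generic X -> generic (- X).
Proof. by move=> gX j hj; rewrite !mulNrn oppr_eq0; apply: gX. Qed.

Lemma generic_tor X v : generic X -> tor v -> generic (X + v).
Proof.
move=> gX hv j hj; rewrite !mulrnDl.
by rewrite [v *+ j *+ p]mulrnAC (hv : v *+ p = 0) mul0rn addr0; apply: gX.
Qed.

Definition indep (S T : G) : Prop :=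
  forall i j : nat, S *+ i + T *+ j = 0 -> (p %| i)%N /\ (p %| j)%N.

Lemma indepC (S T : G) : indep S T -> indep T S.
Proof. by move=> h i j; rewrite addrC => /h[]. Qed.

End Torsion.

Ltac tors := do ![assumption | apply: torMn | apply: torN | apply: torD | apply: tor0].

Section Interchange.

Variables (F : fieldType) (E : elliptic F).
Implicit Types (P Q R X A B T : ept E).

(* The biextension interchange law for the chord functions. *)
Lemma Cf_inter T1 T2 A B :
  T1 != 0 -> T2 != 0 -> A != 0 -> B != 0 -> T1 + T2 != 0 -> B - T1 != 0 ->
  B + T1 != 0 -> B + T1 + T2 != 0 -> B - T1 - T2 != 0 ->
  A + B != 0 -> A + T2 != 0 -> A + T1 + T2 != 0 -> A + B + T2 != 0 ->
  A + B + T1 + T2 != 0 -> A + T2 - T1 != 0 -> A - T1 - T2 != 0 ->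
  A + B + T2 - T1 != 0 -> B - A - T1 - T2 != 0 -> A + B - T1 - T2 != 0 ->
  B - A - T2 != 0 -> A + B - T2 != 0 -> A + B - T1 != 0 -> A + B + T1 != 0 ->
  Cf T1 T2 (- (A + B)) * Cf A B (- T1) * Cf A B (- T2) =
  Cf T1 T2 (- A) * Cf T1 T2 (- B) * Cf A B (- (T1 + T2)).
Proof.
move=> h1 h2 h3 h4 h5 h6 h7 h8 h9 h10 h11 h12 h13 h14 h15 h16 h17 h18 h19 h20 h21 h22 h23.
have s1 : Cf T2 A (- T1) = Cf T1 T2 (- A) by rewrite [RHS]CfC; apply: Cf_swap; nz.
have s2 : Cf (T2 + A) B (- T1) = Cf T1 (T2 + A) (- B).
  by rewrite [RHS]CfC; apply: Cf_swap; nz.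
have s3 : Cf T2 (A + B) (- T1) = Cf T1 T2 (- (A + B)).
  by rewrite [RHS]CfC; apply: Cf_swap; nz.
have s4 : Cf (T1 + T2) A (- B) = Cf A B (- (T1 + T2)).
  by rewrite CfC; apply: Cf_swap; nz.
have s5 : Cf T2 A (- B) = Cf A B (- T2) by rewrite CfC; apply: Cf_swap; nz.
(* Two cocycle relations, one at -T1 and one at -B, share the factor [Cf T1 (T2 + A) (- B)] once
   [Cf_swap] has exchanged subscripts and arguments. *)
have c1 : Cf T2 A (- T1) * Cf (T2 + A) B (- T1) = Cf A B (- T1) * Cf T2 (A + B) (- T1).
  by apply: Cf_cocycle; apply: off_neq; nz.
have c2 : Cf T1 T2 (- B) * Cf (T1 + T2) A (- B) = Cf T2 A (- B) * Cf T1 (T2 + A) (- B).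
  by apply: Cf_cocycle; apply: off_neq; nz.
have K0 : Cf T1 (T2 + A) (- B) != 0.
  by apply: Cf_neq0; [nz|nz|nz|apply: xc_neq; nz|apply: xc_neq; nz|apply: off_neq; nz].
rewrite s1 s2 s3 in c1; rewrite s4 s5 in c2; apply: (mulIf K0).
move: c1 c2; set k := Cf T1 (T2 + A) (- B).
move: (Cf T1 T2 (- (A + B))) (Cf A B (- T1)) (Cf A B (- T2)) (Cf T1 T2 (- A))
  (Cf T1 T2 (- B)) (Cf A B (- (T1 + T2))) => a b c d e f c1 c2.
transitivity (b * a * (c * k)); first by ring.
by rewrite -c1 -c2; ring.
Qed.

Lemma Cf_mul_conj A B T : A != 0 -> B != 0 -> T != 0 -> A + B != 0 ->
  A + B - T != 0 -> A + B + T != 0 ->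
  Cf A B T * Cf A B (- T) =
  - ((xc T - xc A) * (xc T - xc B)) / (xc T - xc (A + B)).
Proof.
move=> A0 B0 T0 AB h1 h2.
have d0 : xc T - xc (A + B) != 0.
  by rewrite subr_eq0; apply: xc_neq => //; nz.
have T0' : - T != 0 by rewrite oppr_eq0.
rewrite /Cf linpE // vtpE // !evpE // !eval_vert pcN //.
have := norm_line (sl_chord A0 B0 AB).
have oT := pc_oncurve T0.
move=> /(congr1 (cr_eval (pc T))); rewrite cr_evalM // cr_evalN.
rewrite !(cr_evalM _ _ oT) !eval_vert eval_conj /=.
have := pcD A0 B0 AB => -[<- _] e.
rewrite mulrACA e; field; exact: d0.
Qed.

(** The interchange law for T2 = -T1, where T1 + T2 = O and the value of the chord function of A and
    B there is 1. *)
Lemma Cf_inter_opp T A B : T != 0 -> A != 0 -> B != 0 -> A + B != 0 ->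
  A + B - T != 0 -> A + B + T != 0 ->
  Cf T (- T) (- (A + B)) * Cf A B (- T) * Cf A B T =
  Cf T (- T) (- A) * Cf T (- T) (- B).
Proof.
move=> T0 A0 B0 AB h1 h2; rewrite -mulrA [Cf A B _ * _]mulrC Cf_mul_conj //.
rewrite !CfN ?oppr_eq0 // !xcN.
have d0 : xc T - xc (A + B) != 0.
  by rewrite subr_eq0; apply: xc_neq => //; nz.
by field.
Qed.

End Interchange.

Section WeilFunctions.

Variables (F : fieldType) (E : elliptic F) (p : nat).
Hypothesis (p_prime : prime p).
Implicit Types (S T X A : ept E).
Local Notation tor := (tor p).
Local Notation generic := (generic p).
Local Notation indep := (indep p).

(** Miller's product: the value at -A of the function with divisor n(T) - (nT) - (n - 1)(O). *)
Definition Phi n T A : F := \prod_(1 <= i < n) Cf T (T *+ i) (- A).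

Lemma Phi1 T A : Phi 1 T A = 1.
Proof. by rewrite /Phi big_geq. Qed.
Lemma PhiS n T A : (0 < n)%N -> Phi n.+1 T A = Phi n T A * Cf T (T *+ n) (- A).
Proof. by move=> n0; rewrite /Phi big_nat_recr. Qed.

Lemma tor_mul_lt T n : tor T -> T != 0 -> (0 < n < p)%N -> T *+ n != 0.
Proof.
move=> hT T0 /andP[n0 np]; apply: (tor_mul_neq0 p_prime) => //.
by rewrite gtnNdvd.
Qed.

Lemma tor_opp T n : tor T -> n.+1 = p -> T *+ n = - T.
Proof.
move=> hT e; apply/eqP; rewrite -addr_eq0 -mulrSr e.
exact/eqP.
Qed.

Ltac cX gX v j := apply: (neq0_eq (@generic_add _ _ _ v j gX _ _ _)); [by tors | by lia | idtac | by zmod].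

(** At n + 1 = p the chord of T and nT becomes vertical, and [Cf_inter_opp] replaces [Cf_inter]. *)
Lemma inter_gg T X n m : tor T -> T != 0 -> generic X -> (0 < n < p)%N ->
  (0 < m < p)%N ->
  Cf T (T *+ n) (- (X *+ m.+1)) * Cf X (X *+ m) (- T) * Cf X (X *+ m) (- (T *+ n))
  = Cf T (T *+ n) (- X) * Cf T (T *+ n) (- (X *+ m))
    * Cf X (X *+ m) (- (T *+ n.+1)).
Proof.
move=> hT T0 gX hn hm; have gX' := genericN gX.
have Tn : T *+ n != 0 by apply: tor_mul_lt.
have p1 := prime_gt1 p_prime.
have X0 : X != 0 by have := @generic_neq0 _ p X 1 gX; rewrite mulr1n; apply; lia.
have Xm : X *+ m != 0 by apply: (@generic_neq0 _ p) => //; lia.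
have Xm1 : X + X *+ m != 0.
  by rewrite -mulrS; apply: (@generic_neq0 _ p) => //; lia.
have [e|n1] := eqVneq n.+1 p.
  rewrite e hT oppr0 Cf_at0 mulr1 (tor_opp hT e) opprK mulrS.
  apply: Cf_inter_opp => //.
    by cX gX (- T) m.+1.
  by cX gX T m.+1.
have Tn1 : T *+ n.+1 != 0 by apply: tor_mul_lt => //; lia.
have Tn1' : T + T *+ n != 0 by rewrite -mulrS.
rewrite !mulrS; case: m hm Xm Xm1 => // m hm Xm Xm1.
apply: Cf_inter => //.
- by cX gX (- T) m.+1.
- by cX gX T m.+1.
- by cX gX (T + T *+ n) m.+1.
- by cX gX (- T - T *+ n) m.+1.
- by cX gX (T *+ n) 1%N.
- by cX gX (T + T *+ n) 1%N.
- by cX gX (T *+ n) m.+2.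
- by cX gX (T + T *+ n) m.+2.
- by cX gX (T *+ n - T) 1%N.
- by cX gX (- T - T *+ n) 1%N.
- by cX gX (T *+ n - T) m.+2.
- by cX gX (- T - T *+ n) m; rewrite -opprD oppr_eq0.
- by cX gX (- T - T *+ n) m.+2.
- by cX gX (- (T *+ n)) m; rewrite oppr_eq0.
- by cX gX (- (T *+ n)) m.+2.
- by cX gX (- T) m.+2.
- by cX gX T m.+2.
Qed.

Lemma inter_gt T S X n : tor T -> T != 0 -> tor S -> indep S T -> generic X ->
  (0 < n < p)%N ->
  Cf T (T *+ n) (- (X + S)) * Cf X S (- T) * Cf X S (- (T *+ n))
  = Cf T (T *+ n) (- X) * Cf T (T *+ n) (- S) * Cf X S (- (T *+ n.+1)).
Proof.
move=> hT T0 hS hST gX hn; have p1 := prime_gt1 p_prime.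
have Tn : T *+ n != 0 by apply: tor_mul_lt.
have S1 k : S + T *+ k != 0.
  by apply/eqP => e; have := hST 1%N k e; rewrite dvdn1; lia.
have S2 k : S - T *+ k != 0.
  apply/eqP => e; have := hST 1%N (k * p.-1)%N.
  rewrite mulrnA (_ : T *+ k *+ p.-1 = - (T *+ k)).
    by move=> /(_ e); rewrite dvdn1; lia.
  by rewrite (tor_opp (n := p.-1)) //; [tors | lia].
have S0 : S != 0 by have := S1 0%N; rewrite addr0.
have X0 : X != 0 by have := @generic_neq0 _ p X 1 gX; rewrite mulr1n; apply; lia.
have XS : X + S != 0 by cX gX S 1%N.
have [e|n1] := eqVneq n.+1 p.
  rewrite e hT oppr0 Cf_at0 mulr1 (tor_opp hT e) opprK.
  apply: Cf_inter_opp => //.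
    by cX gX (S - T) 1%N.
  by cX gX (S + T) 1%N.
have Tn1 : T *+ n.+1 != 0 by apply: tor_mul_lt => //; lia.
have Tn1' : T + T *+ n != 0 by rewrite -mulrS.
rewrite !mulrS; apply: Cf_inter => //.
- exact: (S2 1%N).
- exact: (S1 1%N).
- by have := S1 n.+1; rewrite mulrS addrA.
- by have := S2 n.+1; rewrite mulrS opprD addrA.
- by cX gX (T *+ n) 1%N.
- by cX gX (T + T *+ n) 1%N.
- by cX gX (S + T *+ n) 1%N.
- by cX gX (S + T + T *+ n) 1%N.
- by cX gX (T *+ n - T) 1%N.
- by cX gX (- T - T *+ n) 1%N.
- by cX gX (S + T *+ n - T) 1%N.
- by rewrite -oppr_eq0; cX gX (T + T *+ n - S) 1%N.
- by cX gX (S - T - T *+ n) 1%N.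
- by rewrite -oppr_eq0; cX gX (T *+ n - S) 1%N.
- by cX gX (S - T *+ n) 1%N.
- by cX gX (S - T) 1%N.
- by cX gX (S + T) 1%N.
Qed.

End WeilFunctions.

Ltac generic_nz gX v j :=
  apply: (neq0_eq (@generic_add _ _ _ v j gX _ _ _));
  [by tors | by lia | idtac | by zmod].

(** * Miller products: powers, translations and antisymmetry *)

Section WeilValue.

Variables (F : fieldType) (E : elliptic F) (p : nat).
Hypothesis (p_prime : prime p).
Implicit Types (S T X A : ept E).
Local Notation tor := (tor p).
Local Notation generic := (generic p).
Local Notation indep := (indep p).

Lemma Phi_at0 n T : Phi n T (0 : ept E) = 1.
Proof. by rewrite /Phi big1 // => i _; rewrite oppr0 Cf_at0. Qed.

Lemma Phi_step T X n m : tor T -> T != 0 -> generic X -> (0 < n < p)%N ->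
  (m < p)%N ->
  Cf T (T *+ n) (- (X *+ m.+1)) * Phi m.+1 X T * Phi m.+1 X (T *+ n) =
  Cf T (T *+ n) (- X) ^+ m.+1 * Phi m.+1 X (T *+ n.+1).
Proof.
move=> hT T0 gX hn; elim: m => [|m IH] hm; first by rewrite !Phi1 expr1 !mulr1.
have := @inter_gg _ _ _ p_prime T X n m.+1 hT T0 gX hn hm.
have {IH} := IH (ltnW hm); rewrite !(@PhiS _ _ m.+1) // [_ ^+ m.+2]exprS.
move: (Cf T (T *+ n) (- (X *+ m.+1))) (Phi m.+1 X T) (Phi m.+1 X (T *+ n))
 (Cf T (T *+ n) (- X)) (Phi m.+1 X (T *+ n.+1)) (Cf T (T *+ n) (- (X *+ m.+2)))
 (Cf X (X *+ m.+1) (- T)) (Cf X (X *+ m.+1) (- (T *+ n)))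
 (Cf X (X *+ m.+1) (- (T *+ n.+1))) => a b c d e f g h k e1 e2.
transitivity ((f * g * h) * (b * c)); first by ring.
rewrite e2; transitivity (d * k * (a * b * c)); first by ring.
by rewrite e1; ring.
Qed.

Lemma Phi_pow_gen T X n m : tor T -> T != 0 -> generic X -> (n < p)%N -> (m < p)%N ->
  Phi n.+1 T (X *+ m.+1) * Phi m.+1 X T ^+ n.+1 =
  Phi n.+1 T X ^+ m.+1 * Phi m.+1 X (T *+ n.+1).
Proof.
move=> hT T0 gX hn hm; elim: n hn => [|n IH] hn.
  by rewrite !Phi1 expr1 expr1n mulr1n.
have := @Phi_step T X n.+1 m hT T0 gX hn hm.
have {IH} := IH (ltnW hn); rewrite !(@PhiS _ _ n.+1 T) // [_ ^+ n.+2]exprS.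
rewrite [(Phi n.+1 T X * _) ^+ _]exprMn.
move: (Phi n.+1 T (X *+ m.+1)) (Phi m.+1 X T) (Phi n.+1 T X ^+ m.+1)
  (Phi m.+1 X (T *+ n.+1)) (Cf T (T *+ n.+1) (- (X *+ m.+1)))
  (Cf T (T *+ n.+1) (- X) ^+ m.+1) (Phi m.+1 X (T *+ n.+2)) => a b c d e f g e1 e2.
transitivity ((a * b ^+ n.+1) * (e * b)); first by ring.
rewrite e1; transitivity (c * (e * b * d)); first by ring.
by rewrite e2 mulrA.
Qed.

(** The interchange law is iterated over both products, and the factor with argument pT = O is 1.
    Read at -X, the identity says that [Phi p T (- X) / Phi p (- X) T] is a p-th root of f_T at
    pX. *)
Lemma Phi_pow T X : tor T -> T != 0 -> generic X ->
  Phi p T (X *+ p) * Phi p X T ^+ p = Phi p T X ^+ p.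
Proof.
move=> hT T0 gX; have p0 := prime_gt0 p_prime.
have := @Phi_pow_gen T X p.-1 p.-1 hT T0 gX; rewrite !prednK //.
by rewrite (hT : T *+ p = 0) Phi_at0 mulr1; apply.
Qed.

(** The interchange law telescopes. The defect of additivity is the p-th power of a chord value;
    [Phi_addl] has the same defect, which therefore disappears from the quotient of the two
    products. *)
Lemma Phi_addr T S X : tor T -> T != 0 -> tor S -> indep S T -> generic X ->
  Phi p T (X + S) * Cf X S (- T) ^+ p = Phi p T X * Phi p T S.
Proof.
move=> hT T0 hS hST gX; have p0 := prime_gt0 p_prime.
suff : forall n, (n < p)%N -> Phi n.+1 T (X + S) * Cf X S (- T) ^+ n.+1 =
    Phi n.+1 T X * Phi n.+1 T S * Cf X S (- (T *+ n.+1)).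
  move=> /(_ p.-1); rewrite prednK // => ->; last by [].
  by rewrite (hT : T *+ p = 0) oppr0 Cf_at0 mulr1.
elim=> [|n IH] hn; first by rewrite !Phi1 expr1 mulr1n !mul1r.
have := @inter_gt _ _ _ p_prime T S X n.+1 hT T0 hS hST gX hn.
have {IH} := IH (ltnW hn); rewrite !(@PhiS _ _ n.+1 T) // [_ ^+ n.+2]exprS.
move: (Phi n.+1 T (X + S)) (Cf X S (- T)) (Phi n.+1 T X)
  (Phi n.+1 T S) (Cf X S (- (T *+ n.+1))) (Cf T (T *+ n.+1) (- (X + S)))
  (Cf T (T *+ n.+1) (- X)) (Cf T (T *+ n.+1) (- S)) (Cf X S (- (T *+ n.+2)))
  => a b c d e f g h k e1 e2.
transitivity ((a * b ^+ n.+1) * (f * b)); first by ring.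
rewrite e1; transitivity (c * d * (f * b * e)); first by ring.
by rewrite e2; ring.
Qed.

Lemma indep_add S T i j : tor S -> tor T -> indep S T -> ~~ (p %| i)%N ->
  S *+ i + T *+ j != 0 /\ S *+ i - T *+ j != 0.
Proof.
move=> hS hT h hi; split; apply/eqP => e.
  by have [h1 _] := h i j e; rewrite h1 in hi.
have e' : S *+ i + T *+ (j * p.-1) = 0.
  rewrite -{}e mulrnA; congr (_ + _); apply: (tor_opp (p := p)); first by tors.
  by rewrite prednK // prime_gt0.
by have [h1 _] := h _ _ e'; rewrite h1 in hi.
Qed.

(** Three cocycle relations at -T regroup the chord of X + S and n(X + S) into chords of multiples
    of X and of multiples of S, with one mixed chord that telescopes. *)
Lemma Phi_addl T S X : tor T -> T != 0 -> tor S -> indep S T -> generic X ->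
  Phi p (X + S) T * Cf X S (- T) ^+ p = Phi p X T * Phi p S T.
Proof.
move=> hT T0 hS hST gX; have p0 := prime_gt0 p_prime; have p1 := prime_gt1 p_prime.
suff : forall n, (n < p)%N -> Phi n.+1 (X + S) T * Cf X S (- T) ^+ n.+1 =
    Phi n.+1 X T * Phi n.+1 S T * Cf (X *+ n.+1) (S *+ n.+1) (- T).
  move=> /(_ p.-1); rewrite prednK // => ->; last by [].
  rewrite (hS : S *+ p = 0) Cf0 ?mulr1 //.
  by apply: off_neq; [generic_nz gX T p | generic_nz gX (- T) p] => // e;
     rewrite e in p0.
elim=> [|n IH] hn; first by rewrite !Phi1 expr1 !mulr1n !mul1r.
have {IH} := IH (ltnW hn); rewrite !(@PhiS _ _ n.+1) // [_ ^+ n.+2]exprS.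
have X1 : generic X by [].
have c1 : Cf X S (- T) * Cf (X + S) (X *+ n.+1 + S *+ n.+1) (- T) =
   Cf S (X *+ n.+1 + S *+ n.+1) (- T) * Cf X (S + (X *+ n.+1 + S *+ n.+1)) (- T).
  apply: Cf_cocycle; apply: off_neq.
  - by generic_nz gX (S + T) 1%N.
  - by generic_nz gX (S - T) 1%N.
  - by generic_nz gX (S + S *+ n.+1 + T) n.+1.
  - by generic_nz gX (S + S *+ n.+1 - T) n.+1.
  - by generic_nz gX (S + S *+ n.+1 + T) n.+2.
  - by generic_nz gX (S + S *+ n.+1 - T) n.+2.
have c2 : Cf S (S *+ n.+1) (- T) * Cf (S + S *+ n.+1) (X *+ n.+1) (- T) =
   Cf (S *+ n.+1) (X *+ n.+1) (- T) * Cf S (S *+ n.+1 + X *+ n.+1) (- T).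
  apply: Cf_cocycle; apply: off_neq.
  - have [e|ne] := eqVneq n.+2 p.
      by rewrite -mulrS e (hS : S *+ p = 0) add0r opprK.
    rewrite -mulrS opprK -[T]mulr1n; case: (@indep_add S T n.+2 1%N hS hT hST) => //.
    by rewrite gtnNdvd // ltn_neqAle ne.
  - have [e|ne] := eqVneq n.+2 p.
      by rewrite -mulrS e (hS : S *+ p = 0) add0r oppr_eq0.
    rewrite -mulrS -[T]mulr1n; case: (@indep_add S T n.+2 1%N hS hT hST) => //.
    by rewrite gtnNdvd // ltn_neqAle ne.
  - by generic_nz gX (S *+ n.+1 + T) n.+1.
  - by generic_nz gX (S *+ n.+1 - T) n.+1.
  - by generic_nz gX (S + S *+ n.+1 + T) n.+1.
  - by generic_nz gX (S + S *+ n.+1 - T) n.+1.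
have c3 : Cf X (X *+ n.+1) (- T) * Cf (X + X *+ n.+1) (S + S *+ n.+1) (- T) =
   Cf (X *+ n.+1) (S + S *+ n.+1) (- T) * Cf X (X *+ n.+1 + (S + S *+ n.+1)) (- T).
  apply: Cf_cocycle; apply: off_neq.
  - by generic_nz gX T n.+2.
  - by generic_nz gX (- T) n.+2.
  - by generic_nz gX (S + S *+ n.+1 + T) n.+1.
  - by generic_nz gX (S + S *+ n.+1 - T) n.+1.
  - by generic_nz gX (S + S *+ n.+1 + T) n.+2.
  - by generic_nz gX (S + S *+ n.+1 - T) n.+2.
have e0 : X *+ n.+1 + S *+ n.+1 = (X + S) *+ n.+1 by zmod.
have e1 : S + (X + S) *+ n.+1 = X *+ n.+1 + S *+ n.+2 by zmod.
have e2 : S *+ n.+1 + X *+ n.+1 = (X + S) *+ n.+1 by zmod.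
have eX : X + X *+ n.+1 = X *+ n.+2 by rewrite -mulrS.
have eS : S + S *+ n.+1 = S *+ n.+2 by rewrite -mulrS.
rewrite e0 e1 in c1; rewrite eX eS in c3.
rewrite eS e2 [Cf (S *+ n.+1) (X *+ n.+1) _]CfC in c2.
rewrite [Cf (S *+ n.+2) _ _]CfC in c2.
move: c1 c2 c3.
move: (Phi n.+1 (X + S) T) (Cf X S (- T)) (Phi n.+1 X T) (Phi n.+1 S T)
  (Cf (X *+ n.+1) (S *+ n.+1) (- T)) (Cf (X + S) ((X + S) *+ n.+1) (- T))
  (Cf X (X *+ n.+1) (- T)) (Cf S (S *+ n.+1) (- T))
  (Cf (X *+ n.+2) (S *+ n.+2) (- T)) (Cf S ((X + S) *+ n.+1) (- T))
  (Cf X (X *+ n.+1 + S *+ n.+2) (- T)) (Cf (X *+ n.+1) (S *+ n.+2) (- T))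
  => a b c d e f g h k u v w c1 c2 c3 IH.
transitivity ((a * b ^+ n.+1) * (b * f)); first by ring.
rewrite IH c1; transitivity (c * d * v * (e * u)); first by ring.
rewrite -c2; transitivity (c * d * h * (w * v)); first by ring.
by rewrite -c3; ring.
Qed.

Lemma Phi_gen_neq0 T X : tor T -> T != 0 -> generic X -> Phi p T X != 0.
Proof.
move=> hT T0 gX; have p1 := prime_gt1 p_prime.
rewrite /Phi prodf_seq_neq0; apply/allP => i; rewrite mem_index_iota => hi /=.
have X0 : X != 0 by have := @generic_neq0 _ p X 1 gX; rewrite mulr1n; apply; lia.
apply: Cf_neq0; rewrite ?oppr_eq0 ?xcN //; first exact: (tor_mul_lt p_prime).
- by apply: xc_neq => //; [generic_nz gX (- T) 1%N | generic_nz gX T 1%N].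
- apply: xc_neq => //; first exact: (tor_mul_lt p_prime).
    by generic_nz gX (- (T *+ i)) 1%N.
  by generic_nz gX (T *+ i) 1%N.
apply: off_neq; first by generic_nz gX (T + T *+ i) 1%N.
by rewrite -oppr_eq0; generic_nz gX (- T - T *+ i) 1%N.
Qed.

Lemma Phi_gen_neq0' T X : tor T -> T != 0 -> generic X -> Phi p X T != 0.
Proof.
move=> hT T0 gX; have p1 := prime_gt1 p_prime.
rewrite /Phi prodf_seq_neq0; apply/allP => i; rewrite mem_index_iota => hi /=.
have X0 : X != 0 by have := @generic_neq0 _ p X 1 gX; rewrite mulr1n; apply; lia.
have Xi : X *+ i != 0 by apply: (@generic_neq0 _ p) => //; lia.
apply: Cf_neq0; rewrite ?oppr_eq0 ?xcN //.
- apply: xc_neq => //; last by generic_nz gX T 1%N.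
  by rewrite -oppr_eq0; generic_nz gX (- T) 1%N.
- apply: xc_neq => //; last by generic_nz gX T i.
  by rewrite -oppr_eq0; generic_nz gX (- T) i; rewrite oppr_eq0.
by apply: off_neq; [generic_nz gX T i.+1 | generic_nz gX (- T) i.+1].
Qed.

Lemma Phi_indep_neq0 T S : tor T -> T != 0 -> tor S -> S != 0 -> indep S T -> Phi p T S != 0.
Proof.
move=> hT T0 hS S0 hST; have p1 := prime_gt1 p_prime.
have h1 i : S + T *+ i != 0 /\ S - T *+ i != 0.
  by rewrite -[S]mulr1n; apply: indep_add => //; rewrite gtnNdvd.
rewrite /Phi prodf_seq_neq0; apply/allP => i; rewrite mem_index_iota => hi /=.
apply: Cf_neq0; rewrite ?oppr_eq0 ?xcN //; first exact: (tor_mul_lt p_prime).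
- by apply: xc_neq => //; case: (h1 1%N).
- by apply: xc_neq => //; [exact: (tor_mul_lt p_prime) | case: (h1 i) | case: (h1 i)].
rewrite -mulrS; apply: off_neq; first by rewrite opprK addrC; case: (h1 i.+1).
by rewrite -oppr_eq0 opprB; case: (h1 i.+1).
Qed.

(** The quotient of Miller products that is a p-th root of f_T o [p] when its first point varies
    generically, taken at S. For independent S and T it is also the factor by which translation by S
    multiplies that root. *)
Definition weil_value S T : F := Phi p T (- S) / Phi p (- S) T.

Lemma indepN S T : tor S -> tor T -> indep S T -> indep (- S) T.
Proof.
move=> hS hT h i j e; have p0 := prime_gt0 p_prime.
have cp : ~~ (p %| p.-1)%N.
  by rewrite gtnNdvd ?ltn_predL // -ltnS prednK // prime_gt1.
have e' : S *+ i + T *+ (j * p.-1) = 0.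
  rewrite mulrnA (@tor_opp _ _ p (T *+ j) p.-1) ?prednK //; last by tors.
  by apply: oppr_inj; rewrite oppr0 -e mulNrn opprD opprK.
by have := h _ _ e'; rewrite Euclid_dvdM // (negbTE cp) orbF.
Qed.

Lemma weil_function_add S T X : tor T -> T != 0 -> tor S -> S != 0 ->
  indep (- S) T -> indep T (- S) -> generic X ->
  Phi p T (- (X + S)) / Phi p (- (X + S)) T =
  weil_value S T * (Phi p T (- X) / Phi p (- X) T).
Proof.
move=> hT T0 hS S0 hST hTS gX; have gX' := genericN gX.
have hS' : tor (- S) by tors.
have S0' : - S != 0 by rewrite oppr_eq0.
have e1 := Phi_addr hT T0 hS' hST gX'.
have e2 := Phi_addl hT T0 hS' hST gX'.
rewrite opprD /weil_value.
have n1 : Phi p (- X) T != 0 by apply: Phi_gen_neq0'.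
have n2 : Phi p (- S) T != 0 by apply: Phi_indep_neq0.
have c0 : Cf (- X) (- S) (- T) ^+ p != 0.
  apply/eqP => c0; move/eqP: e2; rewrite c0 mulr0 eq_sym mulf_eq0.
  by rewrite (negbTE n1) (negbTE n2).
rewrite -[Phi p T (- X - S)](mulfK c0) -[Phi p (- X - S) T](mulfK c0) e1 e2.
by field; rewrite n1 n2 c0.
Qed.

Lemma weil_value_antisym S T : tor S -> tor T -> S != 0 -> T != 0 -> (2 < p)%N ->
  indep T (- S) -> indep S (- T) -> weil_value S T * weil_value T S = 1.
Proof.
move=> hS hT S0 T0 p2 hTS hST; have p0 := prime_gt0 p_prime.
have S0' : - S != 0 by rewrite oppr_eq0.
have T0' : - T != 0 by rewrite oppr_eq0.
(* Reflection costs one sign for each chord except the last one, which is vertical: p - 2 signs.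
   They cancel in the product of the two values. *)
have e U V : tor U -> U != 0 -> V != 0 ->
    Phi p (- U) V = (-1) ^+ (p - 2) * Phi p U (- V).
  move=> hU U0 V0; have pp : p.-1.+1 = p by rewrite prednK.
  rewrite -{1 3}pp !PhiS; try lia.
  rewrite mulNrn (tor_opp hU pp) !CfN ?oppr_eq0 // !xcN mulrA; congr (_ * _).
  rewrite /Phi (_ : (p - 2)%N = (p.-1 - 1)%N); last by lia.
  rewrite -(prodr_const_nat 1 p.-1 (-1)) -big_split /=.
  rewrite !big_nat; apply: eq_bigr => i hi.
  rewrite mulNrn CfNN ?mulN1r ?opprK //; first by apply: (tor_mul_lt p_prime) => //; lia.
  by rewrite -mulrS; apply: (tor_mul_lt p_prime) => //; lia.
rewrite /weil_value !e //.
have n1 : Phi p S (- T) != 0 by apply: Phi_indep_neq0 => //; [tors | exact: indepC].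
have n2 : Phi p T (- S) != 0 by apply: Phi_indep_neq0 => //; [tors | exact: indepC].
have n3 : (-1) ^+ (p - 2) != 0 :> F by rewrite signr_eq0.
have n4 : (-1) ^+ (p - 2) * (-1) ^+ (p - 2) = 1 :> F.
  by rewrite -expr2 sqrr_sign.
rewrite !invfM mulrACA; set a := Phi p T _; set b := Phi p S _.
transitivity (a * b / (a * b) / ((-1) ^+ (p - 2) * (-1) ^+ (p - 2))).
  by field; rewrite n1 n2 n3.
by rewrite n4 divr1 divff // mulf_neq0.
Qed.

End WeilValue.

(** * Division polynomials and the p-torsion *)

Section AdditionFormulas.

Variables (F : fieldType) (E : elliptic F).
Implicit Types (P Q X : ept E).
Local Notation W := (model E).
Local Notation B2 := (b2 W).
Local Notation B4 := (b4 W).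
Local Notation B6 := (b6 W).
Local Notation B8 := (b8 W).

(* Homogeneous forms of the sum and product of [x (P + X)] and [x (P - X)],
   where [x P = a / b] and [x X = x]. *)
Definition xsum_den (a b x : F) : F := (a - b * x) ^+ 2.
Definition xsum_num (a b x : F) : F :=
  2 * a * x * (a + b * x) + B2 * a * b * x + B4 * b * (a + b * x) + B6 * b ^+ 2.
Definition xprod_num (a b x : F) : F :=
  a ^+ 2 * x ^+ 2 - B4 * a * b * x - B6 * b * (a + b * x) - B8 * b ^+ 2.

Definition xrep P : F * F := if P == 0 then (1, 0) else (xc P, 1).

Lemma curve_eq P : P != 0 ->
  a6 W = yc P ^+ 2 + a1 W * xc P * yc P + a3 W * yc P
         - (xc P ^+ 3 + a2 W * xc P ^+ 2 + a4 W * xc P).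
Proof. by move=> /pc_oncurve /= e; rewrite e; ring. Qed.

Lemma xcD P Q : P != 0 -> Q != 0 -> P + Q != 0 ->
  xc (P + Q) = third W (pc P) (pc Q) (sl P Q).
Proof. by move=> P0 Q0 PQ; have := pcD P0 Q0 PQ => -[]. Qed.

Lemma xsum_generic P X : P != 0 -> X != 0 -> P + X != 0 -> P - X != 0 ->
  [/\ xsum_den (xc P) 1 (xc X) != 0,
   xsum_num (xc P) 1 (xc X) =
     xsum_den (xc P) 1 (xc X) * (xc (P + X) + xc (P - X)) &
   xprod_num (xc P) 1 (xc X) =
     xsum_den (xc P) 1 (xc X) * (xc (P + X) * xc (P - X))].
Proof.
move=> P0 X0 h1 h2; have X0' : - X != 0 by rewrite oppr_eq0.
have ne : xc P != xc X by apply: xc_neq.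
have d1 : xc P - xc X != 0 by rewrite subr_eq0.
have d2 : xc X - xc P != 0 by rewrite subr_eq0 eq_sym.
have e6 := curve_eq P0; have e6' := curve_eq X0; rewrite e6 in e6'.
rewrite !xcD // /third /sl /slope !pcN // /xsum_den /xsum_num /xprod_num /=.
rewrite (negbTE ne) mul1r.
(* One curve equation has eliminated [a6]; the difference of the two eliminates [a4], after which
   the formulas are identities of rational functions in the coordinates. *)
have e4 : a4 W = ((yc X ^+ 2 + a1 W * xc X * yc X + a3 W * yc X
     - (xc X ^+ 3 + a2 W * xc X ^+ 2)) - (yc P ^+ 2 + a1 W * xc P * yc P + a3 W * yc P
     - (xc P ^+ 3 + a2 W * xc P ^+ 2))) / (xc X - xc P).
  apply: (mulIf d2); rewrite mulfVK //.
  apply: (@addrI _ (yc P ^+ 2 + a1 W * xc P * yc P + a3 W * yc P -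
      (xc P ^+ 3 + a2 W * xc P ^+ 2 + a4 W * xc P))).
  by rewrite {1}e6'; ring.
rewrite /b2 /b4 /b6 /b8 e6 e4; split; first by rewrite expf_neq0.
  by field; rewrite ?d1 ?d2.
by field; rewrite ?d1 ?d2.
Qed.

Lemma xsum_double X : X != 0 ->
  let x := xc X in
  xsum_num x 1 x = tangent_den W (pc X) ^+ 2 /\
  xprod_num x 1 x = tangent_num W (pc X) ^+ 2
    + a1 W * tangent_num W (pc X) * tangent_den W (pc X)
    - (a2 W + 2 * x) * tangent_den W (pc X) ^+ 2.
Proof.
move=> X0 /=; rewrite /xsum_num /xprod_num /b2 /b4 /b6 /b8 (curve_eq X0).
by rewrite /tangent_den /tangent_num /=; split; ring.
Qed.

Lemma double_eq0 X : X != 0 -> (X + X == 0) = (tangent_den W (pc X) == 0).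
Proof.
move=> X0; rewrite -opposite_add // /opposite eqxx /=.
by congr (_ == 0); rewrite /tangent_den /=; ring.
Qed.

(** The free scalar k lets the homogeneous forms cover P = O and P = X, -X as well. In the last two
    cases k is the square of [tangent_den], or the product form itself when X has order 2. *)
Lemma xsum_rep P X : X != 0 -> let x := xc X in let: (a, b) := xrep P in
  let u := xrep (P + X) in let w := xrep (P - X) in
  exists2 k, k != 0 & [/\ xsum_den a b x = k * (u.2 * w.2),
    xsum_num a b x = k * (u.1 * w.2 + u.2 * w.1) &
    xprod_num a b x = k * (u.1 * w.1)].
Proof.
move=> X0 /=; have X0' : - X != 0 by rewrite oppr_eq0.
have dbl : exists2 k, k != 0 & [/\ xsum_den (xc X) 1 (xc X) = 0,
   xsum_num (xc X) 1 (xc X) = k * (xrep (X + X)).2 &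
   xprod_num (xc X) 1 (xc X) = k * (xrep (X + X)).1].
  have [e1 e2] := xsum_double X0; rewrite /xrep double_eq0 //.
  have D0 : xsum_den (xc X) 1 (xc X) = 0.
    by rewrite /xsum_den mul1r subrr expr0n.
  have [d0|d0] := eqVneq (tangent_den W (pc X)) 0.
    exists (xprod_num (xc X) 1 (xc X)).
      rewrite e2 d0 expr0n !mulr0 subr0 addr0 expf_neq0 //; apply/eqP => n0.
      exact: (nonsingular (disc_neq0 E) (pc_oncurve X0)).
    by split; rewrite //= ?mulr0 ?mulr1 // e1 d0 expr0n.
  exists (tangent_den W (pc X) ^+ 2); first by rewrite expf_neq0.
  split=> //=; first by rewrite mulr1.
  have XX : X + X != 0 by rewrite double_eq0.
  rewrite e2 xcD // /third /sl /slope eqxx /=.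
  rewrite -[3 * _ + _ + _ - _]/(tangent_num W (pc X)).
  rewrite -[2 * _ + _ + _]/(tangent_den W (pc X)).
  by field.
rewrite {1}/xrep; have [->|P0] := eqVneq P 0.
  rewrite add0r sub0r /xrep (negbTE X0) (negbTE X0') xcN.
  exists 1; rewrite ?oner_neq0 // /xsum_den /xsum_num /xprod_num /=.
  by split; ring.
have [e|PX] := eqVneq P X.
  case: dbl => k k0 [e1 e2 e3]; exists k => //; rewrite e subrr.
  by rewrite {2 4 6}/xrep eqxx /= !mulr0 !mulr1 e1 e2 e3 add0r.
have [e|PX'] := eqVneq P (- X).
  case: dbl => k k0 [e1 e2 e3]; exists k => //; rewrite e addNr xcN.
  have -> : xrep (- X - X) = xrep (X + X) by rewrite -opprD /xrep oppr_eq0 xcN.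
  by rewrite {1 3 6}/xrep eqxx /= !mul0r !mul1r mulr0 addr0 e1 e2 e3.
have h1 : P + X != 0 by rewrite addr_eq0.
have h2 : P - X != 0 by rewrite subr_eq0.
have [k0 e2 e3] := xsum_generic P0 X0 h1 h2.
exists (xsum_den (xc P) 1 (xc X)) => //.
by rewrite /xrep (negbTE h1) (negbTE h2) /= !mulr1 mul1r; split.
Qed.

End AdditionFormulas.

(** * Polynomials with coefficients in a subring, and the shape of division polynomials *)

Section PolyOver.

Variables (F : fieldType) (S : F -> Prop).

Definition is_subring : Prop :=
  [/\ S 1, forall x y, S x -> S y -> S (x - y) & forall x y, S x -> S y -> S (x * y)].

Hypothesis S_ring : is_subring.

Lemma subring0 : S 0.
Proof. by case: S_ring => S1 SB _; rewrite -(subrr 1); apply: SB. Qed.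
Lemma subringN x : S x -> S (- x).
Proof. by case: S_ring => _ SB _ Sx; rewrite -sub0r; apply: SB => //; apply: subring0. Qed.
Lemma subringD x y : S x -> S y -> S (x + y).
Proof.
by case: S_ring => _ SB _ Sx Sy; rewrite -[y]opprK; apply: SB => //; apply: subringN.
Qed.
Lemma subringM x y : S x -> S y -> S (x * y).
Proof. by case: S_ring => _ _ ; apply. Qed.
Lemma subring1 : S 1.
Proof. by case: S_ring. Qed.
Lemma subringX x n : S x -> S (x ^+ n).
Proof.
by move=> Sx; elim: n => [|n IH]; rewrite ?exprS; [apply: subring1 | apply: subringM].
Qed.
Lemma subring_nat n : S n%:R.
Proof.
elim: n => [|n IH]; first exact: subring0.
by rewrite mulrS; apply: subringD => //; apply: subring1.
Qed.
Lemma subring_sum I (r : seq I) (f : I -> F) :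
  (forall i, S (f i)) -> S (\sum_(i <- r) f i).
Proof.
by move=> h; elim/big_rec: _ => [|i x _]; [apply: subring0 | apply: subringD].
Qed.

Definition coefs_in (p : {poly F}) : Prop := forall i, S p`_i.

Lemma coefs_inD p q : coefs_in p -> coefs_in q -> coefs_in (p + q).
Proof. by move=> hp hq i; rewrite coefD; apply: subringD. Qed.
Lemma coefs_inN p : coefs_in p -> coefs_in (- p).
Proof. by move=> hp i; rewrite coefN; apply: subringN. Qed.
Lemma coefs_inB p q : coefs_in p -> coefs_in q -> coefs_in (p - q).
Proof. by move=> hp hq; apply: coefs_inD => //; apply: coefs_inN. Qed.
Lemma coefs_inM p q : coefs_in p -> coefs_in q -> coefs_in (p * q).
Proof.
by move=> hp hq i; rewrite coefM; apply: subring_sum => j; apply: subringM.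
Qed.
Lemma coefs_inC c : S c -> coefs_in c%:P.
Proof. by move=> hc i; rewrite coefC; case: ifP => // _; apply: subring0. Qed.
Lemma coefs_inX : coefs_in 'X.
Proof. by move=> i; rewrite coefX; apply: subring_nat. Qed.

Lemma coefs_in_div c q : c \is monic -> coefs_in c -> coefs_in (q * c) -> coefs_in q.
Proof.
move=> mc hc; move: {2}(size q) (leqnn (size q)) => n.
elim: n q => [|n IH] q.
  rewrite leqn0 size_poly_eq0 => /eqP -> _ i; rewrite coef0; exact: subring0.
move=> sq hqc; have [->|q0] := eqVneq q 0.
  by move=> i; rewrite coef0; apply: subring0.
have Sl : S (lead_coef q).
  by rewrite -[lead_coef q]mulr1 -(monicP mc) -lead_coefM; apply: hqc.
pose q' := q - lead_coef q *: 'X^((size q).-1).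
have hm : coefs_in (lead_coef q *: 'X^((size q).-1)).
  move=> i; rewrite coefZ coefXn; apply: subringM => //; exact: subring_nat.
have -> : q = q' + lead_coef q *: 'X^((size q).-1) by rewrite subrK.
apply: coefs_inD => //; apply: IH; last first.
  by rewrite mulrBl; apply: coefs_inB => //; apply: coefs_inM.
rewrite -ltnS; apply: leq_trans sq; rewrite -(prednK (_ : 0 < size q)%N) ?size_poly_gt0 //.
apply/leq_sizeP => j hj; rewrite coefB coefZ coefXn.
have [e|ne] := eqVneq j (size q).-1; first by rewrite e mulr1 subrr.
rewrite mulr0 subr0 nth_default //; move: hj ne.
by rewrite -size_poly_gt0 in q0; move: (size q) q0 => s; lia.
Qed.

End PolyOver.

Ltac coefs_in_tac h := repeat first
  [ assumption | apply: (coefs_inX h) | apply: (coefs_inB h) | apply: (coefs_inD h)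
  | apply: (coefs_inN h) | apply: (coefs_inM h) | apply: (coefs_inC h) | apply: (subring_nat h)].

Lemma coefM_top (F : fieldType) (p q : {poly F}) m k :
  (size p <= m.+1)%N -> (size q <= k.+1)%N -> (p * q)`_(m + k) = p`_m * q`_k.
Proof.
move=> hp hq; rewrite coefM (bigD1 (inord m)) //= inordK ?ltnS ?leq_addr //.
rewrite addKn big1 ?addr0 // => i hi.
have {}hi : i != m :> nat.
  by apply: contra hi => /eqP e; apply/eqP/val_inj; rewrite /= inordK // ltnS leq_addr.
have [lt|] := ltnP i m; last move=> le.
  rewrite [q`__]nth_default ?mulr0 // (leq_trans hq) //; lia.
by rewrite nth_default ?mul0r // (leq_trans hp) //; lia.
Qed.

Section DivisionShape.

Variables (F : fieldType) (W : weierstrass F).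
Implicit Types (a b c d : {poly F}).

Definition DP a b : {poly F} := (a - b * 'X) ^+ 2.
Definition SP a b : {poly F} :=
  2%:P * (a * a * 'X) + 2%:P * (a * b * ('X * 'X)) + (b2 W)%:P * (a * b * 'X) +
  (b4 W)%:P * (b * (a + b * 'X)) + (b6 W)%:P * (b * b).
Definition PP a b : {poly F} :=
  a * a * ('X * 'X) + (- ((b4 W)%:P * (a * b * 'X)) - (b6 W)%:P * (b * (a + b * 'X))
  - (b8 W)%:P * (b * b)).

(** S is the whole field when torsion points are counted and a valuation ring when their integrality
    is wanted. The coefficient of degree N - 1 is prescribed rather than the degree of [b], which
    drops when N is 0 in the field. *)
Record division_shape (S : F -> Prop) (N : nat) a b : Prop := DivisionShape {
  shape_monic : a \is monic;
  shape_size1 : size a = N.+1;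
  shape_size2 : (size b <= N)%N;
  shape_lead : b`_N.-1 = N%:R;
  shape_coefs1 : coefs_in S a;
  shape_coefs2 : coefs_in S b }.

Lemma size_polyC_mul (k : F) (q : {poly F}) : (size (k%:P * q)%R <= size q)%N.
Proof. by rewrite mul_polyC; apply: size_scale_leq. Qed.

(** M, N, K stand for three consecutive squares, hence M + K = 2N + 2. Quotients by the monic [c]
    keep their coefficients in S, and comparison in degree 2N + 1 gives [b'] the top coefficient 2 +
    2N - M = K. *)
Lemma shape_step S N M K a b c d a' b' : is_subring S ->
  S (a1 W) -> S (a2 W) -> S (a3 W) -> S (a4 W) -> S (a6 W) ->
  (0 < N)%N -> (M + K = N.*2 + 2)%N -> (0 < K)%N ->
  division_shape S N a b -> division_shape S M c d ->
  SP a b = c * b' + d * a' -> PP a b = c * a' -> division_shape S K a' b'.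
Proof.
move=> hS s1 s2 s3 s4 s6 N0 eK K0 [ma sa sb lb ca cb] [mc sc sd ld cc cd] eS eP.
have hb2 : S (b2 W).
  by rewrite /b2 expr2; apply: (subringD hS); apply: (subringM hS) => //; apply: (subring_nat hS).
have hb4 : S (b4 W).
  by rewrite /b4; apply: (subringD hS); apply: (subringM hS) => //; apply: (subring_nat hS).
have hb6 : S (b6 W).
  by rewrite /b6 expr2; apply: (subringD hS); apply: (subringM hS) => //; apply: (subring_nat hS).
have hb8 : S (b8 W).
  by rewrite /b8 !expr2; do ![assumption | apply: (subring_nat hS) |
    apply: (subringD hS) | apply: (subringN hS) | apply: (subringM hS)].
have cS : coefs_in S (SP a b).
  by rewrite /SP; coefs_in_tac hS.
have cP : coefs_in S (PP a b).
  by rewrite /PP; coefs_in_tac hS.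
have a0 := monic_neq0 ma; have c0 := monic_neq0 mc.
have saX : size (a * a * ('X * 'X)) = (N.*2 + 3)%N.
  rewrite -['X * 'X]expr2 size_mulXn ?mulf_neq0 // size_Mmonic // sa; lia.
have sab : (size (a * b)%R <= N.*2)%N.
  by apply: leq_trans (size_polyMleq_field _ _) _; lia.
have sbb : (size (b * b)%R <= N.*2.-1)%N.
  by apply: leq_trans (size_polyMleq_field _ _) _; lia.
have sX (q : {poly F}) : (size (q * 'X)%R <= (size q).+1)%N.
  by apply: leq_trans (size_polyMleq_field _ _) _; rewrite size_polyX; lia.
have sabX : (size (a * b * 'X)%R <= N.*2.+1)%N.
  by apply: leq_trans (sX _) _; rewrite ltnS.
have sbabX : (size (b * (a + b * 'X))%R <= N.*2.+1)%N.
  apply: leq_trans (size_polyMleq_field _ _) _.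
  have : (size (a + b * 'X)%R <= N.+1)%N.
    apply: leq_trans (size_polyD_field _ _) _; rewrite geq_max sa leqnn /=.
    by apply: leq_trans (sX _) _; rewrite ltnS.
  by move: (size (a + b * 'X)) => z; lia.
have sPt : (size (- ((b4 W)%:P * (a * b * 'X)) - (b6 W)%:P * (b * (a + b * 'X))
    - (b8 W)%:P * (b * b))%R <= N.*2.+1)%N.
  apply: leq_trans (size_polyD_field _ _) _; rewrite geq_max; apply/andP; split.
    apply: leq_trans (size_polyD_field _ _) _; rewrite geq_max !size_polyN_field.
    by rewrite (leq_trans (size_polyC_mul _ _)) //= (leq_trans (size_polyC_mul _ _)).
  rewrite size_polyN_field (leq_trans (size_polyC_mul _ _)) // (leq_trans sbb) //; lia.
have sPP : size (PP a b) = (N.*2 + 3)%N.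
  by rewrite /PP size_polyDl saX //; apply: leq_ltn_trans sPt _; lia.
have mPP : PP a b \is monic.
  rewrite monicE /PP lead_coefDl ?saX; last by apply: leq_ltn_trans sPt _; lia.
  by rewrite !lead_coefM lead_coefX (monicP ma) !mulr1.
have ma' : a' \is monic.
  by rewrite monicE; move: mPP; rewrite monicE eP lead_coefM (monicP mc) mul1r.
have sa' : size a' = K.+1.
  have szl n : ((n + M.+1).-1 = N.*2 + 3 -> n = K.+1)%N by lia.
  by have := sPP; rewrite eP mulrC size_Mmonic ?monic_neq0 // sc => /szl.
have ca' : coefs_in S a'.
  by apply: (coefs_in_div hS mc) => //; rewrite mulrC -eP.
have ebc : c * b' = SP a b - d * a' by rewrite eS addrK.
have cb' : coefs_in S b'.
  apply: (coefs_in_div hS mc) => //; rewrite mulrC ebc.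
  by coefs_in_tac hS.
have sda : (size (d * a')%R <= N.*2 + 2)%N.
  by apply: leq_trans (size_polyMleq_field _ _) _; rewrite sa'; lia.
have saaX : (size (a * a * 'X)%R <= N.*2 + 2)%N.
  rewrite size_mulX ?mulf_neq0 // size_Mmonic // sa; lia.
have sabXX : (size (a * b * ('X * 'X))%R <= N.*2 + 2)%N.
  by rewrite mulrA; apply: leq_trans (sX _) _; lia.
have sSP : (size (SP a b) <= N.*2 + 2)%N.
  have sD (q r : {poly F}) z : (size q <= z)%N -> (size r <= z)%N -> (size (q + r)%R <= z)%N.
    by move=> h1 h2; apply: leq_trans (size_polyD_field _ _) _; rewrite geq_max h1.
  rewrite /SP; apply: (sD); last by apply: leq_trans (size_polyC_mul _ _) _; lia.
  apply: (sD); last by apply: leq_trans (size_polyC_mul _ _) _; lia.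
  apply: (sD); last by apply: leq_trans (size_polyC_mul _ _) _; lia.
  by apply: (sD); apply: leq_trans (size_polyC_mul _ _) _.
have sb' : (size b' <= K)%N.
  have [->|b0] := eqVneq b' 0; first by rewrite size_poly0.
  have : (size (c * b')%R <= N.*2 + 2)%N.
    rewrite ebc; apply: leq_trans (size_polyD_field _ _) _.
    by rewrite size_polyN_field geq_max sSP sda.
  by rewrite size_polyM_field // sc; lia.
split=> //.
have ntop (q : {poly F}) : (size q <= N.*2.+1)%N -> q`_N.*2.+1 = 0.
  by move=> h; rewrite nth_default.
have cSP : (SP a b)`_N.*2.+1 = (2 + 2 * N%:R : F).
  have c1 : (a * a * 'X)`_N.*2.+1 = 1.
    rewrite coefMX /= -addnn coefM_top ?sa //.
    by rewrite -[N]/(N.+1.-1) -sa -lead_coefE (monicP ma) mulr1.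
  have c2 : (a * b * ('X * 'X))`_N.*2.+1 = N%:R.
    rewrite mulrA coefMX /= coefMX.
    have -> : (N.*2 == 0)%N = false by lia.
    have -> : N.*2.-1 = (N + N.-1)%N by lia.
    rewrite coefM_top ?sa //; last by rewrite prednK.
    by rewrite -{1}[N]/(N.+1.-1) -sa -lead_coefE (monicP ma) mul1r lb.
  rewrite /SP !coefD !coefCM c1 c2 !ntop ?mulr0 ?addr0 ?mulr1 //.
  by rewrite (leq_trans sbb) //; lia.
have cda : (d * a')`_N.*2.+1 = M%:R.
  have [M0|M0] := posnP M.
    rewrite M0; have -> : d = 0 by apply/eqP; rewrite -size_poly_eq0 -leqn0 -M0.
    by rewrite mul0r coef0.
  have -> : N.*2.+1 = (M.-1 + K)%N by lia.
  rewrite coefM_top ?sa' ?prednK // ld.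
  by rewrite -[K in a'`_K]/(K.+1.-1) -sa' -lead_coefE (monicP ma') mulr1.
have : (c * b')`_N.*2.+1 = 2 + 2 * N%:R - M%:R by rewrite ebc coefB cSP cda.
have -> : N.*2.+1 = (M + K.-1)%N by lia.
rewrite coefM_top ?sc ?prednK //.
rewrite -{1}[M]/(M.+1.-1) -sc -lead_coefE (monicP mc) mul1r => ->.
by rewrite -[2]/(2%:R) -natrM -natrD -natrB; [congr (_%:R); lia | lia].
Qed.

End DivisionShape.

Section DivisionPolynomials.

Variables (F : closedFieldType) (E : elliptic F).
Implicit Types (P Q X : ept E) (a b c d : {poly F}).
Local Notation W := (model E).
Local Notation SP := (SP W).
Local Notation PP := (PP W).

Lemma point_over x : exists X : ept E, X != 0 /\ xc X = x.
Proof.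
pose q : {poly F} := 'X^2 + ((a1 W * x + a3 W) *: 'X -
   (x ^+ 3 + a2 W * x ^+ 2 + a4 W * x + a6 W)%:P).
have sq : size q = 3.
  rewrite size_polyDl ?size_polyXn //.
  rewrite (leq_ltn_trans (size_polyD _ _)) // gtn_max size_polyN.
  rewrite (leq_ltn_trans (size_scale_leq _ _)) ?size_polyX //=.
  by rewrite (leq_ltn_trans (size_polyC_leq1 _)).
have /closed_rootP[y] : size q != 1 by rewrite sq.
rewrite rootE /q !(hornerD, hornerN, hornerXn, hornerZ, hornerX, hornerC) => /eqP e.
have h : oncurve W (Some (x, y)).
  by rewrite /=; apply/eqP; rewrite -subr_eq0 -[X in _ == X]e; apply/eqP; ring.
by exists (mkept h).
Qed.

(** Homogeneous coordinates of x(nX), up to a factor that may depend on X. As this factor is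
    nonzero, [a] and [b] have no common root. *)
Definition represents (n : nat) a b : Prop := forall X, X != 0 ->
  exists2 k, k != 0 & a.[xc X] = k * (xrep (X *+ n)).1 /\ b.[xc X] = k * (xrep (X *+ n)).2.

Lemma horner_DP a b x : (DP a b).[x] = xsum_den a.[x] b.[x] x.
Proof. by rewrite /DP /xsum_den !hornerE. Qed.
Lemma horner_SP a b x : (SP a b).[x] = xsum_num E a.[x] b.[x] x.
Proof.
rewrite /SP /xsum_num !(hornerD, hornerM, hornerC, hornerX); ring.
Qed.
Lemma horner_PP a b x : (PP a b).[x] = xprod_num E a.[x] b.[x] x.
Proof.
rewrite /PP /xprod_num !(hornerD, hornerN, hornerM, hornerC, hornerX); ring.
Qed.

Lemma xforms_scale (k u v x : F) : [/\ xsum_den (k * u) (k * v) x = k ^+ 2 * xsum_den u v x,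
  xsum_num E (k * u) (k * v) x = k ^+ 2 * xsum_num E u v x &
  xprod_num E (k * u) (k * v) x = k ^+ 2 * xprod_num E u v x].
Proof. by rewrite /xsum_den /xsum_num /xprod_num; split; ring. Qed.

Lemma represents_forms n a b X : (0 < n)%N -> represents n a b -> X != 0 ->
  let u := xrep (X *+ n.+1) in let w := xrep (X *+ n.-1) in
  exists2 k, k != 0 & [/\ (DP a b).[xc X] = k * (u.2 * w.2),
    (SP a b).[xc X] = k * (u.1 * w.2 + u.2 * w.1) &
    (PP a b).[xc X] = k * (u.1 * w.1)].
Proof.
move=> n0 hab X0 /=; have [k k0 [ea eb]] := hab X X0.
have e1 : X *+ n.+1 = X *+ n + X by rewrite mulrSr.
have e2 : X *+ n.-1 = X *+ n - X by rewrite -{2}(prednK n0) mulrSr addrK.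
have := xsum_rep (X *+ n) X0; rewrite -e1 -e2 /=.
case: (xrep (X *+ n)) ea eb => x1 x2 /= ea eb [m m0 [f1 f2 f3]].
have [g1 g2 g3] := xforms_scale k x1 x2 (xc X).
exists (k ^+ 2 * m); first by rewrite mulf_neq0 // expf_neq0.
by rewrite horner_DP horner_SP horner_PP ea eb g1 g2 g3 f1 f2 f3 !mulrA.
Qed.

Lemma xrep_neq0 P : (xrep P).1 != 0 \/ (xrep P).2 != 0.
Proof.
by rewrite /xrep; case: (P == 0) => /=; [left|right]; apply: oner_neq0.
Qed.

Lemma represents_coprime n a b : represents n a b -> coprimep a b.
Proof.
move=> hab; apply/Pdiv.ClosedField.coprimepP => x /rootP ax.
have [X [X0 ex]] := point_over x; rewrite -ex in ax *.
have [k k0 [ea eb]] := hab X X0; rewrite ea in ax.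
move/eqP: ax; rewrite mulf_eq0 (negbTE k0) /= => /eqP x10.
rewrite eb mulf_neq0 //; case: (xrep_neq0 (X *+ n)) => //.
by rewrite x10 eqxx.
Qed.

Lemma poly0_points a : (forall X, X != 0 -> a.[xc X] = 0) -> a = 0.
Proof.
move=> h; apply/eqP/negPn/negP => /closed_nonrootP[x].
by have [X [X0 <-]] := point_over x; rewrite rootE h // eqxx.
Qed.

(** The quadratic DP z^2 - SP z + PP has the roots x((n + 1)X) and x((n - 1)X). The second one is c
    / d in lowest terms, so the linear factor d z - c splits off over F[x] as in Gauss's lemma. *)
Lemma represents_factor n a b c d : (0 < n)%N ->
  represents n a b -> represents n.-1 c d -> c \is monic ->
  exists a' b', [/\ DP a b = d * b', SP a b = c * b' + d * a' & PP a b = c * a'].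
Proof.
move=> n0 hab hcd mc; have cop := represents_coprime hcd.
have e : DP a b * c * c - SP a b * c * d + PP a b * d * d = 0.
  apply: poly0_points => X X0.
  have [k k0 []] := represents_forms n0 hab X0.
  move: (DP a b) (SP a b) (PP a b) => D S P e1 e2 e3.
  have [m m0 [e4 e5]] := hcd X X0.
  by rewrite !(hornerD, hornerN, hornerM) e1 e2 e3 e4 e5; ring.
have c0 := monic_neq0 mc.
have /dvdpP[a' ea'] : c %| PP a b.
  rewrite -(@Gauss_dvdpl _ _ (d * d)); last by rewrite coprimepMr cop.
  apply/dvdpP; exists (SP a b * d - DP a b * c).
  by rewrite mulrA; apply/eqP; rewrite -subr_eq0 -e; apply/eqP; ring.
have e2 : DP a b * c = d * (SP a b - a' * d).
  apply: (mulfI c0); apply/eqP; rewrite -subr_eq0; apply/eqP.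
  by rewrite -[RHS]e ea'; ring.
have [d0|d0] := eqVneq d 0.
  exists a', (SP a b).
  have c1 : c = 1.
    move: cop; rewrite d0 coprimep0 -size_poly_eq1 => /size_poly1P[k k0 ek].
    by move: mc; rewrite ek monicE lead_coefC => /eqP ->.
  move: e2; rewrite d0 !mul0r c1 mulr1 => ->.
  by rewrite ea' c1 mul1r mulr1 mul1r addr0; split.
have /dvdpP[b' eb'] : d %| DP a b.
  rewrite -(@Gauss_dvdpl _ _ c); last by rewrite coprimep_sym.
  by apply/dvdpP; exists (SP a b - a' * d); rewrite e2 mulrC.
exists a', b'; split; last by rewrite mulrC.
  by rewrite mulrC.
apply: (mulfI d0); move: e2; rewrite eb' => e2.
transitivity (d * (SP a b - a' * d) + d * d * a'); first by ring.
by rewrite -e2; ring.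
Qed.

Lemma represents_step n a b c d a' b' : (0 < n)%N ->
  represents n a b -> represents n.-1 c d ->
  DP a b = d * b' -> SP a b = c * b' + d * a' -> PP a b = c * a' ->
  represents n.+1 a' b'.
Proof.
move=> n0 hab hcd e1 e2 e3 X X0.
have [k k0 [f1 f2 f3]] := represents_forms n0 hab X0.
have [m m0 [g1 g2]] := hcd X X0.
move: f1 f2 f3; rewrite e1 e2 e3 !(hornerD, hornerM) g1 g2.
move: (xrep (X *+ n.+1)) => -[u1 u2] /=; rewrite /xrep.
exists (k / m); first by rewrite mulf_neq0 // invr_neq0.
move: f1 f2 f3; case: eqVneq => _ /=.
  rewrite !(mulr0, mulr1, mul0r, add0r, addr0) => _ f2 f3.
  by split; apply: (mulfI m0); rewrite ?f2 ?f3; field.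
rewrite !mulr1 => f1 f2 f3.
have eb : b'.[xc X] = k / m * u2 by apply: (mulfI m0); rewrite f1; field.
split=> //; apply: (mulfI m0); apply: (@addrI _ (m * xc (X *+ n.-1) * b'.[xc X])).
by rewrite f2 eb; field.
Qed.

Lemma represents0 : represents 0 1 0.
Proof.
move=> X X0; exists 1; rewrite ?oner_neq0 // mulr0n /xrep eqxx.
by rewrite hornerC horner0 mulr1 mulr0.
Qed.
Lemma represents1 : represents 1 'X 1.
Proof.
move=> X X0; exists 1; rewrite ?oner_neq0 // mulr1n /xrep (negbTE X0).
by rewrite hornerX hornerC !mul1r.
Qed.

Theorem division_polynomials S n : is_subring S ->
  S (a1 W) -> S (a2 W) -> S (a3 W) -> S (a4 W) -> S (a6 W) ->
  exists a b, represents n a b /\ division_shape S (n ^ 2) a b.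
Proof.
move=> hS s1 s2 s3 s4 s6.
have sh0 : division_shape S 0 1 0.
  split; rewrite ?monic1 ?size_poly1 ?size_poly0 ?coef0 //.
    by apply: (coefs_inC hS); apply: (subring1 hS).
  by apply: (coefs_inC hS); apply: (subring0 hS).
have sh1 : division_shape S 1 'X 1.
  split; rewrite ?monicX ?size_polyX ?size_poly1 ?coefC //; first exact: (coefs_inX hS).
  by apply: (coefs_inC hS); apply: (subring1 hS).
suff : exists a b c d, [/\ represents n.+1 a b, division_shape S (n.+1 ^ 2) a b,
   represents n c d & division_shape S (n ^ 2) c d].
  by move=> [_ [_ [c [d [_ _ h1 h2]]]]]; exists c, d.
elim: n => [|n [a [b [c [d [h1 h2 h3 h4]]]]]].
  by exists 'X, 1, 1, 0; split; [apply: represents1 | | apply: represents0 | ].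
have [a' [b' [e1 e2 e3]]] := represents_factor (ltn0Sn n) h1 h3 (shape_monic h4).
exists a', b', a, b; split=> //.
  exact: (represents_step (ltn0Sn n) h1 h3 e1 e2 e3).
by apply: (@shape_step _ W S (n.+1 ^ 2) (n ^ 2) (n.+2 ^ 2) a b c d) => //; lia.
Qed.

End DivisionPolynomials.

(** * The p-torsion is free of rank 2 *)

Section TorsionStructure.

Variables (F : closedFieldType) (E : elliptic F) (p : nat).
Hypothesis (p_prime : prime p).
Implicit Types (P Q X Y : ept E) (a b : {poly F}).
Local Notation tor := (tor p).
Local Notation W := (model E).

Lemma divpol n : exists a b, represents E n a b /\ division_shape (fun _ : F => True) (n ^ 2) a b.
Proof. by apply: division_polynomials. Qed.

Lemma represents_eq0 n a b X : represents E n a b -> X != 0 ->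
  (X *+ n == 0) = (b.[xc X] == 0).
Proof.
move=> h X0; have [k k0 [_ ->]] := h X X0; rewrite mulf_eq0 (negbTE k0) /= /xrep.
by case: (X *+ n == 0); rewrite /= ?eqxx ?oner_eq0.
Qed.

Lemma shape_neq0 S n a b : division_shape S n a b -> n%:R != 0 :> F -> b != 0.
Proof. by move=> [_ _ _ e _ _] n0; apply: contra n0 => /eqP b0; rewrite -e b0 coef0. Qed.

Definition lift_x x : ept E := projT1 (cid (point_over E x)).
Lemma lift_x_neq0 x : lift_x x != 0.
Proof. by rewrite /lift_x; case: cid => X []. Qed.
Lemma xc_lift x : xc (lift_x x) = x.
Proof. by rewrite /lift_x; case: cid => X []. Qed.
Lemma lift_xP P : P != 0 -> P = lift_x (xc P) \/ P = - lift_x (xc P).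
Proof. by move=> P0; apply: xc_eq; rewrite ?lift_x_neq0 ?xc_lift. Qed.

Hypothesis p_neq0 : p%:R != 0 :> F.

(** O and at most two points over each of at most p^2 - 1 roots of [b]. This crude bound suffices
    for [span_all]. *)
Lemma torsion_list : exists L : seq (ept E),
  (size L <= 2 * p ^ 2 - 1)%N /\ forall P, tor P -> P \in L.
Proof.
have [a [b [hab sh]]] := divpol p.
have b0 : b != 0 by apply: (shape_neq0 sh); rewrite natrX expf_neq0.
have [rs ers] := closed_field_poly_normal b.
exists (0 :: flatten [seq [:: lift_x x; - lift_x x] | x <- rs]); split.
  have -> : size (0 :: flatten [seq [:: lift_x x; - lift_x x] | x <- rs]) = (size rs).*2.+1.
    by rewrite /=; congr _.+1; elim: rs {ers} => //= x rs ->.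
  have := shape_size2 sh; rewrite ers size_scale ?lead_coef_eq0 // size_prod_XsubC.
  lia.
move=> P hP; rewrite inE; case: eqVneq => //= P0.
have : b.[xc P] == 0 by rewrite -(represents_eq0 hab P0); apply/eqP.
rewrite ers hornerZ mulf_eq0 lead_coef_eq0 (negbTE b0) /= -rootE root_prod_XsubC => hx.
apply/flattenP; exists [:: lift_x (xc P); - lift_x (xc P)].
  by apply/mapP; exists (xc P).
by rewrite !inE; case: (lift_xP P0) => <-; rewrite eqxx ?orbT.
Qed.

Lemma tor_opp_mul P : tor P -> - P = P *+ p.-1.
Proof.
move=> hP; apply/eqP; rewrite eq_sym -addr_eq0 -mulrSr prednK ?prime_gt0 //.
exact/eqP.
Qed.

Section Span.

Variables (e1 e2 : ept E).
Hypotheses (h1 : tor e1) (h2 : tor e2).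

Definition in_span P : Prop := exists i j, P = e1 *+ i + e2 *+ j.

Lemma span_tor P : in_span P -> tor P.
Proof. by move=> [i [j ->]]; apply: torD; apply: torMn. Qed.
Lemma spanD P Q : in_span P -> in_span Q -> in_span (P + Q).
Proof.
move=> [i [j ->]] [i' [j' ->]]; exists (i + i')%N, (j + j')%N.
by rewrite !mulrnDr addrACA.
Qed.
Lemma spanMn P n : in_span P -> in_span (P *+ n).
Proof. by move=> [i [j ->]]; exists (i * n)%N, (j * n)%N; rewrite mulrnDl !mulrnA. Qed.
Lemma spanN P : in_span P -> in_span (- P).
Proof. by move=> h; rewrite (tor_opp_mul (span_tor h)); apply: spanMn. Qed.

Lemma tor_unit P d : tor P -> ~~ (p %| d)%N -> exists u, P = P *+ d *+ u.
Proof.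
move=> hP hd; have d0 : (0 < d)%N by case: d hd => //; rewrite dvdn0.
have [u v e _] := egcdnP p d0; exists u; rewrite -mulrnA mulnC e mulrnDr.
rewrite gcdnC (eqP (_ : coprime p d)) ?prime_coprime //.
by rewrite mulnC mulrnA (hP : P *+ p = 0) mul0rn add0r mulr1n.
Qed.

Lemma span_of_mul P d : tor P -> ~~ (p %| d)%N -> in_span (P *+ d) -> in_span P.
Proof. by move=> hP hd; have [u {2}->] := tor_unit hP hd; apply: spanMn. Qed.

Lemma indep_inj i i' j j' : indep p e1 e2 -> (i < p)%N -> (i' < p)%N -> (j < p)%N ->
  (j' < p)%N -> e1 *+ i + e2 *+ j = e1 *+ i' + e2 *+ j' -> i = i' /\ j = j'.
Proof.
move=> hI hi hi' hj hj' e.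
have [] := hI (i + (p - i'))%N (j + (p - j'))%N.
  rewrite !mulrnDr addrACA e addrACA -!mulrnDr !subnKC ?(ltnW hi') ?(ltnW hj') //.
  by rewrite (h1 : e1 *+ p = 0) (h2 : e2 *+ p = 0) addr0.
have dv x y : (x < p)%N -> (y < p)%N -> (p %| x + (p - y))%N -> x = y.
  move=> hx hy /dvdnP[k ek]; case: k ek => [|[|k]] ek; lia.
by move=> /(dv _ _ hi hi') -> /(dv _ _ hj hj') ->.
Qed.

(** A torsion point outside the span of two independent ones would give p^3 torsion points, more
    than the 2p^2 - 1 allowed. *)
Lemma span_all P : indep p e1 e2 -> tor P -> in_span P.
Proof.
move=> hI hP; apply: contrapT => hn.
have [L [sL hL]] := torsion_list.
pose f (z : 'I_p * ('I_p * 'I_p)) := P *+ z.1 + (e1 *+ z.2.1 + e2 *+ z.2.2).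
have f_lt (z z' : 'I_p * ('I_p * 'I_p)) : (z.1 < z'.1)%N -> f z <> f z'.
  move=> lt e; apply: hn; apply: (@span_of_mul _ (z'.1 - z.1)%N) => //.
    rewrite gtnNdvd ?subn_gt0 //; have := ltn_ord z'.1; lia.
  have -> : P *+ (z'.1 - z.1)%N = (e1 *+ z.2.1 + e2 *+ z.2.2) - (e1 *+ z'.2.1 + e2 *+ z'.2.2).
    apply: (@addrI _ (P *+ z.1)); rewrite -mulrnDr subnKC ?(ltnW lt) // addrA -/(f z) e.
    by rewrite /f addrK.
  by apply: spanD; [|apply: spanN]; do 2 eexists.
have f_inj : injective f.
  move=> z z' e; case: (ltngtP z.1 z'.1) => [/f_lt/(_ e)[]|/f_lt/(_ (esym e))[]|ez].
  move: e; rewrite /f ez => /addrI e.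
  have [e3 e4] := indep_inj hI (ltn_ord _) (ltn_ord _) (ltn_ord _) (ltn_ord _) e.
  case: z z' ez e3 e4 {e} => [x [y t]] [x' [y' t']] /= /val_inj -> /val_inj -> /val_inj -> //.
have : (size (map f (enum {: 'I_p * ('I_p * 'I_p)})) <= size L)%N.
  apply: uniq_leq_size; first by rewrite map_inj_uniq ?enum_uniq.
  move=> Q /mapP[z _ ->]; apply: hL; apply: torD; first exact: torMn.
  by apply: torD; apply: torMn.
rewrite size_map -cardE !card_prod card_ord => h.
have p2 := prime_gt1 p_prime; have := leq_trans h sL.
have : (2 * p ^ 2 <= p * (p * p))%N by rewrite expnS expn1 leq_mul2r p2 orbT.
have : (0 < 2 * p ^ 2)%N by rewrite muln_gt0 expn_gt0 (prime_gt0 p_prime).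
lia.
Qed.

End Span.

(* A generic fibre of multiplication by [p] has exactly [p ^ 2] points. *)
Lemma torsion_many : exists L : seq (ept E),
  [/\ uniq L, size L = (p ^ 2)%N & forall P, P \in L -> tor P].
Proof.
have [a [b [hab sh]]] := divpol p; have p0 := prime_gt0 p_prime.
have pp : (0 < p ^ 2)%N by rewrite expn_gt0 p0.
have b0 : b != 0 by apply: (shape_neq0 sh); rewrite natrX expf_neq0.
have p2_neq0 : (p ^ 2)%:R != 0 :> F by rewrite natrX expf_neq0.
(* The Wronskian. With N = p^2 its coefficient in degree 2N - 2 is N^2 - N(N - 1) = N, which is
   nonzero; hence all but finitely many values of a / b are taken with simple roots only. *)
pose w := a^`() * b - a * b^`().
have w0 : w != 0.
  apply: contraNneq p2_neq0 => w0.
  have : w`_((p ^ 2).-1 + (p ^ 2).-1) = 0 by rewrite w0 coef0.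
  have sa := shape_size1 sh; have sb := shape_size2 sh; have lb := shape_lead sh.
  have la : a`_(p ^ 2) = 1.
    by rewrite -[(p ^ 2)%N]/((p ^ 2).+1.-1) -sa -lead_coefE (monicP (shape_monic sh)).
  have c1 : (a^`() * b)`_((p ^ 2).-1 + (p ^ 2).-1) = (p ^ 2)%:R * (p ^ 2)%:R.
    rewrite coefM_top ?prednK //; last first.
      by rewrite -ltnS -sa lt_size_deriv // monic_neq0 // (shape_monic sh).
    by rewrite coef_deriv prednK // la lb.
  have p21 : (1 < p ^ 2)%N by rewrite -{1}(exp1n 2) ltn_exp2r // prime_gt1.
  have c2 : (a * b^`())`_((p ^ 2).-1 + (p ^ 2).-1) = (p ^ 2)%:R * (p ^ 2).-1%:R.
    have -> : ((p ^ 2).-1 + (p ^ 2).-1 = p ^ 2 + (p ^ 2).-2)%N by lia.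
    have e2 : (p ^ 2).-2.+1 = (p ^ 2).-1 by lia.
    rewrite coefM_top ?sa //; last first.
      rewrite e2 -ltnS; apply: leq_trans (lt_size_deriv b0) _.
      by rewrite prednK // (leq_trans sb).
    by rewrite la mul1r coef_deriv e2 lb mulr_natr.
  rewrite /w coefB c1 c2 -mulrBr -natrB ?leq_pred // => /eqP.
  have -> : ((p ^ 2) - (p ^ 2).-1 = 1)%N by lia.
  by rewrite mulr1.
have [rw erw] := closed_field_poly_normal w.
pose q := \prod_(z <- [seq a.[r] / b.[r] | r <- rw]) ('X - z%:P).
have /closed_nonrootP[x0 hx0] : q != 0 by rewrite monic_neq0 // monic_prod_XsubC.
pose f := a - x0 *: b.
have sf : size f = (p ^ 2).+1.
  rewrite /f size_polyDl (shape_size1 sh) // size_polyN ltnS.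
  by rewrite (leq_trans (size_scale_leq _ _)) // (shape_size2 sh).
have f0 : f != 0 by rewrite -size_poly_gt0 sf.
have [rf erf] := closed_field_poly_normal f.
have srf : size rf = (p ^ 2)%N.
  by move: sf; rewrite erf size_scale ?lead_coef_eq0 // size_prod_XsubC => -[].
have bne r : a.[r] = x0 * b.[r] -> b.[r] != 0.
  move=> e; apply/eqP=> br; have := represents_coprime hab.
  move=> /Pdiv.ClosedField.coprimepP /(_ r); rewrite rootE e br mulr0 eqxx.
  by move=> /(_ isT).
have frE r : (f.[r] == 0) = (a.[r] == x0 * b.[r]) by rewrite !hornerE subr_eq0.
have urf : uniq rf.
  rewrite -separable_prod_XsubC; apply: (@dvdp_separable _ f).
    by apply/dvdpP; exists (lead_coef f)%:P; rewrite mul_polyC.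
  rewrite unlock; apply/Pdiv.ClosedField.coprimepP => r.
  rewrite rootE frE => /eqP ar; apply: contra hx0 => /eqP f'r.
  have br := bne _ ar.
  have : w.[r] == 0.
    move: f'r; rewrite /f derivB derivZ /w !hornerE ar => /eqP.
    by rewrite subr_eq0 => /eqP ->; apply/eqP; ring.
  rewrite erw hornerZ mulf_eq0 lead_coef_eq0 (negbTE w0) /= -rootE root_prod_XsubC => hr.
  rewrite root_prod_XsubC; apply/mapP; exists r => //.
  by rewrite ar mulfK.
pose Y := lift_x x0.
pose g r := if lift_x r *+ p == Y then lift_x r else - lift_x r.
have xg r : xc (g r) = r by rewrite /g; case: ifP => _; rewrite ?xcN xc_lift.
have gp r : r \in rf -> g r *+ p = Y.
  move=> hr; have ar : a.[r] = x0 * b.[r].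
    apply/eqP; rewrite -frE erf hornerZ mulf_eq0 -rootE root_prod_XsubC hr.
    by rewrite orbT.
  have br := bne _ ar; rewrite /g; case: eqVneq => // neY.
  have X0 := lift_x_neq0 r.
  have Xp : lift_x r *+ p != 0 by rewrite (represents_eq0 hab X0) xc_lift.
  have [k k0 [ea eb]] := hab _ X0; rewrite xc_lift /xrep (negbTE Xp) /= mulr1 in ea eb.
  have ex : xc (lift_x r *+ p) = xc Y.
    rewrite /Y xc_lift; apply: (mulfI k0); rewrite -ea ar eb mulrC //.
  have [e|e] := xc_eq Xp (lift_x_neq0 x0) ex; first by rewrite e eqxx in neY.
  by rewrite mulNrn e opprK.
have [r0 hr0] : exists r0, r0 \in rf.
  by case: rf srf {erf urf gp} => [|r0 rf] /=; [lia | exists r0; rewrite mem_head].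
exists [seq g r - g r0 | r <- rf]; split.
- rewrite map_inj_in_uniq // => r r' _ _ /addIr /(congr1 (@xc _ _)).
  by rewrite !xg.
- by rewrite size_map srf.
move=> P /mapP[r hr ->]; rewrite /tor mulrnBl !gp // subrr //.
Qed.

Lemma torsion_basis : exists e1 e2 : ept E, [/\ tor e1, tor e2 & indep p e1 e2].
Proof.
have [L [uL sL hL]] := torsion_many; have p1 := prime_gt1 p_prime.
have p21 : (1 < p ^ 2)%N by rewrite -{1}(exp1n 2) ltn_exp2r.
have nin (s : seq (ept E)) : (size s < p ^ 2)%N -> exists2 P, P \in L & P \notin s.
  move=> hs; apply: contrapT => hn; suff : (size L <= size s)%N by rewrite sL leqNgt hs.
  apply: uniq_leq_size => // P PL; apply/negPn/negP => Ps; apply: hn; by exists P.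
have [e1 e1L] := nin [:: 0] p21; rewrite inE => e10.
have ps : (size [seq e1 *+ i | i <- iota 0 p] < p ^ 2)%N.
  by rewrite size_map size_iota -{1}(expn1 p) ltn_exp2l.
have [e2 e2L hn] := nin _ ps.
exists e1, e2; split; try exact: hL.
have h1 := hL _ e1L; have h2 := hL _ e2L.
move=> i j e.
have pj : (p %| j)%N.
  apply: contraNT hn => pj; have [u eu] := tor_unit h2 pj.
  have ej : e2 *+ j = e1 *+ (i * p.-1)%N.
    apply: (@addrI _ (e1 *+ i)).
    by rewrite e mulrnA -(tor_opp_mul (torMn i h1)) subrr.
  apply/mapP; exists ((i * p.-1 * u) %% p)%N.
    by rewrite mem_iota add0n ltn_mod prime_gt0.
  by rewrite -(tor_mod _ h1) mulrnA -ej.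
split=> //; apply: contraNT e10 => pi.
have ei : e1 *+ i = 0.
  by move: e; have /dvdnP[k ->] := pj; rewrite mulnC mulrnA (h2 : e2 *+ p = 0) mul0rn addr0.
by have := tor_mul_neq0 p_prime h1 _ pi; rewrite ei eqxx; case: eqVneq => // _ /(_ isT).
Qed.

Lemma generic_cofinite : (forall n, (0 < n)%N -> n%:R != 0 :> F) ->
  exists2 q : {poly F}, q != 0 & forall X, X != 0 -> q.[xc X] != 0 -> generic p X.
Proof.
move=> ch0.
pose Pd n (q : {poly F}) := (forall X, X != 0 -> (X *+ n == 0) = (q.[xc X] == 0)) /\
    ((0 < n)%N -> q != 0).
have [d hd] : {d : nat -> {poly F} & forall n, Pd n (d n)}.
  apply: boolp.choice => n; have [a [b [hab sh]]] := divpol n; exists b; split.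
    by move=> X X0; apply: represents_eq0 hab X0.
  by move=> n0; apply: (shape_neq0 sh); rewrite ch0 // expn_gt0 n0.
have d0 n : (0 < n)%N -> d n != 0 by case: (hd n).
exists (\prod_(j < p) d (j.+1 * p)%N).
  apply/prodf_neq0 => j _; by apply: d0; rewrite muln_gt0 (prime_gt0 p_prime).
move=> X X0; rewrite horner_prod => /prodf_neq0 h j /andP[j0 jp]; rewrite -mulrnA.
have [-> //] := hd (j * p)%N.
by case: j j0 jp => // j _ jp _; apply: (h (Ordinal jp) isT).
Qed.

End TorsionStructure.

(** * Comparison with the Weil pairing of rational functions *)

Section BivariatePolynomials.

Variables (F : closedFieldType) (W : weierstrass F).
Implicit Types (f g : {poly {poly F}}) (u v : coordring W).

Definition cr_const (c : F) : coordring W := cr_poly W c%:P.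
Fact cr_const_zmod : zmod_morphism cr_const.
Proof. by move=> c d; rewrite /cr_const polyCB rmorphB. Qed.
Fact cr_const_monoid : monoid_morphism cr_const.
Proof. by split=> [|c d]; rewrite /cr_const ?rmorph1 // polyCM rmorphM. Qed.
HB.instance Definition _ := GRing.isZmodMorphism.Build _ _ cr_const cr_const_zmod.
HB.instance Definition _ := GRing.isMonoidMorphism.Build _ _ cr_const cr_const_monoid.

Fact cr_const_comm : commr_rmorph cr_const (cr_y W).
Proof. by move=> c; apply: mulrC. Qed.
Definition cr_of_y : {poly F} -> coordring W := horner_morph cr_const_comm.
HB.instance Definition _ := GRing.RMorphism.on cr_of_y.
Fact cr_of_y_comm : commr_rmorph cr_of_y (cr_poly W 'X).
Proof. by move=> c; apply: mulrC. Qed.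
Definition cr_of_xy : {poly {poly F}} -> coordring W := horner_morph cr_of_y_comm.
HB.instance Definition _ := GRing.RMorphism.on cr_of_xy.

Lemma cr_of_yC c : cr_of_y c%:P = cr_const c.
Proof. exact: horner_morphC. Qed.
Lemma cr_of_yX : cr_of_y 'X = cr_y W.
Proof. exact: horner_morphX. Qed.
Lemma cr_of_xyC q : cr_of_xy q%:P = cr_of_y q.
Proof. exact: horner_morphC. Qed.
Lemma cr_of_xyX : cr_of_xy 'X = cr_poly W 'X.
Proof. exact: horner_morphX. Qed.

Definition xy_of_cr u : {poly {poly F}} :=
  map_poly polyC u.1 + map_poly polyC u.2 * 'X%:P.

Lemma cr_of_xy_map (a : {poly F}) : cr_of_xy (map_poly polyC a) = cr_poly W a.
Proof.
elim/poly_ind: a => [|a c IH]; first by rewrite !rmorph0.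
by rewrite !(rmorphD, rmorphM) /= IH map_polyX map_polyC cr_of_xyX cr_of_xyC cr_of_yC.
Qed.

Lemma xy_of_crK u : cr_of_xy (xy_of_cr u) = u.
Proof.
rewrite /xy_of_cr rmorphD rmorphM /= !cr_of_xy_map cr_of_xyC cr_of_yX.
by rewrite -cr_decomp.
Qed.

Lemma eval_cr_of_xy p f : oncurve W (Some p) ->
  cr_eval p (cr_of_xy f) = f.[p.1, p.2].
Proof.
move=> hp; have e_y (q : {poly F}) : cr_eval p (cr_of_y q) = q.[p.2].
  elim/poly_ind: q => [|q c IH]; first by rewrite rmorph0 cr_eval0 horner0.
  rewrite rmorphD rmorphM /= cr_evalD cr_evalM // IH cr_of_yX cr_of_yC.
  by rewrite cr_eval_y /cr_const cr_eval_poly !hornerE.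
elim/poly_ind: f => [|f q IH]; first by rewrite rmorph0 cr_eval0 !horner0.
rewrite rmorphD rmorphM /= cr_evalD cr_evalM // IH cr_of_xyX cr_of_xyC e_y.
by rewrite cr_eval_poly !hornerE.
Qed.

Local Notation wp := (weierstrass_poly W).

Lemma cr_of_wp : cr_of_xy wp = 0.
Proof.
rewrite /weierstrass_poly !(rmorphD, rmorphN, rmorphM, rmorphXn) /=.
rewrite !(cr_of_xyX, cr_of_xyC, cr_of_yX, cr_of_yC) /cr_const.
by apply: cr_ext; rewrite !cr_mulE /cubic /ycoef /=; ring.
Qed.

Definition xy_cong f g : Prop := exists q, f = g + q * wp.

Lemma xy_cong_refl f : xy_cong f f.
Proof. by exists 0; rewrite mul0r addr0. Qed.
Lemma xy_cong_trans f g h : xy_cong f g -> xy_cong g h -> xy_cong f h.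
Proof. by move=> [q ->] [r ->]; exists (r + q); rewrite mulrDl addrA. Qed.
Lemma xy_congD f g f' g' : xy_cong f g -> xy_cong f' g' -> xy_cong (f + f') (g + g').
Proof. by move=> [q ->] [r ->]; exists (q + r); ring. Qed.
Lemma xy_congM f g f' g' : xy_cong f g -> xy_cong f' g' -> xy_cong (f * f') (g * g').
Proof. by move=> [q ->] [r ->]; exists (q * g' + g * r + q * r * wp); ring. Qed.

Lemma xy_of_crM u v : xy_cong (xy_of_cr u * xy_of_cr v) (xy_of_cr (u * v)).
Proof.
exists (map_poly polyC (u.2 * v.2)); case: u v => [a b] [c d].
rewrite cr_mulE /xy_of_cr /weierstrass_poly /cubic /ycoef /=.
rewrite !(rmorphD, rmorphN, rmorphM, rmorphXn) /= !map_polyC !map_polyX /=.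
move: (map_poly _ a) (map_poly _ b) (map_poly _ c) (map_poly _ d) => A B C D.
move: (a1 W)%:P%:P (a2 W)%:P%:P (a3 W)%:P%:P (a4 W)%:P%:P (a6 W)%:P%:P 'X%:P => k1 k2 k3 k4 k6 Y.
by ring.
Qed.

Lemma xy_cong_cr f : xy_cong f (xy_of_cr (cr_of_xy f)).
Proof.
have cD u v : xy_of_cr (u + v) = xy_of_cr u + xy_of_cr v.
  by rewrite /xy_of_cr -[u + v]/(u.1 + v.1, u.2 + v.2) /= !rmorphD; ring.
have c0 : xy_of_cr 0 = 0 by rewrite /xy_of_cr !rmorph0 mul0r addr0.
have cp (a : {poly F}) : xy_of_cr (cr_poly W a) = map_poly polyC a.
  by rewrite /xy_of_cr /= rmorph0 mul0r addr0.
have cy : xy_of_cr (cr_y W) = 'X%:P by rewrite /xy_of_cr /= rmorph0 rmorph1 mul1r add0r.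
elim/poly_ind: f => [|f q IH]; first by rewrite rmorph0 c0; apply: xy_cong_refl.
rewrite rmorphD rmorphM /= cD; apply: xy_congD.
  apply: xy_cong_trans (xy_of_crM _ _); apply: xy_congM => //.
  by rewrite cr_of_xyX cp map_polyX; apply: xy_cong_refl.
rewrite cr_of_xyC; elim/poly_ind: q => [|q c IHq].
  by rewrite !rmorph0 c0; apply: xy_cong_refl.
rewrite polyCD polyCM rmorphD rmorphM /= cD; apply: xy_congD.
  apply: xy_cong_trans (xy_of_crM _ _); apply: xy_congM => //.
  by rewrite cr_of_yX cy; apply: xy_cong_refl.
by rewrite cr_of_yC /cr_const cp map_polyC; apply: xy_cong_refl.
Qed.

(** Modulo the curve equation, (X - x, Y - y)^n becomes the n-th power of the ideal of the point.
    That ideal is generated by u and v, so its power is spanned by the monomials of degree n in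
    them. *)
Lemma vanishesP f p n : oncurve W (Some p) ->
  vanishes W f p.1 p.2 n <-> ipow (pt_ideal W (Some p)) n (cr_of_xy f).
Proof.
move=> hp; set u := cr_vert W p.1; set v := cr_line W p 0.
have hu : pt_ideal W (Some p) u by rewrite /= eval_vert subrr.
have hv : pt_ideal W (Some p) v by rewrite /= eval_line mul0r addr0 subrr.
have eu : cr_of_xy ('X - (p.1)%:P%:P) = u.
  by rewrite rmorphB /= cr_of_xyX cr_of_xyC cr_of_yC /cr_const -rmorphB.
have ev : cr_of_xy ('X%:P - (p.2)%:P%:P) = v.
  rewrite rmorphB /= !cr_of_xyC cr_of_yX cr_of_yC; apply: cr_ext => /=.
    by rewrite polyC0 mul0r addr0 add0r.
  by rewrite subr0.
have pw i k : (i <= k)%N -> ipow (pt_ideal W (Some p)) k (u ^+ i * v ^+ (k - i)).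
  elim: k i => [|k IH] i.
    by rewrite leqn0 => /eqP ->; exists (u ^+ 0 * v ^+ (0 - 0)); rewrite mulr1.
  case: i => [_|i].
    have -> : u ^+ 0 * v ^+ (k.+1 - 0) = v * (u ^+ 0 * v ^+ (k - 0)).
      by rewrite !subn0 exprS mulrCA.
    by apply: iprod_in => //; apply: IH.
  by rewrite ltnS => le; rewrite exprS subSS -mulrA; apply: iprod_in => //; apply: IH.
split.
  move=> [c [q ->]]; rewrite rmorphD rmorphM /= cr_of_wp mulr0 addr0 rmorph_sum.
  have [I0 ID IM] := ideal_ipow (pt_ideal W (Some p)) n.
  elim/big_rec: _ => // i x _ hx; apply: (ID) => //.
  rewrite !rmorphM !rmorphXn /= eu ev -mulrA; apply: (IM).
  by apply: pw; rewrite -ltnS.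
pose J k w := exists c : nat -> coordring W,
  w = \sum_(i < k.+1) c i * (u ^+ i * v ^+ (k - i)).
have idJ k : is_ideal (J k).
  split.
  - by exists (fun _ => 0); rewrite big1 // => i _; rewrite mul0r.
  - move=> x y [c ->] [d ->]; exists (fun i => c i + d i).
    by rewrite -big_split; apply: eq_bigr => i _; rewrite mulrDl.
  - move=> x y [c ->]; exists (fun i => x * c i).
    by rewrite mulr_sumr; apply: eq_bigr => i _; ring.
have sub k w : ipow (pt_ideal W (Some p)) k w -> J k w.
  elim: k w => [|k IH] w.
    by move=> [q ->]; exists (fun _ => q); rewrite big_ord_recl big_ord0 subnn !expr0 addr0 !mulr1.
  apply; first exact: idJ.
  have mp : pt_ideal W (Some p) = gen2 u v.
    by apply: mI_line => //; rewrite mul0r addr0.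
  move=> z y hz hy; have [c ->] := IH _ hy; move: hz; rewrite mp => -[a [b ->]].
  rewrite mulrDl.
  have [_ JD JM] := idJ k.+1; apply: (JD); rewrite -mulrA; apply: (JM).
    exists (fun i => if i is j.+1 then c j else 0).
    rewrite [RHS]big_ord_recl mul0r add0r mulr_sumr; apply: eq_bigr => i _.
    by rewrite /= subSS exprS; ring.
  exists (fun i => if (i <= k)%N then c i else 0).
  rewrite [RHS]big_ord_recr /= ltnn mul0r addr0 mulr_sumr; apply: eq_bigr => i _.
  rewrite -ltnS ltn_ord subSn; last by rewrite -ltnS.
  by rewrite exprS; ring.
move=> /sub [c e].
pose g : {poly {poly F}} := \sum_(i < n.+1)
  xy_of_cr (c i) * ('X - (p.1)%:P%:P) ^+ i * ('X%:P - (p.2)%:P%:P) ^+ (n - i).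
have eg : cr_of_xy g = cr_of_xy f.
  rewrite e rmorph_sum; apply: eq_bigr => i _.
  by rewrite !rmorphM !rmorphXn /= eu ev xy_of_crK mulrA.
have [q1 e1] := xy_cong_cr f; have [q2 e2] := xy_cong_cr g.
exists (fun i => xy_of_cr (c i)), (q1 - q2).
rewrite -/g; rewrite eg in e2; clearbody g; move: e1 e2.
by move: (xy_of_cr _) => z -> ->; ring.
Qed.

End BivariatePolynomials.

(** * Miller functions and their divisors *)

Section MillerFunction.

Variables (F : fieldType) (E : elliptic F).
Implicit Types (P Q X T : ept E).
Local Notation W := (model E).
Local Notation mI P := (pt_ideal W (val P)).
Let W_disc : disc W != 0 := disc_neq0 E.

(** Multiply by the line through T and nT and divide by the vertical line through nT; the division
    is exact because the ideal of the product contains that vertical factor. *)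
Lemma miller T n : (0 < n)%N -> exists f : coordring W,
  princ f = iprod (ipow (mI T) n) (mI (- (T *+ n))) /\
  forall X, (forall i, (0 < i <= n)%N -> off (T *+ i) X) ->
    evp X f = Phi n T (- X) * evp X (vtp (T *+ n)).
Proof.
case: n => // n _; elim: n => [|n [f [pf vf]]].
  exists (vtp T); split=> [|X _]; last by rewrite Phi1 mul1r mulr1n.
  rewrite vtp_ideal mulr1n; congr iprod; rewrite /ipow /= iprodC iprod1 //.
  by apply: ideal_mI; apply: ept_oncurve.
set v := vtp (T *+ n.+1); set J := iprod (ipow (mI T) n.+2) (mI (- (T *+ n.+2))).
have v0 : v != 0 by apply: vertp_neq0.
have iJ : is_ideal J by apply: ideal_iprod.
have e : princ (f * linp T (T *+ n.+1)) = iprod (princ v) J.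
  rewrite -princM pf linp_ideal vtp_ideal /J -mulrS.
  by rewrite [ipow _ n.+2]/(iprod (mI T) (ipow (mI T) n.+1)); ip_ac.
have : princ (f * linp T (T *+ n.+1)) (f * linp T (T *+ n.+1)) by exists 1; rewrite mul1r.
rewrite e iprod_princl // => -[g _ eg]; exists g; split.
  apply: (iprod_cancel v0) => //; first exact: ideal_princ.
  by rewrite princM -eg.
move=> X hX; have ov : evp X v != 0 by apply: evp_vtp; apply: hX; rewrite leqnSn.
apply: (mulfI ov); rewrite -evpM -eg evpM vf; last first.
  by move=> i /andP[i0 hi]; apply: hX; rewrite i0 leqW.
rewrite [Phi n.+2 _ _]PhiS // /Cf opprK -mulrS.
have := @evp_vtp _ _ (T *+ n.+2) X (hX _ _); rewrite ltnS leqnn => /(_ isT) h.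
by rewrite /v; move: (evp X (vtp (T *+ n.+2))) h => b b0; field.
Qed.

Lemma pt_ideal_sep T X : X != 0 -> X != T -> exists2 h, mI T h & evp X h != 0.
Proof.
move=> X0 XT; have [->|T0] := eqVneq T 0.
  by exists 1 => //; rewrite evpE // cr_eval1 oner_neq0.
have eT := val_neq0 T0; have [ex|nx] := eqVneq (xc X) (xc T).
  exists (cr_line W (pc T) 0); first by rewrite eT /= eval_line mul0r addr0 subrr.
  rewrite evpE // eval_line mul0r addr0 subr_eq0; apply: contra XT => /eqP ey.
  by apply/eqP/(pc_inj X0 T0); rewrite /pc ex; congr pair.
exists (cr_vert W (xc T)); first by rewrite eT /= eval_vert subrr.
by rewrite evpE // eval_vert subr_eq0.
Qed.

Lemma ipowX (I : coordring W -> Prop) h n : I h -> ipow I n (h ^+ n).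
Proof.
move=> hI; elim: n => [|n IH]; first by exists 1; rewrite mulr1.
by rewrite exprS; apply: iprod_in.
Qed.

Lemma ipow_generator T n f q : T != 0 -> f != 0 -> princ f = ipow (mI T) n ->
  ipow (mI T) n.+1 (q * f) -> cr_eval (pc T) q = 0.
Proof.
move=> T0 f0 pf; have -> : ipow (mI T) n.+1 = iprod (princ f) (mI T).
  by rewrite pf iprodC.
have iT : is_ideal (mI T) by apply: ideal_mI; apply: ept_oncurve.
rewrite iprod_princl // (val_neq0 T0) => -[g hg]; rewrite mulrC => /(mulfI f0) ->.
exact: hg.
Qed.

End MillerFunction.

Section WeilDivisor.

Variables (F : closedFieldType) (E : elliptic F) (p : nat).
Hypothesis (p_gt0 : (0 < p)%N).
Implicit Types (P Q X T : ept E).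
Local Notation W := (model E).
Local Notation mI P := (pt_ideal W (val P)).
Let W_disc : disc W != 0 := disc_neq0 E.

Lemma evalpt_cr X f : X != 0 -> evalpt f (val X) = evp X (cr_of_xy W f).
Proof.
move=> X0; rewrite evpE // eval_cr_of_xy ?(val_neq0 X0) //.
exact: pc_oncurve.
Qed.

Definition miller_fun T (f : coordring W) : Prop :=
  [/\ f != 0, princ f = ipow (mI T) p &
   forall X, (forall i, (0 < i < p)%N -> off (T *+ i) X) -> evp X f = Phi p T (- X)].

Lemma miller_exists T : tor p T -> exists f, miller_fun T f.
Proof.
move=> hT; have [f [pf vf]] := miller T p_gt0; exists f.
have hp : T *+ p = 0 by []; rewrite hp oppr0 in pf vf.
have iI := ideal_ipow (mI T) p.
split.
- rewrite -cr_lc_eq0 -evp0 vf ?oppr0 ?Phi_at0 ?mul1r ?lc_vtp ?oner_neq0 //.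
  by rewrite evp0 lc_vtp oner_neq0.
- by rewrite pf ept0E mI_None iprodC iprod1.
- move=> X hX; rewrite vf ?[evp X (vtp 0)]evp_vtp //.
    by rewrite /vtp /= /evp; case: (val X) => [q|]; rewrite ?cr_eval1 ?cr_lc1 mulr1.
  move=> i /andP[i0]; rewrite leq_eqVlt => /orP[/eqP ->|hi]; last by apply: hX; rewrite i0.
  by rewrite hp /off eqxx orbT.
Qed.

Lemma vanishes_ept f X n : X != 0 ->
  vanishes W f (xc X) (yc X) n <-> ipow (mI X) n (cr_of_xy W f).
Proof.
move=> X0; rewrite (val_neq0 X0).
by have := @vanishesP _ W f (pc X) n (pc_oncurve X0).
Qed.

Lemma order0P f X : X != 0 -> order_at W f (xc X) (yc X) 0 <-> evp X (cr_of_xy W f) != 0.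
Proof.
move=> X0; have iX : is_ideal (mI X) by apply: ideal_mI; apply: ept_oncurve.
have e1 : ipow (mI X) 1 = mI X by rewrite /ipow /= iprodC iprod1.
rewrite evpE //; split.
  move=> [_ h]; apply/eqP => e; apply: h; apply/vanishes_ept => //.
  by rewrite e1 (val_neq0 X0).
move=> h; split; first by apply/vanishes_ept => //; exists (cr_of_xy W f); rewrite mulr1.
move=> hv; have := proj1 (vanishes_ept _ _ X0) hv.
by rewrite e1 (val_neq0 X0) /= => e; rewrite e eqxx in h.
Qed.

Lemma miller_div T f : miller_fun T f -> div_eq W (xy_of_cr f) p (val T).
Proof.
move=> [f0 pf _] x y hxy; pose X : ept E := mkept hxy.
have X0 : X != 0 by apply/eqP => /(congr1 val).
have [ex ey] : xc X = x /\ yc X = y by [].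
have ff : princ f f by exists 1; rewrite mul1r.
case: eqP => [e|ne]; last first.
  rewrite -ex -ey; apply/order0P => //; rewrite xy_of_crK.
  have XT : X != T by apply/eqP => e; apply: ne; rewrite -e.
  have [h hh hX] := pt_ideal_sep X0 XT.
  have := @ipowX _ _ (mI T) h p hh; rewrite -pf => -[q eq].
  have hXp : evp X (h ^+ p) != 0.
    by rewrite evpE // cr_evalX ?expf_neq0 -?evpE //; apply: pc_oncurve.
  by apply: contra hXp => /eqP e; rewrite eq evpM e mulr0.
have eX : X = T by apply: val_inj.
rewrite -ex -ey eX; rewrite eX in X0; split.
  by apply/vanishes_ept => //; rewrite xy_of_crK -pf.
move=> hv; have := proj1 (vanishes_ept _ _ X0) hv.
rewrite xy_of_crK -[f]mul1r => /(ipow_generator X0 f0 pf) /eqP.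
by rewrite cr_eval1 oner_eq0.
Qed.

(** A root of the norm is the abscissa of a point X with q(X) q(-X) = 0, so the norm is a nonzero
    constant. *)
Lemma nowhere_zero (q : coordring W) : (forall X, X != 0 -> evp X q != 0) ->
  exists2 c, c != 0 & q = cr_poly W c%:P.
Proof.
move=> h; have [sz|sz] := leqP (size (cr_norm q)) 1; last first.
  have s1 : size (cr_norm q) != 1%N by rewrite gtn_eqF.
  have [x /rootP rx] := closed_rootP _ s1.
  have [X [X0 ex]] := point_over E x.
  have NX0 : - X != 0 by rewrite oppr_eq0.
  suff : evp X q * evp (- X) q = 0.
    by move=> e; have := mulf_neq0 (h X X0) (h (- X) NX0); rewrite e eqxx.
  rewrite !evpE ?oppr_eq0 // pcN // -eval_conj -cr_evalM ?cr_mul_conj; last exact: pc_oncurve.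
  by rewrite cr_eval_poly -[(pc X).1]/(xc X) ex rx.
have [_ [h1 _]] := size_cr_norm q.
have q0 : q != 0.
  have [X [X0 _]] := point_over E 0; apply/eqP => e.
  by have := h X X0; rewrite e evpE // cr_eval0 eqxx.
have n0 := cr_norm_neq0 q0; have [] := h1 _.
  by apply/eqP; rewrite eqn_leq sz lt0n size_poly_eq0.
move=> e2 /eqP/size_poly1P[c c0 ec]; exists c => //; apply: cr_ext => //=.
Qed.

(** The specification of the pairing admits every function with the right divisor; all of them are
    proportional to the Miller function. *)
Lemma div_eq_miller T f g : tor p T -> miller_fun T f -> div_eq W g p (val T) ->
  exists2 c, c != 0 & cr_of_xy W g = cr_poly W c%:P * f.
Proof.
move=> hT [f0 pf _] hg; set u := cr_of_xy W g.
have dv X : X != 0 -> X != T -> evp X u != 0.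
  move=> X0 XT; apply/order0P => //; have := hg _ _ (pc_oncurve X0).
  rewrite ifF //; apply/negbTE; rewrite -[Some _]/(Some (pc X)) -(val_neq0 X0).
  by apply: contra XT => /eqP/val_inj ->.
have [T0|T0] := eqVneq T 0.
  have pf1 : princ f = princ 1.
    rewrite pf T0 ept0E mI_None; elim: (p) => [|n IH] //.
    by apply: etrans (iprod1 _) IH; apply: ideal_ipow.
  have [k k0 ek] := princ_eq (oner_neq0 _) pf1.
  have [c c0 ec] : exists2 c, c != 0 & u = cr_poly W c%:P.
    by apply: nowhere_zero => X X0; apply: dv => //; rewrite T0.
  exists (c / k); first by rewrite mulf_neq0 ?invr_neq0.
  by rewrite ec ek mulr1 -rmorphM -polyCM divfK.
have [hv hn] : order_at W g (xc T) (yc T) p.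
  have := hg _ _ (pc_oncurve T0); rewrite ifT //.
  by apply/eqP; rewrite (val_neq0 T0).
have : ipow (mI T) p u by apply/vanishes_ept.
rewrite -pf => -[q eq].
have [c c0 ec] : exists2 c, c != 0 & q = cr_poly W c%:P.
  apply: nowhere_zero => X X0; have [->|XT] := eqVneq X T; last first.
    by apply: contra (dv X X0 XT) => /eqP e; rewrite eq evpM e mul0r.
  rewrite evpE //; apply/eqP => e; apply: hn; apply/vanishes_ept => //.
  rewrite -/u eq [ipow _ _]/(iprod (mI T) (ipow (mI T) p)) -pf; apply: iprod_in.
    by rewrite (val_neq0 T0).
  by exists 1; rewrite mul1r.
by exists c => //; rewrite eq ec.
Qed.

End WeilDivisor.

(** * Rational functions of a point *)

Section RationalFunctions.

Variables (F : closedFieldType) (E : elliptic F).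
Implicit Types (P Q X T : ept E) (f g h : ept E -> F).
Local Notation W := (model E).

Lemma evp_conj X (u : coordring W) : X != 0 -> evp X (cr_conj u) = evp (- X) u.
Proof. by move=> X0; rewrite !evpE ?oppr_eq0 // eval_conj pcN. Qed.

Lemma evp_poly X (q : {poly F}) : X != 0 -> evp X (cr_poly W q) = q.[xc X].
Proof. by move=> X0; rewrite evpE // cr_eval_poly. Qed.

Lemma evpD X (u v : coordring W) : X != 0 -> evp X (u + v) = evp X u + evp X v.
Proof. by move=> X0; rewrite !evpE // cr_evalD. Qed.

Lemma zero_list (u : coordring W) : u != 0 ->
  exists L : seq (ept E), forall X, X != 0 -> evp X u = 0 -> X \in L.
Proof.
move=> u0; have n0 := cr_norm_neq0 u0.
have [r er] := closed_field_poly_normal (cr_norm u).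
exists (map (@lift_x _ E) r ++ map (fun x => - lift_x E x) r) => X X0 e.
have : root (cr_norm u) (xc X).
  rewrite /root -evp_poly // -cr_mul_conj evpM e mul0r eqxx //.
rewrite er rootZ ?lead_coef_eq0 // root_prod_XsubC => hx.
rewrite mem_cat; apply/orP; case: (lift_xP X0) => e'; [left|right]; rewrite e'.
  by apply: map_f.
by apply/mapP; exists (xc X).
Qed.

Lemma avoid_list (L : seq (ept E)) : exists2 X, X != 0 & X \notin L.
Proof.
have q0 : \prod_(Y <- L) ('X - (xc Y)%:P) != 0.
  by rewrite prodf_seq_neq0; apply/allP => Y _; rewrite polyXsubC_eq0.
have [x hx] := closed_nonrootP _ q0; have [X [X0 ex]] := point_over E x.
exists X => //; apply: contra hx => XL; rewrite -ex rootE horner_prod prodf_seq_eq0.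
by apply/hasP; exists X; rewrite // !hornerE subrr.
Qed.

(** Agreement with N / D is required only where D is nonzero, so finitely many exceptional abscissas
    can be absorbed by the denominator, as in [ratf_ext]. *)
Definition ratf h : Prop := exists N D : coordring W, D != 0 /\
  forall X, X != 0 -> evp X D != 0 -> h X = evp X N / evp X D.

Lemma ratf_evp (u : coordring W) : ratf (fun X => evp X u).
Proof.
exists u, 1; split=> [|X X0 _]; first exact: oner_neq0.
by rewrite [evp X 1]evpE // cr_eval1 divr1.
Qed.

Lemma ratf_ext (q : {poly F}) h h' : q != 0 -> ratf h ->
  (forall X, X != 0 -> q.[xc X] != 0 -> h X = h' X) -> ratf h'.
Proof.
move=> q0 [N [D [D0 hD]]] e; have q0' : cr_poly W q != 0.
  by rewrite -cr_lc_eq0 cr_lc_poly lead_coef_eq0.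
exists (N * cr_poly W q), (D * cr_poly W q); split=> [|X X0].
  by rewrite mulf_neq0.
rewrite !evpM evp_poly // mulf_eq0 negb_or => /andP[d0 qx].
by rewrite -e // hD //; field; rewrite d0 qx.
Qed.

Lemma ratf_eq h h' : ratf h -> (forall X, X != 0 -> h X = h' X) -> ratf h'.
Proof. by move=> r e; apply: (ratf_ext (oner_neq0 _) r) => X X0 _; apply: e. Qed.

Lemma ratfC c : ratf (fun=> c).
Proof.
by apply: (ratf_eq (ratf_evp (cr_poly W c%:P))) => X X0; rewrite evp_poly // hornerC.
Qed.

Lemma ratf_xc : ratf (fun X => xc X).
Proof.
by apply: (ratf_eq (ratf_evp (cr_poly W 'X))) => X X0; rewrite evp_poly // hornerX.
Qed.

Lemma ratf_yc : ratf (fun X => yc X).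
Proof. by apply: (ratf_eq (ratf_evp (cr_y W))) => X X0; rewrite evpE // cr_eval_y. Qed.

Lemma ratfM h h' : ratf h -> ratf h' -> ratf (fun X => h X * h' X).
Proof.
move=> [N [D [D0 hD]]] [N' [D' [D0' hD']]]; exists (N * N'), (D * D').
split=> [|X X0]; first by rewrite mulf_neq0.
rewrite !evpM mulf_eq0 negb_or => /andP[d d']; rewrite hD // hD' //.
by field; rewrite d d'.
Qed.

Lemma ratfD h h' : ratf h -> ratf h' -> ratf (fun X => h X + h' X).
Proof.
move=> [N [D [D0 hD]]] [N' [D' [D0' hD']]]; exists (N * D' + N' * D), (D * D').
split=> [|X X0]; first by rewrite mulf_neq0.
rewrite evpD // !evpM mulf_eq0 negb_or => /andP[d d']; rewrite hD // hD' //.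
by field; rewrite d d'.
Qed.

Lemma ratfN h : ratf h -> ratf (fun X => - h X).
Proof.
move=> r; apply: ratf_eq (ratfM (ratfC (-1)) r) _ => X _; exact: mulN1r.
Qed.

Lemma ratfB h h' : ratf h -> ratf h' -> ratf (fun X => h X - h' X).
Proof. by move=> r r'; apply: ratfD r (ratfN r'). Qed.

Lemma ratfV h : ratf h -> ratf (fun X => (h X)^-1).
Proof.
move=> [N [D [D0 hD]]]; have [e|N0] := eqVneq N 0.
  exists 0, D; split=> // X X0 d; rewrite hD // e.
  by rewrite [evp X 0]evpE // cr_eval0 mul0r invr0.
exists (D * D), (N * D); split=> [|X X0]; first by rewrite mulf_neq0.
rewrite !evpM mulf_eq0 negb_or => /andP[n d]; rewrite hD //.
by field; rewrite n d.
Qed.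

Lemma ratf_prod I (r : seq I) (h : I -> ept E -> F) (Pd : pred I) :
  (forall i, Pd i -> ratf (h i)) -> ratf (fun X => \prod_(i <- r | Pd i) h i X).
Proof.
move=> hr; elim: r => [|i r IH].
  by apply: ratf_eq (ratfC 1) _ => X _; rewrite big_nil.
case e : (Pd i).
  by apply: ratf_eq (ratfM (hr i e) IH) _ => X _; rewrite big_cons e.
by apply: ratf_eq IH _ => X _; rewrite big_cons e.
Qed.

Lemma ratf_opp h : ratf h -> ratf (fun X => h (- X)).
Proof.
move=> [N [D [D0 hD]]]; exists (cr_conj N), (cr_conj D); split=> [|X X0].
  by apply: contra D0 => /eqP e; rewrite -[D]cr_conjK e rmorph0.
by rewrite !evp_conj // => d; apply: hD; rewrite ?oppr_eq0.
Qed.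

Definition rpt (P : ept E -> ept E) := ratf (fun X => xc (P X)) /\ ratf (fun X => yc (P X)).

Lemma rpt_cst T : rpt (fun=> T).
Proof. by split; apply: ratfC. Qed.

Lemma ratf_sl (q : {poly F}) (P Q : ept E -> ept E) : q != 0 -> rpt P -> rpt Q ->
  (forall X, X != 0 -> q.[xc X] != 0 -> xc (P X) != xc (Q X)) ->
  ratf (fun X => sl (P X) (Q X)).
Proof.
move=> q0 [rx ry] [rx' ry'] ne.
apply: (ratf_ext q0 (ratfM (ratfB ry' ry) (ratfV (ratfB rx' rx)))) => X X0 qX.
by rewrite /sl /slope -/(xc (P X)) ifF //=; apply/negbTE/ne.
Qed.

Lemma ratf_sl_same (P : ept E -> ept E) : rpt P -> ratf (fun X => sl (P X) (P X)).
Proof.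
move=> [rx ry]; rewrite /sl /slope.
have rN : ratf (fun X => 3 * xc (P X) ^+ 2 + 2 * a2 W * xc (P X) + a4 W - a1 W * yc (P X)).
  apply: ratfB; last exact: ratfM (ratfC _) ry.
  apply: ratfD; last exact: ratfC.
  apply: ratfD; last exact: ratfM (ratfC _) rx.
  by apply: ratfM (ratfC _) _; apply: (ratfM rx rx).
have rD : ratf (fun X => 2 * yc (P X) + a1 W * xc (P X) + a3 W).
  apply: ratfD; last exact: ratfC.
  by apply: ratfD; apply: ratfM (ratfC _) _.
by apply: ratf_eq (ratfM rN (ratfV rD)) _ => X X0; rewrite eqxx.
Qed.

Lemma rptD (q : {poly F}) (P Q : ept E -> ept E) : q != 0 -> rpt P -> rpt Q ->
  ratf (fun X => sl (P X) (Q X)) ->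
  (forall X, X != 0 -> q.[xc X] != 0 -> [/\ P X != 0, Q X != 0 & P X + Q X != 0]) ->
  rpt (fun X => P X + Q X).
Proof.
move=> q0 [rx ry] [rx' ry'] rs ne.
have r3 : ratf (fun X => third W (pc (P X)) (pc (Q X)) (sl (P X) (Q X))).
  apply: ratfB rx'; apply: ratfB rx; apply: ratfB (ratfC _).
  by apply: ratfD (ratfM rs rs) (ratfM (ratfC _) rs).
split.
  apply: (ratf_ext q0 r3) => X X0 qX; have [P0 Q0 PQ] := ne X X0 qX.
  by rewrite xcD.
have r4 : ratf (fun X => - (yc (P X) + sl (P X) (Q X) *
    (third W (pc (P X)) (pc (Q X)) (sl (P X) (Q X)) - xc (P X)))
    - a1 W * third W (pc (P X)) (pc (Q X)) (sl (P X) (Q X)) - a3 W).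
  apply: ratfB (ratfC _); apply: ratfB; last exact: ratfM (ratfC _) r3.
  by apply: ratfN; apply: ratfD ry (ratfM rs (ratfB r3 rx)).
apply: (ratf_ext q0 r4) => X X0 qX; have [P0 Q0 PQ] := ne X X0 qX.
by have := pcD P0 Q0 PQ => -[_ ->].
Qed.

(* Comparing [a ^+ n - (w b) ^+ n = (a - w b) * sum] at a point where [a = w b] is nonzero
   shows that the second factor is nonzero. *)
Lemma pow_proportional n (a b : coordring W) c : n%:R != 0 :> F -> c != 0 -> b != 0 ->
  a ^+ n = cr_poly W c%:P * b ^+ n ->
  exists2 w, w != 0 & a = cr_poly W w%:P * b.
Proof.
move=> n0 c0 b0 e; have [L hL] := zero_list b0; have [X X0 XL] := avoid_list L.
have bX : evp X b != 0 by apply: contra XL => /eqP; apply: hL.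
have ngt : (0 < n)%N by case: (n) n0 => //; rewrite eqxx.
have evpX (u : coordring W) k : evp X (u ^+ k) = evp X u ^+ k.
  by rewrite !evpE // cr_evalX //; apply: pc_oncurve.
set w := evp X a / evp X b.
have aX : evp X a = w * evp X b by rewrite /w divfK.
have ew : w ^+ n = c.
  have := congr1 (evp X) e; rewrite evpM !evpX evp_poly // hornerC aX exprMn.
  by apply: mulIf; rewrite expf_neq0.
have w0 : w != 0 by apply: contra c0 => /eqP e0; rewrite -ew e0 expr0n gtn_eqF.
exists w => //; apply/eqP; rewrite -subr_eq0.
have : (a - cr_poly W w%:P * b) *
    \sum_(i < n) a ^+ (n.-1 - i) * (cr_poly W w%:P * b) ^+ i = 0.
  rewrite -subrXX_comm; first last.
    by rewrite /GRing.comm mulrC.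
  by rewrite exprMn -rmorphXn -polyC_exp ew e subrr.
move/eqP; rewrite mulf_eq0 => /orP[//|/eqP e0].
have := congr1 (evp X) e0; rewrite !evpE // cr_eval_sum cr_eval0.
rewrite (eq_bigr (fun=> (w * evp X b) ^+ n.-1)) => [|i _]; last first.
  rewrite -evpE // evpM !evpX evpM evp_poly // hornerC -aX -exprD subnK //.
  by rewrite -ltnS prednK.
rewrite sumr_const card_ord => /eqP; rewrite -mulr_natl mulf_eq0 (negbTE n0) /=.
by rewrite expf_eq0 mulf_eq0 (negbTE w0) (negbTE bX) andbF.
Qed.

End RationalFunctions.

(** * Existence, uniqueness and value of the Weil pairing *)

Section WeilPairingExists.

Variables (F : closedFieldType) (E : elliptic F) (p : nat).
Hypothesis (ch0 : forall n, (0 < n)%N -> n%:R != 0 :> F).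
Hypothesis (p_prime : prime p).
Implicit Types (P Q X S T : ept E).
Local Notation W := (model E).
Local Notation tor := (tor p).
Local Notation generic := (generic p).
Let p_gt0 : (0 < p)%N := prime_gt0 p_prime.
Let p_gt1 : (1 < p)%N := prime_gt1 p_prime.

Definition generic_poly : {poly F} := s2val (cid2 (generic_cofinite E p_prime ch0)).
Lemma generic_poly_neq0 : generic_poly != 0.
Proof. by rewrite /generic_poly; case: cid2. Qed.
Lemma generic_polyP X : X != 0 -> generic_poly.[xc X] != 0 -> generic X.
Proof. by rewrite /generic_poly; case: cid2 => q q0 h; apply: h. Qed.

Lemma rpt_mul i : (0 < i <= p)%N -> rpt (fun X => X *+ i).
Proof.
elim: i => // -[|i] IH hi; first by split; [apply: ratf_xc | apply: ratf_yc].
have g0 := generic_poly_neq0; have r := IH ltac:(lia).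
have r1 : rpt (fun X => X *+ 1) by split; [apply: ratf_xc | apply: ratf_yc].
have -> : (fun X => X *+ i.+2) = (fun X => X *+ i.+1 + X *+ 1).
  by apply: funext => X; rewrite -mulrnDr addn1.
apply: (rptD g0) => //.
  case: i r hi {IH} => [|i] r hi; first exact: ratf_sl_same.
  apply: (ratf_sl g0) => // X X0 /generic_polyP -/(_ X0) gX.
  have nz k : (0 < k <= p)%N -> X *+ k != 0 by apply: generic_neq0.
  apply: xc_neq; [apply: nz; lia | apply: nz; lia | | ].
    by rewrite mulrSr mulr1n addrK; apply: nz; lia.
  by rewrite -mulrnDr; apply: nz; lia.
move=> X X0 /generic_polyP -/(_ X0) gX.
have nz k : (0 < k <= p)%N -> X *+ k != 0 by apply: generic_neq0.
by rewrite -mulrnDr; split; apply: nz; lia.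
Qed.

(** The function g_T with f_T o [p] = g_T^p, as [weil_fun_pow] shows: the formula of [weil_value]
    with a generic X in place of S. T = O, where f_T is constant, is set apart. *)
Definition weil_fun T X : F :=
  if T == 0 then 1 else Phi p T (- X) / Phi p (- X) T.

Lemma generic_off T X i : tor T -> generic X -> (0 < i <= p)%N -> off (X *+ i) T.
Proof.
move=> hT gX hi; apply: off_neq.
  apply: (neq0_eq (@generic_add _ _ _ (- T) i gX _ _ _)); [by tors | lia | lia | by zmod].
apply: (neq0_eq (@generic_add _ _ _ T i gX _ _ _)); [by tors | lia | lia | by zmod].
Qed.

(** The denominator contains X as a subscript. Its chord values are rewritten by [Cf_tau] as sums of
    slopes, and slopes are rational in the coordinates of the multiples of X. *)
Lemma ratf_weil_fun T : tor T -> ratf (weil_fun T).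
Proof.
move=> hT; have g0 := generic_poly_neq0; rewrite /weil_fun.
have [T0|T0] := eqVneq T 0; first exact: ratfC.
apply: ratfM.
  rewrite /Phi; apply: ratf_prod => i _; rewrite /Cf.
  have e X : - - X = X by rewrite opprK.
  by apply: ratf_eq (ratfM (ratf_evp _) (ratfV (ratf_evp _))) _ => X X0; rewrite e.
apply: ratfV; apply: (ratf_opp (h := fun X => Phi p X T)); rewrite /Phi.
apply: ratf_eq (_ : ratf (fun X => \prod_(1 <= i < p | (0 < i < p)%N) Cf X (X *+ i) (- T))) _; last first.
  by move=> X X0; rewrite big_nat_cond [RHS]big_nat_cond; apply: eq_bigl => i; rewrite andbb andbT.
apply: ratf_prod => i hi.
have r1 : rpt (fun X => X) by split; [apply: ratf_xc | apply: ratf_yc].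
have r2 : rpt (fun X => X *+ i) by apply: rpt_mul; lia.
have r3 : rpt (fun X => X *+ i.+1) by apply: rpt_mul; lia.
have gen X : X != 0 -> generic_poly.[xc X] != 0 ->
   [/\ generic X, off (X *+ i.+1) T & forall k, (0 < k <= p)%N -> X *+ k != 0].
  move=> X0 /generic_polyP -/(_ X0) gX; split=> //; first by apply: generic_off => //; lia.
  by move=> k; apply: generic_neq0.
have offE X : X != 0 -> generic_poly.[xc X] != 0 -> xc T != xc (X *+ i.+1).
  move=> X0 /(gen X X0)[gX + nz]; rewrite /off (negbTE T0) (negbTE (nz _ _)) //.
  by lia.
have rs1 : ratf (fun X => sl X (X *+ i)).
  have [->|i1] := eqVneq i 1%N; first exact: ratf_sl_same.
  apply: (ratf_sl g0) => // X X0 /(gen X X0)[gX _ nz].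
  apply: xc_neq; [exact: X0 | apply: nz; lia | | ].
    rewrite -opprB oppr_eq0; apply: (neq0_eq (nz i.-1 _)); first by lia.
    by rewrite -[in LHS](prednK (_ : (0 < i)%N)) ?mulrSr ?addrK //; lia.
  by rewrite -mulrS; apply: nz; lia.
have rs2 : ratf (fun X => sl (X *+ i.+1) T).
  apply: (ratf_sl g0 r3 (rpt_cst T)) => X X0 h; rewrite eq_sym; exact: offE.
apply: (ratf_ext g0 (ratfN (ratfD (ratfD rs1 rs2) (ratfC E (a1 W))))) => X X0 h.
have [gX _ nz] := gen X X0 h; have := offE X X0 h; rewrite mulrS => nx.
have n1 : X *+ i != 0 by apply: nz; lia.
have n2 : X + X *+ i != 0 by rewrite -mulrS; apply: nz; lia.
by rewrite Cf_tau // /tau mulrS.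
Qed.

Lemma weil_fun_neq0 T X : tor T -> generic X -> weil_fun T X != 0.
Proof.
move=> hT gX; rewrite /weil_fun; case: (eqVneq T 0) => T0; first exact: oner_neq0.
have gN := genericN gX.
rewrite mulf_neq0 ?invr_eq0 //; first by apply: Phi_gen_neq0.
exact: Phi_gen_neq0'.
Qed.

Lemma weil_fun_pow T X f : tor T -> miller_fun p T f -> generic X ->
  evp (X *+ p) f = weil_fun T X ^+ p.
Proof.
move=> hT [f0 pf vf] gX; rewrite vf => [|i hi]; last first.
  apply: off_neq.
    apply: (neq0_opp (@generic_add _ _ _ (- (T *+ i)) p gX _ _ _)); [by tors | lia | lia | by zmod].
  apply: (neq0_eq (@generic_add _ _ _ (T *+ i) p gX _ _ _)); [by tors | lia | lia | by zmod].
rewrite /weil_fun; case: (eqVneq T 0) => [->|T0].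
  rewrite expr1n /Phi big1 // => i _; rewrite opprK mul0rn Cf0 //.
  rewrite /off eqxx orbT //.
have gN := genericN gX; have := Phi_pow p_prime hT T0 gN; rewrite mulNrn => e.
rewrite expr_div_n -e mulfK // expf_neq0 //; exact: Phi_gen_neq0'.
Qed.

Lemma indepN_both S T : tor S -> tor T -> indep p S T ->
  [/\ indep p (- S) T, indep p T (- S), indep p S (- T), S != 0 & T != 0].
Proof.
move=> hS hT h; have h1 := indepN p_prime hS hT h.
have h2 := indepC (indepN p_prime hT hS (indepC h)).
split=> //; first exact: indepC.
  apply/eqP => e; have := h 1%N 0%N; rewrite e mul0rn mulr0n addr0 => /(_ erefl)[].
  by rewrite dvdn1 => /eqP e1; have := p_gt1; rewrite e1.
apply/eqP => e; have := h 0%N 1%N; rewrite e mul0rn mulr0n addr0 => /(_ erefl)[_].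
by rewrite dvdn1 => /eqP e1; have := p_gt1; rewrite e1.
Qed.

Lemma exists_indep T : tor T -> T != 0 -> exists2 S, tor S & indep p S T.
Proof.
move=> hT T0; have pF := ch0 p_gt0.
have [e1 [e2 [h1 h2 hI]]] := torsion_basis E p_prime pF.
have [i [j eT]] := span_all p_prime pF h1 h2 hI hT.
have cop k : ~~ (p %| k)%N -> coprime p k by rewrite prime_coprime.
have [pi|npi] := boolP (p %| i)%N.
  exists e1 => // a b; rewrite eT.
  have -> : e1 *+ a + (e1 *+ i + e2 *+ j) *+ b = e1 *+ (a + i * b) + e2 *+ (j * b).
    by rewrite mulrnDr mulrnDl -!mulrnA addrA.
  have cj : coprime p j.
    apply: cop; apply: contra T0 => pj.
    by rewrite eT (tor_mod i h1) (tor_mod j h2) (eqP pi) (eqP pj) !mulr0n addr0.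
  move=> /hI[h3]; rewrite Gauss_dvdr // => pb; split=> //.
  by move: h3; rewrite dvdn_addl // dvdn_mulr.
exists e2 => // a b; rewrite eT.
have -> : e2 *+ a + (e1 *+ i + e2 *+ j) *+ b = e1 *+ (i * b) + e2 *+ (a + j * b).
  by rewrite mulrnDr mulrnDl -!mulrnA addrCA.
move/hI => []; rewrite Gauss_dvdr ?cop // => pb.
by rewrite dvdn_addl ?dvdn_mull.
Qed.

Lemma weil_shift_indep S T X : tor S -> tor T -> indep p S T -> generic X ->
  weil_fun T (X + S) = weil_value p S T * weil_fun T X.
Proof.
move=> hS hT h gX; have [i1 i2 i3 S0 T0] := indepN_both hS hT h.
by rewrite /weil_fun (negbTE T0); apply: weil_function_add.
Qed.

Lemma weil_value_neq0 S T : tor S -> tor T -> indep p S T -> weil_value p S T != 0.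
Proof.
move=> hS hT h; have [X [X0 gX]] : exists X : ept E, X != 0 /\ generic X.
  have [x hx] := closed_nonrootP _ generic_poly_neq0.
  have [X [X0 ex]] := point_over E x; exists X; split=> //.
  by apply: (generic_polyP X0); rewrite ex.
have := weil_shift_indep hS hT h gX.
have := weil_fun_neq0 hT (generic_tor gX hS).
by move=> h0 e; apply: contra h0 => /eqP e'; rewrite e e' mul0r.
Qed.

Lemma dependent S T : tor S -> tor T -> T != 0 -> ~ indep p S T -> exists j, S = T *+ j.
Proof.
move=> hS hT T0 nI; have pF := ch0 p_gt0.
have [S0 hS0 I0] := exists_indep hT T0.
have [i [j eS]] := span_all p_prime pF hS0 hT I0 hS.
have [pi|npi] := boolP (p %| i)%N.
  by exists j; rewrite eS (tor_mod _ hS0) (eqP pi) mulr0n add0r.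
case: nI => a b; rewrite eS.
have -> : (S0 *+ i + T *+ j) *+ a + T *+ b = S0 *+ (i * a) + T *+ (j * a + b).
  by rewrite mulrnDr mulrnDl -!mulrnA addrA.
move/I0 => []; rewrite Gauss_dvdr ?prime_coprime // => pa.
by rewrite dvdn_addr ?dvdn_mull.
Qed.

(** The formula [weil_value] may degenerate for dependent points. Then S is written as (S + S0) +
    (-S0) with S0 independent of T; both summands are independent of T, and translation factors
    multiply. *)
Lemma weil_shift S T : tor S -> tor T -> exists z, [/\ z != 0,
  indep p S T -> z = weil_value p S T &
  forall X, generic X -> weil_fun T (X + S) = z * weil_fun T X].
Proof.
move=> hS hT; have [I|nI] := EM (indep p S T).
  exists (weil_value p S T); split=> //; first exact: weil_value_neq0.
  by move=> X; apply: weil_shift_indep.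
have [T0|T0] := eqVneq T 0.
  by exists 1; split=> // [|X _]; rewrite ?oner_neq0 // /weil_fun T0 eqxx mulr1.
have [S0 hS0 I0] := exists_indep hT T0.
have [j eS] := dependent hS hT T0 nI.
have I1 : indep p (S + S0) T.
  move=> a b; rewrite eS.
  have -> : (T *+ j + S0) *+ a + T *+ b = S0 *+ a + T *+ (j * a + b).
    by rewrite mulrnDr mulrnDl -!mulrnA; zmod.
  by move/I0 => [pa]; rewrite dvdn_addr ?dvdn_mull.
have I2 : indep p (- S0) T by apply: indepN.
have t1 : tor (S + S0) by tors.
have t2 : tor (- S0) by tors.
exists (weil_value p (S + S0) T * weil_value p (- S0) T); split=> //.
  by rewrite mulf_neq0 // weil_value_neq0.
move=> X gX; have -> : X + S = X + (- S0) + (S + S0) by zmod.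
rewrite weil_shift_indep //; last exact: generic_tor.
by rewrite weil_shift_indep // mulrA.
Qed.

Lemma weil_pairing_exists S T z : tor S -> tor T ->
  (forall X, generic X -> weil_fun T (X + S) = z * weil_fun T X) ->
  is_weil_pairing W p (val S) (val T) z.
Proof.
move=> hS hT hz; have [f hf] := miller_exists p_gt0 hT.
have [N [D [D0 hD]]] := ratf_weil_fun hT.
(* Putting this factor into numerator and denominator confines the pointwise conditions to generic
   points. *)
pose q := cr_poly W generic_poly.
have q0 : q != 0 by rewrite -cr_lc_eq0 cr_lc_poly lead_coef_eq0 generic_poly_neq0.
exists (xy_of_cr f), (xy_of_cr (N * q)), (xy_of_cr (D * q)).
have ev X u : X != 0 -> evalpt (xy_of_cr u) (val X) = evp X u.
  by move=> X0; rewrite evalpt_cr // xy_of_crK.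
have good X : X != 0 -> evp X (D * q) != 0 ->
    generic X /\ evp X (N * q) / evp X (D * q) = weil_fun T X.
  move=> X0; rewrite !evpM evp_poly // mulf_eq0 negb_or => /andP[d q'].
  split; first exact: generic_polyP.
  by rewrite hD //; field; rewrite d q'.
split.
- exact: miller_div.
- have [L hL] := zero_list (mulf_neq0 D0 q0); have [X X0 XL] := avoid_list L.
  exists (val X); split; [by rewrite val_neq0 | exact: ept_oncurve |].
  by rewrite ev //; apply: contra XL => /eqP; apply: hL.
- move=> X' hX; rewrite -[X']/(val (mkept hX)); move: (mkept hX) => X Xn.
  have X0 : X != 0 by apply/eqP => e; rewrite e in Xn.
  rewrite mulptE => Xp; have Xp0 : X *+ p != 0 by apply/eqP => e; rewrite e in Xp.
  rewrite !ev // => /(good X X0)[gX ->].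
  by rewrite (weil_fun_pow hT hf).
move=> X' hX; rewrite -[X']/(val (mkept hX)); move: (mkept hX) => X Xn.
have X0 : X != 0 by apply/eqP => e; rewrite e in Xn.
rewrite -eptDE => XS; have XS0 : X + S != 0 by apply/eqP => e; rewrite e in XS.
rewrite !ev // => /(good X X0)[gX ->] /(good _ XS0)[_ ->].
exact: hz.
Qed.

(** The p-th powers of N' / D' and of [weil_fun p T] are proportional, hence so are the functions
    themselves by [pow_proportional]. Their translation factors are then compared at one X such that
    X and X + S avoid finitely many points. *)
Lemma weil_pairing_unique S T z z' : tor S -> tor T ->
  (forall X, generic X -> weil_fun T (X + S) = z * weil_fun T X) ->
  is_weil_pairing W p (val S) (val T) z' -> z' = z.
Proof.
move=> hS hT hz [f' [N' [D' [hf' [X1 [X1n hX1 D1]] hp ha]]]].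
have [f hf] := miller_exists p_gt0 hT.
have [c c0 ef] := div_eq_miller hT hf hf'.
have [N [D [D0 hD]]] := ratf_weil_fun hT.
pose n1 := cr_of_xy W N'; pose d1 := cr_of_xy W D'.
have d10 : d1 != 0.
  move: D1; rewrite -[X1]/(val (mkept hX1)) in X1n *; move: (mkept hX1) X1n => X Xn.
  have X0 : X != 0 by apply/eqP => e; rewrite e in Xn.
  rewrite evalpt_cr // -/d1; apply: contra => /eqP ->.
  by rewrite evpE // cr_eval0.
pose q := cr_poly W generic_poly.
have q0 : q != 0 by rewrite -cr_lc_eq0 cr_lc_poly lead_coef_eq0 generic_poly_neq0.
have dq0 : d1 * D * q != 0 by rewrite !mulf_neq0.
have [L hL] := zero_list dq0.
have good X : X != 0 -> X \notin L ->
    [/\ generic X, evp X d1 != 0, evp X D != 0, X *+ p != 0 &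
      c * weil_fun T X ^+ p = (evp X n1 / evp X d1) ^+ p].
  move=> X0 XL; have : evp X (d1 * D * q) != 0 by apply: contra XL => /eqP; apply: hL.
  rewrite !evpM evp_poly // !mulf_eq0 !negb_or => /andP[/andP[hd1 hD1] hq].
  have gX := generic_polyP X0 hq.
  have Xp : X *+ p != 0 by apply: (generic_neq0 gX); lia.
  split=> //; have := hp (val X) (ept_oncurve X); rewrite mulptE.
  rewrite !evalpt_cr // ef => <- //.
  - by rewrite evpM evp_poly // hornerC (weil_fun_pow hT hf).
  - by rewrite val_neq0.
  by rewrite val_neq0.
have [w w0 ew] : exists2 w, w != 0 & n1 * D = cr_poly W w%:P * (N * d1).
  have N0 : N != 0.
    have [X X0 XL] := avoid_list L; have [gX h1 h2 _ _] := good X X0 XL.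
    have := weil_fun_neq0 hT gX; rewrite hD //; apply: contra => /eqP ->.
    by rewrite [evp X 0]evpE // cr_eval0 mul0r.
  apply: (pow_proportional (ch0 p_gt0) c0); first by rewrite mulf_neq0.
  apply/eqP; rewrite -subr_eq0; apply/negPn/negP => u0.
  have [L' hL'] := zero_list u0; have [X X0] := avoid_list (L ++ L').
  rewrite mem_cat negb_or => /andP[XL /negP[]]; apply: hL' => //.
  have [gX h1 h2 _ e] := good X X0 XL.
  have evpX (u : coordring W) k : evp X (u ^+ k) = evp X u ^+ k.
    by rewrite !evpE // cr_evalX //; apply: pc_oncurve.
  have evpN (u : coordring W) : evp X (- u) = - evp X u.
    by rewrite !evpE // cr_evalN.
  rewrite evpD // evpN evpM !evpX !evpM evp_poly // hornerC.
  have -> : evp X N = weil_fun T X * evp X D by rewrite hD // divfK.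
  rewrite !exprMn; have -> : evp X n1 = (evp X n1 / evp X d1) * evp X d1 by rewrite divfK.
  rewrite exprMn -e; ring.
have [X X0] := avoid_list (- S :: L ++ map (fun Y => Y - S) L).
rewrite inE mem_cat !negb_or => /and3P[XS XL XSL].
have XS0 : X + S != 0 by rewrite addr_eq0.
have XSL' : X + S \notin L.
  by apply: contra XSL => h; apply/mapP; exists (X + S) => //; zmod.
have rat Y : Y != 0 -> Y \notin L -> evp Y n1 / evp Y d1 = w * weil_fun T Y.
  move=> Y0 YL; have [gY h1 h2 _ _] := good Y Y0 YL.
  have := congr1 (evp Y) ew; rewrite !evpM evp_poly // hornerC hD // => e.
  by apply: (mulIf h1); rewrite divfK //; apply: (mulIf h2); rewrite e; field.
have [gX h1 _ _ _] := good X X0 XL; have [_ h1' _ _ _] := good _ XS0 XSL'.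
have := ha (val X) (ept_oncurve X); rewrite -eptDE !evalpt_cr // -/n1 -/d1.
rewrite !rat // hz // => /(_ _ _ h1 h1') e.
have /eqP : w * (z * weil_fun T X) = z' * (w * weil_fun T X).
  by apply: e; rewrite val_neq0.
rewrite mulrCA -subr_eq0 -mulrBl mulf_eq0 subr_eq0 mulf_eq0 (negbTE w0) /=.
by rewrite (negbTE (weil_fun_neq0 hT gX)) orbF => /eqP ->.
Qed.

Definition weil S T : F := weil_pairing W p (val S) (val T).

(** The value chosen by [epsilon] satisfies the specification because some value does, and
    uniqueness identifies it. *)
Lemma weilP S T : tor S -> tor T -> [/\ weil S T != 0,
  indep p S T -> weil S T = weil_value p S T &
  forall X, generic X -> weil_fun T (X + S) = weil S T * weil_fun T X].
Proof.
move=> hS hT; have [z [z0 zI hz]] := weil_shift hS hT.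
suff -> : weil S T = z by [].
apply: (weil_pairing_unique hS hT hz).
apply: Stdlib.Logic.ClassicalEpsilon.epsilon_spec; exists z.
exact: weil_pairing_exists.
Qed.

End WeilPairingExists.

(** * The Weil pairing is bilinear and alternating *)

Section WeilPairingProperties.

Variables (F : closedFieldType) (E : elliptic F) (p : nat).
Hypothesis (ch0 : forall n, (0 < n)%N -> n%:R != 0 :> F).
Hypothesis (p_prime : prime p).
Implicit Types (P Q X S T : ept E).
Local Notation W := (model E).
Local Notation tor := (tor p).
Local Notation generic := (generic p).
Local Notation weil := (@weil F E p).
Let p_gt0 : (0 < p)%N := prime_gt0 p_prime.

Lemma generic_exists : exists X : ept E, X != 0 /\ generic X.
Proof.
have [x hx] := closed_nonrootP _ (generic_poly_neq0 E ch0 p_prime).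
have [X [X0 ex]] := point_over E x; exists X; split=> //.
by apply: (generic_polyP (ch0 := ch0) (p_prime := p_prime) X0); rewrite ex.
Qed.

Let weilP S T (hS : tor S) (hT : tor T) := weilP ch0 p_prime hS hT.

Lemma weil_eq S T z : tor S -> tor T ->
  (forall X, generic X -> weil_fun p T (X + S) = z * weil_fun p T X) -> weil S T = z.
Proof.
move=> hS hT h; have [X [X0 gX]] := generic_exists; have [_ _ h'] := weilP hS hT.
by apply: (mulIf (weil_fun_neq0 p_prime hT gX)); rewrite -h // h'.
Qed.

Lemma weil_addl S S' T : tor S -> tor S' -> tor T ->
  weil (S + S') T = weil S T * weil S' T.
Proof.
move=> hS hS' hT; have [_ _ h] := weilP hS hT; have [_ _ h'] := weilP hS' hT.
apply: weil_eq => // [|X gX]; first by tors.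
by rewrite addrA h' ?h; [ring | | apply: generic_tor].
Qed.

Lemma weil_0l T : tor T -> weil 0 T = 1.
Proof.
by move=> hT; apply: weil_eq => // [|X gX]; [tors | rewrite addr0 mul1r].
Qed.

Lemma weil_0r S : tor S -> weil S 0 = 1.
Proof.
move=> hS; apply: weil_eq => // [|X gX]; first by tors.
by rewrite /weil_fun eqxx mulr1.
Qed.

Lemma weil_Mnl S T n : tor S -> tor T -> weil (S *+ n) T = weil S T ^+ n.
Proof.
move=> hS hT; elim: n => [|n IH]; first by rewrite mulr0n weil_0l.
by rewrite mulrS weil_addl // ?IH ?exprS //; tors.
Qed.

Lemma weil_exp_p S T : tor S -> tor T -> weil S T ^+ p = 1.
Proof. by move=> hS hT; rewrite -weil_Mnl // (hS : S *+ p = 0) weil_0l. Qed.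

Lemma weil_neq0 S T : tor S -> tor T -> weil S T != 0.
Proof. by move=> hS hT; have [] := weilP hS hT. Qed.

Hypothesis (p_ge5 : (5 <= p)%N).

Lemma weil_antisym_indep S T : tor S -> tor T -> indep p S T ->
  weil S T * weil T S = 1.
Proof.
move=> hS hT I; have [i1 i2 i3 S0 T0] := indepN_both p_prime hS hT I.
have [_ h1 _] := weilP hS hT; have [_ h2 _] := weilP hT hS.
rewrite h1 // h2; last exact: indepC.
by apply: (weil_value_antisym p_prime hS hT S0 T0 _ i2 i3); lia.
Qed.

Lemma indep_shift S T k : indep p S T -> indep p (S + T *+ k) T.
Proof.
move=> I a b; have -> : (S + T *+ k) *+ a + T *+ b = S *+ a + T *+ (k * a + b).
  by rewrite mulrnDr mulrnDl -!mulrnA addrA.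
by move/I => [pa]; rewrite dvdn_addr ?dvdn_mull.
Qed.

Lemma indep_shift2 S T k d : indep p S T -> (0 < d < p)%N ->
  indep p (S + T *+ k) (S + T *+ k + T *+ d).
Proof.
move=> /(indep_shift (k := k)) I hd a b; move: (S + T *+ k) I => A I.
have -> : A *+ a + (A + T *+ d) *+ b = A *+ (a + b) + T *+ (d * b).
  by rewrite mulrnDr mulrnDl -!mulrnA addrA.
move/I => [pab]; rewrite Gauss_dvdr => [pb|]; last first.
  by rewrite prime_coprime // gtnNdvd //; lia.
by split=> //; move: pab; rewrite dvdn_addl.
Qed.

(** So far the pairing is linear on the left and antisymmetric on independent points only. For B_k =
    S + kT, with t(k) the pairing of B_k with itself and u that of T with itself, this gives t(k +
    d) t(k) u^(d^2) = 1. The values d = 1, three times, and d = 3 force u^8 = 1, whereas u^p = 1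
    with p odd; d = 3 is allowed because p is at least 5. *)
Lemma weil_self T : tor T -> weil T T = 1.
Proof.
move=> hT; have [->|T0] := eqVneq T 0; first by rewrite weil_0l // ; tors.
have [S hS I] := exists_indep ch0 p_prime hT T0.
pose B k := S + T *+ k; pose t k := weil (B k) (B k).
set u := weil T T; have u0 : u != 0 := weil_neq0 hT hT.
have tB k : tor (B k) by rewrite /B; tors.
have t0 k : t k != 0 by apply: weil_neq0.
have key k d : (0 < d < p)%N -> t (k + d)%N * t k * u ^+ (d * d) = 1.
  move=> hd; have eB : B (k + d)%N = B k + T *+ d by rewrite /B mulrnDr addrA.
  have I2 := @indep_shift2 S T k d I hd; rewrite -/(B k) -eB in I2.
  have bt j : weil (B j) T = weil S T * u ^+ j.
    by rewrite /B weil_addl ?weil_Mnl //; tors.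
  have tb j : weil T (B j) * (weil S T * u ^+ j) = 1.
    rewrite -bt mulrC weil_antisym_indep //; exact: indep_shift.
  have c0 : weil S T != 0 := weil_neq0 hS hT.
  have e1 : weil (B (k + d)%N) (B k) = t k * weil T (B k) ^+ d.
    by rewrite {1}eB weil_addl ?weil_Mnl //; tors.
  have e2 : t (k + d)%N = weil (B k) (B (k + d)%N) * weil T (B (k + d)%N) ^+ d.
    by rewrite /t {1}eB weil_addl ?weil_Mnl //; tors.
  have := weil_antisym_indep (tB k) (tB (k + d)%N) I2; rewrite e1.
  have f0 j : weil S T * u ^+ j != 0 by rewrite mulf_neq0 ?expf_neq0.
  have v j : weil T (B j) = (weil S T * u ^+ j)^-1.
    by apply: (mulIf (f0 j)); rewrite tb mulVf.
  rewrite v in e2; rewrite v e2 !exprVn !exprMn exprD exprMn => <-.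
  have -> : u ^+ (d * d) = (u ^+ d) ^+ d by rewrite exprM.
  by field; rewrite !expf_neq0.
have h01 := key 0%N 1%N ltac:(lia); have h12 := key 1%N 1%N ltac:(lia).
have h23 := key 2%N 1%N ltac:(lia); have h03 := key 0%N 3%N ltac:(lia).
rewrite ?(add0n, addn1) expr1 in h01 h12 h23 h03.
have e02 : t 0%N = t 2%N.
  apply: (mulfI (t0 1%N)); apply: (mulIf u0); rewrite h01 [t 1%N * t 2%N]mulrC.
  by rewrite h12.
have u8 : u ^+ 8 = 1.
  have h : t 3 * t 0%N * u = 1 by rewrite e02; exact: h23.
  by move: h03; rewrite -[(3 * 3)%N]/9%N exprS mulrA h mul1r.
have up : u ^+ p = 1 by apply: weil_exp_p.
have [a b eab _] := egcdnP 8 p_gt0.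
have g1 : gcdn p 8 = 1%N.
  apply/eqP; rewrite -/(coprime p 8) (_ : 8 = 2 ^ 3)%N // coprimeXr // prime_coprime //.
  by apply/negP => /(dvdn_leq (ltn0Sn 1)); lia.
have : u ^+ (a * p) = u ^+ (b * 8 + 1) by rewrite eab g1.
by rewrite exprD mulnC exprM up mulnC exprM u8 !expr1n mul1r expr1 => <-.
Qed.

Lemma weil_antisym S T : tor S -> tor T -> weil S T * weil T S = 1.
Proof.
move=> hS hT; have [I|nI] := EM (indep p S T); first exact: weil_antisym_indep.
have [->|S0] := eqVneq S 0; first by rewrite weil_0l // weil_0r // mulr1.
have [->|T0] := eqVneq T 0; first by rewrite weil_0l // weil_0r // mulr1.
have [j ej] := dependent ch0 p_prime hS hT T0 nI.
have nI' : ~ indep p T S by move=> I; apply: nI; apply: indepC.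
have [i ei] := dependent ch0 p_prime hT hS S0 nI'.
have -> : weil S T = 1 by rewrite ej weil_Mnl // weil_self // expr1n.
have -> : weil T S = 1 by rewrite ei weil_Mnl // weil_self // expr1n.
exact: mulr1.
Qed.

Lemma weil_dependent S T : tor S -> tor T -> ~ indep p S T -> weil S T = 1.
Proof.
move=> hS hT nI; have [->|T0] := eqVneq T 0; first exact: weil_0r.
have [j ->] := dependent ch0 p_prime hS hT T0 nI.
by rewrite weil_Mnl // weil_self // expr1n.
Qed.

Lemma weilV S T : tor S -> tor T -> weil S T = (weil T S)^-1.
Proof.
move=> hS hT; apply: (mulIf (weil_neq0 hT hS)).
by rewrite weil_antisym // mulVf // weil_neq0.
Qed.

Lemma weil_Mnr S T n : tor S -> tor T -> weil S (T *+ n) = weil S T ^+ n.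
Proof.
move=> hS hT; have -> : weil S (T *+ n) = (weil (T *+ n) S)^-1 by apply: weilV; tors.
by rewrite weil_Mnl // (weilV hS hT) exprVn.
Qed.

Lemma weil_scale S T n : tor S -> tor T ->
  weil (S *+ n) (T *+ n) = weil S T ^+ (n * n).
Proof. by move=> hS hT; rewrite weil_Mnl ?weil_Mnr ?exprM //; tors. Qed.

Lemma Phi_mul_opp T X n : tor T -> T != 0 -> generic X -> (0 < n <= p)%N ->
  Phi n (- X) T * Phi n X T * (xc T - xc (X *+ n)) = (xc T - xc X) ^+ n.
Proof.
move=> hT T0 gX; case: n => // n; elim: n => [|n IH] hn.
  by rewrite !Phi1 !mul1r expr1.
have nz k : (0 < k <= p)%N -> X *+ k != 0 by apply: generic_neq0.
have ne k : (0 < k <= p)%N -> xc T - xc (X *+ k) != 0.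
  move=> hk; have := generic_off p_prime hT gX hk; rewrite /off (negbTE T0) (negbTE (nz k hk)) /=.
  by rewrite subr_eq0.
have X0 : X != 0 by apply: (nz 1%N); lia.
have Xn : X *+ n.+1 != 0 by apply: nz; lia.
have XS : X + X *+ n.+1 != 0 by rewrite -mulrS; apply: nz; lia.
rewrite !(PhiS (n := n.+1)) // mulNrn CfNN //.
have d0 : X + X *+ n.+1 - T != 0.
  apply: (neq0_eq (@generic_add _ _ _ (- T) n.+2 gX _ _ _)); [by tors | lia | lia | by zmod].
have d1 : X + X *+ n.+1 + T != 0.
  apply: (neq0_eq (@generic_add _ _ _ T n.+2 gX _ _ _)); [by tors | lia | lia | by zmod].
have := Cf_mul_conj X0 Xn T0 XS d0 d1; rewrite -mulrS => e.
rewrite [RHS]exprSr -IH; last by lia.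
have n2 := ne n.+2 ltac:(lia).
have -> : Phi n.+1 (- X) T * - Cf X (X *+ n.+1) T * (Phi n.+1 X T * Cf X (X *+ n.+1) (- T))
   = - (Phi n.+1 (- X) T * Phi n.+1 X T) * (Cf X (X *+ n.+1) T * Cf X (X *+ n.+1) (- T)) by ring.
by rewrite e; field.
Qed.

Lemma Phi_opp_mul T X n : tor T -> T != 0 -> generic X -> (0 < n < p)%N ->
  Phi n T (- X) * Phi n T X * (xc X - xc (T *+ n)) = (-1) ^+ n.-1 * (xc X - xc T) ^+ n.
Proof.
move=> hT T0 gX; case: n => // n; elim: n => [|n IH] hn.
  by rewrite !Phi1 /= expr0 expr1 !mul1r.
have X0 : X != 0 by apply: (generic_neq0 gX (j := 1%N)); lia.
have nz k : (0 < k < p)%N -> T *+ k != 0 by apply: tor_mul_lt.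
have dm k : X - T *+ k != 0.
  apply: (neq0_eq (@generic_add _ _ _ (- (T *+ k)) 1 gX _ _ _)); [by tors | lia | lia | by zmod].
have dp k : X + T *+ k != 0.
  apply: (neq0_eq (@generic_add _ _ _ (T *+ k) 1 gX _ _ _)); [by tors | lia | lia | by zmod].
have ne k : (0 < k < p)%N -> xc X - xc (T *+ k) != 0.
  by move=> hk; rewrite subr_eq0; apply: xc_neq => //; apply: nz.
rewrite !(PhiS (n := n.+1)) // opprK.
have Tn : T *+ n.+1 != 0 by apply: nz; lia.
have TS : T + T *+ n.+1 != 0 by rewrite -mulrS; apply: nz; lia.
have d0 : T + T *+ n.+1 - X != 0.
  by apply: (neq0_opp (dm n.+2)); zmod.
have d1 : T + T *+ n.+1 + X != 0.
  by apply: (neq0_eq (dp n.+2)); zmod.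
have := Cf_mul_conj T0 Tn X0 TS d0 d1; rewrite -mulrS => e.
have -> : (-1) ^+ n.+2.-1 * (xc X - xc T) ^+ n.+2 = - (xc X - xc T) * ((-1) ^+ n.+1.-1 * (xc X - xc T) ^+ n.+1) :> F.
  by rewrite /= !exprS; ring.
rewrite -IH; last by lia.
have n2 := ne n.+2 ltac:(lia).
have -> : Phi n.+1 T (- X) * Cf T (T *+ n.+1) X * (Phi n.+1 T X * Cf T (T *+ n.+1) (- X))
   = Phi n.+1 T (- X) * Phi n.+1 T X * (Cf T (T *+ n.+1) X * Cf T (T *+ n.+1) (- X)) by ring.
by rewrite e; field.
Qed.

Lemma Phi_opp_mul_p T X : tor T -> T != 0 -> generic X ->
  Phi p T (- X) * Phi p T X = (xc T - xc X) ^+ p.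
Proof.
move=> hT T0 gX; have X0 : X != 0 by apply: (generic_neq0 gX (j := 1%N)); lia.
have [n en] : exists n, p = n.+2 by exists p.-2; lia.
have := @Phi_opp_mul T X n.+1 hT T0 gX ltac:(lia).
have eT : T *+ n.+1 = - T by apply: tor_opp hT _; rewrite en.
rewrite en !(PhiS (n := n.+1)) // eT opprK !CfN ?oppr_eq0 // !xcN.
have : xc X - xc T != 0.
  rewrite subr_eq0; apply: xc_neq => //.
    apply: (neq0_eq (@generic_add _ _ _ (- T) 1 gX _ _ _)); [by tors | lia | lia | by zmod].
  apply: (neq0_eq (@generic_add _ _ _ T 1 gX _ _ _)); [by tors | lia | lia | by zmod].
have -> : xc T - xc X = - (xc X - xc T) by ring.
have od : odd p.
  by have [e2|//] := even_prime p_prime; have := p_ge5; rewrite e2.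
move: (xc X - xc T) (Phi n.+1 T (- X)) (Phi n.+1 T X) => z A B z0 e.
have s1 : (-1) ^+ n = (-1) :> F.
  by rewrite -signr_odd; have := od; rewrite en /= negbK => ->.
rewrite /= s1 in e; have e' : A * B = - z ^+ n.
  by apply: (mulIf z0); rewrite e exprSr; ring.
have -> : A * z * (B * z) = A * B * z ^+ 2 by ring.
by rewrite e' exprNn -en -signr_odd od en !exprS; ring.
Qed.

(** Values of a chord function at opposite points multiply to a quotient of differences of abscissas
    ([Cf_mul_conj]). Both telescoping products contain the p-th power of x(T) - x(X), which
    cancels. *)
Lemma weil_fun_norm T X : tor T -> T != 0 -> generic X ->
  weil_fun p T X * weil_fun p T (- X) = xc T - xc (X *+ p).
Proof.
move=> hT T0 gX; rewrite /weil_fun (negbTE T0) opprK.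
have gN := genericN gX.
have e1 := @Phi_mul_opp T X p hT T0 gX ltac:(lia).
have e2 := Phi_opp_mul_p hT T0 gX.
have a0 := Phi_gen_neq0' p_prime hT T0 gX; have b0 := Phi_gen_neq0' p_prime hT T0 gN.
have -> : Phi p T (- X) / Phi p (- X) T * (Phi p T X / Phi p X T) =
   (Phi p T (- X) * Phi p T X) / (Phi p (- X) T * Phi p X T) by field; rewrite a0 b0.
by rewrite e2 -e1; field; rewrite a0 b0.
Qed.

End WeilPairingProperties.

(* The Lucas sequence [V_k(P, Q)], with [V_k(x + y, x y) = x ^ k + y ^ k]. *)
Fixpoint lucas (R : comNzRingType) (P Q : R) (k : nat) {struct k} : R :=
  match k with
  | 0 => 2
  | k'.+1 => match k' with 0 => P | k''.+1 => P * lucas P Q k' - Q * lucas P Q k'' end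
  end.

Lemma lucasS (R : comNzRingType) (P Q : R) k :
  lucas P Q k.+2 = P * lucas P Q k.+1 - Q * lucas P Q k.
Proof. by []. Qed.

Lemma nat_ind2 (Pr : nat -> Prop) : Pr 0%N -> Pr 1%N ->
  (forall k, Pr k -> Pr k.+1 -> Pr k.+2) -> forall k, Pr k.
Proof.
move=> h0 h1 hS k; suff [] : Pr k /\ Pr k.+1 by [].
by elim: k => [|k [IH IH']]; split=> //; apply: hS.
Qed.

Lemma lucas_sum (R : comNzRingType) (x y : R) k :
  lucas (x + y) (x * y) k = x ^+ k + y ^+ k.
Proof.
by elim/nat_ind2: k => [||k IH IH'] //; rewrite lucasS IH IH' !exprS; ring.
Qed.

Lemma lucas_horner (R : comNzRingType) (P Q : {poly R}) k x :
  (lucas P Q k).[x] = lucas P.[x] Q.[x] k.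
Proof.
elim/nat_ind2: k => [||k IH IH'] //; first by rewrite /= hornerMn hornerC.
by rewrite !lucasS !hornerE IH IH'.
Qed.

Lemma lucas0 (R : comNzRingType) (P : R) k : lucas P 0 k.+1 = P ^+ k.+1.
Proof.
by elim: k => // k IH; rewrite lucasS IH mul0r subr0 -exprS.
Qed.

Lemma size_lucas (F : fieldType) (P Q : {poly F}) m k : 2 != 0 :> F ->
  size P = m.+1 -> (size Q <= m.*2)%N -> size (lucas P Q k) = (k * m).+1.
Proof.
move=> n2 sP sQ; have P0 : P != 0 by rewrite -size_poly_eq0 sP.
elim/nat_ind2: k => [||k IH IH'] //; first by rewrite /= -[2]/(2%:R) -polyC_natr size_polyC n2.
  by rewrite sP mul1n.
have s1 : size (P * lucas P Q k.+1) = (k.+2 * m).+1.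
  by rewrite size_polyM_field -?size_poly_eq0 ?IH' ?sP // !mulSn; lia.
have s2 : (size (Q * lucas P Q k)%R <= k.+2 * m)%N.
  apply: leq_trans (size_polyMleq_field _ _) _; rewrite IH !mulSn; move: sQ; lia.
by rewrite lucasS size_polyDl ?s1 // size_polyN_field ltnS.
Qed.

(** V^m c(U / V) written without division; [k] embeds the coefficients, so that U and V may be
    polynomials or functions on the curve. *)
Definition homog (R F : nzRingType) (k : F -> R) (c : {poly F}) (m : nat) (U V : R) : R :=
  \sum_(j < m.+1) k c`_j * U ^+ j * V ^+ (m - j).

Lemma homogE (F : fieldType) (c : {poly F}) m (U V : F) : V != 0 -> (size c <= m.+1)%N ->
  homog id c m U V = V ^+ m * c.[U / V].
Proof.
move=> V0 sc; rewrite (horner_coef_wide _ sc) mulr_sumr; apply: eq_bigr => j _.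
rewrite expr_div_n mulrCA -mulrA; congr (_ * _).
have -> : V ^+ m = V ^+ (m - j) * V ^+ j by rewrite -exprD subnK // -ltnS.
by field; rewrite expf_neq0.
Qed.

Lemma collect_powers (R : comNzRingType) (q1 q2 q3 b r z : R) i j :
  (q1 * z ^+ i) ^+ 2 * (q3 * z) * b = (q2 * z ^+ j) ^+ 2 * r ->
  q1 ^+ 2 * q3 * b * z ^+ i.*2.+1 = q2 ^+ 2 * r * z ^+ j.*2.
Proof.
rewrite [z ^+ _.+1]exprS -!addnn !exprD; move: (z ^+ i) (z ^+ j) => x y e.
transitivity ((q1 * x) ^+ 2 * (q3 * z) * b); first by ring.
by rewrite e; ring.
Qed.

Section CofiniteIdentities.

Variables (F : closedFieldType) (E : elliptic F).
Implicit Types (X : ept E).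

Lemma poly_eq_cofinite (u q r : {poly F}) : u != 0 ->
  (forall X, X != 0 -> u.[xc X] != 0 -> q.[xc X] = r.[xc X]) -> q = r.
Proof.
move=> u0 h; have : (q - r) * u = 0.
  apply: (@poly0_points _ E) => X X0; rewrite !hornerE.
  by case: (eqVneq u.[xc X] 0) => [->|/(h X X0) ->]; rewrite ?mulr0 // subrr mul0r.
by move/eqP; rewrite mulf_eq0 (negbTE u0) orbF subr_eq0 => /eqP.
Qed.

End CofiniteIdentities.

(** * Nondegeneracy: [weil_fun] is not invariant under all p-torsion translations *)

Section Nontrivial.

Variables (F : closedFieldType) (E : elliptic F) (p : nat).
Hypothesis (ch0 : forall n, (0 < n)%N -> n%:R != 0 :> F).
Hypothesis (p_prime : prime p).
Hypothesis (p_ge5 : (5 <= p)%N).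
Implicit Types (P Q X S : ept E).
Local Notation W := (model E).
Local Notation tor := (tor p).
Local Notation generic := (generic p).
Let p_gt0 : (0 < p)%N := prime_gt0 p_prime.
Let W_disc : disc W != 0 := disc_neq0 E.

Variable (T : ept E).
Hypotheses (hT : tor T) (T0 : T != 0).
Local Notation g := (weil_fun p T).
Hypothesis (inv : forall S X, tor S -> generic X -> g (X + S) = g X).

(** The 2-division polynomial: the discriminant of the curve equation as a quadratic in y, with the
    abscissas of the points of order 2 as roots. *)
Definition psi2 : {poly F} := 4%:P * cubic W + ycoef W ^+ 2.

Lemma size_psi2 : size psi2 = 4.
Proof.
have s4 : size (4%:P * cubic W) = 4 by rewrite size_Cmul ?size_cubic // ch0.
rewrite /psi2 size_polyDl s4 //; apply: leq_ltn_trans (size_polyMleq_field _ _) _.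
have := size_ycoef W; lia.
Qed.

Lemma psi2_discr (u : coordring W) :
  (u.1 * 2%:P - u.2 * ycoef W) ^+ 2 - u.2 ^+ 2 * psi2 = 4%:P * cr_norm u.
Proof.
have e2 : 2%:P = 1 + 1 :> {poly F} by rewrite -polyCD.
have e4 : 4%:P = (1 + 1) * (1 + 1) :> {poly F} by rewrite -!polyCD -polyCM; congr polyC; ring.
by rewrite /psi2 /cr_norm e2 e4; ring.
Qed.

(* The two terms on the left have sizes of different parity. *)
Lemma size_trace (u : coordring W) n : size (cr_norm u) = n ->
  ((size (u.1 * 2%:P - u.2 * ycoef W)%R).*2 <= n.+1)%N.
Proof.
move=> sn; have := psi2_discr u; set A := _ - _ * ycoef W.
move/(congr1 (fun q : {poly F} => size q)); rewrite size_Cmul ?ch0 // sn.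
have [->|A0] := eqVneq A 0; first by rewrite size_poly0.
have sA : size (A ^+ 2) = (size A).*2.-1 by rewrite expr2 size_polyM_field // addnn.
have pA : (0 < size A)%N by rewrite lt0n size_poly_eq0.
have [->|u0] := eqVneq u.2 0.
  rewrite expr0n mul0r subr0 sA; have aux x y : (0 < x)%N -> x.*2.-1 = y -> (x.*2 <= y.+1)%N by lia.
  exact: aux.
have p0 : psi2 != 0 by rewrite -size_poly_eq0 size_psi2.
have su : size (u.2 ^+ 2 * psi2) = ((size u.2).*2 + 2)%N.
  rewrite size_polyM_field ?expf_neq0 // size_psi2 expr2 size_polyM_field // addnn.
  have : (0 < size u.2)%N by rewrite lt0n size_poly_eq0.
  lia.
have [lt|ge] := ltnP (size (u.2 ^+ 2 * psi2)) (size (A ^+ 2)).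
  rewrite size_polyDl ?size_polyN_field // sA.
  have aux x y : (0 < x)%N -> x.*2.-1 = y -> (x.*2 <= y.+1)%N by lia.
  exact: aux.
have aux x y : (0 < x)%N -> (x.*2.-1 <= y.*2 + 2)%N -> (x.*2.-1 < y.*2 + 2)%N by lia.
have lt : (size (A ^+ 2)%R < size (u.2 ^+ 2 * psi2)%R)%N.
  by move: ge; rewrite sA su; apply: aux.
rewrite addrC size_polyDl ?size_polyN_field // su => <-; move: lt; rewrite sA su.
have aux2 x y : (x.*2.-1 < y.*2 + 2)%N -> (x.*2 <= (y.*2 + 2).+1)%N by lia.
exact: aux2.
Qed.

(** The norm of f is (x(T) - x)^p, so by [size_trace] the trace has degree at most p / 2; a degree
    below p is what [trace_size] uses. *)
Lemma miller_trace (f : coordring W) : miller_fun p T f ->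
  exists2 A : {poly F}, (size A <= p)%N &
    forall Y, Y != 0 -> evp Y f + evp (- Y) f = A.[xc Y].
Proof.
move=> [f0 _ vf]; exists (f.1 * 2%:P - f.2 * ycoef W); last first.
  move=> Y Y0; rewrite -evp_conj // -evpD // -evp_poly //; congr evp.
  apply: cr_ext; last by rewrite -[f + _]/(f.1 + (cr_conj f).1, f.2 + (cr_conj f).2) /= subrr.
  rewrite -[f + _]/(f.1 + (cr_conj f).1, f.2 + (cr_conj f).2) /=.
  by rewrite -[2]/(1 + 1) polyCD; ring.
suff en : cr_norm f = ((xc T)%:P - 'X) ^+ p.
  suff sn : size (cr_norm f) = p.+1.
    have aux : forall y, (y.*2 <= p.+2)%N -> (y <= p)%N by move=> y; lia.
    exact: (aux _ (size_trace sn)).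
  have od : odd p by have [e2|//] := even_prime p_prime; have := p_ge5; rewrite e2.
  rewrite en -opprB exprNn -signr_odd od expr1 mulN1r size_polyN_field.
  exact: size_exp_XsubC.
apply: (@poly_eq_cofinite _ E (generic_poly E ch0 p_prime)) => [|X X0 hX].
  exact: generic_poly_neq0.
have gX : generic X := generic_polyP X0 hX.
have ofT (Y : ept E) i : generic Y -> (0 < i < p)%N -> off (T *+ i) Y.
  move=> gY hi; apply: off_neq.
    apply: (neq0_opp (@generic_add _ _ _ (- (T *+ i)) 1 gY _ _ _)); [by tors | lia | lia | by zmod].
  apply: (neq0_eq (@generic_add _ _ _ (T *+ i) 1 gY _ _ _)); [by tors | lia | lia | by zmod].
rewrite -evp_poly // -cr_mul_conj evpM evp_conj // !vf; first last.
- by move=> i; apply: ofT.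
- by move=> i; apply: ofT; apply: genericN.
by rewrite opprK (Phi_opp_mul_p p_prime p_ge5 hT T0 gX) !hornerE.
Qed.

(** Multiplication by the conjugate of the denominator leaves a denominator in x alone, hence the
    same one at X and at -X. *)
Lemma weil_fun_form : exists (w : coordring W) (dl u : {poly F}), [/\ dl != 0, u != 0 &
  forall X, X != 0 -> u.[xc X] != 0 ->
   [/\ generic X, dl.[xc X] != 0, g X = evp X w / dl.[xc X] & g (- X) = evp (- X) w / dl.[xc X]]].
Proof.
have [N [D [D0 hD]]] := ratf_weil_fun ch0 p_prime hT.
have n0 := cr_norm_neq0 D0; have g0 := generic_poly_neq0 E ch0 p_prime.
exists (N * cr_conj D), (cr_norm D), (cr_norm D * generic_poly E ch0 p_prime).
split=> //; first by rewrite mulf_neq0.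
have key X : X != 0 -> (cr_norm D).[xc X] != 0 -> g X = evp X (N * cr_conj D) / (cr_norm D).[xc X].
  move=> X0; rewrite -evp_poly // -cr_mul_conj !evpM mulf_eq0 negb_or => /andP[d d'].
  by rewrite hD //; field; rewrite d d'.
move=> X X0; rewrite hornerM mulf_eq0 negb_or => /andP[d /(generic_polyP X0) gX].
by split=> //; [apply: key | rewrite key ?oppr_eq0 ?xcN].
Qed.

Variables (a b : {poly F}).
Hypotheses (hab : represents E p a b) (shape : division_shape (fun _ : F => True) (p ^ 2) a b).

Lemma size_b : size b = (p ^ 2)%N.
Proof.
case: shape => _ _ sb lb _ _; apply/eqP; rewrite eqn_leq sb /=.
have pp : (0 < p ^ 2)%N by rewrite expn_gt0 p_gt0.
rewrite leqNgt; apply/negP => h; have : b`_(p ^ 2).-1 = 0.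
  by apply: nth_default; rewrite -ltnS prednK.
by rewrite lb => /eqP; apply/negP; apply: ch0.
Qed.

Lemma b_neq0 : b != 0.
Proof. by rewrite -size_poly_eq0 size_b -lt0n expn_gt0 p_gt0. Qed.

Lemma mul_p_coord X : X != 0 -> X *+ p != 0 ->
  b.[xc X] != 0 /\ a.[xc X] = b.[xc X] * xc (X *+ p).
Proof.
move=> X0 Xp; have [k k0 [ea eb]] := hab X0; rewrite /xrep (negbTE Xp) /= mulr1 in ea eb.
by rewrite eb ea.
Qed.

Section TraceConstant.

Variables (n d u : {poly F}).
Hypotheses (cop : coprimep n d) (d0 : d != 0) (u0 : u != 0).
Hypothesis (tr : forall X, X != 0 -> u.[xc X] != 0 ->
  [/\ generic X, d.[xc X] != 0 & g X + g (- X) = n.[xc X] / d.[xc X]]).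

(** With c = d b, the sum and the product of c g(X) and c g(-X) are polynomials in x. The Lucas
    polynomial is thus the sum of their p-th powers, and since g^p = f o [p] this is c^p times the
    trace of f at pX, where x(pX) = a / b. *)
Lemma lucas_identity : exists2 A : {poly F}, (size A <= p)%N &
  lucas (n * b) (d ^+ 2 * b * ((xc T)%:P * b - a)) p = d ^+ p * homog polyC A p a b.
Proof.
have [f hf] := miller_exists p_gt0 hT; have [A sA eA] := miller_trace hf.
exists A => //; apply: (@poly_eq_cofinite _ E u) => // X X0 /(tr X0)[gX dX eX].
have Xp : X *+ p != 0 by apply: generic_neq0 gX _; lia.
have [bX aX] := mul_p_coord X0 Xp.
have gN := genericN gX; rewrite lucas_horner.
set x := xc X; pose c := d.[x] * b.[x].
have -> : (n * b).[x] = c * g X + c * g (- X).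
  by rewrite -mulrDr eX /c hornerM; field.
have -> : (d ^+ 2 * b * ((xc T)%:P * b - a)).[x] = (c * g X) * (c * g (- X)).
  rewrite mulrACA (weil_fun_norm p_prime p_ge5 hT T0 gX) !(hornerM, hornerD, hornerN, hornerC, horner_exp) /x aX /c /x; ring.
rewrite lucas_sum !exprMn -(weil_fun_pow p_prime hT hf gX) -(weil_fun_pow p_prime hT hf gN).
rewrite mulNrn -mulrDr eA // /c hornerM horner_exp -mulrA; congr (_ * _).
rewrite /homog horner_sum (eq_bigr (fun j : 'I_p.+1 => id A`_j * a.[x] ^+ j * b.[x] ^+ (p - j))).
  rewrite -[RHS]/(homog id A p a.[x] b.[x]) homogE //; last by rewrite leqW.
  by rewrite aX [b.[x] * xc _]mulrC mulfK.
by move=> j _; rewrite !hornerE.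
Qed.

(** If the trace had a pole at O, the Lucas polynomial would have degree p (deg n + p^2 - 1), while
    A of degree below p keeps the other side of [lucas_identity] smaller. *)
Lemma trace_size : (size n <= size d)%N.
Proof.
have [A sA e] := lucas_identity; rewrite leqNgt; apply/negP => lt.
have [_ sa _ _ _ _] := shape; have sb := size_b; have b0 := b_neq0.
have pd : (0 < size d)%N by rewrite lt0n size_poly_eq0.
have n0 : n != 0 by rewrite -size_poly_eq0; lia.
have pp : (0 < p ^ 2)%N by rewrite expn_gt0 p_gt0.
pose m := ((size n).-1 + (p ^ 2).-1)%N.
have sP : size (n * b) = m.+1.
    have aux x N : (0 < x)%N -> (0 < N)%N -> (x + N).-1 = (x.-1 + N.-1).+1 by lia.
    by rewrite size_polyM_field // sb; apply: aux => //; apply: leq_ltn_trans lt.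
have sQ : (size (d ^+ 2 * b * ((xc T)%:P * b - a))%R <= m.*2)%N.
  have s1 : (size ((xc T)%:P * b - a)%R <= (p ^ 2).+1)%N.
    apply: leq_trans (size_polyD_field _ _) _; rewrite size_polyN_field sa geq_max leqnn andbT.
    by apply: leq_trans (size_polyC_mul _ _) _; rewrite sb.
  have s2 : size (d ^+ 2 * b) = ((size d).*2.-1 + p ^ 2).-1.
    by rewrite size_polyM_field ?expf_neq0 // expr2 size_polyM_field // addnn sb.
  apply: leq_trans (size_polyMleq_field _ _) _; rewrite s2 /m; move: s1 lt pd pp.
  by move: (p ^ 2)%N => N; lia.
have n2 : 2 != 0 :> F by apply: (ch0 (n := 2)).
have := size_lucas p n2 sP sQ; rewrite e => sL.
have : (size (d ^+ p * homog polyC A p a b)%R <= (p * (size d).-1 + p * (p ^ 2).-1 + p.-1).+1)%N.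
  have hX (q : {poly F}) k : (size (q ^+ k)%R <= (k * (size q).-1).+1)%N.
    by have := size_poly_exp_leq q k; rewrite mulnC.
  apply: leq_trans (size_polyMleq_field _ _) _.
  have : (size (homog polyC A p a b) <= (p * (p ^ 2).-1 + p.-1).+1)%N.
    rewrite /homog; apply: (leq_trans (size_sum _ _ _)); apply/bigmax_leqP => j _.
    have [hj|hj] := ltnP j p; last first.
      by rewrite nth_default ?mul0r ?size_poly0 // (leq_trans sA).
    apply: leq_trans (size_polyMleq_field _ _) _.
    have h1 : (size ((A`_j)%:P * a ^+ j)%R <= (j * p ^ 2).+1)%N.
      by apply: leq_trans (size_polyC_mul _ _) _; have := hX a j; rewrite sa.
    have h2 := hX b (p - j)%N; rewrite sb in h2.
    move: h1 h2; have -> : (p * (p ^ 2).-1 = j * (p ^ 2).-1 + (p - j) * (p ^ 2).-1)%N.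
      by rewrite -mulnDl subnKC // ltnW.
    have -> : (j * p ^ 2 = j * (p ^ 2).-1 + j)%N by rewrite -{1}(prednK pp) mulnS addnC.
    have aux s1 s2 y z : (s1 <= (y + j).+1)%N -> (s2 <= z.+1)%N ->
      ((s1 + s2).-1 <= (y + z + p.-1).+1)%N by lia.
    exact: aux.
  move=> h2; have h1 := hX d p.
  have aux s1 s2 y z : (s1 <= y.+1)%N -> (s2 <= (z + p.-1).+1)%N ->
      ((s1 + s2).-1 <= (y + z + p.-1).+1)%N by lia.
  exact: aux.
rewrite sL ltnS /m mulnDr; apply/negP; rewrite -ltnNge.
have : (p * (size d).-1 + p <= p * (size n).-1)%N.
  by rewrite addnC -mulnS leq_mul2l; apply/orP; right; lia.
move: (p * (size d).-1)%N (p * (p ^ 2).-1)%N (p * (size n).-1)%N => y z t; lia.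
Qed.

(** At a root of d the Lucas polynomial degenerates to the p-th power of n b, and n does not vanish
    there. *)
Lemma trace_pole x : d.[x] = 0 -> b.[x] = 0.
Proof.
move=> dx; have [A sA e] := lucas_identity.
have := congr1 (fun q : {poly F} => q.[x]) e.
rewrite lucas_horner !hornerM horner_exp dx expr0n gtn_eqF // !mul0r.
rewrite -(prednK p_gt0) lucas0 => /eqP; rewrite expf_eq0 /= mulf_eq0 => /orP[nx|/eqP //].
by have := coprimep_root cop (nx : root n x); rewrite dx eqxx.
Qed.

(* The translate of the trace by [S] is again the trace; comparing both at [- S]. *)
Lemma trace_no_pole S : S != 0 -> tor S -> d.[xc S] != 0.
Proof.
move=> S0 hS; apply/eqP => dS; have sz := trace_size.
pose m := (size d).-1; have pd : (0 < size d)%N by rewrite lt0n size_poly_eq0.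
have sd : size d = m.+1 by rewrite prednK.
pose k c := cr_poly W c%:P.
pose uu := cr_vert W (xc S); pose vv := cr_line W (pc S) 0.
(* U / V is x(X + S) by the addition formula. Both are regular, so the relation obtained for generic
   X extends to -S, where V = 0 and U is the square of y(-S) - y(S), nonzero because S does not have
   order 2. *)
pose U := vv ^+ 2 + k (a1 W) * vv * uu - (k (a2 W + xc S) + cr_poly W 'X) * uu ^+ 2.
pose V := uu ^+ 2.
have evpX X (z : coordring W) i : X != 0 -> evp X (z ^+ i) = evp X z ^+ i.
  by move=> X0; rewrite !evpE // cr_evalX //; apply: pc_oncurve.
have evpk X c : X != 0 -> evp X (k c) = c by move=> X0; rewrite evp_poly // hornerC.
have evpB X (y z : coordring W) : X != 0 -> evp X (y - z) = evp X y - evp X z.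
  by move=> X0; rewrite !evpE // cr_evalB.
have euu X : X != 0 -> evp X uu = xc X - xc S by move=> X0; rewrite evpE // eval_vert.
have evv X : X != 0 -> evp X vv = yc X - yc S.
  by move=> X0; rewrite evpE // eval_line mul0r addr0.
have eU X : X != 0 -> evp X U = (yc X - yc S) ^+ 2 + a1 W * (yc X - yc S) * (xc X - xc S)
     - (a2 W + xc S + xc X) * (xc X - xc S) ^+ 2.
  move=> X0; rewrite /U evpB // evpD // !evpM evpD // !evpk // evp_poly // hornerX.
  by rewrite euu // evv //; ring.
have ehom X (c : {poly F}) : X != 0 -> evp X (homog k c m U V) = homog id c m (evp X U) (evp X V).
  move=> X0; rewrite /homog evpE // cr_eval_sum; apply: eq_bigr => j _.
  by rewrite -evpE // !evpM !evpX // evpk.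
have n1 : tor (- S) by tors.
have z0 : homog k n m U V * cr_poly W d - cr_poly W n * homog k d m U V = 0.
  set z := _ - _; apply/eqP/negPn/negP => z1.
  have u1 : cr_poly W u != 0 by rewrite -cr_lc_eq0 cr_lc_poly lead_coef_eq0.
  have w0 : z * cr_poly W u * uu != 0 by rewrite !mulf_neq0 // vert_neq0.
  have [L hL] := zero_list w0.
  have [X X0] := avoid_list (- S :: L ++ map (fun Y => Y - S) L).
  rewrite inE mem_cat !negb_or => /and3P[XS XL XSL].
  have XS0 : X + S != 0 by rewrite addr_eq0.
  have XSL' : X + S \notin L.
    by apply: contra XSL => h; apply/mapP; exists (X + S) => //; zmod.
  have : evp X (z * cr_poly W u * uu) != 0 by apply: contra XL => /eqP; apply: hL.
  have : evp (X + S) (z * cr_poly W u * uu) != 0 by apply: contra XSL' => /eqP; apply: hL.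
  rewrite !evpM !mulf_eq0 !negb_or (evp_poly _ XS0) (evp_poly _ X0) => /andP[/andP[_ uXS] _].
  rewrite euu // => /andP[/andP[zX uX] xX].
  case/negP: zX; rewrite /z evpB // !evpM !ehom // !evp_poly //.
  have [gX dX eX] := tr X0 uX; have [gXS dXS eXS] := tr XS0 uXS.
  rewrite opprD !inv // in eXS; last exact: genericN.
  have VX : evp X V = (xc X - xc S) ^+ 2 by rewrite /V evpX // euu.
  have V0 : evp X V != 0 by rewrite VX expf_neq0.
  have ex : evp X U / evp X V = xc (X + S).
    rewrite xcD // /third /sl /slope -/(xc X) -/(xc S) ifF; last by apply/negbTE; rewrite -subr_eq0.
    have xX' : xc S - xc X != 0 by rewrite -opprB oppr_eq0.
    by rewrite eU // VX /=; field; rewrite ?xX ?xX'.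
  rewrite !homogE ?sd ?ex -?sd //.
  have -> : n.[xc (X + S)] = n.[xc X] / d.[xc X] * d.[xc (X + S)] by rewrite -eX eXS divfK.
  by apply/eqP; field.
have NS0 : - S != 0 by rewrite oppr_eq0.
have : evp (- S) (homog k n m U V * cr_poly W d - cr_poly W n * homog k d m U V) = 0.
  by rewrite z0 evpE // cr_eval0.
rewrite evpB // !evpM !evp_poly // !ehom // xcN dS mulr0 sub0r.
move/eqP; rewrite oppr_eq0 mulf_eq0 => /orP[nS|].
  by have := coprimep_root cop (nS : root n (xc S)); rewrite dS eqxx.
rewrite /V evpX // euu // xcN subrr expr0n /= /homog big_ord_recr /= subnn expr0 mulr1.
rewrite big1 => [|j _]; last by rewrite expr0n subn_eq0 leqNgt ltn_ord mulr0.
rewrite add0r mulf_eq0 expf_eq0 eU // xcN subrr mulr0 addr0 expr0n mulr0 subr0 expf_eq0 /=.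
case/orP; first by have := lead_coef_eq0 d; rewrite lead_coefE -/m => ->; rewrite (negbTE d0).
move=> /andP[_]; rewrite subr_eq0 => /eqP ey.
have e2 : - S = S by apply: pc_inj => //; rewrite /pc xcN ey.
have : S *+ 2 != 0 by apply: (tor_mul_neq0 p_prime) => //; rewrite gtnNdvd //; lia.
by rewrite mulr2n -{1}e2 addNr eqxx.
Qed.

Lemma trace_constant : exists k, forall X, X != 0 -> u.[xc X] != 0 -> g X + g (- X) = k.
Proof.
have d1 : size d = 1%N.
  apply/eqP/negPn/negP => /closed_rootP[x /rootP dx].
  have := trace_pole dx; have [X [X0 ex]] := point_over E x; rewrite -ex => bX.
  have tX : tor X by apply/eqP; rewrite (represents_eq0 hab X0) bX.
  by have := trace_no_pole X0 tX; rewrite ex dx eqxx.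
have sn := trace_size; rewrite d1 in sn; have tr' := tr; rewrite (size1_polyC sn) in tr'.
have sd : (size d <= 1)%N by rewrite d1.
rewrite (size1_polyC sd) in tr'; exists (n`_0 / d`_0) => X X0 /(tr' X X0)[_ _ ->].
by rewrite !hornerC.
Qed.

End TraceConstant.

Lemma evp_trace (f : coordring W) Y : Y != 0 ->
  evp Y f + evp (- Y) f = (f.1 * 2%:P - f.2 * ycoef W).[xc Y].
Proof.
move=> Y0; rewrite -evp_conj // -evpD // -evp_poly //; congr evp.
apply: cr_ext; last by rewrite -[f + _]/(f.1 + (cr_conj f).1, f.2 + (cr_conj f).2) /= subrr.
rewrite -[f + _]/(f.1 + (cr_conj f).1, f.2 + (cr_conj f).2) /=.
by rewrite -[2]/(1 + 1) polyCD; ring.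
Qed.

Lemma psi2_horner X : X != 0 -> psi2.[xc X] = tangent_den W (pc X) ^+ 2.
Proof.
move=> X0; rewrite /psi2 /cubic /ycoef /tangent_den.
rewrite !(hornerD, hornerM, hornerC, hornerX, horner_exp) (curve_eq X0) /pc /=; ring.
Qed.

Lemma psi2_deriv X : psi2^`().[xc X] = 4 * tangent_num W (pc X) + 2 * a1 W * tangent_den W (pc X).
Proof.
rewrite /psi2 /cubic /ycoef /tangent_num /tangent_den /pc /=.
rewrite !(derivD, derivM, derivC, derivX, derivXn, derivX, exprSr, expr0) /=.
rewrite !(hornerD, hornerM, hornerC, hornerX, horner_exp, hornerMn); ring.
Qed.

Lemma psi2_simple e : ~~ root psi2^`() e \/ ~~ root psi2 e.
Proof.
have [X [X0 <-]] := point_over E e; rewrite !rootE psi2_horner // psi2_deriv.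
case: (eqVneq (tangent_den W (pc X)) 0) => [td|td]; last by right; rewrite expf_neq0.
left; rewrite td mulr0 addr0 mulf_neq0 ?ch0 //; apply/eqP => tn.
by apply: (nonsingular W_disc (pc_oncurve X0)).
Qed.

(** All roots of [psi2] are simple, so a polynomial of its degree 3 has more than one. *)
Lemma psi2_root_avoid x : exists2 e, root psi2 e & e != x.
Proof.
apply: contrapT => h.
have rx e : root psi2 e -> e = x.
  by move=> re; apply/eqP/negPn/negP => ne; apply: h; exists e.
have /closed_rootP[e1 re1] : size psi2 != 1%N by rewrite size_psi2.
have e1x := rx _ re1; rewrite e1x in re1; have /factor_theorem[q eq] := re1.
have q0 : q != 0.
  by apply/eqP => q0; have := size_psi2; rewrite eq q0 mul0r size_poly0.
have sq : size q = 3.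
  have := size_psi2; rewrite eq size_polyM_field ?polyXsubC_eq0 // size_XsubC.
  have aux y : (y + 2).-1 = 4 -> y = 3 by lia.
  exact: aux.
have /closed_rootP[e2 re2] : size q != 1%N by rewrite sq.
have e2x : e2 = x by apply: rx; rewrite eq rootM re2.
have := psi2_simple x; rewrite re1 => -[]// /negP; apply.
rewrite e2x in re2; rewrite rootE eq derivM derivXsubC hornerD !hornerM hornerXsubC subrr.
by rewrite hornerC mulr0 add0r mulr1.
Qed.

Lemma XsubC_power_eq (A B : {poly F}) e m k : A.[e] != 0 -> B.[e] != 0 ->
  A * ('X - e%:P) ^+ m = B * ('X - e%:P) ^+ k -> m = k.
Proof.
have key (A' B' : {poly F}) m' k' : A'.[e] != 0 -> (m' < k')%N ->
    A' * ('X - e%:P) ^+ m' <> B' * ('X - e%:P) ^+ k'.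
  move=> A0 lt; rewrite -(subnK (ltnW lt)) exprD mulrA => eq.
  have : A' = B' * ('X - e%:P) ^+ (k' - m').
    by apply: mulIf eq; rewrite expf_neq0 // polyXsubC_eq0.
  move=> e'; move: A0; rewrite e' hornerM horner_exp hornerXsubC subrr expr0n.
  by rewrite subn_eq0 leqNgt lt mulr0 eqxx.
move=> A0 B0 e1; case: (ltngtP m k) => // lt.
  by case: (key A B m k A0 lt e1).
by case: (key B A k m B0 lt (esym e1)).
Qed.

(** Once the trace is a constant k, g(X) and g(-X) are the roots of z^2 - k z + x(T) - x(pX). Since
    g is w over a polynomial in x, the discriminant equals [psi2] times the square of a rational
    function of x. At a simple root of [psi2] where the discriminant is finite and nonzero,
    multiplicities have opposite parities. *)
Lemma weil_fun_not_invariant : False.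
Proof.
have [w [dl [u [dl0 u0 hw]]]] := weil_fun_form.
pose t := w.1 * 2%:P - w.2 * ycoef W.
pose h := gcdp t dl; pose n := t %/ h; pose d := dl %/ h.
have et : t = n * h by rewrite divpK // dvdp_gcdl.
have ed : dl = d * h by rewrite divpK // dvdp_gcdr.
have cop : coprimep n d by apply: coprimep_div_gcd; rewrite dl0 orbT.
have d0 : d != 0 by apply: contra dl0 => /eqP d0; rewrite ed d0 mul0r.
have tr X : X != 0 -> u.[xc X] != 0 ->
    [/\ generic X, d.[xc X] != 0 & g X + g (- X) = n.[xc X] / d.[xc X]].
  move=> X0 /(hw X X0)[gX dX -> ->]; rewrite -mulrDl evp_trace // -/t et.
  move: dX; rewrite ed !hornerM mulf_eq0 negb_or => /andP[dX hX].
  by split=> //; field; rewrite dX hX.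
have [k hk] := trace_constant cop d0 u0 tr.
pose r := (k ^+ 2 - 4 * xc T)%:P * b + 4%:P * a.
have key : w.2 ^+ 2 * psi2 * b = dl ^+ 2 * r.
  apply: (@poly_eq_cofinite _ E u) => // X X0 uX.
  have [gX dX eX eX'] := hw X X0 uX; have hkX := hk X X0 uX.
  have Xp : X *+ p != 0 by apply: generic_neq0 gX _; lia.
  have [bX aX] := mul_p_coord X0 Xp.
  have -> : w.2 ^+ 2 * psi2 = t ^+ 2 - 4%:P * cr_norm w by rewrite -psi2_discr -/t; ring.
  have eN : (cr_norm w).[xc X] = evp X w * evp (- X) w.
    by rewrite -evp_conj // -evpM cr_mul_conj evp_poly.
  have wX : evp X w = dl.[xc X] * g X by rewrite eX mulrC divfK.
  have wX' : evp (- X) w = dl.[xc X] * g (- X) by rewrite eX' mulrC divfK.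
  have tX : t.[xc X] = dl.[xc X] * k by rewrite -evp_trace // wX wX' -mulrDr hkX.
  have gg := weil_fun_norm p_prime p_ge5 hT T0 gX.
  clearbody t; move: eN; move: (cr_norm w) => nw eN.
  rewrite /r !(hornerD, hornerM, hornerN, hornerC, horner_exp) eN tX wX wX' aX.
  have -> : xc T = g X * g (- X) + xc (X *+ p) by rewrite gg subrK.
  by ring.
(* A point of order 2 is fixed by multiplication by the odd p, so at its abscissa e the discriminant
   is 4(e - (x(T) - k^2 / 4)); this is the value to be avoided. *)
have [e re ne] := psi2_root_avoid (xc T - k ^+ 2 / 4).
have [X [X0 ex]] := point_over E e.
have n4 : 4 != 0 :> F by apply: (ch0 (n := 4)).
have X2 : X *+ 2 = 0.
  apply/eqP; rewrite mulr2n double_eq0 // -sqrf_eq0 -psi2_horner // ex.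
  exact: re.
have Xp : X *+ p = X.
  have od : odd p by have [e2|//] := even_prime p_prime; have := p_ge5; rewrite e2.
  by rewrite -(odd_double_half p) od -muln2 mulnC mulrnDr mulrnA X2 mul0rn addr0 mulr1n.
have [be ae] : b.[e] != 0 /\ a.[e] = b.[e] * e.
  by have := mul_p_coord X0 (_ : X *+ p != 0); rewrite Xp ex; apply.
have re0 : r.[e] != 0.
  have -> : r.[e] = b.[e] * 4 * (e - (xc T - k ^+ 2 / 4)).
    by rewrite /r !(hornerD, hornerM, hornerC) ae; field.
  by rewrite !mulf_neq0 // subr_eq0.
have w0 : w.2 != 0.
  apply/eqP => w0; have := key; rewrite w0 expr0n !mul0r => /esym/eqP.
  rewrite mulf_eq0 expf_eq0 (negbTE dl0) /= => /eqP r0.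
  by rewrite r0 horner0 eqxx in re0.
have /factor_theorem[q3 e3] := re.
have q30 : q3.[e] != 0.
  have := psi2_simple e; rewrite re => -[]//.
  by rewrite rootE e3 derivM derivXsubC hornerD !hornerM hornerXsubC subrr mulr0 add0r hornerC mulr1.
have [i [q1 r1 e1]] := multiplicity_XsubC w.2 e; rewrite w0 /= in r1.
have [j [q2 r2 e2]] := multiplicity_XsubC dl e; rewrite dl0 /= in r2.
have : i.*2.+1 = j.*2.
  apply: (@XsubC_power_eq (q1 ^+ 2 * q3 * b) (q2 ^+ 2 * r) e).
  - by rewrite !hornerM !mulf_neq0.
  - by rewrite !hornerM !mulf_neq0.
  apply: (@collect_powers _ q1 q2 q3 b r ('X - e%:P) i j).
  by move: key; rewrite e1 e2 e3.
by move/(congr1 odd); rewrite /= !odd_double.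
Qed.

End Nontrivial.

Theorem weil_nontrivial (F : closedFieldType) (E : elliptic F) (p : nat) (T : ept E) :
  (forall n, (0 < n)%N -> n%:R != 0 :> F) -> prime p -> (5 <= p)%N ->
  tor p T -> T != 0 -> exists2 S, tor p S & weil p S T != 1.
Proof.
move=> ch0 p_prime p5 hT T0; apply: contrapT => h.
have [a [b [hab sh]]] := divpol E p.
apply: (weil_fun_not_invariant ch0 p_prime p5 hT T0 _ hab sh) => S X hS gX.
have [_ _ ->//] := weilP ch0 p_prime hS hT.
suff -> : weil p S T = 1 by rewrite mul1r.
by apply/eqP/negPn/negP => ne; apply: h; exists S.
Qed.

(** An algebraic closure carries no discrete valuation; its ring of integers is handled through the
    dichotomy between x and 1 / x. *)
Record valring (F : fieldType) := Valring {
  vO :> F -> Prop;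
  vO_ring : is_subring vO;
  vO_total : forall x, vO x \/ vO x^-1 }.

(** * Valuation rings and Henselian fields *)

Section ResidueField.

Variables (F : fieldType) (V : valring F).
Implicit Types (x y z : F).

Let VR : is_subring V := vO_ring V.
Lemma vO0 : V 0. Proof. exact: subring0. Qed.
Lemma vO1 : V 1. Proof. exact: subring1. Qed.
Lemma vOD x y : V x -> V y -> V (x + y). Proof. exact: subringD. Qed.
Lemma vOB x y : V x -> V y -> V (x - y).
Proof. by case: VR => _ h _ Vx Vy; apply: h. Qed.
Lemma vOM x y : V x -> V y -> V (x * y). Proof. exact: subringM. Qed.
Lemma vON x : V x -> V (- x). Proof. exact: subringN. Qed.
Lemma vOX x n : V x -> V (x ^+ n). Proof. exact: subringX. Qed.
Lemma vO_nat n : V n%:R. Proof. exact: subring_nat. Qed.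
Lemma vO_sum I (r : seq I) (f : I -> F) : (forall i, V (f i)) -> V (\sum_(i <- r) f i).
Proof. exact: subring_sum. Qed.

(** The maximal ideal. Zero is listed apart because its inverse is again 0, an element of the
    ring. *)
Definition vm x : Prop := V x /\ (x = 0 \/ ~ V x^-1).

Lemma vm0 : vm 0. Proof. by split; [apply: vO0 | left]. Qed.
Lemma vm1 : ~ vm 1.
Proof. by move=> [_ []]; [apply/eqP; apply: oner_neq0 | rewrite invr1; case; apply: vO1]. Qed.

Lemma vmMl x y : V x -> vm y -> vm (x * y).
Proof.
move=> Vx [Vy [->|h]]; first by rewrite mulr0; apply: vm0.
split; first exact: vOM.
have [->|x0] := eqVneq x 0; first by left; rewrite mul0r.
right=> Vi; apply: h; have := vOM Vx Vi.
by rewrite invfM mulrA divff // mul1r.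
Qed.

Lemma vmN x : vm x -> vm (- x).
Proof.
move=> h; rewrite -mulN1r; apply: vmMl => //; apply: vON; exact: vO1.
Qed.

Lemma vmD x y : vm x -> vm y -> vm (x + y).
Proof.
have key a b : vm a -> vm b -> b != 0 -> V (a / b) -> vm (a + b).
  move=> ha hb b0 Vab; have -> : a + b = (a / b + 1) * b by rewrite mulrDl divfK // mul1r.
  by apply: vmMl => //; apply: vOD => //; apply: vO1.
move=> hx hy; have [->|x0] := eqVneq x 0; first by rewrite add0r.
have [->|y0] := eqVneq y 0; first by rewrite addr0.
have [h|h] := vO_total V (x / y); first exact: key.
by rewrite addrC; apply: key => //; rewrite -invf_div.
Qed.

Lemma vmB x y : vm x -> vm y -> vm (x - y).
Proof. by move=> hx hy; apply: vmD => //; apply: vmN. Qed.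

Lemma vm_unit x : V x -> ~ vm x -> x != 0 /\ V x^-1.
Proof.
move=> Vx h; split; first by apply/eqP => x0; apply: h; rewrite x0; apply: vm0.
by apply: contrapT => nV; apply: h; split=> //; right.
Qed.

Lemma vm_of_inv x : ~ V x -> vm x^-1.
Proof.
move=> h; split; first by have [|//] := vO_total V x.
by right; rewrite invrK.
Qed.

(** Otherwise 1 / x lies in the maximal ideal, and dividing the equation by x^n puts 1 there too. *)
Lemma vO_closed (q : {poly F}) x : q \is monic -> coefs_in V q -> root q x -> V x.
Proof.
move=> mq hq rx; apply: contrapT => nV; have hi := vm_of_inv nV.
have x0 : x != 0 by apply/eqP => x0; apply: nV; rewrite x0; apply: vO0.
have q0 := monic_neq0 mq.
have [n sn] : exists n, size q = n.+1.
  by exists (size q).-1; rewrite prednK // lt0n size_poly_eq0.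
move/rootP: rx; rewrite horner_coef sn big_ord_recr /=.
have -> : q`_n = 1 by move/monicP: mq; rewrite lead_coefE sn.
rewrite mul1r => e; apply: vm1.
have -> : 1 = - \sum_(i < n) q`_i * x^-1 ^+ (n - i).
  apply: (mulIf (expf_neq0 n x0)); rewrite mul1r mulNr mulr_suml.
  rewrite (eq_bigr (fun i : 'I_n => q`_i * x ^+ i)) => [|i _].
    by apply/eqP; rewrite -addr_eq0 addrC e.
  rewrite -mulrA exprVn; congr (_ * _).
  have -> : x ^+ n = x ^+ (n - i) * x ^+ i by rewrite -exprD subnK // ltnW.
  by rewrite mulKf // expf_neq0.
apply: vmN; elim/big_rec: _ => [|i y _ hy]; first exact: vm0.
apply: vmD => //; apply: vmMl => //.
have : (0 < n - i)%N by rewrite subn_gt0.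
case: (n - i)%N => // k _; rewrite exprSr; apply: vmMl => //.
by apply: vOX; case: hi.
Qed.

(** A canonical representative modulo the maximal ideal, which makes the residue field a subtype of
    F and reduction a total function; elements outside the ring are first replaced by 0. *)
Definition vrep x : F :=
  choose (fun y => `[< vm ((if `[< V x >] then x else 0) - y) >]) (if `[< V x >] then x else 0).

Lemma vrepP x : V x -> vm (x - vrep x).
Proof.
move=> Vx; rewrite /vrep asboolT //; set P := (fun y : F => _).
have : P (choose P x) by apply: chooseP; apply/asboolP; rewrite subrr; apply: vm0.
by move/asboolP.
Qed.

Lemma vrepO x : V (vrep x).
Proof.
have key y : V y -> V (vrep y).
  move=> Vy; have := vrepP Vy => -[h _].
  by have -> : vrep y = y - (y - vrep y) by [ring]; apply: vOB.
have [Vx|nV] := EM (V x); first exact: key.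
have -> : vrep x = vrep 0 by rewrite /vrep asboolF // asboolT //; exact: vO0.
exact/key/vO0.
Qed.

Lemma vrep_eq x y : V x -> V y -> vm (x - y) -> vrep x = vrep y.
Proof.
move=> Vx Vy h; rewrite /vrep !asboolT //.
have -> : (fun z : F => `[< vm (x - z) >]) = (fun z => `[< vm (y - z) >]).
  apply: funext => z; apply/asboolP/asboolP => hz.
    by have -> : y - z = (x - z) - (x - y) by [ring]; apply: vmB.
  by have -> : x - z = (x - y) + (y - z) by [ring]; apply: vmD.
apply: choose_id; apply/asboolP; last by rewrite subrr; apply: vm0.
by have -> : y - x = - (x - y) by [ring]; apply: vmN.
Qed.

Lemma vrepK x : vrep (vrep x) = vrep x.
Proof.
have key y : V y -> vrep (vrep y) = vrep y.
  move=> Vy; apply: vrep_eq => //; first exact: vrepO.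
  by have -> : vrep y - y = - (y - vrep y) by [ring]; apply: vmN; apply: vrepP.
have [Vx|nV] := EM (V x); first exact: key.
have -> : vrep x = vrep 0 by rewrite /vrep asboolF // asboolT //; exact: vO0.
exact/key/vO0.
Qed.

Record resf := Resf { resval : F; _ : vrep resval == resval }.
HB.instance Definition _ := [isSub for resval].
HB.instance Definition _ := [Choice of resf by <:].

Definition red x : resf := Resf (introT eqP (vrepK x)).

Lemma red_eqP x y : V x -> V y -> red x = red y <-> vm (x - y).
Proof.
move=> Vx Vy; split=> [/(congr1 val) /= e|h]; last by apply: val_inj => /=; apply: vrep_eq.
have -> : x - y = (x - vrep x) - (y - vrep y) by rewrite e; ring.
by apply: vmB; apply: vrepP.
Qed.

Lemma resvalK (a : resf) : red (val a) = a.
Proof. by case: a => x h; apply: val_inj => /=; apply/eqP. Qed.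

Lemma resvalO (a : resf) : V (val a).
Proof. by rewrite -[a]resvalK; apply: vrepO. Qed.

Lemma red_off x : ~ V x -> red x = red 0.
Proof.
by move=> h; apply: val_inj; rewrite /= /vrep asboolF // asboolT //; exact: vO0.
Qed.

Lemma red_val x : V x -> vm (val (red x) - x).
Proof. by move=> Vx; rewrite -opprB; apply: vmN; apply: vrepP. Qed.

Definition resf_add (a b : resf) := red (val a + val b).
Definition resf_opp (a : resf) := red (- val a).
Definition resf_mul (a b : resf) := red (val a * val b).
Definition resf_inv (a : resf) := red (val a)^-1.

Lemma red_add x y : V x -> V y -> resf_add (red x) (red y) = red (x + y).
Proof.
move=> Vx Vy; apply/red_eqP; [apply: vOD; exact: resvalO | exact: vOD |].
rewrite opprD addrACA; apply: vmD; exact: red_val.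
Qed.

Lemma red_opp x : V x -> resf_opp (red x) = red (- x).
Proof.
move=> Vx; apply/red_eqP; [apply: vON; exact: resvalO | exact: vON |].
by rewrite -opprD; apply: vmN; apply: red_val.
Qed.

Lemma red_mul x y : V x -> V y -> resf_mul (red x) (red y) = red (x * y).
Proof.
move=> Vx Vy; apply/red_eqP; [apply: vOM; exact: resvalO | exact: vOM |].
have -> : val (red x) * val (red y) - x * y =
  val (red x) * (val (red y) - y) + y * (val (red x) - x) by ring.
by apply: vmD; apply: vmMl; rewrite //; [apply: resvalO | apply: red_val | apply: red_val].
Qed.

Lemma resf_ind (P : resf -> Prop) : (forall x, V x -> P (red x)) -> forall a, P a.
Proof. by move=> h a; rewrite -[a]resvalK; apply: h; apply: resvalO. Qed.

Fact resf_addA : associative resf_add.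
Proof.
elim/resf_ind=> x Vx; elim/resf_ind=> y Vy; elim/resf_ind=> z Vz.
by rewrite !red_add ?addrA //; apply: vOD.
Qed.
Fact resf_addC : commutative resf_add.
Proof. by move=> a b; rewrite /resf_add addrC. Qed.
Fact resf_add0 : left_id (red 0) resf_add.
Proof. by elim/resf_ind=> x Vx; rewrite red_add ?add0r //; apply: vO0. Qed.
Fact resf_addN : left_inverse (red 0) resf_opp resf_add.
Proof. by elim/resf_ind=> x Vx; rewrite red_opp // red_add ?addNr //; apply: vON. Qed.
HB.instance Definition _ := GRing.isZmodule.Build resf resf_addA resf_addC resf_add0 resf_addN.

Fact resf_mulA : associative resf_mul.
Proof.
elim/resf_ind=> x Vx; elim/resf_ind=> y Vy; elim/resf_ind=> z Vz.
by rewrite !red_mul ?mulrA //; apply: vOM.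
Qed.
Fact resf_mulC : commutative resf_mul.
Proof. by move=> a b; rewrite /resf_mul mulrC. Qed.
Fact resf_mul1 : left_id (red 1) resf_mul.
Proof. by elim/resf_ind=> x Vx; rewrite red_mul ?mul1r //; apply: vO1. Qed.
Fact resf_mulDl : left_distributive resf_mul resf_add.
Proof.
elim/resf_ind=> x Vx; elim/resf_ind=> y Vy; elim/resf_ind=> z Vz.
rewrite ?(red_add, red_mul) ?mulrDl //; try apply: vOM => //; exact: vOD.
Qed.
Fact resf_1neq0 : red 1 != 0 :> resf.
Proof.
apply/eqP => /(red_eqP vO1 vO0); rewrite subr0; exact: vm1.
Qed.
HB.instance Definition _ := GRing.Zmodule_isComNzRing.Build resf
  resf_mulA resf_mulC resf_mul1 resf_mulDl resf_1neq0.

Lemma red0 : red 0 = 0. Proof. by []. Qed.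
Lemma red1 : red 1 = 1. Proof. by []. Qed.
Lemma redD x y : V x -> V y -> red (x + y) = red x + red y.
Proof. by move=> Vx Vy; rewrite -red_add. Qed.
Lemma redN x : V x -> red (- x) = - red x.
Proof. by move=> Vx; rewrite -red_opp. Qed.
Lemma redB x y : V x -> V y -> red (x - y) = red x - red y.
Proof. by move=> Vx Vy; rewrite redD ?redN //; apply: vON. Qed.
Lemma redM x y : V x -> V y -> red (x * y) = red x * red y.
Proof. by move=> Vx Vy; rewrite -red_mul. Qed.
Lemma red_eq0 x : V x -> red x = 0 <-> vm x.
Proof. by move=> Vx; rewrite -red0 red_eqP ?subr0 //; exact: vO0. Qed.

Fact resf_mulV (a : resf) : a != 0 -> resf_inv a * a = 1.
Proof.
move=> a0; have nm : ~ vm (val a).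
  by move=> h; move/eqP: a0; apply; rewrite -[a]resvalK; apply/red_eq0 => //; apply: resvalO.
have [v0 Vi] := vm_unit (resvalO a) nm.
rewrite /resf_inv -{2}[a]resvalK -redM ?mulVf //; exact: resvalO.
Qed.
Fact resf_inv0 : resf_inv 0 = 0.
Proof.
rewrite /resf_inv; have : vm (val (red 0)) by rewrite -[val _]subr0; apply: red_val; exact: vO0.
rewrite red0 => -[_ [->|h]]; first by rewrite invr0.
by rewrite (red_off h).
Qed.
HB.instance Definition _ := GRing.ComNzRing_isField.Build resf resf_mulV resf_inv0.

Lemma redX x n : V x -> red (x ^+ n) = red x ^+ n.
Proof.
move=> Vx; elim: n => [|n IH]; first by rewrite !expr0.
by rewrite !exprS redM ?IH //; apply: vOX.
Qed.
Lemma redMn n : red n%:R = n%:R.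
Proof.
elim: n => [|n IH]; first exact: red0.
by rewrite !mulrS redD ?IH //; [apply: vO1 | apply: vO_nat].
Qed.
Lemma red_sum I (r : seq I) (f : I -> F) : (forall i, V (f i)) ->
  red (\sum_(i <- r) f i) = \sum_(i <- r) red (f i).
Proof.
move=> h; elim: r => [|i r IH]; first by rewrite !big_nil.
by rewrite !big_cons redD ?IH //; apply: vO_sum.
Qed.
Lemma redV x : V x -> red x != 0 -> V x^-1 /\ red x^-1 = (red x)^-1.
Proof.
move=> Vx r0; have nm : ~ vm x by move/(red_eq0 Vx)/eqP; apply/negP.
have [x0 Vi] := vm_unit Vx nm; split=> //.
by apply: (mulIf r0); rewrite mulVf // -redM // mulVf.
Qed.

End ResidueField.

Section ClosedResidueField.

Variables (F : closedFieldType) (V : valring F).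

Fact resf_closed : GRing.closed_field_axiom (resf V).
Proof.
move=> n P n0.
pose q : {poly F} := 'X^n - \poly_(i < n) val (P i).
have sr : (size (\poly_(i < n) val (P i)) < size ('X^n : {poly F}))%N.
  by rewrite size_polyXn ltnS size_poly.
have mq : q \is monic by rewrite monicE lead_coefDl ?size_polyN // lead_coefXn.
have sq : size q = n.+1 by rewrite size_polyDl ?size_polyN // size_polyXn.
have /closed_rootP[x rx] : size q != 1%N by rewrite sq; case: (n) n0.
have cq : coefs_in V q.
  apply: coefs_inB; [exact: vO_ring | | ].
    by move=> i; rewrite coefXn; apply: vO_nat.
  by move=> i; rewrite coef_poly; case: ifP => _; [apply: resvalO | apply: vO0].
have Vx := vO_closed mq cq rx; exists (red V x).
rewrite -redX //; move/rootP: rx; rewrite /q hornerD hornerN hornerXn.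
move/eqP; rewrite subr_eq0 => /eqP ->; rewrite horner_poly red_sum => [|i].
  by apply: eq_bigr => i _; rewrite redM ?redX ?resvalK //; [apply: resvalO | apply: vOX].
by apply: vOM; [apply: resvalO | apply: vOX].
Qed.
HB.instance Definition _ := Field_isAlgClosed.Build (resf V) resf_closed.

End ClosedResidueField.

Section ValuationRingType.

Variables (F : fieldType) (V : valring F).

Definition vpred : {pred F} := fun x => `[< V x >].
Fact vpred_subring : subring_closed vpred.
Proof.
have [S1 SB SM] := vO_ring V.
by split=> [|x y /asboolP hx /asboolP hy|x y /asboolP hx /asboolP hy]; apply/asboolP;
  [apply: S1 | apply: SB | apply: SM].
Qed.
HB.instance Definition _ := GRing.isSubringClosed.Build F vpred vpred_subring.

Record vring := Vring { vval : F; _ : vval \in vpred }.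
HB.instance Definition _ := [isSub for vval].
HB.instance Definition _ := [Choice of vring by <:].
HB.instance Definition _ := [SubChoice_isSubComNzRing of vring by <:].

Lemma vvalP (x : vring) : V (val x).
Proof. by case: x => x h /=; apply/asboolP. Qed.

Definition lift_coefs (q : {poly F}) : {poly vring} :=
  \poly_(i < size q) insubd (0 : vring) q`_i.
Lemma lift_coefsK q : coefs_in V q -> map_poly val (lift_coefs q) = q.
Proof.
move=> hq; apply/polyP => i; rewrite coef_map coef_poly.
case: ltnP => hi; last by rewrite nth_default.
by apply: insubdK; apply/asboolP.
Qed.

End ValuationRingType.

(** * Hensel factorization and the integral closure in an algebraic closure *)

Section NormalizedValuation.

Variables (K : fieldType) (v : K -> int).
Hypothesis (hv : normalized_valuation v).
Local Notation vge := (val_ge v).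
Implicit Types (x y : K).

Lemma val_one : v 1 = 0.
Proof.
have := Defs.valM hv (oner_neq0 K) (oner_neq0 K); rewrite mulr1 => e.
by apply: (addrI (v 1)); rewrite addr0 -e.
Qed.
Lemma val_inv x : x != 0 -> v x^-1 = - v x.
Proof.
move=> x0; have := Defs.valM hv x0 (invr_neq0 x0 : x^-1 != 0); rewrite divff // val_one; lia.
Qed.
Lemma vge0 n : vge n 0. Proof. by left. Qed.
Lemma vgeD n x y : vge n x -> vge n y -> vge n (x + y). Proof. exact: (Defs.valD hv). Qed.
Lemma vgeM m n x y : vge m x -> vge n y -> vge (m + n) (x * y).
Proof.
move=> [->|hx] [->|hy]; rewrite ?mul0r ?mulr0; try by left.
have [->|x0] := eqVneq x 0; first by rewrite mul0r; left.
have [->|y0] := eqVneq y 0; first by rewrite mulr0; left.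
by right; rewrite (Defs.valM hv) // lerD.
Qed.
Lemma vgeN n x : vge n x -> vge n (- x).
Proof.
have m1 : v (-1) = 0.
  have n1 : (-1 : K) != 0 by rewrite oppr_eq0 oner_neq0.
  by have := Defs.valM hv n1 n1; rewrite mulrNN mulr1 val_one; lia.
move=> h; rewrite -mulN1r -[n]add0r; apply: vgeM => //; right; rewrite m1 //.
Qed.
Lemma vgeB n x y : vge n x -> vge n y -> vge n (x - y).
Proof. by move=> hx hy; apply: vgeD => //; apply: vgeN. Qed.
Lemma vgeW m n x : m <= n -> vge n x -> vge m x.
Proof. by move=> le [->|h]; [left | right; apply: le_trans h]. Qed.
Lemma vge_all0 x : (forall n : nat, vge n%:Z x) -> x = 0.
Proof.
move=> h; apply/eqP/negPn/negP => x0; have [e|] := h (`|v x|.+1)%N; last by lia.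
by rewrite e eqxx in x0.
Qed.
Lemma vge1 : vge 0 1. Proof. by right; rewrite val_one. Qed.
Lemma vge_sum n I (r : seq I) (f : I -> K) : (forall i, vge n (f i)) ->
  vge n (\sum_(i <- r) f i).
Proof. by move=> h; elim/big_rec: _ => [|i x _]; [apply: vge0 | apply: vgeD]. Qed.

Fact base_ring : is_subring (vge 0).
Proof. by split=> [|x y|x y hx hy]; [exact: vge1 | exact: vgeB | exact: vgeM hx hy]. Qed.
Fact base_total x : vge 0 x \/ vge 0 x^-1.
Proof.
have [->|x0] := eqVneq x 0; first by left; left.
have [h|h] := leP 0 (v x); first by left; right.
by right; right; rewrite val_inv //; lia.
Qed.
Definition base_valring : valring K := Valring base_ring base_total.

Definition cge (n : int) (p : {poly K}) : Prop := coefs_in (vge n) p.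

Lemma cgeD n p q : cge n p -> cge n q -> cge n (p + q).
Proof. by move=> hp hq i; rewrite coefD; apply: vgeD. Qed.
Lemma cgeB n p q : cge n p -> cge n q -> cge n (p - q).
Proof. by move=> hp hq i; rewrite coefB; apply: vgeB. Qed.
Lemma cgeM m n p q : cge m p -> cge n q -> cge (m + n) (p * q).
Proof. by move=> hp hq i; rewrite coefM; apply: vge_sum => j; apply: vgeM. Qed.
Lemma cgeW m n p : m <= n -> cge n p -> cge m p.
Proof. by move=> le h i; apply: vgeW le (h i). Qed.

Lemma cge_divmod k (G S : {poly K}) : G \is monic -> cge 0 G -> cge k S ->
  cge k (S %/ G) /\ cge k (S %% G).
Proof.
move=> mG hG; have G0 := monic_neq0 mG.
move: {2}(size S) (leqnn (size S)) => n; elim: n S => [|n IH] S.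
  rewrite leqn0 size_poly_eq0 => /eqP -> _; rewrite div0p mod0p.
  by split=> i; rewrite coef0; apply: vge0.
move=> sS hS; have [lt|ge] := ltnP (size S) (size G).
  by rewrite divp_small // modp_small //; split=> // i; rewrite coef0; apply: vge0.
pose c := (lead_coef S)%:P * 'X^(size S - size G).
have hc : cge k c.
  by move=> i; rewrite coefCM coefXn; case: eqP => _; rewrite ?mulr1 ?mulr0; [apply: hS | apply: vge0].
have [S0|S0] := eqVneq S 0.
  by rewrite S0 div0p mod0p; split=> i; rewrite coef0; apply: vge0.
have cs : size (c * G) = size S.
  rewrite /c -mulrA size_Cmul ?lead_coef_eq0 // mulrC size_mulXn // subnK //.
have lc : lead_coef (c * G) = lead_coef S.
  by rewrite lead_coefM (monicP mG) mulr1 /c lead_coefM lead_coefXn mulr1 lead_coefC.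
have lt : (size (S - c * G)%R <= n)%N.
  rewrite -ltnS; apply: leq_trans sS.
  have sz : (size (S - c * G)%R <= size S)%N.
    by apply: leq_trans (size_polyD_field _ _) _; rewrite size_polyN_field cs maxnn.
  rewrite ltn_neqAle sz andbT; apply: contra S0 => /eqP e.
  have : lead_coef (S - c * G) = 0.
    by rewrite lead_coefE e coefB -cs -lead_coefE lc cs lead_coefE subrr.
  by move/eqP; rewrite lead_coef_eq0 -size_poly_eq0 e size_poly_eq0.
have cG : cge k (c * G) by rewrite -[k]addr0; apply: cgeM.
have [hq' hr'] := IH _ lt (cgeB hS cG).
rewrite -[S](subrK (c * G)) divpD modpD mulpK // modp_mull addr0; split=> //.
exact: cgeD.
Qed.

Hypothesis (hc : complete_valuation v).

Section Hensel.

Variables (f : {poly K}) (j : nat).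
Hypotheses (f0 : cge 0 f) (fj : f`_j = 1) (fm : forall i, (j < i)%N -> vge 1 f`_i).

(** If f = H G + R, then f = H (G + R) + (1 - H) R. As H stays congruent to 1 modulo the maximal
    ideal, the correction G + R gains one unit of precision at each step. *)
Definition hensel_seq (k : nat) : {poly K} :=
  iter k (fun G => G + f %% G) (\poly_(i < j.+1) f`_i).

Lemma monic_of_coef (G : {poly K}) : (size G <= j.+1)%N -> G`_j = 1 ->
  G \is monic /\ size G = j.+1.
Proof.
move=> sG e; have sz : size G = j.+1.
  apply/eqP; rewrite eqn_leq sG ltnNge; apply/negP => h.
  by move/eqP: e; rewrite nth_default // eq_sym oner_eq0.
by rewrite monicE lead_coefE sz e.
Qed.

Lemma hensel_inv k : let G := hensel_seq k in
  [/\ G \is monic, size G = j.+1, cge 0 G, cge k.+1%:Z (f %% G) & cge 1 (f %/ G - 1)].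
Proof.
elim: k => [|k]; rewrite /hensel_seq /=.
  set G := \poly_(i < _) _.
  have [mG sG] : G \is monic /\ size G = j.+1.
    by apply: monic_of_coef; rewrite ?size_poly // coef_poly ltnSn.
  have hG : cge 0 G.
    by move=> i; rewrite coef_poly; case: ifP => _; [apply: f0 | apply: vge0].
  have hS : cge 1 (f - G).
    move=> i; rewrite coefB coef_poly; case: ltnP => hi; first by rewrite subrr; apply: vge0.
    by rewrite subr0; apply: fm.
  have [hq hr] := cge_divmod mG hG hS; have G0 := monic_neq0 mG.
  have ef : f = f - G + 1 * G by rewrite mul1r subrK.
  have e1 : f %/ G = (f - G) %/ G + 1 by rewrite {1}ef divpD mulpK.
  have e2 : f %% G = (f - G) %% G by rewrite {1}ef modpD modp_mull addr0.
  by split=> //; rewrite ?e2 // e1 addrK.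
rewrite -/(hensel_seq k); set G := hensel_seq k => -[mG sG hG hR hH].
set R := f %% G; have lt : (size R <= j)%N by rewrite -ltnS -sG ltn_modp monic_neq0.
have [mG' sG'] : (G + R) \is monic /\ size (G + R) = j.+1.
  apply: monic_of_coef.
    by apply: leq_trans (size_polyD_field _ _) _; rewrite geq_max sG leqnn ltnW.
  by rewrite coefD [R`_j]nth_default // addr0; have := monicP mG; rewrite lead_coefE sG.
have hG' : cge 0 (G + R) by apply: cgeD => //; apply: cgeW hR.
pose S := R * - (f %/ G - 1).
have hS : cge k.+2%:Z S.
  have -> : k.+2%:Z = k.+1%:Z + 1 by lia.
  by apply: cgeM => // i; rewrite coefN; apply: vgeN.
have ef : f = S + f %/ G * (G + R).
  by rewrite {1}(divp_eq f G) /S; rewrite -/R; ring.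
have [hq hr] := cge_divmod mG' hG' hS; have G0 := monic_neq0 mG'.
split=> //.
  by rewrite [X in X %% _]ef modpD modp_mull addr0.
rewrite [X in X %/ _ - 1]ef divpD mulpK // -addrA; apply: cgeD => //.
by apply: cgeW hq; lia.
Qed.

Lemma hensel_cauchy k n : cge k.+1%:Z (hensel_seq (k + n) - hensel_seq k).
Proof.
elim: n => [|n IH].
  by rewrite addn0 subrr => i; rewrite coef0; apply: vge0.
have [_ _ _ h _] := hensel_inv (k + n).
rewrite addnS [hensel_seq (k + n).+1]/(hensel_seq (k + n) + f %% hensel_seq (k + n)).
rewrite addrAC; apply: cgeD => //.
by apply: cgeW h; lia.
Qed.

Lemma hensel : exists G : {poly K}, [/\ G \is monic, size G = j.+1 & G %| f].
Proof.
have lim i : exists a : K, forall k : nat, vge k.+1%:Z ((hensel_seq k)`_i - a).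
  have [|a ha] := hc (u := fun k => (hensel_seq k)`_i).
    move=> n; exists `|n|%N => a b ha hb.
    have key c : (`|n| <= c)%N -> vge n ((hensel_seq c)`_i - (hensel_seq `|n|)`_i).
      move=> hc'; have := hensel_cauchy `|n| (c - `|n|) i; rewrite subnKC // coefB.
      by apply: vgeW; lia.
    have -> : (hensel_seq a)`_i - (hensel_seq b)`_i =
      ((hensel_seq a)`_i - (hensel_seq `|n|)`_i) - ((hensel_seq b)`_i - (hensel_seq `|n|)`_i) by ring.
    by apply: vgeB; apply: key.
  exists a => k; have [N hN] := ha k.+1%:Z.
  have := hN (maxn N k) (leq_maxl _ _); have le : (k <= maxn N k)%N := leq_maxr _ _.
  have := hensel_cauchy k (maxn N k - k) i; rewrite subnKC // coefB => h1 h2.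
  have -> : (hensel_seq k)`_i - a = ((hensel_seq (maxn N k))`_i - a)
     - ((hensel_seq (maxn N k))`_i - (hensel_seq k)`_i) by ring.
  exact: vgeB.
pose a i := projT1 (cid (lim i)); have ha i : forall k : nat, vge k.+1%:Z ((hensel_seq k)`_i - a i).
  by rewrite /a; case: cid.
pose G := \poly_(i < j.+1) a i.
have hG k : cge k.+1%:Z (hensel_seq k - G).
  move=> i; rewrite coefB coef_poly; case: ltnP => hi; first exact: ha.
  have [_ sG _ _ _] := hensel_inv k.
  by rewrite nth_default ?sG // subr0; apply: vge0.
have aj : a j = 1.
  apply/eqP; rewrite eq_sym -subr_eq0; apply/eqP/vge_all0 => n.
  have [mG sG _ _ _] := hensel_inv n; have := ha j n.
  have -> : (hensel_seq n)`_j = 1 by have := monicP mG; rewrite lead_coefE sG.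
  by apply: vgeW; lia.
have [mG sG] : G \is monic /\ size G = j.+1.
  by apply: monic_of_coef; rewrite ?size_poly // coef_poly ltnSn.
exists G; split=> //; rewrite /dvdp; apply/eqP/polyP => i; rewrite coef0.
have G0 : cge 0 G.
  have -> : G = hensel_seq 0 - (hensel_seq 0 - G) by rewrite subKr.
  have [_ _ h _ _] := hensel_inv 0; apply: cgeB => //.
  exact: cgeW (hG 0%N).
apply: vge_all0 => n; have [mGn sGn hGn hR hH] := hensel_inv n.
pose S := f %% hensel_seq n + f %/ hensel_seq n * (hensel_seq n - G).
have hS : cge n.+1%:Z S.
  apply: cgeD => //; rewrite -[n.+1%:Z]add0r; apply: cgeM => //.
  have -> : f %/ hensel_seq n = (f %/ hensel_seq n - 1) + 1 by rewrite subrK.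
  apply: cgeD; first by apply: cgeW hH.
  by move=> k; rewrite coef1; case: eqP => _; [apply: vge1 | apply: vge0].
have -> : f = S + f %/ hensel_seq n * G.
  by rewrite {1}(divp_eq f (hensel_seq n)) /S; ring.
rewrite modpD modp_mull addr0.
have [_ h] := cge_divmod mG G0 hS; apply: vgeW (h i); lia.
Qed.

End Hensel.

Variables (Kbar : closedFieldType) (iota : {rmorphism K -> Kbar}).
Hypothesis (Kbar_closure : is_algebraic_closure iota).
Implicit Types (z : Kbar).

Lemma min_poly z : exists f : {poly K}, [/\ f != 0, root (map_poly iota f) z &
  forall g : {poly K}, g != 0 -> root (map_poly iota g) z -> (size f <= size g)%N].
Proof.
pose P n := `[< exists f : {poly K}, [/\ f != 0, root (map_poly iota f) z & size f = n] >].
have exP : exists n, P n.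
  by have [q q0 rq] := Kbar_closure z; exists (size q); apply/asboolP; exists q.
case: (ex_minnP exP) => n /asboolP[f [f0 rf <-]] h; exists f; split=> // g g0 rg.
by apply: h; apply/asboolP; exists g.
Qed.

(** The minimal polynomial is scaled so that, among its coefficients of least valuation, the one of
    highest index j is 1. For j = 0 the second alternative holds. Otherwise [hensel] splits off a
    monic factor of degree j, and minimality forces j to be the full degree. *)
Lemma valuation_dichotomy z :
  (exists q : {poly K}, [/\ q \is monic, cge 0 q & root (map_poly iota q) z]) \/
  (exists q : {poly K}, [/\ q`_0 = 1, forall i, (0 < i)%N -> vge 1 q`_i & root (map_poly iota q) z]).
Proof.
have [f [f0 rf fmin]] := min_poly z.
pose P i := (f`_i != 0) && `[< forall k, vge (v f`_i) f`_k >].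
have exP : exists i, P i.
  have [n sn] : exists n, size f = n.+1 by exists (size f).-1; rewrite prednK // lt0n size_poly_eq0.
  have n0 : f`_n != 0 by have := lead_coef_eq0 f; rewrite lead_coefE sn /= => ->.
  pose i0 : 'I_n.+1 := ord_max.
  case: (Order.TotalTheory.arg_minP (fun i : 'I_n.+1 => v f`_i) (i0 := i0) (P := fun i : 'I_n.+1 => f`_i != 0)) => // i fi hi.
  exists i; apply/andP; split=> //; apply/asboolP => k.
  have [->|fk] := eqVneq f`_k 0; first exact: vge0.
  have [hk|hk] := ltnP k n.+1; first by right; apply: (hi (Ordinal hk)).
  by move: fk; rewrite nth_default ?sn // eqxx.
have bP i : P i -> (i <= size f)%N.
  move=> /andP[fi _]; rewrite leqNgt; apply: contra fi => h.
  by rewrite nth_default // ltnW.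
case: (ex_maxnP exP bP) => j /andP[fj /asboolP hj] jmax.
pose g := (f`_j)^-1 *: f.
have gf : g != 0 by rewrite scaler_eq0 invr_eq0 (negbTE fj).
have rg : root (map_poly iota g) z by rewrite map_polyZ rootZ // fmorph_eq0 invr_eq0.
have g0 : cge 0 g.
  move=> i; rewrite coefZ; have [->|fi] := eqVneq f`_i 0; first by rewrite mulr0; apply: vge0.
  have [e|h] := hj i; first by rewrite e eqxx in fi.
  by right; rewrite (Defs.valM hv) ?invr_eq0 // val_inv //; move: h; lia.
have gj : g`_j = 1 by rewrite coefZ mulVf.
have gm i : (j < i)%N -> vge 1 g`_i.
  move=> ji; rewrite coefZ; have [->|fi] := eqVneq f`_i 0; first by rewrite mulr0; apply: vge0.
  have [e|h] := hj i; first by rewrite e eqxx in fi.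
  right; rewrite (Defs.valM hv) ?invr_eq0 // val_inv //.
  suff ne : v f`_j != v f`_i.
    have lt : v f`_j < v f`_i by rewrite lt_neqAle ne h.
    by rewrite -[1]add0r lezD1 addrC subr_gt0.
  apply/eqP => e; have : P i by rewrite /P fi -e; apply/asboolP.
  by move/jmax; rewrite leqNgt ji.
case: (posnP j) => [j0|j0].
  by right; exists g; split=> // [|i]; [rewrite -j0 | rewrite -{1}j0; apply: gm].
left; have [G [mG sG /dvdpP[H eH]]] := hensel g0 gj gm.
exists g; split=> //; have G0 := monic_neq0 mG.
have H0 : H != 0 by apply: contra gf => /eqP e; rewrite eH e mul0r.
have sH : size g = (size H + j)%N.
  by rewrite eH size_polyM_field // sG addnS.
have sgf : size g = size f by rewrite size_scale // invr_eq0.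
have pH : (0 < size H)%N by rewrite lt0n size_poly_eq0.
have : root (map_poly iota H * map_poly iota G) z by rewrite -rmorphM -eH.
rewrite rootM => /orP[rH|rG].
  by have := fmin H H0 rH; rewrite -sgf sH -{2}[size H]addn0 leq_add2l leqNgt j0.
have := fmin G G0 rG; rewrite -sgf sH sG => le.
have sH1 : size H = 1%N by lia.
by rewrite monicE lead_coefE sH sH1 add1n /= gj.
Qed.

Lemma integralP z : integral v iota z <-> integralOver (iota \o (val : vring base_valring -> K)) z.
Proof.
split=> [[q [mq hq rq]]|[q mq rq]].
  exists (lift_coefs base_valring q); last by rewrite map_poly_comp lift_coefsK.
  rewrite monicE; apply/eqP/val_inj.
  have v0 : val (0 : vring base_valring) = 0 by exact: rmorph0.
  rewrite -(lead_coef_map_inj val_inj v0) lift_coefsK //.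
  exact: (monicP mq).
exists (map_poly val q); split.
- exact: monic_map.
- by move=> i; rewrite coef_map; apply: (@vvalP _ base_valring).
- by rewrite -map_poly_comp.
Qed.

Fact integral_ring : is_subring (integral v iota).
Proof.
split=> [|x y /integralP hx /integralP hy|x y /integralP hx /integralP hy]; apply/integralP.
- exact: integral1.
- exact: integral_sub.
- exact: integral_mul.
Qed.

Fact integral_total z : integral v iota z \/ integral v iota z^-1.
Proof.
have [[q [mq hq rq]]|[q [q0 hq rq]]] := valuation_dichotomy z.
  by left; exists q.
right; have z0 : z != 0.
  by apply: contraTneq rq => ->; rewrite rootE horner_coef0 coef_map fmorph_eq0 q0 oner_eq0.
have [n sn] : exists n, size q = n.+1.
  exists (size q).-1; rewrite prednK // lt0n size_poly_eq0; apply: contraTneq (oner_neq0 K) => e.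
  by rewrite -q0 e coef0 negbK.
exists (\poly_(i < n.+1) q`_(n - i)); split.
- rewrite monicE lead_coef_poly ?subnn ?q0 //; exact: oner_neq0.
- move=> i; rewrite coef_poly; case: ifP => _; last exact: vge0.
  case: (posnP (n - i)) => [->|h]; first by rewrite q0; apply: vge1.
  by apply: vgeW (hq _ h).
rewrite rootE horner_coef.
have sz : size (map_poly iota (\poly_(i < n.+1) q`_(n - i))) = n.+1.
  by rewrite size_map_poly size_poly_eq ?subnn ?q0 ?oner_neq0.
rewrite sz; move: rq; rewrite rootE horner_coef size_map_poly sn => /eqP e.
apply/eqP; apply: (mulfI (expf_neq0 n z0)); rewrite mulr0; apply: etrans e; rewrite mulr_sumr.
rewrite (reindex_inj rev_ord_inj) /=; apply: eq_bigr => i _.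
rewrite !coef_map coef_poly subSS ltnS leq_subr subKn -1?ltnS // mulrCA; congr (_ * _).
by rewrite exprVn -{1}(subnK (_ : i <= n)%N) -1?ltnS // exprD mulrAC divff ?mul1r // expf_neq0.
Qed.

Definition int_valring : valring Kbar := Valring integral_ring integral_total.
Local Notation V := int_valring.

Lemma int_base x : V (iota x) <-> vge 0 x.
Proof.
split=> [[q [mq hq rq]]|h].
  by apply: (@vO_closed _ base_valring q x mq hq); rewrite -(fmorph_root iota).
exists ('X - x%:P); split.
- exact: monicXsubC.
- by apply: (coefs_inB base_ring); [apply: (coefs_inX base_ring) | apply: (coefs_inC base_ring)].
- by rewrite rmorphB /= map_polyX map_polyC root_XsubC.
Qed.

Lemma vm_base x : vm V (iota x) <-> vge 1 x.
Proof.
rewrite /vm int_base -fmorphV; split.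
  move=> [h [/eqP|h']]; first by rewrite fmorph_eq0 => /eqP ->; apply: vge0.
  have [->|x0] := eqVneq x 0; first exact: vge0.
  have [e|hx] := h; first by rewrite e eqxx in x0.
  right; suff : v x != 0 by move: hx; lia.
  by apply/eqP => e; apply: h'; apply/int_base; right; rewrite val_inv // e.
move=> h; split; first by apply: vgeW h.
have [->|x0] := eqVneq x 0; first by left; rewrite rmorph0.
right=> /int_base[/eqP|]; first by rewrite invr_eq0 (negbTE x0).
have [e|hx] := h; first by rewrite e eqxx in x0.
by rewrite val_inv //; lia.
Qed.

Lemma galois_int sg z : galois_aut iota sg -> V z -> V (sg z).
Proof.
move=> [_ fix_sg] [q [mq hq rq]]; exists q; split=> //.
have -> : map_poly iota q = map_poly sg (map_poly iota q).
  by rewrite -map_poly_comp; apply: eq_map_poly => x; rewrite /= fix_sg.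
by rewrite fmorph_root.
Qed.

End NormalizedValuation.

(** * Automorphisms of the algebraic closure *)

Section ExtendAutomorphisms.

Import classical_sets.

Variables (K : fieldType) (Kbar : closedFieldType) (iota : {rmorphism K -> Kbar}).
Hypothesis (Kbar_closure : is_algebraic_closure iota).
Implicit Types (x y z : Kbar) (p q : {poly Kbar}) (f : {poly K}).

(** Partial embeddings over K as relations: chains have unions, and swapping the arguments inverts.
    The condition at 0 makes the relation functional, and closure under inverses follows because an
    inverse is a polynomial value over K ([inverse_poly]). *)
Record embedding_graph (G : Kbar -> Kbar -> Prop) : Prop := EmbeddingGraph {
  eg_base : forall c : K, G (iota c) (iota c);
  eg_sub : forall a b c d, G a b -> G c d -> G (a - c) (b - d);
  eg_mul : forall a b c d, G a b -> G c d -> G (a * c) (b * d);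
  eg_zero : forall b, G 0 b -> b = 0 }.

Section Graph.

Variables (G : Kbar -> Kbar -> Prop).
Hypothesis (gG : embedding_graph G).

Lemma eg0 : G 0 0.
Proof. by have := eg_base gG 0; rewrite rmorph0. Qed.
Lemma eg1 : G 1 1.
Proof. by have := eg_base gG 1; rewrite rmorph1. Qed.
Lemma eg_add a b c d : G a b -> G c d -> G (a + c) (b + d).
Proof.
move=> h h'; rewrite -[c]opprK -[d]opprK; apply: (eg_sub gG) => //.
rewrite -[- c]sub0r -[- d]sub0r; apply: (eg_sub gG) => //; exact: eg0.
Qed.
Lemma eg_sum I (r : seq I) (u w : I -> Kbar) : (forall i, G (u i) (w i)) ->
  G (\sum_(i <- r) u i) (\sum_(i <- r) w i).
Proof.
move=> h; elim: r => [|i r IH]; first by rewrite !big_nil; apply: eg0.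
by rewrite !big_cons; apply: eg_add.
Qed.
Lemma eg_exp a b n : G a b -> G (a ^+ n) (b ^+ n).
Proof.
by move=> h; elim: n => [|n IH]; rewrite ?exprS; [apply: eg1 | apply: (eg_mul gG)].
Qed.
Lemma eg_fun a b b' : G a b -> G a b' -> b = b'.
Proof.
move=> h h'; apply/eqP; rewrite -subr_eq0; apply/eqP/(eg_zero gG).
by rewrite -[0](subrr a); apply: (eg_sub gG).
Qed.

Lemma eg_poly f a b : G a b -> G (map_poly iota f).[a] (map_poly iota f).[b].
Proof.
move=> h; rewrite !horner_coef; apply: eg_sum => i; apply: (eg_mul gG); last exact: eg_exp.
by rewrite coef_map; apply: (eg_base gG).
Qed.

Lemma inverse_poly x : x != 0 -> exists f c, [/\ c != 0 :> K, iota c = x * (map_poly iota f).[x] &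
  root (map_poly iota (c%:P - 'X * f)) x].
Proof.
move=> x0; have [m [m0 rm mmin]] := min_poly Kbar_closure x.
have [f ef] := poly_root_decomp m 0; rewrite subr0 in ef.
have e : (map_poly iota m).[x] = iota m.[0] + x * (map_poly iota f).[x].
  by rewrite {1}ef rmorphD rmorphM /= map_polyC map_polyX !hornerE mulrC.
have c0 : m.[0] != 0.
  apply/eqP => c0; have f0 : f != 0.
    by apply: contra m0 => /eqP f0; rewrite ef c0 f0 mul0r addr0.
  have rf : root (map_poly iota f) x.
    by move: rm; rewrite rootE e c0 rmorph0 add0r mulf_eq0 (negbTE x0).
  have := mmin f f0 rf; rewrite ef c0 add0r size_mulX //.
  by rewrite ltnn.
have e2 : iota m.[0] = x * (map_poly iota (- f)).[x].
  by move: rm; rewrite rootE e rmorphN hornerN mulrN addr_eq0 => /eqP.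
exists (- f), m.[0]; split=> //.
have e3 : (map_poly iota (m.[0]%:P - 'X * - f)).[x] = iota m.[0] - x * (map_poly iota (- f)).[x].
  by rewrite rmorphB rmorphM /= map_polyC map_polyX !hornerE.
by apply/rootP; apply: etrans e3 _; apply/eqP; rewrite subr_eq0; apply/eqP.
Qed.

Lemma eg_inv a b : G a b -> a != 0 -> b != 0 /\ G a^-1 b^-1.
Proof.
move=> h a0; have [f [c [c0 ec rc]]] := inverse_poly a0.
have hz := eg_poly (c%:P - 'X * f) h; rewrite (rootP rc) in hz.
have eb : iota c = b * (map_poly iota f).[b].
  have := eg_zero gG hz; rewrite rmorphB rmorphM /= map_polyC map_polyX !hornerE.
  by move/eqP; rewrite subr_eq0 => /eqP.
have ic0 : iota c != 0 by rewrite fmorph_eq0.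
have b0 : b != 0 by apply: contra ic0 => /eqP b0; rewrite eb b0 mul0r.
split=> //.
have -> : a^-1 = iota c^-1 * (map_poly iota f).[a].
  by apply: (mulfI a0); rewrite divff // mulrCA -ec fmorphV mulVf.
have -> : b^-1 = iota c^-1 * (map_poly iota f).[b].
  by apply: (mulfI b0); rewrite divff // mulrCA -eb fmorphV mulVf.
by apply: (eg_mul gG); [apply: (eg_base gG) | apply: eg_poly].
Qed.

Lemma eg_swap : embedding_graph (fun a b => G b a).
Proof.
split=> [c|a b c d|a b c d|b].
- exact: (eg_base gG).
- exact: (eg_sub gG).
- exact: (eg_mul gG).
move=> h; apply/eqP/negPn/negP => b0; have [/eqP] := eg_inv h b0.
by [].
Qed.

Definition eg_polys p q : Prop := forall i, G p`_i q`_i.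

Lemma eg_polysC a b : G a b -> eg_polys a%:P b%:P.
Proof. by move=> h i; rewrite !coefC; case: eqP => _ //; apply: eg0. Qed.
Lemma eg_polysXn n : eg_polys 'X^n 'X^n.
Proof. by move=> i; rewrite !coefXn; case: eqP => _; [apply: eg1 | apply: eg0]. Qed.
Lemma eg_polysB p q p' q' : eg_polys p q -> eg_polys p' q' -> eg_polys (p - p') (q - q').
Proof. by move=> h h' i; rewrite !coefB; apply: (eg_sub gG). Qed.
Lemma eg_polysM p q p' q' : eg_polys p q -> eg_polys p' q' -> eg_polys (p * p') (q * q').
Proof. by move=> h h' i; rewrite !coefM; apply: eg_sum => j; apply: (eg_mul gG). Qed.
Lemma eg_polys0 q : eg_polys 0 q -> q = 0.
Proof.
by move=> h; apply/polyP => i; have := h i; rewrite !coef0; apply: (eg_zero gG).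
Qed.
Variables (m m' : {poly Kbar}) (x y : Kbar).
Hypotheses (hm : eg_polys m m') (m0 : m != 0) (ry : root m' y)
  (mmin : forall p q, eg_polys p q -> p != 0 -> root p x -> (size m <= size p)%N)
  (rx : root m x).

(** Division by m, of least degree among the annihilators of x over the domain, is carried out
    simultaneously on both sides of the graph; no quotient ring has to be formed. *)
Lemma eg_root p q : eg_polys p q -> root p x -> root q y.
Proof.
move: {2}(size p) (leqnn (size p)) => n; elim: n p q => [|n IH] p q.
  rewrite leqn0 size_poly_eq0 => /eqP -> /eg_polys0 -> _; exact: root0.
move=> sp hpq rp; have [p0|p0] := eqVneq p 0.
  by rewrite p0 in hpq; rewrite (eg_polys0 hpq) root0.
have le := mmin hpq p0 rp.
have sm : (0 < size m)%N by rewrite lt0n size_poly_eq0.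
have lm : m`_(size m).-1 != 0 by rewrite -lead_coefE lead_coef_eq0.
have [d0 hinv] := eg_inv (hm (size m).-1) lm.
pose c := (p`_(size p).-1 / m`_(size m).-1)%:P * 'X^(size p - size m).
pose d := (q`_(size p).-1 / m'`_(size m).-1)%:P * 'X^(size p - size m).
have hcd : eg_polys c d.
  by apply: eg_polysM (eg_polysXn _); apply: eg_polysC; apply: (eg_mul gG).
have hpq1 : eg_polys (p - c * m) (q - d * m') by apply: eg_polysB => //; apply: eg_polysM.
have rp1 : root (p - c * m) x by rewrite rootE hornerD hornerN hornerM (rootP rp) (rootP rx) mulr0 subr0.
have sp1 : (size (p - c * m)%R <= n)%N.
  have lp0 : p`_(size p).-1 != 0 by rewrite -lead_coefE lead_coef_eq0.
  have scm : size (c * m) = size p.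
    rewrite /c -mulrA size_Cmul ?mulf_neq0 ?invr_eq0 // mulrC size_mulXn // subnK //.
  have lc : lead_coef (c * m) = lead_coef p.
    by rewrite lead_coefM /c lead_coefM lead_coefXn mulr1 lead_coefC (lead_coefE m) divfK.
  rewrite -ltnS; apply: leq_trans sp.
  have sz : (size (p - c * m)%R <= size p)%N.
    by apply: leq_trans (size_polyD _ _) _; rewrite size_polyN scm maxnn.
  rewrite ltn_neqAle sz andbT; apply: contra p0 => /eqP e.
  have : lead_coef (p - c * m) = 0.
    by rewrite lead_coefE e coefB -{2}scm -!lead_coefE lc subrr.
  by move/eqP; rewrite lead_coef_eq0 -size_poly_eq0 e size_poly_eq0.
have := IH _ _ sp1 hpq1 rp1.
by rewrite !rootE hornerD hornerN hornerM (rootP ry) mulr0 subr0.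
Qed.

Definition eg_adjoin a b : Prop := exists p q, [/\ eg_polys p q, a = p.[x] & b = q.[y]].

Lemma eg_adjoin_graph : embedding_graph eg_adjoin.
Proof.
split=> [c|_ _ _ _ [p [q [h -> ->]]] [p' [q' [h' -> ->]]]|_ _ _ _ [p [q [h -> ->]]] [p' [q' [h' -> ->]]]|b [p [q [h e ->]]]].
- exists (iota c)%:P, (iota c)%:P; rewrite !hornerC; split=> //.
  by apply: eg_polysC; apply: (eg_base gG).
- by exists (p - p'), (q - q'); rewrite !hornerE; split=> //; apply: eg_polysB.
- by exists (p * p'), (q * q'); rewrite !hornerM; split=> //; apply: eg_polysM.
by apply/rootP; apply: (eg_root h); rewrite rootE -e.
Qed.

Lemma eg_adjoin_sub a b : G a b -> eg_adjoin a b.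
Proof. by move=> h; exists a%:P, b%:P; rewrite !hornerC; split=> //; apply: eg_polysC. Qed.

Lemma eg_adjoin_gen : eg_adjoin x y.
Proof. by exists 'X^1, 'X^1; rewrite expr1 !hornerX; split=> //; apply: (eg_polysXn 1). Qed.

End Graph.

Lemma eg_extend G x : embedding_graph G ->
  exists y G', [/\ embedding_graph G', forall a b, G a b -> G' a b & G' x y].
Proof.
move=> gG.
pose P n := `[< exists p q, [/\ eg_polys G p q, p != 0, root p x & size p = n] >].
have exP : exists n, P n.
  have [f f0 rf] := Kbar_closure x; exists (size (map_poly iota f)); apply/asboolP.
  exists (map_poly iota f), (map_poly iota f); split=> //; last by rewrite map_poly_eq0.
  by move=> i; rewrite coef_map; apply: (eg_base gG).
case: (ex_minnP exP) => n /asboolP[m [m' [hm m0 rx sm]]] h.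
have mmin p q : eg_polys G p q -> p != 0 -> root p x -> (size m <= size p)%N.
  by move=> hpq p0 rp; rewrite sm; apply: h; apply/asboolP; exists p, q.
have s1 : (1 < size m)%N by apply: root_size_gt1 rx.
have lm : m`_(size m).-1 != 0 by rewrite -lead_coefE lead_coef_eq0.
have [d0 _] := eg_inv gG (hm (size m).-1) lm.
have /closed_rootP[y ry] : size m' != 1%N.
  apply/eqP => s'; move/eqP: d0; apply; rewrite nth_default // s'.
  by move: s1; case: (size m) => // -[].
exists y, (eg_adjoin G x y); split.
- exact: (eg_adjoin_graph gG hm m0 ry mmin rx).
- exact: eg_adjoin_sub.
- exact: eg_adjoin_gen.
Qed.

Section GraphFunction.

Variables (G : Kbar -> Kbar -> Prop).
Hypotheses (gG : embedding_graph G) (Gl : forall x, exists y, G x y) (Gr : forall y, exists x, G x y).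

Definition eg_map x : Kbar := projT1 (cid (Gl x)).
Lemma eg_mapP x : G x (eg_map x).
Proof. by rewrite /eg_map; case: cid. Qed.
Fact eg_map_zmod : zmod_morphism eg_map.
Proof.
move=> x y; apply: (eg_fun gG (eg_mapP _)); apply: (eg_sub gG); exact: eg_mapP.
Qed.
Fact eg_map_monoid : monoid_morphism eg_map.
Proof.
split=> [|x y]; apply: (eg_fun gG (eg_mapP _)); first exact: (eg1 gG).
by apply: (eg_mul gG); apply: eg_mapP.
Qed.
HB.instance Definition _ := GRing.isZmodMorphism.Build _ _ eg_map eg_map_zmod.
HB.instance Definition _ := GRing.isMonoidMorphism.Build _ _ eg_map eg_map_monoid.

Lemma eg_galois : exists sg : {rmorphism Kbar -> Kbar}, galois_aut iota sg /\
  forall x y, G x y -> sg x = y.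
Proof.
exists eg_map; have ext x y : G x y -> eg_map x = y by apply: (eg_fun gG (eg_mapP _)).
split=> //; split; last by move=> c; apply: ext; apply: (eg_base gG).
pose g y := projT1 (cid (Gr y)); have hg y : G (g y) y by rewrite /g; case: cid.
exists g => x; last exact: ext.
exact: (eg_fun (eg_swap gG) (hg _) (eg_mapP x)).
Qed.

End GraphFunction.

(** Zorn's lemma for sets of pairs whose union with G is an embedding graph; the union with G takes
    care of the empty chain. A maximal graph has full domain by [eg_extend], and full range by the
    same lemma for the swapped graph. *)
Theorem eg_automorphism G : embedding_graph G ->
  exists sg : {rmorphism Kbar -> Kbar}, galois_aut iota sg /\ forall x y, G x y -> sg x = y.
Proof.
move=> gG; pose U (A : set (Kbar * Kbar)) a b := A (a, b) \/ G a b.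
have [|A [gA Amax]] := @Zorn_bigcup (Kbar * Kbar)%type (fun A => embedding_graph (U A)).
  move=> C hC tC; pose D := (\bigcup_(X in C) X)%classic.
  have dir a b c d : U D a b -> U D c d -> exists2 A, embedding_graph (U A) &
     [/\ U A a b, U A c d & forall e e', U A e e' -> U D e e'].
    have sub X : C X -> forall e e', U X e e' -> U D e e'.
      by move=> CX e e' [h|h]; [left; exists X | right].
    have one X : C X -> U X a b -> U X c d -> exists2 A, embedding_graph (U A) &
       [/\ U A a b, U A c d & forall e e', U A e e' -> U D e e'].
      by move=> CX h1 h2; exists X; [apply: hC | split=> //; apply: sub].
    move=> [[X CX hX]|h1] [[Y CY hY]|h2].
    - have [XY|YX] := tC X Y CX CY.
        by apply: (one Y) => //; left => //; apply: XY.
      by apply: (one X) => //; left => //; apply: YX.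
    - by apply: (one X) => //; [left | right].
    - by apply: (one Y) => //; [right | left].
    exists set0; last by split; [right | right | move=> e e' [//|h]; right].
    have e0 a' b' : U set0 a' b' <-> G a' b' by split=> [[//|]|]; [ | right].
    split=> [e|? ? ? ? /e0 ? /e0 ?|? ? ? ? /e0 ? /e0 ?|? /e0]; rewrite ?e0.
    - exact: (eg_base gG).
    - exact: (eg_sub gG).
    - exact: (eg_mul gG).
    - exact: (eg_zero gG).
  split=> [c|a b c d h h'|a b c d h h'|b h].
  - by right; apply: (eg_base gG).
  - by have [A gA [h1 h2 hs]] := dir _ _ _ _ h h'; apply: hs; apply: (eg_sub gA).
  - by have [A gA [h1 h2 hs]] := dir _ _ _ _ h h'; apply: hs; apply: (eg_mul gA).
  - by have [A gA [h1 _ _]] := dir _ _ _ _ h h; apply: (eg_zero gA).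
have maxU G' : embedding_graph G' -> (forall a b, U A a b -> G' a b) ->
    forall a b, G' a b -> U A a b.
  move=> gG' sub a b h; apply: contrapT => nh.
  apply: (Amax [set z | G' z.1 z.2]%classic).
    split; first by move=> [c d] hA; apply: sub; left.
    by move=> hs; apply: nh; left; apply: (hs (a, b)).
  have e a' b' : U [set z | G' z.1 z.2]%classic a' b' <-> G' a' b'.
    by split=> [[//|h']|h']; [apply: sub; right | left].
  split=> [c|? ? ? ? /e ? /e ?|? ? ? ? /e ? /e ?|? /e]; rewrite ?e.
  - exact: (eg_base gG').
  - exact: (eg_sub gG').
  - exact: (eg_mul gG').
  - exact: (eg_zero gG').
have Gl x : exists y, U A x y.
  have [y [G' [gG' sub hxy]]] := eg_extend x gA; exists y; exact: (maxU G').
have Gr y : exists x, U A x y.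
  have [x [G' [gG' sub hxy]]] := eg_extend y (eg_swap gA); exists x.
  by apply: (maxU _ (eg_swap gG')) => // a b hab; apply: sub.
have [sg [hsg h]] := eg_galois gA Gl Gr; exists sg; split=> // x y hxy.
by apply: h; right.
Qed.

Hypothesis (ch0 : forall n, (0 < n)%N -> n%:R != 0 :> K).

(** If z were a double root of its minimal polynomial, it would be a root of the derivative, which
    in characteristic 0 is nonzero of smaller degree. *)
Lemma conjugate_root z : ~ base iota z -> exists f, exists2 y, y != z &
  [/\ root (map_poly iota f) z, root (map_poly iota f) y, f != 0 &
   forall g : {poly K}, g != 0 -> root (map_poly iota g) z -> (size f <= size g)%N].
Proof.
move=> nz; have [f [f0 rf fmin]] := min_poly Kbar_closure z; exists f.
have if0 : map_poly iota f != 0 by rewrite map_poly_eq0.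
have s1 : (1 < size f)%N by have := root_size_gt1 if0 rf; rewrite size_map_poly.
have [q eq] := factor_theorem _ _ rf.
have q0 : q != 0 by apply: contra if0 => /eqP q0; rewrite eq q0 mul0r.
have sq : size f = (size q).+1.
  by rewrite -(size_map_poly iota f) eq size_mul ?polyXsubC_eq0 // size_XsubC addn2.
have s2 : size q != 1%N.
  apply/eqP => sq1; apply: nz; rewrite sq1 in sq.
  have e : f = (f`_1)%:P * 'X + (f`_0)%:P.
    apply/polyP => -[|[|i]]; rewrite coefD coefCM coefX coefC /= ?mulr0 ?mulr1 ?add0r ?addr0 //.
    by rewrite nth_default ?sq.
  have l0 : f`_1 != 0 by have := lead_coef_eq0 f; rewrite lead_coefE sq /= => ->.
  have e1 : iota f`_1 * z = - iota f`_0.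
    apply/eqP; rewrite -addr_eq0; move: rf; rewrite rootE {1}e rmorphD rmorphM /=.
    by rewrite !map_polyC map_polyX !hornerE.
  exists (- f`_0 / f`_1); apply: (mulfI (_ : iota f`_1 != 0)); first by rewrite fmorph_eq0.
  by rewrite e1 -rmorphM -rmorphN; congr (iota _); field.
have /closed_rootP[y ry] := s2; have [yz|yz] := eqVneq y z; last first.
  by exists y => //; split=> //; rewrite eq rootM ry.
rewrite {}yz in ry; have := fmin f^`().
have d0 : f^`() != 0.
  apply/eqP => /(congr1 (fun g : {poly K} => g`_(size f).-2)) /eqP.
  rewrite coef_deriv coef0 -mulr_natr mulf_eq0.
  have -> : ((size f).-2.+1 = (size f).-1)%N by move: s1; case: (size f) => // -[].
  rewrite -lead_coefE lead_coef_eq0 (negbTE f0) /=; apply/negP/ch0.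
  by move: s1; case: (size f) => // -[].
move/(_ d0); rewrite -deriv_map rootE eq derivM derivXsubC hornerD !hornerM (rootP ry).
rewrite hornerXsubC subrr mulr0 mul0r addr0 eqxx => /(_ isT).
by rewrite leqNgt lt_size_deriv.
Qed.

Theorem fixed_field z : ~ base iota z ->
  exists sg : {rmorphism Kbar -> Kbar}, galois_aut iota sg /\ sg z != z.
Proof.
move=> nz; have [f [y yz [rz ry f0 fmin]]] := conjugate_root nz.
pose G a b := a = b /\ base iota a.
have gG : embedding_graph G.
  split=> [c|_ a _ b [-> [c ->]] [-> [d ->]]|_ a _ b [-> [c ->]] [-> [d ->]]|b [<- //]].
  - by split=> //; exists c.
  - by split=> //; exists (c - d); rewrite rmorphB.
  - by split=> //; exists (c * d); rewrite rmorphM.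
have hm : eg_polys G (map_poly iota f) (map_poly iota f).
  by move=> i; rewrite coef_map; split=> //; exists f`_i.
have m0 : map_poly iota f != 0 by rewrite map_poly_eq0.
have mmin p q : eg_polys G p q -> p != 0 -> root p z -> (size (map_poly iota f) <= size p)%N.
  move=> hpq p0 rp; pose c i := projT1 (cid (hpq i).2).
  have hc i : p`_i = iota (c i) by rewrite /c; case: cid.
  have ep : p = map_poly iota (\poly_(i < size p) c i).
    apply/polyP => i; rewrite coef_map coef_poly; case: ltnP => hi; first exact: hc.
    by rewrite raddf0 nth_default.
  move: p0 rp; rewrite ep map_poly_eq0 => g0 rg; rewrite !size_map_poly.
  exact: fmin.
have [sg [hsg h]] := eg_automorphism (eg_adjoin_graph gG hm m0 ry mmin rz).
by exists sg; split=> //; rewrite (h _ _ (eg_adjoin_gen gG z y)).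
Qed.

End ExtendAutomorphisms.

Lemma int_mul_neq1 (e : nat) (y : int) : (1 < e)%N -> e%:Z * y <> 1.
Proof.
move=> e1 /(congr1 absz); rewrite abszM absz_nat => /eqP; rewrite muln_eq1.
by move=> /andP[/eqP e2 _]; rewrite e2 in e1.
Qed.

Lemma bezout_residue (N D u w Q L : int) : u * L + w * D = 1 ->
  N - (w * N - Q * L) * D = L * (N * u + Q * D).
Proof.
move=> h; transitivity (N * (u * L + w * D) - (w * N - Q * L) * D); last by ring.
by rewrite h mulr1.
Qed.

(** * Ramified quadratic extensions of the l-adic numbers *)

Section RamifiedQuadratic.

Variables (l : nat) (l_prime : prime l) (Ql : fieldType) (vl : Ql -> int) (Ql_l : is_Ql l vl).
Variables (K : fieldExtType Ql) (K_quadratic : \dim {:K} = 2%N).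
Variables (v : K -> int) (v_normalized : normalized_valuation v) (K_ramified : ramified vl v).
Local Notation vge := (val_ge v).
Let hl : normalized_valuation vl := Ql_valuation Ql_l.
Let hv := v_normalized.

Lemma Ql_char0 n : (0 < n)%N -> n%:R != 0 :> Ql.
Proof.
move=> n0; have /pcharf0P h := Ql_pchar0 Ql_l.
by rewrite h -lt0n.
Qed.

Lemma Ql_int_neq0 (m : int) : m != 0 -> m%:~R != 0 :> Ql.
Proof.
move=> m0; rewrite [m]intEsign intrM mulf_neq0 //.
  by rewrite rmorph_sign signr_eq0.
by rewrite -pmulrn Ql_char0 // absz_gt0.
Qed.

Lemma K_char0 n : (0 < n)%N -> n%:R != 0 :> K.
Proof.
by move=> n0; rewrite -(rmorph_nat (in_alg K)) fmorph_eq0; apply: Ql_char0.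
Qed.

Definition ram_index : nat := projT1 (cid K_ramified).
Lemma ram_index_gt1 : (1 < ram_index)%N.
Proof. by rewrite /ram_index; case: cid => e []. Qed.
Lemma val_alg (x : Ql) : x != 0 -> v x%:A = ram_index%:Z * vl x.
Proof. by move=> x0; rewrite /ram_index; case: cid => e /= [_ h]; apply: h. Qed.

Lemma alg_neq0 (x : Ql) : x != 0 -> x%:A != 0 :> K.
Proof. by move=> x0; rewrite scaler_eq0 oner_eq0 orbF. Qed.

Lemma uniformizer_ex : exists2 x : K, x != 0 & v x = 1.
Proof. exact: (val_onto hv). Qed.

Lemma val_sum_ne n (s t : K) : s != 0 -> t != 0 -> v s != v t -> vge n (s + t) ->
  vge n s /\ vge n t.
Proof.
have key (a b : K) : a != 0 -> b != 0 -> v a < v b -> vge n (a + b) -> vge n a /\ vge n b.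
  move=> a0 b0 lt h; have ha : vge n a.
    right; rewrite leNgt; apply/negP => lt'.
    have [e|] : vge (v a + 1) a.
      suff: vge (v a + 1) ((a + b) - b) by rewrite addrK.
      apply: (vgeB hv); first by apply: vgeW h; lia.
      by right; move: lt; lia.
    - by rewrite e eqxx in a0.
    - lia.
  split=> //; have -> : b = (a + b) - a by rewrite addrC addKr.
  exact: (vgeB hv).
move=> s0 t0 ne h; have [lt|lt|e] := ltgtP (v s) (v t).
- exact: key.
- by rewrite addrC in h; have [] := key _ _ t0 s0 lt h.
- by rewrite e eqxx in ne.
Qed.

Lemma vge_alg n (a : Ql) : vge (ram_index%:Z * n) (a%:A : K) <-> val_ge vl n a.
Proof.
have e1 := ram_index_gt1; have [->|a0] := eqVneq a 0.
  by rewrite scale0r; split=> _; left.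
rewrite /val_ge val_alg //; split=> -[/eqP|h].
- by rewrite (negbTE (alg_neq0 a0)).
- by right; move: h; rewrite ler_pM2l //; lia.
- by rewrite (negbTE a0).
- by right; rewrite ler_pM2l //; lia.
Qed.

Section Coordinates.

Variables (pi : K) (pi0 : pi != 0) (vpi : v pi = 1).

(** A uniformizer is not in Q_l, whose values in K are multiples of e > 1, so 1 and [pi] are a basis
    of the quadratic extension. *)
Lemma coordinates x : exists a b : Ql, x = a%:A + b *: pi.
Proof.
have fr : free [:: pi; 1].
  rewrite free_cons seq1_free oner_neq0 andbT span_seq1; apply/vlineP => -[k ek].
  have k0 : k != 0 by apply: contra pi0 => /eqP k0; rewrite ek k0 scale0r.
  have := val_alg k0; rewrite -ek vpi.
  by move/esym; apply: int_mul_neq1; apply: ram_index_gt1.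
have bs : basis_of {:K} [:: pi; 1] by rewrite basisEfree fr subvf K_quadratic.
have := coord_basis (X := in_tuple [:: pi; 1]) bs (memvf x).
rewrite !big_ord_recl big_ord0 addr0 /= => ->.
by eexists; eexists; rewrite addrC.
Qed.

(** The two terms have valuations 0 and 1 modulo e, so they cannot cancel. Completeness and the
    residue field of K are deduced from those of Q_l coordinate by coordinate. *)
Lemma vge_coordinates n (a b : Ql) : vge n (a%:A + b *: pi) ->
  vge n (a%:A : K) /\ vge n (b *: pi).
Proof.
have [->|a0] := eqVneq a 0; first by rewrite scale0r add0r; split=> //; left.
have [->|b0] := eqVneq b 0; first by rewrite scale0r addr0; split=> //; left.
have b0' : b *: pi != 0 by rewrite scaler_eq0 negb_or b0.
apply: val_sum_ne => //; first exact: alg_neq0.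
rewrite -[b *: pi]mul1r -scalerAr scalerAl (Defs.valM hv) ?alg_neq0 // !val_alg // vpi.
apply/eqP => e1; apply: (@int_mul_neq1 ram_index (vl a - vl b) ram_index_gt1).
by rewrite mulrBr e1 addrC addKr.
Qed.

Lemma val_scale (b : Ql) : b != 0 -> v (b *: pi) = ram_index%:Z * vl b + 1.
Proof.
move=> b0; rewrite -[b *: pi]mul1r -scalerAr scalerAl (Defs.valM hv) ?alg_neq0 //.
by rewrite val_alg // vpi.
Qed.

Lemma vge_scale n (b : Ql) : vge (ram_index%:Z * n + 1) (b *: pi) <-> val_ge vl n b.
Proof.
have e1 := ram_index_gt1; have [->|b0] := eqVneq b 0.
  by rewrite scale0r; split=> _; left.
have b0' : b *: pi != 0 by rewrite scaler_eq0 negb_or b0.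
rewrite /val_ge val_scale // lerD2r; split=> -[/eqP|h].
- by rewrite (negbTE b0').
- by right; move: h; rewrite ler_pM2l //; lia.
- by rewrite (negbTE b0).
- by right; rewrite ler_pM2l //; lia.
Qed.

End Coordinates.

Lemma K_complete : complete_valuation v.
Proof.
have [pi pi0 vpi] := uniformizer_ex; have e1 := ram_index_gt1; move=> u hu.
pose a n := projT1 (cid (coordinates pi0 vpi (u n))).
pose b n := projT1 (cid (projT2 (cid (coordinates pi0 vpi (u n))))).
have eu n : u n = (a n)%:A + (b n) *: pi by rewrite /a /b; case: cid => y ? /=; case: cid.
have ed i j : u i - u j = (a i - a j)%:A + (b i - b j) *: pi.
  by rewrite !eu !scalerBl opprD addrACA.
have ca : exists y : Ql, forall n : int, exists N : nat, forall i, (N <= i)%N -> val_ge vl n (a i - y).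
  apply: (Ql_complete Ql_l) => n; have [N hN] := hu (ram_index%:Z * n); exists N => i j hi hj.
  have := hN i j hi hj; rewrite ed => /(vge_coordinates pi0 vpi)[h _].
  exact: (proj1 (vge_alg n (a i - a j)) h).
have cb : exists y : Ql, forall n : int, exists N : nat, forall i, (N <= i)%N -> val_ge vl n (b i - y).
  apply: (Ql_complete Ql_l) => n; have [N hN] := hu (ram_index%:Z * n + 1); exists N => i j hi hj.
  have := hN i j hi hj; rewrite ed => /(vge_coordinates pi0 vpi)[_ h].
  by apply/(vge_scale pi0 vpi).
have [a' ha] := ca; have [b' hb] := cb; exists (a'%:A + b' *: pi) => n.
have [N hN] := ha `|n|%N%:Z; have [M hM] := hb `|n|%N%:Z; exists (maxn N M) => i.
rewrite geq_max => /andP[hi hj].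
have -> : u i - (a'%:A + b' *: pi) = (a i - a')%:A + (b i - b') *: pi.
  by rewrite eu !scalerBl opprD addrACA.
have /vge_alg h1 := hN i hi; have /(vge_scale pi0 vpi) h2 := hM i hj.
by apply: (vgeD hv); [apply: vgeW h1 | apply: vgeW h2]; move: e1; nia.
Qed.

Lemma vl_int (m : int) : m != 0 -> vl m%:~R = (logn l `|m|%N)%:Z.
Proof.
move=> m0; have := Ql_padic Ql_l (q := m%:~R); rewrite intr_eq0 m0 => /(_ isT).
by rewrite ratr_int /padic_val numq_int denq_int /= logn1 subr0.
Qed.

Lemma vl_int_ge0 (m : int) : val_ge vl 0 m%:~R.
Proof.
have [->|m0] := eqVneq m 0; first by left.
by right; rewrite vl_int.
Qed.

Lemma vl_l : vl l%:R = 1.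
Proof.
have l0 : (l%:Z : int) != 0 by have := prime_gt0 l_prime; lia.
by have := vl_int l0; rewrite pmulrn => ->; rewrite absz_nat logn_prime // eqxx.
Qed.

Lemma residue_Ql (a : Ql) : val_ge vl 0 a -> exists n : nat, val_ge vl 1 (a - n%:R).
Proof.
move=> ha; have [q hq] := Ql_dense Ql_l a 1.
have rq : val_ge vl 0 (ratr q).
  have -> : ratr q = a - (a - ratr q) by rewrite subKr.
  by apply: (vgeB hl) => //; apply: vgeW hq.
have [q0|q0] := eqVneq q 0.
  by exists 0%N; move: hq; rewrite q0 /ratr (_ : numq 0 = 0) // mul0r.
have d0 : (denq q)%:~R != 0 :> Ql by rewrite Ql_int_neq0 // denq_neq0.
have r0 : ratr q != 0 :> Ql.
  by rewrite /ratr mulf_neq0 ?invr_eq0 // Ql_int_neq0 // numq_eq0.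
have ld : ~~ (l %| `|denq q|)%N.
  apply/negP => ld; case: rq => [/eqP|]; first by rewrite (negbTE r0).
  rewrite (Ql_padic Ql_l q0) /padic_val => h.
  have nd : (0 < `|denq q|)%N by rewrite absz_gt0 denq_neq0.
  have h1 : (0 < logn l `|denq q|)%N by rewrite logn_gt0 mem_primes l_prime nd.
  have h2 : (0 < logn l `|numq q|)%N by move: h h1; lia.
  move: h2; rewrite logn_gt0 mem_primes => /and3P[_ _ ln].
  have := coprime_num_den q; rewrite /coprime => /eqP e.
  by have := dvdn_gcd l `|numq q| `|denq q|; rewrite ln ld e dvdn1 => /eqP e'; have := l_prime; rewrite e'.
have cop : coprimez l%:Z (denq q).
  by rewrite coprimezE absz_nat prime_coprime.
have [[u w] /= e] := coprimezP _ _ cop.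
(* The Bezout coefficient w inverts the denominator modulo l, so n is the residue of the
   fraction. *)
pose n := `|((w * numq q) %% l%:Z)%Z|%N.
have l0 : (l%:Z : int) != 0 by have := prime_gt0 l_prime; lia.
have en : n%:Z = ((w * numq q) %% l%:Z)%Z by rewrite /n gez0_abs // modz_ge0.
exists n.
have -> : a - n%:R = (a - ratr q) + (ratr q - n%:R) by rewrite addrA subrK.
apply: (vgeD hl) => //.
have [z ez] : exists z : int, numq q - n%:Z * denq q = l%:Z * z.
  exists (numq q * u + (w * numq q %/ l%:Z)%Z * denq q).
  have := divz_eq (w * numq q) l%:Z; rewrite -en => ew.
  have -> : n%:Z = w * numq q - (w * numq q %/ l%:Z)%Z * l%:Z by rewrite {1}ew addrC addKr.
  exact: bezout_residue.
have -> : ratr q - n%:R = l%:R * z%:~R / (denq q)%:~R :> Ql.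
  apply: (mulIf d0); rewrite divfK //.
  have -> : l%:R * z%:~R = (l%:Z * z)%:~R :> Ql by rewrite intrM.
  by rewrite -ez intrB intrM /ratr mulrBl divfK // pmulrn.
rewrite -mulrA -[1]addr0; apply: (vgeM hl); first by right; rewrite vl_l.
rewrite -[0]addr0; apply: (vgeM hl); first exact: vl_int_ge0.
right; rewrite (val_inv hl) // vl_int ?denq_neq0 // lognE.
by rewrite l_prime (negbTE ld) andbF oppr0.
Qed.

(** Integrality gives the coordinate along [pi] a positive valuation, so only the one in Q_l
    contributes to the residue. This is where ramification keeps the residue field equal to that of
    Q_l. *)
Lemma residue_K (x : K) : vge 0 x -> exists n : nat, vge 1 (x - n%:R).
Proof.
have [pi pi0 vpi] := uniformizer_ex; have e1 := ram_index_gt1.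
have [a [b ->]] := coordinates pi0 vpi x => /(vge_coordinates pi0 vpi)[ha hb].
have ha' : val_ge vl 0 a by apply: (proj1 (vge_alg 0 a)); rewrite mulr0.
have [n hn] := residue_Ql ha'; exists n.
have -> : a%:A + b *: pi - n%:R = (a - n%:R)%:A + b *: pi.
  by rewrite scalerBl scaler_nat addrAC.
apply: (vgeD hv); first by apply: vgeW (_ : vge (ram_index%:Z * 1) _); [lia | apply/vge_alg].
have [->|b0] := eqVneq b 0; first by rewrite scale0r; left.
case: hb => [/eqP|]; first by rewrite scaler_eq0 (negbTE b0) (negbTE pi0).
rewrite (val_scale pi0 vpi) // => h; right; rewrite (val_scale pi0 vpi) //.
move: h e1; move: (ram_index) (vl b) => e y h e1.
suff : 0 <= e%:Z * y by lia.
apply: mulr_ge0 => //; rewrite leNgt; apply/negP => y0.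
have : e%:Z * y <= e%:Z * -1 by rewrite ler_pM2l //; lia.
by move: h e1; move: (e%:Z * y); lia.
Qed.

Lemma val_nat n : (0 < n)%N -> v n%:R = ram_index%:Z * (logn l n)%:Z.
Proof.
move=> n0; have -> : n%:R = (n%:R : Ql)%:A :> K by rewrite scaler_nat.
rewrite val_alg ?Ql_char0 //; congr (_ * _).
have n0' : (n%:Z : int) != 0 by lia.
by have := vl_int n0'; rewrite pmulrn absz_nat.
Qed.

End RamifiedQuadratic.

(** * Galois action on the residue field of the algebraic closure *)

Section RootsOfUnityInResidueField.

Variables (k : fieldType) (l : nat).
Hypotheses (l_gt0 : (0 < l)%N) (l_char : l%:R = 0 :> k).

(** By the monic relation every power of z is a combination of finitely many powers with
    coefficients among 0, ..., l - 1; two powers therefore coincide. *)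
Lemma root_of_unity (q : {poly k}) (z : k) : q \is monic ->
  (forall i, exists m : nat, q`_i = m%:R) -> root q z -> z != 0 ->
  exists2 N, (0 < N)%N & z ^+ N = 1.
Proof.
move=> mq hq rq z0.
have [n sn] : exists n, size q = n.+1.
  by exists (size q).-1; rewrite prednK // lt0n size_poly_eq0 monic_neq0.
case: n sn => [|n] sn.
  have := monicP mq; rewrite lead_coefE sn /= => q0.
  have q1 : q = 1 by rewrite (size1_polyC (eq_leq sn)) q0.
  by move: rq; rewrite q1 rootC oner_eq0.
have en : z ^+ n.+1 = - \sum_(i < n.+1) q`_i * z ^+ i.
  move/rootP: rq; rewrite horner_coef sn big_ord_recr /=.
  have -> : q`_n.+1 = 1 by have := monicP mq; rewrite lead_coefE sn.
  by rewrite mul1r addrC => /eqP; rewrite addr_eq0 => /eqP.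
pose val_c (c : {ffun 'I_n.+1 -> 'I_l}) : k := \sum_(i < n.+1) (c i : nat)%:R * z ^+ i.
have lred (m : nat) : exists j : 'I_l, m%:R = (j : nat)%:R :> k.
  have lt : (m %% l < l)%N by rewrite ltn_mod.
  exists (Ordinal lt); rewrite /= {1}(divn_eq m l) natrD natrM l_char mulr0 add0r //.
have combo (d : 'I_n.+1 -> nat) : exists c, \sum_(i < n.+1) (d i)%:R * z ^+ i = val_c c.
  exists [ffun i => projT1 (cid (lred (d i)))]; apply: eq_bigr => i _.
  by rewrite ffunE; case: cid => j /= ->.
have pw m : exists c, z ^+ m = val_c c.
  elim: m => [|m [c ec]].
    have [c ec] := combo (fun i => (i == ord0) : nat); exists c; rewrite -ec.
    rewrite big_ord_recl big1 => [|i _]; last by rewrite mul0r.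
    by rewrite addr0 mul1r.
  pose cq i := projT1 (cid (hq i)); have hcq i : q`_i = (cq i)%:R by rewrite /cq; case: cid.
  pose t := (c ord_max : nat).
  pose dd (i : 'I_n.+1) := ((if i is Ordinal j.+1 h then (c (inord j) : nat) else 0)
     + t * (l.-1 * cq i))%N.
  have [c' ec'] := combo dd.
  exists c'; rewrite -ec' exprS ec /val_c mulr_sumr.
  rewrite (eq_bigr (fun i : 'I_n.+1 => (c i : nat)%:R * z ^+ i.+1)) => [|i _]; last first.
    by rewrite exprS mulrCA.
  rewrite big_ord_recr /= en.
  have el : l.-1%:R = -1 :> k.
    by apply/eqP; rewrite -addr_eq0 -[1]/(1%:R) -natrD addn1 prednK // l_char.
  rewrite [RHS](eq_bigr (fun i : 'I_n.+1 => (if i is Ordinal j.+1 h then (c (inord j) : nat)%:R else 0) * z ^+ i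
     - (t%:R * (q`_i * z ^+ i)))) => [|i _]; last first.
    rewrite /dd natrD !natrM el hcq mulrDl; congr (_ * _ + _); first by case: i => -[|j] h.
    by ring.
  rewrite sumrB -mulr_sumr mulrN; congr (_ - _).
  rewrite [RHS]big_ord_recl /= mul0r add0r; apply: eq_bigr => i _.
  congr (_ * _); congr (_%:R); congr (nat_of_ord (c _)); apply: val_inj => /=.
  by rewrite inordK //; apply: leq_trans (ltn_ord i) _.
pose f (i : 'I_(#|{ffun 'I_n.+1 -> 'I_l}|.+1)) := projT1 (cid (pw i)).
have hf (i : 'I_(#|{ffun 'I_n.+1 -> 'I_l}|.+1)) : z ^+ i = val_c (f i) by rewrite /f; case: cid.
have /injectivePn[i [j ij eij]] : ~~ injectiveb f.
  by apply/negP => /injectiveP /leq_card; rewrite card_ord ltnn.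
have [a [b [ab eab]]] : exists a b : nat, (a < b)%N /\ z ^+ a = z ^+ b.
  have e : z ^+ i = z ^+ j by rewrite !hf eij.
  have : val i != val j by [].
  by rewrite neq_ltn => /orP[lt|lt]; [exists i, j | exists j, i].
exists (b - a)%N; first by rewrite subn_gt0.
apply: (mulIf (expf_neq0 a z0)); rewrite -exprD subnK 1?ltnW // mul1r //.
Qed.

End RootsOfUnityInResidueField.

Section LocalContext.

Variables (l : nat) (l_prime : prime l) (Ql : fieldType) (vl : Ql -> int) (Ql_l : is_Ql l vl).
Variables (K : fieldExtType Ql) (K_quadratic : \dim {:K} = 2%N).
Variables (v : K -> int) (v_normalized : normalized_valuation v) (K_ramified : ramified vl v).
Variables (Kbar : closedFieldType) (iota : {rmorphism K -> Kbar}).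
Hypothesis (Kbar_closure : is_algebraic_closure iota).
Let hv := v_normalized.

Definition Kbar_valring : valring Kbar :=
  int_valring v_normalized (K_complete l_prime Ql_l K_quadratic v_normalized K_ramified) Kbar_closure.
Local Notation V := Kbar_valring.
Local Notation k := (resf V).
Local Notation vge := (val_ge v).
Implicit Types (sg : {rmorphism Kbar -> Kbar}) (x y z : Kbar).

Lemma Kbar_char0 n : (0 < n)%N -> n%:R != 0 :> Kbar.
Proof. by move=> n0; rewrite -(rmorph_nat iota) fmorph_eq0; apply: (K_char0 Ql_l). Qed.

Lemma V_base (a : K) : V (iota a) <-> vge 0 a.
Proof. exact: int_base. Qed.
Lemma V_max_base (a : K) : vm V (iota a) <-> vge 1 a.
Proof. exact: vm_base. Qed.

Lemma res_nat_eq0 n : (0 < n)%N -> (n%:R = 0 :> k) <-> (l %| n)%N.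
Proof.
move=> n0; rewrite -redMn red_eq0; last exact: vO_nat.
rewrite -(rmorph_nat iota) V_max_base /val_ge (val_nat l_prime Ql_l _ K_ramified) //.
have e1 := ram_index_gt1 K_ramified; split.
  move=> [/eqP|h]; first by rewrite (negbTE (K_char0 Ql_l K n0)).
  rewrite -[n in (_ %| n)%N]expn1; have : (0 < logn l n)%N by move: h; case: (logn l n); lia.
  by rewrite logn_gt0 mem_primes => /and3P[].
move=> ln; right; have : (0 < logn l n)%N by rewrite logn_gt0 mem_primes l_prime n0.
move: e1; move: (ram_index K_ramified) (logn l n) => e m; nia.
Qed.

Lemma res_l : l%:R = 0 :> k.
Proof. by apply/res_nat_eq0 => //; apply: prime_gt0. Qed.

Lemma res_nat_neq0 n : ~~ (l %| n)%N -> n%:R != 0 :> k.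
Proof.
move=> ln; have n0 : (0 < n)%N by case: n ln => //; rewrite dvdn0.
by apply/eqP => /(res_nat_eq0 n0) h; rewrite h in ln.
Qed.

Lemma res_base (a : K) : vge 0 a -> exists n : nat, red V (iota a) = n%:R.
Proof.
move=> ha; have [n hn] := residue_K l_prime Ql_l K_quadratic v_normalized K_ramified ha.
exists n; rewrite -redMn; apply/red_eqP; [exact/V_base | exact: vO_nat |].
by rewrite -(rmorph_nat iota) -rmorphB; apply/V_max_base.
Qed.

Lemma galois_inv sg : galois_aut iota sg -> exists2 sg' : {rmorphism Kbar -> Kbar},
  galois_aut iota sg' & cancel sg sg' /\ cancel sg' sg.
Proof.
move=> [bij fix_sg]; pose G a b := sg b = a.
have gG : embedding_graph iota G.
  split=> [c|a b c d|a b c d|b]; rewrite /G.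
  - by rewrite fix_sg.
  - by move=> <- <-; rewrite rmorphB.
  - by move=> <- <-; rewrite rmorphM.
  by move=> h; apply/eqP; rewrite -(fmorph_eq0 sg) h.
have [sg' [h' e]] := eg_automorphism Kbar_closure gG; exists sg' => //.
have c1 : cancel sg sg' by move=> x; apply: e.
by split=> //; have [g cg cg'] := bij; move=> x; rewrite -{1}[x]cg' c1 cg'.
Qed.

Lemma galois_comp sg tau : galois_aut iota sg -> galois_aut iota tau ->
  galois_aut iota (sg \o tau : {rmorphism Kbar -> Kbar}).
Proof. by move=> [b f] [b' f']; split=> [|x]; [apply: bij_comp | rewrite /= f' f]. Qed.

Lemma galois_V sg x : galois_aut iota sg -> V x -> V (sg x).
Proof. exact: galois_int. Qed.

Lemma galois_vm sg x : galois_aut iota sg -> vm V x -> vm V (sg x).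
Proof.
move=> hsg [Vx [->|h]]; first by rewrite rmorph0; apply: vm0.
split; first exact: galois_V.
right=> h'; apply: h; have [sg' hsg' [c _]] := galois_inv hsg.
by rewrite -[x^-1]c fmorphV; apply: galois_V.
Qed.

Lemma galois_red sg x y : galois_aut iota sg -> V x -> V y -> red V x = red V y ->
  red V (sg x) = red V (sg y).
Proof.
move=> hsg Vx Vy /(red_eqP Vx Vy) h; apply/red_eqP; try exact: galois_V.
by rewrite -rmorphB; apply: galois_vm.
Qed.

Lemma res_root_of_unity x : V x -> red V x != 0 ->
  exists2 N, (0 < N)%N & red V x ^+ N = 1.
Proof.
move=> Vx r0; have [q [mq hq rq]] := Vx.
have Vq i : V (iota q`_i) by apply/V_base.
pose qb : {poly k} := \poly_(i < size q) red V (iota q`_i).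
have sq : (0 < size q)%N by rewrite lt0n size_poly_eq0 monic_neq0.
have l1 : red V (iota q`_(size q).-1) = 1.
  by rewrite -lead_coefE (monicP mq) rmorph1 red1.
have [n sn] : exists n, size q = n.+1 by exists (size q).-1; rewrite prednK.
rewrite sn /= in l1.
apply: (@root_of_unity k l (prime_gt0 l_prime) res_l qb) => //.
- by rewrite monicE /qb sn lead_coef_poly // l1 ?oner_neq0.
- move=> i; rewrite coef_poly; case: ifP => _; first exact: res_base.
  by exists 0%N.
rewrite rootE horner_poly; move: rq; rewrite rootE horner_coef size_map_poly => /eqP /(congr1 (red V)).
rewrite red0 red_sum => [e|i]; last first.
  by rewrite coef_map; exact: (vOM (Vq i) (vOX i Vx)).
apply/eqP; rewrite -[RHS]e; apply: eq_bigr => i _.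
by rewrite coef_map (redM (Vq i) (vOX i Vx)) redX.
Qed.

(** A nonzero residue is a root of unity, and on the group it generates automorphisms act by
    exponents, which commute. *)
Lemma res_aut_commute sg tau x : galois_aut iota sg -> galois_aut iota tau -> V x ->
  red V (sg (tau x)) = red V (tau (sg x)).
Proof.
move=> hsg htau Vx; have Vs := galois_V hsg Vx; have Vt := galois_V htau Vx.
have [z0|z0] := eqVneq (red V x) 0.
  have hx : vm V x by apply/red_eq0.
  by rewrite !(proj2 (red_eq0 _)) //; do ?[exact: galois_V | apply: galois_vm].
have [N N0 eN] := res_root_of_unity Vx z0.
have [m mz _] := prim_order_exists N0 eN.
have key rho : galois_aut iota rho -> exists i : nat, red V (rho x) = red V (x ^+ i).
  move=> hr; have : red V (rho x) ^+ m = 1.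
    rewrite -redX; last exact: galois_V.
    rewrite -rmorphXn -(red1 V) -(rmorph1 rho); apply: galois_red => //.
    - exact: vOX.
    - exact: vO1.
    by rewrite redX // (prim_expr_order mz) red1.
  by move/(prim_rootP mz) => [i ei]; exists i; rewrite redX.
have [i ei] := key sg hsg; have [j ej] := key tau htau.
rewrite (galois_red hsg Vt (vOX j Vx) ej) (galois_red htau Vs (vOX i Vx) ei).
by rewrite !rmorphXn !redX // ei ej !redX // -!exprM mulnC.
Qed.

Hypothesis (l_mod3 : (l %% 3)%N = 2%N).

Lemma l_ndvd3 : ~~ (l %| 3)%N.
Proof.
apply/negP => h; have le := dvdn_leq (isT : (0 < 3)%N) h.
have l2 : (1 < l)%N := prime_gt1 l_prime.
by move: h le l2 l_mod3; case: l => [|[|[|[|n]]]].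
Qed.

Lemma res3 : 3 != 0 :> k.
Proof. exact: (res_nat_neq0 l_ndvd3). Qed.

Lemma res_nat_frob (n : nat) : (n%:R : k) ^+ l = n%:R.
Proof.
rewrite -natrX (divn_eq (n ^ l) l) (divn_eq n l) !natrD !natrM res_l !mulr0 !add0r.
by rewrite -(divn_eq n l) fermat_little.
Qed.

(* The cube root of [n] modulo [l] is [n ^ ((2 l - 1) / 3)]. *)
Lemma res_cube_root (n : nat) : exists t : nat, n%:R = (t%:R : k) ^+ 3.
Proof.
exists (n ^ ((l * 2).-1 %/ 3))%N; rewrite -natrX -expnM.
have -> : ((l * 2).-1 %/ 3 * 3 = l + l.-1)%N.
  by have := prime_gt0 l_prime; move: l_mod3; lia.
rewrite natrX exprD res_nat_frob -exprS prednK ?prime_gt0 //.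
by rewrite res_nat_frob.
Qed.

Lemma omega_ex : exists w : Kbar, [/\ w ^+ 2 + w + 1 = 0, w ^+ 3 = 1, w != 1 & w != 0].
Proof.
pose q : {poly Kbar} := 'X^2 + 'X + 1.
have sq : size q = 3.
  rewrite /q -addrA size_polyDl size_polyXn // size_polyDl size_polyX // size_polyC oner_neq0 //.
have /closed_rootP[w rw] : size q != 1%N by rewrite sq.
have e : w ^+ 2 + w + 1 = 0 by move/rootP: rw; rewrite /q !hornerE.
exists w; split=> //.
- have -> : w ^+ 3 = (w - 1) * (w ^+ 2 + w + 1) + 1 by ring.
  by rewrite e mulr0 add0r.
- apply/eqP => w1; have : 3 = 0 :> Kbar by rewrite -e w1 expr1n; ring.
  by move/eqP; apply/negP; apply: Kbar_char0.
apply/eqP => w0; move: e; rewrite w0 expr0n /= !add0r => /eqP.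
by rewrite oner_eq0.
Qed.

Lemma res_cube1 (n : nat) : (n%:R : k) ^+ 3 = 1 -> n%:R = 1 :> k.
Proof.
move=> e; have [a b] : exists a, (l = a * 3 + 2)%N by exists (l %/ 3)%N; rewrite {1}(divn_eq l 3) l_mod3.
have := res_nat_frob n; rewrite {1}b exprD mulnC exprM e expr1n mul1r => e2.
by move: e; rewrite exprS e2 -expr2 e2.
Qed.

(** In K, the residue of w would be an integer modulo l with cube 1, hence 1 because l = 2 mod 3;
    then w^2 + w + 1 = 0 would reduce to 3 = 0. *)
Lemma omega_not_base w : w ^+ 2 + w + 1 = 0 -> w ^+ 3 = 1 -> ~ base iota w.
Proof.
move=> e e3 [c ec]; have Vw : V w.
  apply: (@vO_closed _ V ('X^3 - 1)).
  - by rewrite monicE lead_coefDl ?lead_coefXn // size_polyN size_polyXn size_poly1.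
  - apply: (coefs_inB (vO_ring V)) => i; rewrite ?coefXn ?coef1; exact: vO_nat.
  - by rewrite rootE !hornerE e3 subrr.
have hc : vge 0 c by apply/V_base; rewrite -ec.
have [n en] := res_base hc; rewrite -ec in en.
have r3 : red V w ^+ 3 = 1 by rewrite -redX // e3.
have r1 : red V w = 1 by rewrite en; apply: res_cube1; rewrite -en.
have : red V (w ^+ 2 + w + 1) = 3.
  have V1 := vO1 V; have V2 : V (w ^+ 2) := vOX 2 Vw; have V3 : V (w ^+ 2 + w) := vOD V2 Vw.
  by rewrite (redD V3 V1) (redD V2 Vw) redX // r1 red1 expr1n; ring.
by rewrite e red0 => /esym/eqP; rewrite (negbTE res3).
Qed.

Lemma omega_moved w : w ^+ 2 + w + 1 = 0 -> w ^+ 3 = 1 ->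
  exists2 tau : {rmorphism Kbar -> Kbar}, galois_aut iota tau & tau w = w ^+ 2.
Proof.
move=> e e3; have chK : forall n, (0 < n)%N -> n%:R != 0 :> K := K_char0 Ql_l K.
have [tau [ht tw]] := fixed_field Kbar_closure chK (omega_not_base e e3).
exists tau => //; have : (tau w - w) * (tau w - w ^+ 2) = 0.
  have et : tau w ^+ 2 + tau w + 1 = 0 by rewrite -rmorphXn -rmorphD -(rmorph1 tau) -rmorphD e rmorph0.
  transitivity (tau w ^+ 2 + tau w + 1 - tau w * (w ^+ 2 + w + 1) + (w ^+ 3 - 1)); first by ring.
  by rewrite et e e3; ring.
by move/eqP; rewrite mulf_eq0 subr_eq0 (negbTE tw) subr_eq0 => /eqP.
Qed.

End LocalContext.

(** Converse of [slope_chord]: the chord equations determine the slope, for tangents too. Slopes are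
    thus transported by checking polynomial identities, without a case distinction. *)
Lemma chord_slope (F : fieldType) (W : weierstrass F) (p q : F * F) lam :
  disc W != 0 -> chord W p q lam -> ~~ opposite W p q /\ slope W p q = lam.
Proof.
move=> dW [hp hq e3 e4]; have nop : ~~ opposite W p q.
  rewrite oppositeP; apply/eqP => eq; rewrite eq /= subrr mulr0 addr0 in e3.
  have td : 2 * p.2 + a1 W * p.1 + a3 W = 0.
    have -> : 2 * p.2 + a1 W * p.1 + a3 W = p.2 - (- p.2 - a1 W * p.1 - a3 W) by ring.
    by rewrite e3 subrr.
  apply: (nonsingular dW hp td); rewrite eq /= e3 in e4.
  transitivity (p.1 ^+ 2 + p.1 * p.1 + p.1 ^+ 2 + a2 W * (p.1 + p.1) + a4 W - a1 W * p.2).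
    by ring.
  by rewrite -e4 -[RHS](mulr0 lam) -td; ring.
split=> //; rewrite /slope; case: eqVneq => [ex|nx]; last first.
  have d0 : q.1 - p.1 != 0 by rewrite subr_eq0 eq_sym.
  by rewrite e3 addrC addKr mulfK.
have [eq|eq] := same_x hp hq ex; last by rewrite oppositeP eq eqxx in nop.
have td : 2 * p.2 + a1 W * p.1 + a3 W != 0.
  apply: contra nop => /eqP h; rewrite /opposite -eq eqxx /=; apply/eqP.
  by rewrite -[RHS]h; ring.
apply: (mulIf td); rewrite divfK //; rewrite -eq in e4.
transitivity (p.1 ^+ 2 + p.1 * p.1 + p.1 ^+ 2 + a2 W * (p.1 + p.1) + a4 W - a1 W * p.2).
  by ring.
by rewrite -e4; ring.
Qed.

(** * Transport of torsion points along maps of coordinates *)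

Section CoordinateMap.

Variables (F F' : fieldType) (E : elliptic F) (E' : elliptic F').
Implicit Types (P Q : ept E).
Local Notation W := (model E).
Local Notation W' := (model E').
Variables (f : F * F -> F' * F').

(** Default values: whatever f sends off the target curve becomes O. The subset S of the hypotheses
    below allows maps such as reduction, which behave well on torsion points only. *)
Definition coord_map P : ept E' := insubd (0 : ept E') (omap f (val P)).

Lemma coord_map0 : coord_map 0 = 0.
Proof. by apply: val_inj; rewrite /coord_map insubdK. Qed.

Lemma coord_map_val P : P != 0 -> oncurve W' (Some (f (pc P))) ->
  val (coord_map P) = Some (f (pc P)).
Proof.
move=> P0 h; rewrite /coord_map (val_neq0 P0) /= insubdK //.
exact: (introT (oncurveP _ _)).
Qed.

Lemma coord_map_neq0 P : P != 0 -> oncurve W' (Some (f (pc P))) -> coord_map P != 0.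
Proof. by move=> P0 h; apply/eqP => /(congr1 val); rewrite coord_map_val. Qed.

Lemma coord_map_pc P : P != 0 -> oncurve W' (Some (f (pc P))) -> pc (coord_map P) = f (pc P).
Proof.
move=> P0 h; have := val_neq0 (coord_map_neq0 P0 h); rewrite coord_map_val //.
by case.
Qed.

Variables (S : ept E -> Prop) (lam : F -> F').
Hypotheses (S_N : forall P, S P -> S (- P)) (S_D : forall P Q, S P -> S Q -> S (P + Q)).
Hypothesis (h_on : forall P, S P -> P != 0 -> oncurve W' (Some (f (pc P)))).
Hypothesis (h_neg : forall P, S P -> P != 0 -> f (negc W (pc P)) = negc W' (f (pc P))).
Hypothesis (h_chord : forall P Q, S P -> S Q -> P != 0 -> Q != 0 -> P + Q != 0 ->
  chord W' (f (pc P)) (f (pc Q)) (lam (sl P Q)) /\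
  f (third W (pc P) (pc Q) (sl P Q),
     yc P + sl P Q * (third W (pc P) (pc Q) (sl P Q) - xc P)) =
  (third W' (f (pc P)) (f (pc Q)) (lam (sl P Q)),
     (f (pc P)).2 + lam (sl P Q) * (third W' (f (pc P)) (f (pc Q)) (lam (sl P Q)) - (f (pc P)).1))).
Local Notation th := coord_map.

Lemma coord_mapN P : S P -> th (- P) = - th P.
Proof.
move=> hP; have [->|P0] := eqVneq P 0; first by rewrite oppr0 coord_map0 oppr0.
have NP0 : - P != 0 by rewrite oppr_eq0.
have hN := h_on (S_N hP) NP0.
apply: pc_inj; rewrite ?oppr_eq0 ?coord_map_neq0 //; try exact: h_on.
by rewrite coord_map_pc // !pcN ?coord_map_neq0 ?coord_map_pc ?h_neg //; exact: h_on.
Qed.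

Lemma coord_map_sl P Q : S P -> S Q -> P != 0 -> Q != 0 -> P + Q != 0 ->
  th P + th Q != 0 /\ sl (th P) (th Q) = lam (sl P Q).
Proof.
move=> hP hQ P0 Q0 PQ; have oP := h_on hP P0; have oQ := h_on hQ Q0.
have [hc _] := h_chord hP hQ P0 Q0 PQ.
have [nop es] := chord_slope (disc_neq0 E') hc.
rewrite -opposite_add ?coord_map_neq0 // /sl !coord_map_pc //.
Qed.

Lemma coord_mapD P Q : S P -> S Q -> th (P + Q) = th P + th Q.
Proof.
move=> hP hQ; have [->|P0] := eqVneq P 0; first by rewrite coord_map0 !add0r.
have [->|Q0] := eqVneq Q 0; first by rewrite coord_map0 !addr0.
have [PQ|PQ] := eqVneq (P + Q) 0.
  have -> : Q = - P by apply/eqP; rewrite -addr_eq0 addrC PQ.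
  by rewrite coord_mapN // !subrr coord_map0.
have oP := h_on hP P0; have oQ := h_on hQ Q0; have oPQ := h_on (S_D hP hQ) PQ.
have [tn ts] := coord_map_sl hP hQ P0 Q0 PQ; have [hc h2] := h_chord hP hQ P0 Q0 PQ.
apply: pc_inj; rewrite ?coord_map_neq0 //.
have NPQ : - (P + Q) != 0 by rewrite oppr_eq0.
have h3 := h_neg (S_N (S_D hP hQ)) NPQ.
rewrite pcN // pcD // !negcK h2 in h3.
have ex : xc (th P) = (f (pc P)).1 by rewrite -(coord_map_pc P0 oP).
have ey : yc (th P) = (f (pc P)).2 by rewrite -(coord_map_pc P0 oP).
by rewrite coord_map_pc // [RHS]pcD ?coord_map_neq0 // ts !coord_map_pc // ex ey pcD // h3.
Qed.

Lemma coord_map_eq0 P : S P -> th P = 0 -> P = 0.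
Proof.
move=> hP e; apply/eqP/negPn/negP => P0.
by have := coord_map_neq0 P0 (h_on hP P0); rewrite e eqxx.
Qed.

End CoordinateMap.

(** * Transport of the Weil pairing *)

Section WeilTransport.

Variables (F F' : closedFieldType) (E : elliptic F) (E' : elliptic F') (p : nat).
Hypotheses (p_prime : prime p) (p_gt2 : (2 < p)%N).
Implicit Types (P Q R S T A : ept E).
Local Notation tor := (tor p).
Variables (th : ept E -> ept E') (u : F') (O : F -> Prop) (ka : F -> F').
Hypotheses (u0 : u != 0).
Hypothesis (thD : forall P Q, tor P -> tor Q -> th (P + Q) = th P + th Q).
Hypothesis (th_eq0 : forall P, tor P -> th P = 0 -> P = 0).
Hypothesis (O1 : O 1) (OM : forall x y, O x -> O y -> O (x * y)).
Hypothesis (O_unity : forall z, z ^+ p = 1 -> O z).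
Hypotheses (ka1 : ka 1 = 1) (kaM : forall x y, O x -> O y -> ka (x * y) = ka x * ka y).
Hypothesis (h_tau : forall P Q R, tor P -> tor Q -> tor R -> P != 0 -> Q != 0 -> R != 0 ->
  P + Q != 0 -> P + Q + R != 0 -> O (tau P Q R) /\ ka (tau P Q R) = u * tau (th P) (th Q) (th R)).
Hypothesis (h_xc : forall P Q, tor P -> tor Q -> P != 0 -> Q != 0 ->
  O (xc P - xc Q) /\ ka (xc P - xc Q) = u ^+ 2 * (xc (th P) - xc (th Q))).

Lemma transport0 : th 0 = 0.
Proof. by apply: (addrI (th 0)); rewrite -thD ?addr0 //; apply: tor0. Qed.

Lemma transportMn P n : tor P -> th (P *+ n) = th P *+ n.
Proof.
move=> hP; elim: n => [|n IH]; first by rewrite !mulr0n transport0.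
by rewrite !mulrS thD ?IH //; tors.
Qed.

Lemma transportN P : tor P -> th (- P) = - th P.
Proof.
move=> hP; apply/eqP; rewrite -addr_eq0 -thD ?addNr ?transport0 //; tors.
Qed.

Lemma transport_tor P : tor P -> tor (th P).
Proof. by move=> hP; have := transportMn p hP; rewrite hP transport0 => /esym. Qed.

Lemma transport_neq0 P : tor P -> P != 0 -> th P != 0.
Proof. by move=> hP; apply: contra => /eqP/(th_eq0 hP) ->. Qed.

Lemma transport_inj P Q : tor P -> tor Q -> th P = th Q -> P = Q.
Proof.
move=> hP hQ e; apply/eqP; rewrite -subr_eq0; apply/eqP/th_eq0; first by tors.
rewrite thD ?transportN ?e ?subrr //; tors.
Qed.

Lemma transport_indep S T : tor S -> tor T -> indep p S T -> indep p (th S) (th T).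
Proof.
move=> hS hT I i j; rewrite -!transportMn // -thD; try by tors.
by move/th_eq0 => h; apply: I; apply: h; tors.
Qed.

Lemma ndvd_neq0 S T i : tor S -> tor T -> indep p S T -> ~~ (p %| i)%N ->
  forall j, S *+ i + T *+ j != 0 /\ S *+ i - T *+ j != 0.
Proof. by move=> hS hT I hi j; apply: (indep_add p_prime). Qed.

Lemma xc_transport_neq P Q : tor P -> tor Q -> P != 0 -> Q != 0 -> P + Q != 0 -> P - Q != 0 ->
  xc (th P) != xc (th Q).
Proof.
move=> hP hQ P0 Q0 h1 h2.
have t1 : tor (P + Q) by tors.
have t2 : tor (P - Q) by tors.
have t3 : tor (- Q) by tors.
apply: xc_neq; try exact: transport_neq0.
  by rewrite -transportN // -thD //; apply: transport_neq0.
by rewrite -thD //; apply: transport_neq0.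
Qed.

(** Of the p - 1 factors, p - 2 are values of [tau] and scale by u, and the last is a difference of
    abscissas and scales by u^2: altogether u^p. *)
Lemma Phi_transport T A : tor T -> tor A -> indep p A T ->
  O (Phi p T A) /\ ka (Phi p T A) = u ^+ p * Phi p (th T) (th A).
Proof.
move=> hT hA I.
have p1 : ~~ (p %| 1)%N by rewrite dvdn1; apply/eqP => e; move: p_gt2; rewrite e.
have nA j : A + T *+ j != 0 /\ A - T *+ j != 0.
  by have := ndvd_neq0 hA hT I p1 j; rewrite mulr1n.
have A0 : A != 0 by have := (nA 0%N).1; rewrite mulr0n addr0.
have T0 : T != 0.
  apply/eqP => T0; have := I 0%N 1%N; rewrite T0 mul0rn mulr0n addr0 => /(_ erefl)[_].
  by move: p1 => /negP.
have tA0 : th A != 0 by apply: transport_neq0.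
have nz n : (0 < n < p)%N -> T *+ n != 0 by apply: tor_mul_lt.
have part n : (n.+1 < p)%N -> O (Phi n.+1 T A) /\
    ka (Phi n.+1 T A) = u ^+ n * Phi n.+1 (th T) (th A).
  elim: n => [|n IH] hn; first by rewrite !Phi1 ka1 expr0 mulr1.
  have [O_n ka_n] := IH (ltnW hn).
  have Tn : T *+ n.+1 != 0 by apply: nz; lia.
  have TS : T + T *+ n.+1 != 0 by rewrite -mulrS; apply: nz; lia.
  have tn : tor (T *+ n.+1) by tors.
  have tS : tor (T + T *+ n.+1) by tors.
  have nA1 : A - (T + T *+ n.+1) != 0 by rewrite -mulrS; exact: (nA n.+2).2.
  have nA2 : A + (T + T *+ n.+1) != 0 by rewrite -mulrS; exact: (nA n.+2).1.
  have nA3 : T + T *+ n.+1 + A != 0 by rewrite addrC.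
  have [O_t ka_t] := h_tau hT tn hA T0 Tn A0 TS nA3.
  have nx : xc A != xc (T + T *+ n.+1) by apply: xc_neq.
  have nx' : xc (th A) != xc (th T + th T *+ n.+1).
    by rewrite -transportMn // -thD //; apply: xc_transport_neq.
  have tT0 := transport_neq0 hT T0.
  have tTn : th T *+ n.+1 != 0 by rewrite -transportMn //; apply: transport_neq0.
  have tTS : th T + th T *+ n.+1 != 0 by rewrite -transportMn // -thD //; apply: transport_neq0.
  rewrite !(PhiS (n := n.+1)) // !Cf_tau //; split; first exact: OM.
  by rewrite kaM // ka_n ka_t transportMn // exprS; ring.
have [n en] : exists n, p = n.+2 by exists p.-2; move: p_gt2; lia.
have [O_n ka_n] := part n ltac:(lia).
have eT : T *+ n.+1 = - T by apply: (tor_opp hT); rewrite en.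
have eT' : th T *+ n.+1 = - th T by rewrite -transportMn // eT transportN.
have [O_x ka_x] := h_xc hA hT A0 T0.
have tT0 := transport_neq0 hT T0.
rewrite en !(PhiS (n := n.+1)) // eT eT' !CfN ?oppr_eq0 // !xcN; split; first exact: OM.
by rewrite kaM // ka_n ka_x !exprS; ring.
Qed.

(** Numerator and denominator scale by the same u^p. Since [ka] is multiplicative on O only, where
    quotients may leave O, the relation is used in product form; the value itself is in O as a p-th
    root of unity. *)
Lemma weil_value_transport S T : tor S -> tor T -> indep p S T ->
  weil_value p S T ^+ p = 1 -> ka (weil_value p S T) = weil_value p (th S) (th T).
Proof.
move=> hS hT I zp; have Oz := O_unity zp.
have [i1 i2 i3 S0 T0] := indepN_both p_prime hS hT I.
have tN : tor (- S) by tors.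
have [O_a ka_a] := Phi_transport hT tN i1.
have [O_b ka_b] := Phi_transport tN hT i2.
have I' := transport_indep hS hT I.
have tS := transport_tor hS; have tT := transport_tor hT.
have [j1 j2 j3 S0' T0'] := indepN_both p_prime tS tT I'.
have NS0 : - S != 0 by rewrite oppr_eq0.
have NS0' : - th S != 0 by rewrite oppr_eq0.
have tN' : tor (- th S) by tors.
have b0 : Phi p (- S) T != 0 by apply: Phi_indep_neq0.
have b0' : Phi p (- th S) (th T) != 0 by apply: Phi_indep_neq0.
have e : weil_value p S T * Phi p (- S) T = Phi p T (- S) by rewrite /weil_value divfK.
have := congr1 ka e; rewrite kaM // ka_a ka_b transportN // => e'.
apply: (mulIf b0'); rewrite /weil_value divfK //.
by apply: (mulfI (expf_neq0 p u0)); rewrite -e'; ring.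
Qed.

End WeilTransport.

Section TorsionSurjective.

Variables (F F' : closedFieldType) (E : elliptic F) (E' : elliptic F') (p : nat).
Hypotheses (p_prime : prime p) (pF : p%:R != 0 :> F) (pF' : p%:R != 0 :> F').
Variables (th : ept E -> ept E').
Hypothesis (thD : forall P Q, tor p P -> tor p Q -> th (P + Q) = th P + th Q).
Hypothesis (th_eq0 : forall P, tor p P -> th P = 0 -> P = 0).

Lemma transport_surj Q : tor p Q -> exists2 P, tor p P & th P = Q.
Proof.
move=> hQ; have [e1 [e2 [h1 h2 I]]] := torsion_basis E p_prime pF.
have I' := transport_indep thD th_eq0 h1 h2 I.
have [i [j ->]] := span_all p_prime pF' (transport_tor thD h1) (transport_tor thD h2) I' hQ.
exists (e1 *+ i + e2 *+ j); first by tors.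
by rewrite thD ?(transportMn thD) //; tors.
Qed.

End TorsionSurjective.

(** * Changes of Weierstrass model *)

Section ModelChange.

Variables (F : closedFieldType) (E E' : elliptic F) (u r s t : F).
Hypotheses (u0 : u != 0) (hE : model E' = change_model u r s t (model E)).
Implicit Types (P Q R : ept E).
Local Notation W := (model E).
Local Notation W' := (model E').

Definition change_coord (q : F * F) : F * F :=
  ((q.1 - r) / u ^+ 2, (q.2 - s * (q.1 - r) - t) / u ^+ 3).
Definition change_slope (lam : F) : F := (lam - s) / u.

Lemma change_oncurve q : oncurve W (Some q) -> oncurve W' (Some (change_coord q)).
Proof.
case: q => x y /= h; rewrite hE /=; apply/eqP; rewrite -subr_eq0; apply/eqP.
transitivity ((y ^+ 2 + a1 W * x * y + a3 W * y - (x ^+ 3 + a2 W * x ^+ 2 + a4 W * x + a6 W)) / u ^+ 6).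
  by field.
by rewrite h subrr mul0r.
Qed.

Lemma change_neg q : change_coord (negc W q) = negc W' (change_coord q).
Proof.
by rewrite /change_coord /negc hE /=; congr pair; field.
Qed.

Lemma change_chord p q lam : chord W p q lam ->
  chord W' (change_coord p) (change_coord q) (change_slope lam).
Proof.
move=> [hp hq e3 e4]; split; try exact: change_oncurve.
  by rewrite /change_coord /change_slope /= e3; field.
move: e4; rewrite e3 => e4; rewrite /change_coord /change_slope hE /= e3.
apply/eqP; rewrite -subr_eq0; apply/eqP.
transitivity ((lam * (p.2 + (p.2 + lam * (q.1 - p.1))) + a1 W * (p.2 + lam * q.1) + a3 W * lam
  - (p.1 ^+ 2 + p.1 * q.1 + q.1 ^+ 2 + a2 W * (p.1 + q.1) + a4 W)) / u ^+ 4).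
  by field.
by rewrite e4 subrr mul0r.
Qed.

Lemma change_third p q lam :
  change_coord (third W p q lam, p.2 + lam * (third W p q lam - p.1)) =
  (third W' (change_coord p) (change_coord q) (change_slope lam),
   (change_coord p).2 + change_slope lam *
     (third W' (change_coord p) (change_coord q) (change_slope lam) - (change_coord p).1)).
Proof.
by rewrite /third /change_coord /change_slope hE /=; congr pair; field.
Qed.

Definition change_pt : ept E -> ept E' := coord_map E' change_coord.

Let hon P (_ : True) (P0 : P != 0) : oncurve W' (Some (change_coord (pc P))) :=
  change_oncurve (pc_oncurve P0).
Let hneg P (_ : True) (_ : P != 0) := change_neg (pc P).
Let hchord P Q (_ _ : True) (P0 : P != 0) (Q0 : Q != 0) (PQ : P + Q != 0) :=
  conj (change_chord (sl_chord P0 Q0 PQ)) (change_third (pc P) (pc Q) (sl P Q)).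

Lemma change_ptD P Q : change_pt (P + Q) = change_pt P + change_pt Q.
Proof. by apply: (coord_mapD (S := fun=> True) (lam := change_slope) _ _ hon hneg hchord). Qed.
Lemma change_pt_eq0 P : change_pt P = 0 -> P = 0.
Proof. by apply: (coord_map_eq0 (S := fun=> True)) => // Q; apply: hon. Qed.
Lemma change_pt_pc P : P != 0 -> pc (change_pt P) = change_coord (pc P).
Proof. by move=> P0; apply: coord_map_pc => //; apply: hon. Qed.
Lemma change_pt_sl P Q : P != 0 -> Q != 0 -> P + Q != 0 ->
  sl (change_pt P) (change_pt Q) = change_slope (sl P Q).
Proof.
move=> P0 Q0 PQ.
by have [] := coord_map_sl (S := fun=> True) (lam := change_slope) hon hchord I I P0 Q0 PQ.
Qed.

Variable (p : nat).
Hypotheses (p_prime : prime p) (p_gt2 : (2 < p)%N).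

Lemma weil_value_change S T : tor p S -> tor p T -> indep p S T ->
  weil_value p S T ^+ p = 1 -> weil_value p S T = weil_value p (change_pt S) (change_pt T).
Proof.
move=> hS hT hI zp.
apply: (weil_value_transport p_prime p_gt2 (u := u) (O := fun=> True) (ka := id)) => //.
- by move=> P Q _ _; apply: change_ptD.
- by move=> P _; apply: change_pt_eq0.
- move=> P Q R _ _ _ P0 Q0 R0 PQ PQR; split=> //.
  rewrite /tau -change_ptD !change_pt_sl // /change_slope hE /=; by field.
move=> P Q _ _ P0 Q0; split=> //.
have ex R : R != 0 -> xc (change_pt R) = (xc R - r) / u ^+ 2.
  by move=> R0; have := congr1 fst (change_pt_pc R0).
by rewrite !ex //; field.
Qed.

End ModelChange.

(** * Maps induced by a ring homomorphism defined on a subring *)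

Section RingHomMap.

Variables (F F' : closedFieldType) (E : elliptic F) (E' : elliptic F') (p : nat).
Implicit Types (P Q R : ept E).
Local Notation W := (model E).
Local Notation W' := (model E').
Local Notation tor := (tor p).
Variables (O : F -> Prop) (ka : F -> F').
Hypothesis (hO : is_subring O).
Hypotheses (ka1 : ka 1 = 1) (kaB : forall x y, O x -> O y -> ka (x - y) = ka x - ka y)
  (kaM : forall x y, O x -> O y -> ka (x * y) = ka x * ka y).
Hypotheses (O_a1 : O (a1 W)) (O_a2 : O (a2 W)) (O_a3 : O (a3 W)) (O_a4 : O (a4 W)) (O_a6 : O (a6 W)).
Hypothesis (hE : W' = map_weierstrass ka W).
Hypothesis (O_xc : forall P, tor P -> P != 0 -> O (xc P)).
Hypothesis (O_yc : forall P, tor P -> P != 0 -> O (yc P)).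
Hypothesis (O_sl : forall P Q, tor P -> tor Q -> P != 0 -> Q != 0 -> P + Q != 0 -> O (sl P Q)).

Let O0 : O 0 := subring0 hO.
Let O1 : O 1 := subring1 hO.
Let OD x y : O x -> O y -> O (x + y) := @subringD _ _ hO x y.
Let OB x y : O x -> O y -> O (x - y).
Proof. by case: hO => _ h _; apply: h. Qed.
Let ON x : O x -> O (- x) := @subringN _ _ hO x.
Let OM x y : O x -> O y -> O (x * y) := @subringM _ _ hO x y.
Let OX x n : O x -> O (x ^+ n) := @subringX _ _ hO x n.

Let ka0 : ka 0 = 0.
Proof. by rewrite -(subrr 1) kaB // subrr. Qed.
Let kaN x : O x -> ka (- x) = - ka x.
Proof. by move=> hx; rewrite -sub0r kaB // ka0 sub0r. Qed.
Let kaD x y : O x -> O y -> ka (x + y) = ka x + ka y.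
Proof. by move=> hx hy; rewrite -{1}[y]opprK kaB ?kaN ?opprK //; apply: ON. Qed.
Let kaX x n : O x -> ka (x ^+ n) = ka x ^+ n.
Proof.
move=> hx; elim: n => [|n IH]; first by rewrite !expr0.
by rewrite !exprS kaM ?IH //; apply: OX.
Qed.

Ltac ko := do ![assumption | apply: OD | apply: ON | apply: OM | apply: OX].
Ltac push := rewrite ?(kaD, kaM, kaX, kaN); try (by ko).

Definition hom_coord (q : F * F) : F' * F' := (ka q.1, ka q.2).

Lemma hom_oncurve q : O q.1 -> O q.2 -> oncurve W (Some q) -> oncurve W' (Some (hom_coord q)).
Proof.
case: q => x y /= hx hy h; rewrite hE /=.
by have := congr1 ka h; push.
Qed.

Lemma hom_neg q : O q.1 -> O q.2 -> hom_coord (negc W q) = negc W' (hom_coord q).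
Proof.
move=> hx hy; rewrite /hom_coord /negc hE /=; congr pair.
by push.
Qed.

Lemma hom_chord q q' lam : O q.1 -> O q.2 -> O q'.1 -> O q'.2 -> O lam -> chord W q q' lam ->
  chord W' (hom_coord q) (hom_coord q') (ka lam).
Proof.
move=> hx hy hx' hy' hl [hq hq' e3 e4]; split; try exact: hom_oncurve.
  by have := congr1 ka e3; push.
by have := congr1 ka e4; rewrite hE /=; push.
Qed.

Lemma hom_third q q' lam : O q.1 -> O q.2 -> O q'.1 -> O q'.2 -> O lam ->
  hom_coord (third W q q' lam, q.2 + lam * (third W q q' lam - q.1)) =
  (third W' (hom_coord q) (hom_coord q') (ka lam),
   (hom_coord q).2 + ka lam * (third W' (hom_coord q) (hom_coord q') (ka lam) - (hom_coord q).1)).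
Proof.
move=> hx hy hx' hy' hl.
have ht : O (third W q q' lam) by rewrite /third; ko.
have et : ka (third W q q' lam) = third W' (hom_coord q) (hom_coord q') (ka lam).
  by rewrite /third hE /=; push.
by rewrite {1}/hom_coord -et /=; congr pair; push.
Qed.

Definition hom_pt : ept E -> ept E' := coord_map E' hom_coord.

Let tN P : tor P -> tor (- P) := @torN _ _ P.
Let tD P Q : tor P -> tor Q -> tor (P + Q) := @torD _ _ P Q.
Let hon P (hP : tor P) (P0 : P != 0) : oncurve W' (Some (hom_coord (pc P))) :=
  @hom_oncurve (pc P) (O_xc hP P0) (O_yc hP P0) (pc_oncurve P0).
Let hneg P (hP : tor P) (P0 : P != 0) := @hom_neg (pc P) (O_xc hP P0) (O_yc hP P0).
Let hchord P Q (hP : tor P) (hQ : tor Q) (P0 : P != 0) (Q0 : Q != 0) (PQ : P + Q != 0) :=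
  conj (@hom_chord (pc P) (pc Q) _ (O_xc hP P0) (O_yc hP P0) (O_xc hQ Q0) (O_yc hQ Q0)
          (O_sl hP hQ P0 Q0 PQ) (sl_chord P0 Q0 PQ))
       (@hom_third (pc P) (pc Q) _ (O_xc hP P0) (O_yc hP P0) (O_xc hQ Q0) (O_yc hQ Q0)
          (O_sl hP hQ P0 Q0 PQ)).

Lemma hom_ptD P Q : tor P -> tor Q -> hom_pt (P + Q) = hom_pt P + hom_pt Q.
Proof. exact: (coord_mapD tN tD hon hneg hchord). Qed.
Lemma hom_pt_eq0 P : tor P -> hom_pt P = 0 -> P = 0.
Proof. exact: (coord_map_eq0 hon). Qed.
Lemma hom_pt_pc P : tor P -> P != 0 -> pc (hom_pt P) = hom_coord (pc P).
Proof. by move=> hP P0; apply: coord_map_pc => //; apply: hon. Qed.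
Lemma hom_pt_sl P Q : tor P -> tor Q -> P != 0 -> Q != 0 -> P + Q != 0 ->
  sl (hom_pt P) (hom_pt Q) = ka (sl P Q).
Proof. by move=> hP hQ P0 Q0 PQ; have [] := coord_map_sl hon hchord hP hQ P0 Q0 PQ. Qed.

Hypotheses (p_prime : prime p) (p_gt2 : (2 < p)%N).
Hypothesis (O_unity : forall z, z ^+ p = 1 -> O z).

Lemma weil_value_hom S T : tor S -> tor T -> indep p S T ->
  weil_value p S T ^+ p = 1 -> ka (weil_value p S T) = weil_value p (hom_pt S) (hom_pt T).
Proof.
move=> hS hT hI zp.
apply: (weil_value_transport p_prime p_gt2 (u := 1) (O := O) (ka := ka)) => //.
- exact: oner_neq0.
- exact: hom_ptD.
- exact: hom_pt_eq0.
- move=> P Q R hP hQ hR P0 Q0 R0 PQ PQR.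
  have hPQ := tD hP hQ; have h1 := O_sl hP hQ P0 Q0 PQ; have h2 := O_sl hPQ hR PQ R0 PQR.
  rewrite mul1r /tau -hom_ptD // !hom_pt_sl // hE /=; split; first by ko.
  by push.
move=> P Q hP hQ P0 Q0; have hx := O_xc hP P0; have hy := O_xc hQ Q0; split; first exact: OB.
have ex R : tor R -> R != 0 -> xc (hom_pt R) = ka (xc R).
  by move=> hR R0; have := congr1 fst (hom_pt_pc hR R0).
by rewrite kaB // !ex // expr1n mul1r.
Qed.

End RingHomMap.

(** * Integrality of torsion coordinates and slopes *)

Section IntegralTorsion.

Variables (F : closedFieldType) (V : valring F) (E : elliptic F) (p : nat).
Hypotheses (p_prime : prime p) (pV : V p%:R^-1) (pF : p%:R != 0 :> F).
Local Notation W := (model E).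
Hypotheses (V_a1 : V (a1 W)) (V_a2 : V (a2 W)) (V_a3 : V (a3 W)) (V_a4 : V (a4 W)) (V_a6 : V (a6 W)).
Implicit Types (P Q : ept E).
Let hV := vO_ring V.

Lemma quadratic_integral x c d : V c -> V d -> x ^+ 2 + c * x = d -> V x.
Proof.
move=> hc hd e; apply: (@vO_closed _ V ('X^2 + (c *: 'X - d%:P))).
- have lt : (size (c *: 'X - d%:P)%R < 3)%N.
    rewrite ltnS; apply: leq_trans (size_polyD _ _) _; rewrite size_polyN geq_max.
    by rewrite (leq_trans (size_scale_leq _ _)) ?size_polyX // (leq_trans (size_polyC_leq1 _)).
  by rewrite monicE lead_coefDl ?size_polyXn // lead_coefXn.
- apply: coefs_inD => //; first by move=> i; rewrite coefXn; apply: vO_nat.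
  apply: coefs_inB => //; last exact: coefs_inC.
  by move=> i; rewrite coefZ coefX; apply: vOM => //; apply: vO_nat.
by rewrite rootE !(hornerD, hornerN, hornerZ, hornerXn, hornerX, hornerC) addrA e subrr.
Qed.

(** The denominator [b] of multiplication by p has coefficients in V and leading coefficient p^2, a
    unit of V; divided by it, it is a monic equation for x(P). *)
Lemma torsion_xc_integral P : tor p P -> P != 0 -> V (xc P).
Proof.
move=> hP P0; have [a [b [hab sh]]] := division_polynomials p hV V_a1 V_a2 V_a3 V_a4 V_a6.
have pp : (0 < p ^ 2)%N by rewrite expn_gt0 prime_gt0.
have ppF : (p ^ 2)%:R != 0 :> F by rewrite natrX expf_neq0.
have [_ _ sb lb _ cb] := sh.
have szb : size b = (p ^ 2)%N.
  apply/eqP; rewrite eqn_leq sb leqNgt; apply/negP => lt.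
  have : b`_(p ^ 2).-1 = 0 by apply: nth_default; rewrite -ltnS prednK.
  by rewrite lb => /eqP; apply/negP.
apply: (@vO_closed _ V ((p ^ 2)%:R^-1 *: b)).
- by rewrite monicE lead_coefZ lead_coefE szb lb mulVf.
- move=> i; rewrite coefZ; apply: vOM; last exact: cb.
  by rewrite natrX -exprVn; apply: vOX.
rewrite rootZ ?invr_eq0 //; have := represents_eq0 hab P0.
by rewrite (hP : P *+ p = 0) eqxx => /esym.
Qed.

Lemma torsion_yc_integral P : tor p P -> P != 0 -> V (yc P).
Proof.
move=> hP P0; have hx := torsion_xc_integral hP P0.
apply: (@quadratic_integral _ (a1 W * xc P + a3 W)
  (xc P ^+ 3 + a2 W * xc P ^+ 2 + a4 W * xc P + a6 W)).
- by apply: vOD => //; apply: vOM.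
- by do ![assumption | apply: vOD | apply: vOM | apply: vOX].
by have := pc_oncurve P0; rewrite /= => <-; ring.
Qed.

(** The formula for the abscissa of a sum is a monic quadratic equation for the slope. *)
Lemma torsion_sl_integral P Q : tor p P -> tor p Q -> P != 0 -> Q != 0 -> P + Q != 0 ->
  V (sl P Q).
Proof.
move=> hP hQ P0 Q0 PQ.
have hx := torsion_xc_integral hP P0; have hx' := torsion_xc_integral hQ Q0.
have hx2 := torsion_xc_integral (torD hP hQ) PQ.
apply: (@quadratic_integral _ (a1 W) (xc (P + Q) + a2 W + xc P + xc Q)) => //.
  by do ![assumption | apply: vOD].
by rewrite xcD // /third /=; rewrite /xc; ring.
Qed.

End IntegralTorsion.

Lemma map_change_model (F F' : fieldType) (f : {rmorphism F -> F'}) (u r s t : F) (W : weierstrass F) :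
  map_weierstrass f (change_model u r s t W) =
  change_model (f u) (f r) (f s) (f t) (map_weierstrass f W).
Proof.
rewrite /map_weierstrass /change_model /=.
congr Weierstrass; rewrite !(fmorph_div, rmorphXn) !(rmorphD, rmorphN, rmorphM, rmorphXn, rmorph_nat); rewrite ?rmorph1;
  congr (_ / _); ring.
Qed.

Lemma map_disc (F F' : fieldType) (f : {rmorphism F -> F'}) (W : weierstrass F) :
  disc (map_weierstrass f W) = f (disc W).
Proof.
rewrite /disc /b8 /b2 /b4 /b6 /=.
by rewrite !(rmorphD, rmorphN, rmorphM, rmorphXn, rmorph_nat) ?rmorph1; ring.
Qed.

Lemma change_model_scale (F : fieldType) (u r s t A B : F) (W : weierstrass F) :
  change_model 1 r s t W = Weierstrass A 0 B 0 0 ->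
  change_model u r s t W = Weierstrass (A / u) 0 (B / u ^+ 3) 0 0.
Proof.
rewrite /change_model !expr1n !divr1 => -[-> -> -> -> ->].
by rewrite !mul0r.
Qed.

Lemma disc_three (F : fieldType) (A B : F) :
  disc (Weierstrass A 0 B 0 0) = B ^+ 3 * (A ^+ 3 - 27 * B).
Proof. by rewrite /disc /b2 /b4 /b6 /b8 /=; ring. Qed.

Definition c4 (F : fieldType) (W : weierstrass F) : F := b2 W ^+ 2 - 24 * b4 W.

Lemma c4_change (F : fieldType) (u r s t : F) (W : weierstrass F) : u != 0 ->
  c4 (change_model u r s t W) * u ^+ 4 = c4 W.
Proof. by move=> u0; rewrite /c4 /b2 /b4 /=; field. Qed.

(** The point goes to the origin and its tangent to y = 0. As 2P = -P, the tangent meets the curve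
    three times there, which removes the terms in x^2 and x. *)
Lemma three_torsion_model (F : fieldType) (E : elliptic F) :
  (exists P : point F, has_order E P 3) ->
  exists r s t A B, change_model 1 r s t E = Weierstrass A 0 B 0 0.
Proof.
move=> [P' [hP _ h3 hm]]; pose P : ept E := mkept hP.
have P0 : P != 0.
  apply/eqP => e; apply: (hm 1%N) => //.
  by rewrite -[P']/(val P) mulptE e mulr1n.
have P2 : P + P != 0.
  apply/eqP => e; apply: (hm 2%N) => //.
  by rewrite -[P']/(val P) mulptE mulr2n e.
have P3 : P + P = - P.
  apply/eqP; rewrite -addr_eq0 -mulr2n -mulrSr; apply/eqP/val_inj.
  by rewrite -mulptE.
have td : tangent_den E (pc P) != 0 by rewrite -double_eq0.
pose lam := sl P P.
have el : lam * tangent_den E (pc P) = tangent_num E (pc P).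
  by rewrite /lam /sl /slope eqxx divfK.
have ex : third E (pc P) (pc P) lam = xc P by rewrite -xcD // P3 xcN.
exists (xc P), lam, (yc P), ((a1 E + 2 * lam) / 1), ((a3 E + xc P * a1 E + 2 * yc P) / 1 ^+ 3).
rewrite /change_model; congr Weierstrass.
- rewrite expr1n divr1.
  transitivity (xc P - third E (pc P) (pc P) lam); last by rewrite ex subrr.
  by rewrite /third /=; ring.
- rewrite expr1n divr1.
  transitivity (tangent_num E (pc P) - lam * tangent_den E (pc P)); last by rewrite el subrr.
  by rewrite /tangent_num /tangent_den /=; ring.
- by rewrite expr1n divr1 (curve_eq P0); ring.
Qed.

(** * Curves with a 3-torsion point and defect 3 *)

Section CurveAnalysis.

Variables (l : nat) (l_prime : prime l) (Ql : fieldType) (vl : Ql -> int) (Ql_l : is_Ql l vl).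
Variables (K : fieldExtType Ql) (K_quadratic : \dim {:K} = 2%N).
Variables (v : K -> int) (v_normalized : normalized_valuation v) (K_ramified : ramified vl v).
Variables (Kbar : closedFieldType) (iota : {rmorphism K -> Kbar}).
Hypothesis (Kbar_closure : is_algebraic_closure iota).
Hypothesis (l_mod3 : (l %% 3)%N = 2%N).
Let hv := v_normalized.
Let V : valring Kbar := Kbar_valring l_prime Ql_l K_quadratic v_normalized K_ramified Kbar_closure.
Let OK : valring K := base_valring v_normalized.
Local Notation vge := (val_ge v).
Implicit Types (x y : K).

Lemma vO_cube (F : fieldType) (U : valring F) (y : F) : U (y ^+ 3) -> U y.
Proof.
move=> h; apply: (@vO_closed _ U ('X^3 - (y ^+ 3)%:P)).
- by rewrite monicE lead_coefDl ?lead_coefXn // size_polyN size_polyXn ltnS (leq_trans (size_polyC_leq1 _)).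
- apply: (coefs_inB (vO_ring U)); last exact: (coefs_inC (vO_ring U)).
  by move=> i; rewrite coefXn; apply: vO_nat.
by rewrite rootE !hornerE subrr.
Qed.

Lemma vm_cube (F : fieldType) (U : valring F) (y : F) : vm U (y ^+ 3) -> vm U y.
Proof.
move=> [h h']; have Uy := vO_cube h; split=> //.
case: h' => [/eqP|h']; first by rewrite expf_eq0 => /eqP; left.
by right=> Ui; apply: h'; rewrite -exprVn; apply: vOX.
Qed.

Lemma unit_val x : vge 0 x -> ~ vge 1 x -> x != 0 /\ v x = 0.
Proof.
move=> h h'; have x0 : x != 0 by apply/eqP => x0; apply: h'; left.
split=> //; have [e|h0] := h; first by rewrite e eqxx in x0.
apply/eqP; rewrite eq_le h0 andbT leNgt; apply/negP => lt; apply: h'; right.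
by move: lt; lia.
Qed.

Lemma val_exp x n : x != 0 -> v (x ^+ n) = n%:Z * v x.
Proof.
move=> x0; elim: n => [|n IH]; first by rewrite expr0 (val_one v_normalized) mul0r.
by rewrite exprS (Defs.valM v_normalized) ?expf_neq0 // IH; lia.
Qed.

Lemma val_add_small x y : x != 0 -> v x = 0 -> vge 1 y -> x + y != 0 /\ v (x + y) = 0.
Proof.
move=> x0 vx hy; apply: unit_val.
  by apply: (vgeD hv); [right; rewrite vx | apply: vgeW hy].
move=> h; have : vge 1 x by rewrite -[x](addrK y); apply: (vgeB hv).
by move=> [e|]; [rewrite e eqxx in x0 | rewrite vx].
Qed.

Lemma val_coprime_nat n : (0 < n)%N -> ~~ (l %| n)%N -> v n%:R = 0.
Proof.
move=> n0 ln; rewrite (val_nat l_prime Ql_l _ K_ramified) // lognE.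
by rewrite l_prime n0 (negbTE ln) mulr0.
Qed.

Lemma val_27 : v 27 = 0 /\ (27 : K) != 0.
Proof.
have h : ~~ (l %| 27)%N.
  by rewrite -[27%N]/((3 ^ 3)%N) Euclid_dvdX // negb_and (l_ndvd3 l_prime l_mod3).
by rewrite val_coprime_nat // (K_char0 Ql_l K (n := 27)).
Qed.

Variable (E : elliptic K).
Variables (r s t A B : K).
Hypothesis (hAB : change_model 1 r s t E = Weierstrass A 0 B 0 0).

Lemma disc_AB : disc E = B ^+ 3 * (A ^+ 3 - 27 * B).
Proof.
by rewrite -disc_three -hAB -(disc_change_model E r s t (oner_neq0 K)) expr1n mulr1.
Qed.

Lemma B_neq0 : B != 0.
Proof.
by apply/eqP => B0; have := disc_neq0 E; rewrite disc_AB B0 expr0n mul0r eqxx.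
Qed.

Lemma c4_AB : c4 E = A * (A ^+ 3 - 24 * B).
Proof.
rewrite -(c4_change r s t E (oner_neq0 K)) hAB expr1n mulr1 /c4 /b2 /b4 /=; ring.
Qed.

Hypothesis (E_good : potentially_good_reduction v iota E).

(** This quotient is the j-invariant, computed on a model with unit discriminant. *)
Lemma j_integral : vge 0 (c4 E ^+ 3 / disc E).
Proof.
have [L _ [u [r' [s' [t' [_ u0 [i1 i2 i3 i4 i6] [d0 _ di]]]]]]] := E_good.
apply/(V_base l_prime Ql_l K_quadratic v_normalized K_ramified Kbar_closure).
set W' := change_model u r' s' t' _ in i1 i2 i3 i4 i6 d0 di.
have ed := disc_change_model (map_weierstrass iota E) r' s' t' u0; rewrite -/W' map_disc in ed.
have ec := c4_change r' s' t' (map_weierstrass iota E) u0; rewrite -/W' in ec.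
have ec' : c4 (map_weierstrass iota E) = iota (c4 E).
  by rewrite /c4 /b2 /b4 /= !(rmorphB, rmorphD, rmorphM, rmorphXn, rmorph_nat) ?rmorph1; ring.
have -> : iota (c4 E ^+ 3 / disc E) = c4 W' ^+ 3 * (disc W')^-1.
  rewrite fmorph_div rmorphXn -ec' -ec -ed; field.
  by rewrite u0 d0.
have Vc : V (c4 W').
  have hV := vO_ring V.
  rewrite /c4 /b2 /b4; apply: vOB; [apply: vOX | apply: vOM; [exact: vO_nat |]].
    by apply: vOD; [apply: vOX | apply: vOM; [exact: vO_nat |]].
  by apply: vOD; [apply: vOM; [exact: vO_nat |] | apply: vOM].
by apply: (vOM (V := V)); [apply: (vOX 3 Vc) | exact: di].
Qed.

(** For x = A^3 / B one has j (x - 27) = x (x - 24)^3, a monic quartic equation for x over the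
    integers of K. *)
Lemma ratio_integral : vge 0 (A ^+ 3 / B).
Proof.
have B0 := B_neq0; set x := A ^+ 3 / B; set j := c4 E ^+ 3 / disc E.
have d0 := disc_neq0 E.
have eA : A ^+ 3 = x * B by rewrite /x divfK.
have ej : j * (x - 27) = x * (x - 24) ^+ 3.
  have x27 : x - 27 != 0.
    apply: contra d0 => /eqP h; rewrite disc_AB eA.
    have -> : x * B - 27 * B = (x - 27) * B by ring.
    by rewrite h mul0r mulr0.
  rewrite /j disc_AB c4_AB exprMn eA.
  have -> : x * B - 24 * B = (x - 24) * B by ring.
  have -> : x * B - 27 * B = (x - 27) * B by ring.
  by field; rewrite B0 x27.
apply: (@vO_closed _ OK ('X * ('X - 24%:P) ^+ 3 - j%:P * ('X - 27%:P))).
- have m1 : 'X * ('X - 24%:P) ^+ 3 \is @monic K.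
    by rewrite monicMl ?monicX // monic_exp // monicXsubC.
  rewrite monicE lead_coefDl ?(monicP m1) // size_polyN.
  have s1 : size ('X * ('X - 24%:P) ^+ 3 : {poly K}) = 5%N.
    by rewrite mulrC size_mulX ?size_exp_XsubC // expf_neq0 // polyXsubC_eq0.
  rewrite s1 ltnS; apply: leq_trans (size_polyC_mul _ _) _; by rewrite size_XsubC.
- have hO := vO_ring OK; have hj : OK j := j_integral.
  apply: coefs_inB => //.
    apply: coefs_inM => //; first exact: coefs_inX.
    rewrite !exprS expr0 mulr1; do 2 ?[apply: coefs_inM => //];
    by apply: coefs_inB => //; [apply: coefs_inX | apply: coefs_inC => //; apply: (vO_nat OK)].
  apply: coefs_inM => //; first exact: coefs_inC.
  by apply: coefs_inB => //; [apply: coefs_inX | apply: coefs_inC => //; apply: (vO_nat OK)].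
by rewrite rootE !(hornerD, hornerN, hornerM, hornerC, hornerX, horner_exp) ej subrr.
Qed.

(** Were x = A^3 / B congruent to 27, then x (x - 24)^3 would be a unit because l is not 3, and yet
    equal to j (x - 27). *)
Lemma unit_27 : vge 1 (A ^+ 3 / B - 27) -> False.
Proof.
set x := A ^+ 3 / B => h; have B0 := B_neq0.
have d0 := disc_neq0 E; have [v27 n27] := val_27.
have ej : c4 E ^+ 3 / disc E * (x - 27) = x * (x - 24) ^+ 3.
  have eA : A ^+ 3 = x * B by rewrite /x divfK.
  have x27 : x - 27 != 0.
    apply: contra d0 => /eqP h'; rewrite disc_AB eA.
    have -> : x * B - 27 * B = (x - 27) * B by ring.
    by rewrite h' mul0r mulr0.
  rewrite disc_AB c4_AB exprMn eA.
  have -> : x * B - 24 * B = (x - 24) * B by ring.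
  have -> : x * B - 27 * B = (x - 27) * B by ring.
  by field; rewrite B0 x27.
have h1 : vge 1 (x * (x - 24) ^+ 3).
  by rewrite -ej -[1]add0r; apply: (vgeM hv) => //; apply: j_integral.
have [x0 vx] : x != 0 /\ v x = 0.
  by rewrite -[x](subrK 27) addrC; apply: val_add_small.
have n3 : (3 : K) != 0 by apply: (K_char0 Ql_l K (n := 3)).
have v3 : v 3 = 0 by apply: val_coprime_nat => //; apply: l_ndvd3.
have [y0 vy] : x - 24 != 0 /\ v (x - 24) = 0.
  have -> : x - 24 = 3 + (x - 27) by ring.
  exact: val_add_small.
have vM := Defs.valM v_normalized.
case: h1 => [/eqP|]; first by rewrite mulf_eq0 expf_eq0 (negbTE x0) (negbTE y0).
by rewrite vM ?expf_neq0 // val_exp // vx vy mulr0.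
Qed.

Lemma Kur_base (z : Kbar) : base iota z -> Kur v iota z.
Proof. by move=> hz M [_ sub] _; apply: sub. Qed.

Lemma Kur_subfield : is_subfield (Kur v iota).
Proof.
split=> [M hM h|x y hx hy M hM h|x y hx hy M hM h|x hx M hM h].
- exact: (subfield1 hM.1).
- by apply: (subfieldB hM.1); [apply: hx | apply: hy].
- by apply: (subfieldM hM.1); [apply: hx | apply: hy].
by apply: (subfieldV hM.1); apply: hx.
Qed.

Hypothesis (E_defect : defect v iota E 3).

(** Otherwise minimality, applied to the maximal unramified extension itself, puts L inside it, and
    a field has no basis of three elements over itself. *)
Lemma no_good_reduction_base : ~ good_reduction_over v iota E (Kur v iota).
Proof.
move=> hg; have [L [[hL subL] _ minL [b [Lb hb]]]] := E_defect.
have [f1 fB fM fV] := Kur_subfield.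
have f0 : Kur v iota 0 by rewrite -(subrr 1); apply: fB.
have fin : is_finite_extension (Kur v iota) (Kur v iota).
  split; first by split=> //; exact: Kur_subfield.
  exists 1%N, (fun _ => 1); split=> // x hx; exists [ffun=> x]; split.
    by split=> [i|]; rewrite ?big_ord1 !ffunE ?mulr1.
  move=> c [_]; rewrite big_ord1 mulr1 => e; apply/ffunP => i.
  by rewrite ffunE e [i]ord1.
have LK := minL _ fin hg.
pose i0 : 'I_3 := ord0; pose i1 : 'I_3 := lift ord0 ord0.
pose d (i : 'I_3) (a : Kbar) : {ffun 'I_3 -> Kbar} := [ffun j => if j == i then a else 0].
have Kd i a : Kur v iota a -> forall j, Kur v iota (d i a j).
  by move=> ha j; rewrite ffunE; case: eqP.
have sd i a : \sum_(j < 3) d i a j * b j = a * b i.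
  rewrite (bigD1 i) //= big1 ?addr0 ?ffunE ?eqxx // => j /negbTE ji.
  by rewrite ffunE ji mul0r.
have uniq (x : Kbar) (c c' : {ffun 'I_3 -> Kbar}) : L x -> (forall i, Kur v iota (c i)) -> (forall i, Kur v iota (c' i)) ->
    x = \sum_(j < 3) c j * b j -> x = \sum_(j < 3) c' j * b j -> c = c'.
  by move=> Lx hc hc' e e'; have [c0 [_ h]] := hb x Lx; rewrite -(h c) // -(h c').
have L01 : L (b i0 * b i1) by apply: (subfieldM hL).
(* The product b0 b1 has two expansions, b1 times b0 and b0 times b1. Uniqueness gives b1 = 0, which
   contradicts the uniqueness of the expansion of 0. *)
have /(congr1 (fun c : {ffun 'I_3 -> Kbar} => c i0)) : d i0 (b i1) = d i1 (b i0).
  apply: (uniq (b i0 * b i1)) => //; rewrite ?sd //; try exact: Kd (LK _ (Lb _)).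
  by rewrite mulrC.
rewrite !ffunE eqxx (_ : i0 == i1 = false) // => b10.
have L0 : L 0 by rewrite -(subrr 1); apply: (subfieldB hL); apply: (subfield1 hL).
have /(congr1 (fun c : {ffun 'I_3 -> Kbar} => c i1)) : d i1 1 = d i1 0.
  by apply: (uniq 0) => //; rewrite ?sd ?b10 ?mulr0 //; apply: Kd.
by rewrite !ffunE eqxx => /eqP; rewrite oner_eq0.
Qed.

(** If v(B) = 3m, scaling by some u with v(u) = m gives, already over K, an integral model with unit
    discriminant. *)
Lemma val_B_mod3 (m : int) : v B <> 3 * m.
Proof.
move=> e; apply: no_good_reduction_base.
have [u u0 vu] := val_onto v_normalized m; have B0 := B_neq0.
have vM := Defs.valM v_normalized.
have vu3 : v (u ^+ 3) = 3 * m.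
  by rewrite val_exp // vu.
have u30 : u ^+ 3 != 0 by rewrite expf_neq0.
have vB : v (B / u ^+ 3) = 0.
  by rewrite vM ?invr_eq0 // (val_inv v_normalized) // vu3 e; lia.
have hB : vge 0 (B / u ^+ 3) by right; rewrite vB.
have hA : vge 0 (A / u).
  apply: (@vO_cube _ OK); rewrite expr_div_n.
  have -> : A ^+ 3 / u ^+ 3 = A ^+ 3 / B * (B / u ^+ 3) by field; rewrite B0 u0.
  by apply: (vOM (V := OK)); [exact: ratio_integral | exact: hB].
pose W1 := change_model u r s t E.
have eW1 : W1 = Weierstrass (A / u) 0 (B / u ^+ 3) 0 0 by apply: change_model_scale.
have toV x : vge 0 x -> integral v iota (iota x).
  by move/(V_base l_prime Ql_l K_quadratic v_normalized K_ramified Kbar_closure).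
exists (iota u), (iota r), (iota s), (iota t); split.
- by split; apply: Kur_base; eexists.
- by rewrite fmorph_eq0.
- rewrite -map_change_model -/W1 eW1; split=> /=; apply: toV => //; left => //.
rewrite -map_change_model -/W1 map_disc.
have d0 : disc W1 != 0.
  apply: contra (disc_neq0 E) => /eqP d0.
  by rewrite -(disc_change_model E r s t u0) -/W1 d0 mul0r.
have [x0 vx] : A ^+ 3 / B - 27 != 0 /\ v (A ^+ 3 / B - 27) = 0.
  apply: unit_val unit_27; apply: (vgeB hv); first exact: ratio_integral.
  by right; have [-> _] := val_27.
have ed : disc W1 = (B / u ^+ 3) ^+ 4 * (A ^+ 3 / B - 27).
  by rewrite eW1 disc_three; field; rewrite B0 u0.
have vd : v (disc W1) = 0.
  have Bu0 : B / u ^+ 3 != 0 by rewrite mulf_neq0 ?invr_eq0.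
  by rewrite ed vM ?expf_neq0 // val_exp // vx vB mulr0.
split; first by rewrite fmorph_eq0.
- by apply: toV; right; rewrite vd.
by rewrite -fmorphV; apply: toV; right; rewrite (val_inv v_normalized) // vd.
Qed.

(** If A^3 / B were a unit, v(B) would be 3 v(A). *)
Lemma ratio_max : vge 1 (A ^+ 3 / B).
Proof.
have B0 := B_neq0; apply: contrapT => h.
have [x0 vx] := unit_val ratio_integral h.
have A0 : A != 0.
  by apply: contra x0 => /eqP ->; rewrite expr0n mul0r.
have vM := Defs.valM v_normalized.
apply: (@val_B_mod3 (v A)); move: vx; rewrite vM ?invr_eq0 ?expf_neq0 // (val_inv v_normalized) //.
rewrite val_exp //; lia.
Qed.

Lemma val_disc : v (disc E) = 4 * v B.
Proof.
have B0 := B_neq0; have vM := Defs.valM v_normalized; have [v27 n27] := val_27.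
have n27' : - 27 != 0 :> K by rewrite oppr_eq0.
have v27' : v (- 27) = 0.
  have h : vge 0 (- 27 : K) by apply: (vgeN hv); right; rewrite v27.
  have h' : ~ vge 1 (- 27 : K).
    by move=> h1; have := vgeN hv h1; rewrite opprK => -[/eqP|]; rewrite ?(negbTE n27) // v27.
  by have [] := unit_val h h'.
have [y0 vy] := val_add_small n27' v27' ratio_max.
have -> : disc E = B ^+ 4 * (- 27 + A ^+ 3 / B) by rewrite disc_AB; field.
by rewrite vM ?expf_neq0 // vy val_exp // addr0.
Qed.

End CurveAnalysis.

(** * Reduction of the p-torsion *)

Section ReductionOfTorsion.

Variables (K : fieldType) (Kbar : closedFieldType) (iota : {rmorphism K -> Kbar}) (V : valring Kbar).
Local Notation k := (resf V).
Hypothesis (galois_V : forall sg x, galois_aut iota sg -> V x -> V (sg x)).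
Hypothesis (galois_red : forall sg x y, galois_aut iota sg -> V x -> V y ->
  red V x = red V y -> red V (sg x) = red V (sg y)).
Hypotheses (char0 : forall n, (0 < n)%N -> n%:R != 0 :> Kbar) (res3 : (3 : k) != 0).
Variables (p : nat).
Hypotheses (p_prime : prime p) (p_ge5 : (5 <= p)%N) (res_p : p%:R != 0 :> k).
Let p_gt2 : (2 < p)%N.
Proof. exact: leq_trans p_ge5. Qed.
Let p_neq0 : p%:R != 0 :> Kbar := char0 (prime_gt0 p_prime).
Let V_pinv : V p%:R^-1.
Proof.
have r : red V p%:R != 0 by rewrite redMn.
by have [] := redV (vO_nat V p) r.
Qed.

Lemma V_unity z : z ^+ p = 1 -> V z.
Proof.
move=> e; apply: (@vO_closed _ V ('X^p - 1)).
- by rewrite monicE lead_coefDl ?lead_coefXn // size_polyN size_polyXn size_poly1 ltnS prime_gt0.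
- apply: (coefs_inB (vO_ring V)) => i; rewrite ?coefXn ?coef1; exact: vO_nat.
by rewrite rootE !hornerE e subrr.
Qed.

(** If w = z / z' were not 1 but reduced to 1, the vanishing sum of its first p powers would reduce
    to p, which is nonzero in the residue field. *)
Lemma red_unity_inj z z' : z ^+ p = 1 -> z' ^+ p = 1 -> red V z = red V z' -> z = z'.
Proof.
move=> ez ez' er; have Vz := V_unity ez; have Vz' := V_unity ez'.
have [n en] : exists n, p = n.+1 by exists p.-1; rewrite prednK // prime_gt0.
have z0 : z' != 0.
  by apply: contraTneq (oner_neq0 Kbar) => e; rewrite -ez' e en expr0n eqxx.
pose w := z / z'; have ew : w ^+ p = 1 by rewrite /w expr_div_n ez ez' divr1.
have Vw := V_unity ew; have zw : z = w * z' by rewrite /w divfK.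
have r0 : red V z' != 0.
  apply/eqP => r0; have := congr1 (red V) ez'; rewrite redX // r0 en expr0n /= red1 => /esym/eqP.
  by rewrite oner_eq0.
have rw : red V w = 1.
  by apply: (mulIf r0); rewrite -redM // -zw er mul1r.
have [w1|w1] := eqVneq w 1; first by rewrite zw w1 mul1r.
have s0 : \sum_(i < p) w ^+ i = 0.
  have := subrX1 w p; rewrite ew subrr => /esym/eqP.
  by rewrite mulf_eq0 subr_eq0 (negbTE w1) => /eqP.
have := congr1 (red V) s0; rewrite red_sum => [|i]; last exact: vOX.
rewrite (eq_bigr (fun=> 1)) => [|i _]; last by rewrite redX // rw expr1n.
by rewrite sumr_const card_ord red0 => /eqP; rewrite (negbTE res_p).
Qed.

Fact disc_residue_curve : disc (Weierstrass 0 0 1 0 0 : weierstrass k) != 0.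
Proof.
rewrite disc_three expr1n mul1r mulr1 expr0n /= sub0r oppr_eq0.
have -> : 27 = 3 ^+ 3 :> k by ring.
by rewrite expf_neq0.
Qed.
Definition residue_curve : elliptic k := Elliptic disc_residue_curve.
Local Notation C := residue_curve.

Section OneCurve.

Variables (E : elliptic K).

Fact disc_Kbar : disc (points iota E) != 0.
Proof. by rewrite /points map_disc fmorph_eq0 disc_neq0. Qed.
Definition curve_Kbar : elliptic Kbar := Elliptic disc_Kbar.
Local Notation EK := curve_Kbar.
Implicit Types (P Q S T : ept EK).
Local Notation tor := (tor p).

Section GaloisAction.

Variable (sg : {rmorphism Kbar -> Kbar}).
Hypothesis (hsg : galois_aut iota sg).

Definition gal_pt : ept EK -> ept EK := hom_pt (E := EK) EK sg.

Let fixW : model EK = map_weierstrass sg (model EK).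
Proof. by case: hsg => _ fix_sg; rewrite /= /points /map_weierstrass /= !fix_sg. Qed.
Let hT : is_subring (fun _ : Kbar => True). Proof. by []. Qed.
Let sgB (x y : Kbar) (_ _ : True) : sg (x - y) = sg x - sg y := rmorphB sg x y.
Let sgM (x y : Kbar) (_ _ : True) : sg (x * y) = sg x * sg y := rmorphM sg x y.

Lemma gal_ptD P Q : tor P -> tor Q -> gal_pt (P + Q) = gal_pt P + gal_pt Q.
Proof. exact: (hom_ptD hT sgB sgM I I I I I fixW (fun _ _ _ => I) (fun _ _ _ => I) (fun _ _ _ _ _ _ _ => I)). Qed.
Lemma gal_pt_eq0 P : tor P -> gal_pt P = 0 -> P = 0.
Proof. exact: (hom_pt_eq0 hT sgB sgM I I I I I fixW (fun _ _ _ => I) (fun _ _ _ => I)). Qed.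
Lemma gal_pt_pc P : tor P -> P != 0 -> pc (gal_pt P) = (sg (xc P), sg (yc P)).
Proof. exact: (hom_pt_pc hT sgB sgM I I I I I fixW (fun _ _ _ => I) (fun _ _ _ => I)). Qed.
Lemma gal_pt_tor P : tor P -> tor (gal_pt P).
Proof. exact: (transport_tor gal_ptD). Qed.
Lemma gal_pt_neq0 P : tor P -> P != 0 -> gal_pt P != 0.
Proof. exact: (transport_neq0 gal_pt_eq0). Qed.
Lemma gal_ptMn P n : tor P -> gal_pt (P *+ n) = gal_pt P *+ n.
Proof. exact: (transportMn gal_ptD). Qed.
Lemma gal_pt_val P : tor P -> val (gal_pt P) = galois_act sg (val P).
Proof.
move=> hP; have [->|P0] := eqVneq P 0; first by rewrite /gal_pt /hom_pt coord_map0.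
by rewrite (val_neq0 P0) (val_neq0 (gal_pt_neq0 hP P0)) gal_pt_pc.
Qed.

End GaloisAction.

Variables (r s t A B : K) (al : Kbar).
Hypotheses (hAB : change_model 1 r s t E = Weierstrass A 0 B 0 0).
Hypotheses (al0 : al != 0) (al3 : al ^+ 3 = iota B) (hA : vm V (iota A / al)).

Lemma scaled_model : change_model al (iota r) (iota s) (iota t) (model EK) =
  Weierstrass (iota A / al) 0 1 0 0.
Proof.
have h1 : change_model 1 (iota r) (iota s) (iota t) (model EK) =
    Weierstrass (iota A) 0 (iota B) 0 0.
  have := congr1 (map_weierstrass iota) hAB; rewrite map_change_model rmorph1 => ->.
  by rewrite /map_weierstrass /= rmorph0.
rewrite (change_model_scale _ h1) -al3 divff // expf_neq0 //.
Qed.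

Fact disc_scaled : disc (Weierstrass (iota A / al) 0 1 0 0) != 0.
Proof.
rewrite -scaled_model; apply: contra disc_Kbar => /eqP d0.
by rewrite -(disc_change_model (model EK) (iota r) (iota s) (iota t) al0) d0 mul0r.
Qed.
Definition scaled_curve : elliptic Kbar := Elliptic disc_scaled.
Local Notation EA := scaled_curve.
Let hEA : model EA = change_model al (iota r) (iota s) (iota t) (model EK) := esym scaled_model.

Let hC : model C = map_weierstrass (red V) (model EA).
Proof.
have [Va _] := hA; have : red V (iota A / al) = 0 by apply/red_eq0.
by rewrite /map_weierstrass /= => ->; rewrite red0 red1.
Qed.

Let Va1 : V (a1 EA). Proof. by case: hA. Qed.
Let V0 : V 0 := vO0 V.
Let V1 : V 1 := vO1 V.
Let rB x y : V x -> V y -> red V (x - y) = red V x - red V y := @redB _ V x y.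
Let rM x y : V x -> V y -> red V (x * y) = red V x * red V y := @redM _ V x y.
Let Vx (P : ept EA) : tor P -> P != 0 -> V (xc P) :=
  torsion_xc_integral p_prime V_pinv p_neq0 Va1 V0 V1 V0 V0 (P := P).
Let Vy (P : ept EA) : tor P -> P != 0 -> V (yc P) :=
  torsion_yc_integral p_prime V_pinv p_neq0 Va1 V0 V1 V0 V0 (P := P).
Let Vs (P Q : ept EA) : tor P -> tor Q -> P != 0 -> Q != 0 -> P + Q != 0 -> V (sl P Q) :=
  torsion_sl_integral p_prime V_pinv p_neq0 Va1 V0 V1 V0 V0 (P := P) (Q := Q).

Definition scale_pt : ept EK -> ept EA := change_pt (E := EK) EA al (iota r) (iota s) (iota t).
Definition red_pt : ept EA -> ept C := hom_pt (E := EA) C (red V).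
Definition theta (P : ept EK) : ept C := red_pt (scale_pt P).

Lemma scale_ptD P Q : scale_pt (P + Q) = scale_pt P + scale_pt Q.
Proof. exact: (change_ptD al0 hEA). Qed.
Lemma scale_pt_eq0 P : scale_pt P = 0 -> P = 0.
Proof. exact: (change_pt_eq0 al0 hEA). Qed.
Lemma scale_pt_pc P : P != 0 -> pc (scale_pt P) = ((xc P - iota r) / al ^+ 2,
  (yc P - iota s * (xc P - iota r) - iota t) / al ^+ 3).
Proof. exact: (change_pt_pc al0 hEA). Qed.
Lemma scale_pt_tor P : tor P -> tor (scale_pt P).
Proof. by apply: (transport_tor (th := scale_pt)) => ? ? _ _; apply: scale_ptD. Qed.
Lemma scale_pt_neq0 P : P != 0 -> scale_pt P != 0.
Proof. by apply: contra => /eqP/scale_pt_eq0 ->. Qed.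

Lemma red_ptD (P Q : ept EA) : tor P -> tor Q -> red_pt (P + Q) = red_pt P + red_pt Q.
Proof. exact: (hom_ptD (vO_ring V) rB rM Va1 V0 V1 V0 V0 hC Vx Vy Vs). Qed.
Lemma red_pt_eq0 (P : ept EA) : tor P -> red_pt P = 0 -> P = 0.
Proof. exact: (hom_pt_eq0 (vO_ring V) rB rM Va1 V0 V1 V0 V0 hC Vx Vy). Qed.
Lemma red_pt_pc (P : ept EA) : tor P -> P != 0 -> pc (red_pt P) = (red V (xc P), red V (yc P)).
Proof. exact: (hom_pt_pc (vO_ring V) rB rM Va1 V0 V1 V0 V0 hC Vx Vy). Qed.

Lemma thetaD P Q : tor P -> tor Q -> theta (P + Q) = theta P + theta Q.
Proof. by move=> hP hQ; rewrite /theta scale_ptD red_ptD //; apply: scale_pt_tor. Qed.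
Lemma theta_eq0 P : tor P -> theta P = 0 -> P = 0.
Proof.
by move=> hP /red_pt_eq0 h; apply: scale_pt_eq0; apply: h; apply: scale_pt_tor.
Qed.
Lemma theta_tor P : tor P -> tor (theta P).
Proof. exact: (transport_tor thetaD). Qed.
Lemma theta_neq0 P : tor P -> P != 0 -> theta P != 0.
Proof. exact: (transport_neq0 theta_eq0). Qed.
Lemma theta_inj P Q : tor P -> tor Q -> theta P = theta Q -> P = Q.
Proof. exact: (transport_inj thetaD theta_eq0). Qed.
Lemma theta_surj (Q : ept C) : tor Q -> exists2 P, tor P & theta P = Q.
Proof. exact: (transport_surj p_prime p_neq0 res_p thetaD theta_eq0). Qed.
Lemma theta_indep S T : tor S -> tor T -> indep p S T -> indep p (theta S) (theta T).
Proof. exact: (transport_indep thetaD theta_eq0). Qed.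

Lemma theta_weil S T : tor S -> tor T -> indep p S T ->
  red V (weil p S T) = weil_value p (theta S) (theta T).
Proof.
move=> hS hT I; have ep := weil_exp_p char0 p_prime hS hT.
have [_ ev _] := weilP char0 p_prime hS hT; rewrite ev // in ep *.
have e := weil_value_change al0 hEA p_prime p_gt2 hS hT I ep.
have {}ep := etrans (congr1 (fun z => z ^+ p) (esym e)) ep; rewrite e.
have sD P Q : tor P -> tor Q -> scale_pt (P + Q) = scale_pt P + scale_pt Q.
  by move=> _ _; apply: scale_ptD.
have s0 P : tor P -> scale_pt P = 0 -> P = 0 by move=> _; apply: scale_pt_eq0.
have I' := transport_indep sD s0 hS hT I.
exact: (weil_value_hom (vO_ring V) (red1 V) rB rM Va1 V0 V1 V0 V0 hC Vx Vy Vs p_prime p_gt2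
  V_unity (scale_pt_tor hS) (scale_pt_tor hT) I' ep).
Qed.

Definition lift_x' P : Kbar := (xc P - iota r) / al ^+ 2.
Definition lift_y P : Kbar := (yc P - iota s * (xc P - iota r) - iota t) / al ^+ 3.

Lemma theta_pc P : tor P -> P != 0 ->
  [/\ V (lift_x' P), V (lift_y P) & pc (theta P) = (red V (lift_x' P), red V (lift_y P))].
Proof.
move=> hP P0; have hS := scale_pt_tor hP; have S0 := scale_pt_neq0 P0.
have := scale_pt_pc P0; rewrite {1}/pc => -[ex ey].
rewrite /lift_x' /lift_y -ex -ey; split; [exact: Vx | exact: Vy | exact: red_pt_pc].
Qed.

Lemma cocycle3 sg : galois_aut iota sg -> (sg al / al) ^+ 3 = 1.
Proof.
move=> [_ fix_sg]; rewrite expr_div_n -rmorphXn al3 fix_sg divff //.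
by rewrite -al3 expf_neq0.
Qed.

Lemma cocycle_V sg : galois_aut iota sg -> V (sg al / al).
Proof. by move=> h; apply: vO_cube; rewrite cocycle3. Qed.

(** Abscissas are divided by [al ^+ 2], which produces the square of the cocycle; ordinates are
    divided by [al ^+ 3], which is fixed. *)
Lemma theta_gal sg P : galois_aut iota sg -> tor P -> P != 0 ->
  pc (theta (gal_pt sg P)) = (red V (sg al / al) ^+ 2 * red V (sg (lift_x' P)), red V (sg (lift_y P))).
Proof.
move=> hsg hP P0; have hG := gal_pt_tor hsg hP; have G0 := gal_pt_neq0 hsg hP P0.
have [_ _ ->] := theta_pc hG G0; have [Vlx Vly _] := theta_pc hP P0.
have Vz := cocycle_V hsg; have e3 := cocycle3 hsg.
have := gal_pt_pc hsg hP P0; rewrite {1}/pc => -[ex ey].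
case: (hsg) => _ fix_sg.
have sal0 : sg al != 0 by rewrite fmorph_eq0.
rewrite -redX // -redM; [| exact: vOX | exact: galois_V].
congr (red V _, red V _).
  rewrite /lift_x' ex fmorph_div rmorphB rmorphXn fix_sg; field.
  by rewrite al0 sal0.
rewrite /lift_y ex ey fmorph_div !rmorphB rmorphM rmorphB rmorphXn !fix_sg.
have -> : al ^+ 3 = sg al ^+ 3 by rewrite al3 -rmorphXn al3 fix_sg.
by [].
Qed.

End OneCurve.

End ReductionOfTorsion.

(** * Lifting a power of Frobenius to the torsion of two curves *)

Section TwoCurves.

Variables (K : fieldType) (Kbar : closedFieldType) (iota : {rmorphism K -> Kbar}) (V : valring Kbar).
Local Notation k := (resf V).
Hypothesis (galois_V : forall sg x, galois_aut iota sg -> V x -> V (sg x)).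
Hypothesis (galois_red : forall sg x y, galois_aut iota sg -> V x -> V y ->
  red V x = red V y -> red V (sg x) = red V (sg y)).
Hypotheses (char0 : forall n, (0 < n)%N -> n%:R != 0 :> Kbar) (res3 : (3 : k) != 0).
Variables (l p : nat).
Hypotheses (l_prime : prime l) (res_l : l%:R = 0 :> k).
Hypotheses (p_prime : prime p) (p_ge5 : (5 <= p)%N) (res_p : p%:R != 0 :> k).
Local Notation C := (residue_curve res3).
Variable (n : nat).
Local Notation q := (l ^ n)%N.

(** In the application n = r, so that q is 1 or l. *)
Definition frob (x : k) : k := x ^+ q.

Lemma frobB x y : frob (x - y) = frob x - frob y.
Proof.
have chl : l \in [pchar k] by rewrite inE l_prime res_l eqxx.
rewrite /frob; elim: n => [|m IH] //.
have e z : z ^+ (l ^ m.+1) = pFrobenius_aut chl (z ^+ (l ^ m)).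
  by rewrite pFrobenius_autE -exprM expnSr.
by rewrite !e IH rmorphB.
Qed.

Let q_gt0 : (0 < q)%N.
Proof. by rewrite expn_gt0 prime_gt0. Qed.

Let hT : is_subring (fun _ : k => True). Proof. by []. Qed.
Let fB (x y : k) (_ _ : True) : frob (x - y) = frob x - frob y := frobB x y.
Let fM (x y : k) (_ _ : True) : frob (x * y) = frob x * frob y := exprMn q x y.
Let f1 : frob 1 = 1 := expr1n k q.
Let fC : model C = map_weierstrass frob (model C).
Proof. by rewrite /map_weierstrass /= /frob expr1n expr0n eqn0Ngt q_gt0. Qed.

Definition frob_pt : ept C -> ept C := hom_pt (E := C) C frob.

Lemma frob_ptD (P Q : ept C) : tor p P -> tor p Q -> frob_pt (P + Q) = frob_pt P + frob_pt Q.
Proof. exact: (hom_ptD hT fB fM I I I I I fC (fun _ _ _ => I) (fun _ _ _ => I) (fun _ _ _ _ _ _ _ => I)). Qed.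
Lemma frob_pt_eq0 (P : ept C) : tor p P -> frob_pt P = 0 -> P = 0.
Proof. exact: (hom_pt_eq0 hT fB fM I I I I I fC (fun _ _ _ => I) (fun _ _ _ => I)). Qed.
Lemma frob_pt_pc (P : ept C) : tor p P -> P != 0 -> pc (frob_pt P) = (frob (xc P), frob (yc P)).
Proof. exact: (hom_pt_pc hT fB fM I I I I I fC (fun _ _ _ => I) (fun _ _ _ => I)). Qed.
Lemma frob_pt_tor (P : ept C) : tor p P -> tor p (frob_pt P).
Proof. exact: (transport_tor frob_ptD). Qed.
Lemma frob_pt_weil (S T : ept C) : tor p S -> tor p T -> indep p S T ->
  weil_value p S T ^+ p = 1 -> weil_value p (frob_pt S) (frob_pt T) = weil_value p S T ^+ q.
Proof.
move=> hS hT' I' e; apply/esym.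
exact: (weil_value_hom hT f1 fB fM I I I I I fC (fun _ _ _ => I) (fun _ _ _ => I)
  (fun _ _ _ _ _ _ _ => I) p_prime (leq_trans (isT : 2 < 5)%N p_ge5) (fun _ _ => I) hS hT' I' e).
Qed.

Variables (E E' : elliptic K).
Variables (r s t A B : K) (al : Kbar).
Hypotheses (hAB : change_model 1 r s t E = Weierstrass A 0 B 0 0).
Hypotheses (al0 : al != 0) (al3 : al ^+ 3 = iota B) (hA : vm V (iota A / al)).
Variables (r' s' t' A' B' : K) (al' : Kbar).
Hypotheses (hAB' : change_model 1 r' s' t' E' = Weierstrass A' 0 B' 0 0).
Hypotheses (al0' : al' != 0) (al3' : al' ^+ 3 = iota B') (hA' : vm V (iota A' / al')).
Hypothesis (cocycle_frob : forall sg, galois_aut iota sg ->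
  red V (sg al' / al') = red V (sg al / al) ^+ q).

Local Notation EK := (curve_Kbar iota E).
Local Notation EK' := (curve_Kbar iota E').
Local Notation th := (theta res3 hAB al0 al3).
Local Notation th' := (theta res3 hAB' al0' al3').

Section Comparison.

Variable (f : ept EK -> ept EK').
Hypotheses (f_tor : forall P, tor p P -> tor p (f P))
  (f_theta : forall P, tor p P -> th' (f P) = frob_pt (th P)).

Let thT (P : ept EK) (hP : tor p P) : tor p (th P) := theta_tor char0 res3 p_prime res_p hAB al0 al3 hA hP.

Lemma compareD (P Q : ept EK) : tor p P -> tor p Q -> f (P + Q) = f P + f Q.
Proof.
move=> hP hQ; have hPQ := torD hP hQ.
apply: (theta_inj (hAB := hAB') (al0 := al0') (al3 := al3') char0 p_prime res_p hA' (f_tor hPQ) (torD (f_tor hP) (f_tor hQ))).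
rewrite (thetaD char0 res3 p_prime res_p hAB' al0' al3' hA' (f_tor hP) (f_tor hQ)).
rewrite !f_theta // (thetaD char0 res3 p_prime res_p hAB al0 al3 hA hP hQ).
by rewrite frob_ptD //; apply: thT.
Qed.

Lemma compare_eq0 (P : ept EK) : tor p P -> f P = 0 -> P = 0.
Proof.
move=> hP e; have := f_theta hP; rewrite e.
rewrite (transport0 (thetaD char0 res3 p_prime res_p hAB' al0' al3' hA')).
move=> /esym/(frob_pt_eq0 (thT hP)); exact: (theta_eq0 char0 p_prime res_p hA hP).
Qed.

Lemma compare_neq0 (P : ept EK) : tor p P -> P != 0 -> f P != 0.
Proof. by move=> hP; apply: contra => /eqP/compare_eq0 ->. Qed.

(** Both sides are compared on the residue curve. Raising to the power q commutes with [sg], and it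
    raises the twist of E to the power q, which is the twist of E' by [cocycle_frob]. *)
Lemma compare_gal sg (P : ept EK) : galois_aut iota sg -> tor p P -> f (gal_pt sg P) = gal_pt sg (f P).
Proof.
move=> hsg hP; have [->|P0] := eqVneq P 0.
  have f0 : f 0 = 0 by exact: (transport0 compareD).
  by rewrite f0 !(transport0 (gal_ptD (p := p) hsg)).
have hG := gal_pt_tor hsg hP; have G0 := gal_pt_neq0 hsg hP P0.
have hf := f_tor hP; have f0 := compare_neq0 hP P0.
have hGf := gal_pt_tor hsg hf; have Gf0 := gal_pt_neq0 hsg hf f0.
apply: (theta_inj (hAB := hAB') (al0 := al0') (al3 := al3') char0 p_prime res_p hA' (f_tor hG) hGf).
rewrite f_theta //; apply: pc_inj.
- apply/eqP => /(frob_pt_eq0 (thT hG))/(theta_eq0 char0 p_prime res_p hA hG)/eqP.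
  by apply/negP.
- by apply/eqP => /(theta_eq0 char0 p_prime res_p hA' hGf)/eqP; apply/negP.
rewrite (theta_gal galois_V char0 res3 p_prime res_p hAB' al0' al3' hA' hsg hf f0).
have thG0 : th (gal_pt sg P) != 0.
  by apply/eqP => /(theta_eq0 char0 p_prime res_p hA hG)/eqP; apply/negP.
have thP0 : th P != 0.
  by apply/eqP => /(theta_eq0 char0 p_prime res_p hA hP)/eqP; apply/negP.
have := frob_pt_pc (thT hG) thG0.
have := theta_gal galois_V char0 res3 p_prime res_p hAB al0 al3 hA hsg hP P0.
rewrite {1}/pc => -[-> ->] ->.
have [Vx Vy ep] := theta_pc char0 res3 p_prime res_p hAB al0 al3 hA hP P0.
have [Vx' Vy' ep'] := theta_pc char0 res3 p_prime res_p hAB' al0' al3' hA' hf f0.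
have := frob_pt_pc (thT hP) thP0; move: ep; rewrite {1}/pc => -[-> ->].
rewrite -f_theta // ep' => -[ex ey].
have ex' : red V (sg (lift_x' r' al' (f P))) = frob (red V (sg (lift_x' r al P))).
  rewrite /frob -redX; last exact: galois_V.
  rewrite -rmorphXn; apply: galois_red => //; first exact: vOX.
  by rewrite redX.
have ey' : red V (sg (lift_y r' s' t' al' (f P))) = frob (red V (sg (lift_y r s t al P))).
  rewrite /frob -redX; last exact: galois_V.
  rewrite -rmorphXn; apply: galois_red => //; first exact: vOX.
  by rewrite redX.
by rewrite ex' ey' cocycle_frob // /frob exprMn -!exprM mulnC.
Qed.

Lemma compare_weil (S T : ept EK) : tor p S -> tor p T -> weil p (f S) (f T) = weil p S T ^+ q.
Proof.
move=> hS hT'; have fS := f_tor hS; have fT := f_tor hT'.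
have ep := weil_exp_p char0 p_prime hS hT'; have ep' := weil_exp_p char0 p_prime fS fT.
have [I'|nI] := pselect (indep p S T); last first.
  rewrite (weil_dependent char0 p_prime p_ge5 hS hT' nI) expr1n.
  apply: (weil_dependent char0 p_prime p_ge5 fS fT) => If; apply: nI => i j e.
  apply: If; rewrite -!(transportMn compareD) // -compareD ?e; try exact: torMn.
  exact: (transport0 compareD).
have If := transport_indep compareD compare_eq0 hS hT' I'.
apply: (red_unity_inj p_prime res_p ep'); first by rewrite exprAC ep expr1n.
rewrite (theta_weil char0 res3 p_prime p_ge5 res_p hAB' al0' al3' hA' fS fT If).
have Vw : V (weil p S T) := @V_unity _ V p p_prime _ ep.
rewrite (redX _ Vw).
have It : indep p (th S) (th T) := theta_indep char0 p_prime res_p hA hS hT' I'.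
rewrite (theta_weil char0 res3 p_prime p_ge5 res_p hAB al0 al3 hA hS hT' I') !f_theta //.
rewrite frob_pt_weil //; try exact: thT.
rewrite -(theta_weil char0 res3 p_prime p_ge5 res_p hAB al0 al3 hA hS hT' I') -redX ?ep ?red1 //.
Qed.

End Comparison.

Lemma comparison : exists f : ept EK -> ept EK',
  [/\ forall P, tor p P -> tor p (f P),
      forall P Q, tor p P -> tor p Q -> f (P + Q) = f P + f Q,
      forall P, tor p P -> f P = 0 -> P = 0,
      forall sg P, galois_aut iota sg -> tor p P -> f (gal_pt sg P) = gal_pt sg (f P)
    & forall S T, tor p S -> tor p T -> weil p (f S) (f T) = weil p S T ^+ q].
Proof.
have h (P : ept EK) : exists Q : ept EK', tor p P -> tor p Q /\ th' Q = frob_pt (th P).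
  have [hP|nP] := pselect (tor p P); last by exists 0.
  have hF := frob_pt_tor (theta_tor char0 res3 p_prime res_p hAB al0 al3 hA hP).
  by have [Q hQ eQ] := theta_surj char0 p_prime res_p hAB' al0' al3' hA' hF; exists Q.
have [f hf] := choice h; exists f.
have f_tor P : tor p P -> tor p (f P) by move=> /hf[].
have f_theta P : tor p P -> th' (f P) = frob_pt (th P) by move=> /hf[].
split=> //.
- exact: compareD.
- exact: compare_eq0.
- by move=> sg P hsg hP; apply: compare_gal.
exact: compare_weil.
Qed.

End TwoCurves.

(** * The commutant of the Galois action *)

Section Commutant.

Variables (F : closedFieldType) (E : elliptic F) (p : nat).
Hypotheses (char0 : forall n, (0 < n)%N -> n%:R != 0 :> F) (p_prime : prime p) (p_ge5 : (5 <= p)%N).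
Local Notation tor := (tor p).
Implicit Types (P Q R : ept E).
Variables (J T : ept E -> ept E).
Hypotheses (J_tor : forall P, tor P -> tor (J P)) (T_tor : forall P, tor P -> tor (T P)).
Hypotheses (JD : forall P Q, tor P -> tor Q -> J (P + Q) = J P + J Q)
  (TD : forall P Q, tor P -> tor Q -> T (P + Q) = T P + T Q).
Hypothesis (T_eq0 : forall P, tor P -> T P = 0 -> P = 0).
Hypothesis (J_cyclotomic : forall P, tor P -> P + J P + J (J P) = 0).
Hypothesis (TJ : forall P, tor P -> T (J P) = J (J (T P))).

Let p_neq0 : p%:R != 0 :> F := char0 (prime_gt0 p_prime).
Let J0 : J 0 = 0 := transport0 JD.
Let JMn P n : tor P -> J (P *+ n) = J P *+ n := transportMn JD n (P := P).
Let TMn P n : tor P -> T (P *+ n) = T P *+ n := transportMn TD n (P := P).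

Lemma J_fixed P : tor P -> J P = P -> P = 0.
Proof.
move=> hP e; have := J_cyclotomic hP; rewrite !e => e3.
have {}e3 : P *+ 3 = 0 by rewrite -{}e3 !mulrS mulr0n addr0 addrA.
apply/eqP/negPn/negP => P0.
have : ~~ (p %| 3)%N by rewrite gtnNdvd // (leq_trans _ p_ge5).
by move/(tor_mul_neq0 p_prime hP P0); rewrite e3 eqxx.
Qed.

Lemma J_eq0 P : tor P -> J P = 0 -> P = 0.
Proof. by move=> hP e; have := J_cyclotomic hP; rewrite e J0 !addr0. Qed.

(** If every vector were an eigenvector, J would be a scalar and commute with T; then TJ = J^2 T
    would make J fix a nonzero vector, against [J_fixed]. *)
Lemma cyclic_vector : exists2 R, tor R & indep p R (J R).
Proof.
apply: contrapT => none.
have ev P : tor P -> exists j, J P = P *+ j.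
  move=> hP; have [->|P0] := eqVneq P 0; first by exists 0%N; rewrite J0.
  apply: (dependent char0 p_prime (J_tor hP) hP P0) => I; apply: none; exists P => //.
  exact: indepC.
have [S [U [hS hU I]]] := torsion_basis E p_prime p_neq0.
have [a ea] := ev _ hS; have [b eb] := ev _ hU; have [c ec] := ev _ (torD hS hU).
have minus P i : tor P -> P *+ i - P *+ c = P *+ (i + p.-1 * c).
  by move=> hP; rewrite mulrnDr mulrnA -(tor_opp_mul p_prime hP) mulNrn.
have mul0 P i : tor P -> (p %| i)%N -> P *+ i = 0.
  by move=> hP /dvdnP[j ->]; rewrite mulnC mulrnA hP mul0rn.
have [da db] : (p %| a + p.-1 * c)%N /\ (p %| b + p.-1 * c)%N.
  apply: I; rewrite -!minus // -ea -eb addrACA -opprD -JD //.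
  by rewrite ec mulrnDl subrr.
have ec' P : tor P -> J P = P *+ c.
  move=> hP; have [i [j ->]] := span_all p_prime p_neq0 hS hU I hP.
  have hi := torMn i hS; have hj := torMn j hU.
  have eS : J S = S *+ c by apply/eqP; rewrite -subr_eq0 ea minus ?mul0.
  have eU : J U = U *+ c by apply/eqP; rewrite -subr_eq0 eb minus ?mul0.
  by rewrite JD // !JMn // eS eU mulrnDl -!mulrnA ![(c * _)%N]mulnC.
have hTS := T_tor hS; have := TJ hS; rewrite ec' // TMn // -ec' // => e.
have /(J_eq0 hTS)/(T_eq0 hS) S0 := J_fixed (J_tor hTS) (esym e).
have [] := I 1%N 0%N; first by rewrite S0 mul0rn mulr0n addr0.
by rewrite gtnNdvd // prime_gt1.
Qed.

(** A map commuting with J is a + bJ, as there is a cyclic vector. Moving it past T replaces J by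
    J^2, so b(J - J^2) kills T R; J fixes only 0, and therefore p divides b. *)
Lemma commutant_scalar (M : ept E -> ept E) : (forall P, tor P -> tor (M P)) ->
  (forall P Q, tor P -> tor Q -> M (P + Q) = M P + M Q) ->
  (forall P, tor P -> M (J P) = J (M P)) -> (forall P, tor P -> M (T P) = T (M P)) ->
  exists a, forall P, tor P -> M P = P *+ a.
Proof.
move=> M_tor MD MJ MT; have [R hR I] := cyclic_vector; have hJR := J_tor hR.
have MMn P n : tor P -> M (P *+ n) = M P *+ n := transportMn MD n (P := P).
have [a [b eM]] := span_all p_prime p_neq0 hR hJR I (M_tor R hR).
have ePM P : tor P -> M P = P *+ a + J P *+ b.
  move=> hP; have [i [j ->]] := span_all p_prime p_neq0 hR hJR I hP.
  have hi := torMn i hR; have hj := torMn j hJR.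
  rewrite MD // JD // !JMn // !MMn // MJ // eM JD ?JMn //; try exact: torMn.
  by rewrite !mulrnDl -!mulrnA ![(i * _)%N]mulnC ![(j * _)%N]mulnC addrACA.
have hQ := T_tor hR; have hJQ := J_tor hQ.
have := MT _ hR; rewrite !ePM // TD ?TMn //; try exact: torMn.
move=> /addrI; rewrite TJ // -!JMn ?torMn //; try exact: J_tor.
move=> e; have h1 := torMn b hJQ.
have /(J_eq0 (torMn b hQ)) := J_fixed (J_tor (torMn b hQ)) (esym e).
have TR0 : T R != 0.
  apply/eqP => /(T_eq0 hR) R0; have [] := I 1%N 0%N; first by rewrite R0 mul0rn mulr0n addr0.
  by rewrite gtnNdvd // prime_gt1.
have [/dvdnP[d eb] _|nd /eqP] := boolP (p %| b)%N; last first.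
  by rewrite (negbTE (tor_mul_neq0 p_prime hQ TR0 nd)).
by exists a => P hP; rewrite ePM // eb mulnC mulrnA (J_tor hP : _ *+ p = 0) mul0rn addr0.
Qed.

End Commutant.

(* The points of the orbit of [P] under the automorphism (x, y) -> (z x, y) of C
   lie on a horizontal line. *)
Lemma sum_orbit (F : fieldType) (C : elliptic F) (z : F) (P Q R : ept C) :
  model C = Weierstrass 0 0 1 0 0 -> z ^+ 2 + z + 1 = 0 -> P != 0 -> Q != 0 -> R != 0 ->
  pc Q = (z * xc P, yc P) -> pc R = (z ^+ 2 * xc P, yc P) -> P + Q + R = 0.
Proof.
move=> hC hz P0 Q0 R0 eQ eR.
have hc : chord (model C) (pc P) (pc Q) 0.
  split; [exact: (pc_oncurve P0) | exact: (pc_oncurve Q0) | |]; rewrite eQ /=.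
    by rewrite mul0r addr0.
  rewrite hC /=; transitivity ((z ^+ 2 + z + 1) * xc P ^+ 2); last by ring.
  by rewrite hz; ring.
have [nop es] := chord_slope (disc_neq0 C) hc.
have PQ : P + Q != 0 by rewrite -opposite_add.
apply/eqP; rewrite addr_eq0; apply/eqP; apply: (pc_inj PQ); first by rewrite oppr_eq0.
rewrite (pcD P0 Q0 PQ) (pcN R0) /sl es eQ eR /third /negc /= hC /=; congr pair; last by ring.
transitivity (z ^+ 2 * xc P - (z ^+ 2 + z + 1) * xc P); first by ring.
by rewrite hz; ring.
Qed.

(** * Two automorphisms acting on the p-torsion *)

Section InertiaAndFrobenius.

Variables (K : fieldType) (Kbar : closedFieldType) (iota : {rmorphism K -> Kbar}) (V : valring Kbar).
Local Notation k := (resf V).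
Hypothesis (galois_V : forall sg x, galois_aut iota sg -> V x -> V (sg x)).
Hypothesis (galois_red : forall sg x y, galois_aut iota sg -> V x -> V y ->
  red V x = red V y -> red V (sg x) = red V (sg y)).
Hypotheses (char0 : forall n, (0 < n)%N -> n%:R != 0 :> Kbar) (res3 : (3 : k) != 0).
Variable (p : nat).
Hypotheses (p_prime : prime p) (p_ge5 : (5 <= p)%N) (res_p : p%:R != 0 :> k).
Local Notation C := (residue_curve res3).

Variables (E : elliptic K) (r s t A B : K) (al : Kbar).
Hypotheses (hAB : change_model 1 r s t E = Weierstrass A 0 B 0 0).
Hypotheses (al0 : al != 0) (al3 : al ^+ 3 = iota B) (hA : vm V (iota A / al)).
Local Notation EK := (curve_Kbar iota E).
Local Notation th := (theta res3 hAB al0 al3).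
Variables (w : Kbar) (c tau : {rmorphism Kbar -> Kbar}).
Hypotheses (hw : w ^+ 2 + w + 1 = 0) (hc : galois_aut iota c) (htau : galois_aut iota tau).
Hypotheses (c_red : forall x, V x -> red V (c x) = red V x) (c_al : c al = w * al).
Hypotheses (tau_al : tau al = al) (tau_w : tau w = w ^+ 2).

Let w3 : w ^+ 3 = 1.
Proof. by apply/eqP; rewrite -subr_eq0; apply/eqP; rewrite -(mul0r (w - 1)) -hw; ring. Qed.
Let Vw : V w.
Proof. by apply: vO_cube; rewrite w3; apply: vO1. Qed.
Let rw : red V w ^+ 2 + red V w + 1 = 0.
Proof.
have V2 : V (w ^+ 2) by apply: vOX.
by rewrite -(redX _ Vw) -(redD V2 Vw) -(red1 V) -(redD (vOD V2 Vw) (vO1 V)) hw red0.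
Qed.
Let rw3 : red V w ^+ 3 = 1.
Proof. by rewrite -redX // w3 red1. Qed.

Lemma inertia_pc (P : ept EK) : tor p P -> P != 0 ->
  pc (th (gal_pt c P)) = (red V w ^+ 2 * xc (th P), yc (th P)).
Proof.
move=> hP P0; rewrite (theta_gal galois_V char0 res3 p_prime res_p hAB al0 al3 hA hc hP P0).
have [Vx Vy] := theta_pc char0 res3 p_prime res_p hAB al0 al3 hA hP P0.
by rewrite {1}/pc => -[-> ->]; rewrite !c_red // c_al mulfK.
Qed.

Let th_neq0 (P : ept EK) : tor p P -> P != 0 -> th P != 0.
Proof. exact: (theta_neq0 char0 res3 p_prime res_p hAB al0 al3 hA). Qed.

Lemma inertia_cyclotomic (P : ept EK) : tor p P -> P + gal_pt c P + gal_pt c (gal_pt c P) = 0.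
Proof.
move=> hP; have g0 : gal_pt c (0 : ept EK) = 0 := transport0 (gal_ptD (p := p) hc).
have [->|P0] := eqVneq P 0; first by rewrite !g0 !addr0.
have hQ := gal_pt_tor hc hP; have Q0 := gal_pt_neq0 hc hP P0.
have hR := gal_pt_tor hc hQ; have R0 := gal_pt_neq0 hc hQ Q0.
have thD := thetaD char0 res3 p_prime res_p hAB al0 al3 hA.
apply: (theta_eq0 (hAB := hAB) (al0 := al0) (al3 := al3) char0 p_prime res_p hA).
  by rewrite /tor; do 2 (apply: torD => //).
rewrite (thD _ _ (torD hP hQ) hR) (thD _ _ hP hQ).
have eQ := inertia_pc hP P0; have eR := inertia_pc hQ Q0.
apply: (@sum_orbit _ C (red V w ^+ 2) _ _ _ erefl _ (th_neq0 hP P0) (th_neq0 hQ Q0) (th_neq0 hR R0) eQ).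
  rewrite -rw; transitivity (red V w ^+ 3 * red V w + red V w ^+ 2 + 1); first by ring.
  by rewrite rw3; ring.
by rewrite eR; move: eQ; rewrite {1}/pc => -[-> ->]; rewrite mulrA -expr2.
Qed.

Lemma frobenius_inertia (P : ept EK) : tor p P ->
  gal_pt tau (gal_pt c P) = gal_pt c (gal_pt c (gal_pt tau P)).
Proof.
move=> hP; have g0 sg : galois_aut iota sg -> gal_pt sg (0 : ept EK) = 0.
  by move=> h; apply: (transport0 (gal_ptD (p := p) h)).
have [->|P0] := eqVneq P 0; first by rewrite !g0.
have hQ := gal_pt_tor hc hP; have Q0 := gal_pt_neq0 hc hP P0.
have hT := gal_pt_tor htau hP; have T0 := gal_pt_neq0 htau hP P0.
have hJ := gal_pt_tor hc hT; have J0 := gal_pt_neq0 hc hT T0.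
have hL := gal_pt_tor htau hQ; have L0 := gal_pt_neq0 htau hQ Q0.
have hR := gal_pt_tor hc hJ; have R0 := gal_pt_neq0 hc hJ J0.
apply: (theta_inj (hAB := hAB) (al0 := al0) (al3 := al3) char0 p_prime res_p hA hL hR).
apply: pc_inj; try exact: th_neq0.
rewrite (inertia_pc hJ J0); have := inertia_pc hT T0; rewrite {1}/pc => -[-> ->].
have tg := theta_gal galois_V char0 res3 p_prime res_p hAB al0 al3 hA htau.
rewrite (tg _ hQ Q0); have := tg _ hP P0; rewrite {1}/pc => -[-> ->].
have [Vx Vy] := theta_pc char0 res3 p_prime res_p hAB al0 al3 hA hP P0.
have [Vx' Vy'] := theta_pc char0 res3 p_prime res_p hAB al0 al3 hA hQ Q0.
rewrite (inertia_pc hP P0) => eQ; have eQx := congr1 fst eQ; have eQy := congr1 snd eQ.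
rewrite {1}/pc => -[ePx ePy]; cbn [fst snd] in eQx, eQy.
rewrite tau_al divff // red1 expr1n !mul1r; congr pair; last first.
  by apply: galois_red => //; rewrite -eQy.
have -> : red V (tau (lift_x' r al (gal_pt c P))) = red V (tau (w ^+ 2 * lift_x' r al P)).
  apply: galois_red => //; first by apply: vOM => //; apply: vOX.
  by rewrite -eQx ePx -(redX 2 Vw) -redM //; apply: vOX.
rewrite rmorphM rmorphXn tau_w redM ?redX //; try by do ?apply: vOX.
  by rewrite mulrA -!exprM -exprD.
exact: galois_V.
Qed.

Lemma galois_commutant (M : ept EK -> ept EK) : (forall P, tor p P -> tor p (M P)) ->
  (forall P Q, tor p P -> tor p Q -> M (P + Q) = M P + M Q) ->
  (forall sg P, galois_aut iota sg -> tor p P -> M (gal_pt sg P) = gal_pt sg (M P)) ->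
  exists a, forall P, tor p P -> M P = P *+ a.
Proof.
move=> M_tor MD Mgal.
apply: (commutant_scalar char0 p_prime p_ge5 (J := gal_pt c) (T := gal_pt tau)) => //.
- by move=> P; apply: gal_pt_tor.
- by move=> P; apply: gal_pt_tor.
- by move=> P Q; apply: gal_ptD.
- by move=> P Q; apply: gal_ptD.
- by move=> P; apply: gal_pt_eq0.
- exact: inertia_cyclotomic.
- exact: frobenius_inertia.
- by move=> P; apply: Mgal.
by move=> P; apply: Mgal.
Qed.

End InertiaAndFrobenius.

Lemma cube_root (F : closedFieldType) (a : F) : exists x, x ^+ 3 = a.
Proof.
have [x hx] := @solve_monicpoly F 3 (fun i => if i == 0%N then a else 0) isT.
exists x; rewrite hx big_ord_recl big1 ?addr0 /= ?expr0 ?mulr1 // => i _.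
by rewrite mul0r.
Qed.

Lemma cube_roots_of_unity (F : fieldType) (w x : F) : w ^+ 2 + w + 1 = 0 -> x ^+ 3 = 1 ->
  [\/ x = 1, x = w | x = w ^+ 2].
Proof.
move=> hw hx; have : (x - 1) * ((x - w) * (x - w ^+ 2)) == 0.
  apply/eqP; have w3 : w ^+ 3 = 1.
    by apply/eqP; rewrite -subr_eq0; apply/eqP; rewrite -(mul0r (w - 1)) -hw; ring.
  transitivity (x ^+ 3 - (w ^+ 2 + w + 1) * (x ^+ 2 - x) + (w ^+ 3 - 1) * (x - 1) - 1).
    by ring.
  by rewrite hw w3 hx; ring.
rewrite !mulf_eq0 !subr_eq0 => /orP[/eqP|/orP[]/eqP]; by [constructor 1 | constructor 2 | constructor 3].
Qed.

(** * Cube roots of B and their cocycles *)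

Section CubeRoots.

Variables (l : nat) (l_prime : prime l) (Ql : fieldType) (vl : Ql -> int) (Ql_l : is_Ql l vl).
Variables (K : fieldExtType Ql) (K_quadratic : \dim {:K} = 2%N).
Variables (v : K -> int) (v_normalized : normalized_valuation v) (K_ramified : ramified vl v).
Variables (Kbar : closedFieldType) (iota : {rmorphism K -> Kbar}).
Hypothesis (Kbar_closure : is_algebraic_closure iota).
Hypothesis (l_mod3 : (l %% 3)%N = 2%N).
Local Notation V := (Kbar_valring l_prime Ql_l K_quadratic v_normalized K_ramified Kbar_closure).
Local Notation k := (resf V).
Implicit Types (sg : {rmorphism Kbar -> Kbar}) (x y z al : Kbar) (B : K).

Lemma vm_ratio (A B : K) al : al != 0 -> al ^+ 3 = iota B -> val_ge v 1 (A ^+ 3 / B) ->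
  vm V (iota A / al).
Proof.
move=> al0 al3 h; apply: vm_cube; rewrite expr_div_n al3 -rmorphXn -fmorph_div.
exact/V_max_base.
Qed.

Lemma cube_root_not_base B al : B != 0 -> (forall m : int, v B <> 3 * m) -> al ^+ 3 = iota B ->
  ~ base iota al.
Proof.
move=> B0 hB al3 [a ea]; have eB : B = a ^+ 3.
  by apply: (fmorph_inj iota); rewrite -al3 ea rmorphXn.
have a0 : a != 0 by apply: contraNneq B0 => a0; rewrite eB a0 expr0n.
by apply: (hB (v a)); rewrite eB (val_exp K_quadratic v_normalized l_mod3).
Qed.

(* [c] is the commutator of [tau] and of an automorphism moving [al]; it acts
   trivially on the residue field because Galois groups of finite fields commute. *)
Lemma inertia_generator B : B != 0 -> (forall m : int, v B <> 3 * m) ->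
  exists (al w : Kbar) (c tau : {rmorphism Kbar -> Kbar}),
  [/\ al ^+ 3 = iota B, w ^+ 2 + w + 1 = 0, galois_aut iota c & galois_aut iota tau] /\
  [/\ forall x, V x -> red V (c x) = red V x, c al = w * al, tau al = al & tau w = w ^+ 2].
Proof.
move=> B0 hB; have [al1 al1E] := cube_root (iota B).
have al10 : al1 != 0.
  by apply: contraNneq B0 => e; rewrite -(fmorph_eq0 iota) -al1E e expr0n.
have [om [om2 om3 _ _]] := omega_ex Ql_l iota.
have [tau htau tau_om] := omega_moved l_prime Ql_l K_quadratic v_normalized K_ramified Kbar_closure l_mod3 om2 om3.
have tau_z z : z ^+ 3 = 1 -> tau z = z ^+ 2.
  case/(cube_roots_of_unity om2) => ->; rewrite ?rmorph1 ?expr1n // rmorphXn tau_om //.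
have coc sg al : galois_aut iota sg -> al != 0 -> al ^+ 3 = iota B -> (sg al / al) ^+ 3 = 1.
  move=> [_ fix_sg] al0 alE; rewrite expr_div_n -rmorphXn alE fix_sg divff //.
  by rewrite -alE expf_neq0.
pose ze := tau al1 / al1; have ze3 : ze ^+ 3 = 1 := coc _ _ htau al10 al1E.
(* [tau] squares cube roots of unity, so it sends ze^2 al1 to ze^4 ze al1 = ze^2 al1: this cube root
   of B is fixed. *)
pose al := ze ^+ 2 * al1.
have alE : al ^+ 3 = iota B by rewrite exprMn exprAC ze3 expr1n mul1r.
have al0 : al != 0.
  by apply: contraNneq B0 => e; rewrite -(fmorph_eq0 iota) -alE e expr0n.
have tau_al : tau al = al.
  have e : tau al1 = ze * al1 by rewrite divfK.
  rewrite /al rmorphM rmorphXn tau_z // e; transitivity (ze ^+ 3 * (ze ^+ 2 * al1)); first by ring.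
  by rewrite ze3 mul1r.
have ch0 n : (0 < n)%N -> n%:R != 0 :> K by apply: (K_char0 Ql_l).
have [sg [hsg sg_al]] := fixed_field Kbar_closure ch0 (cube_root_not_base B0 hB alE).
pose z := sg al / al; have z3 : z ^+ 3 = 1 := coc _ _ hsg al0 alE.
have sgal : sg al = z * al by rewrite divfK.
have z1 : z != 1 by apply: contraNneq sg_al => e; rewrite sgal e mul1r.
have z0 : z != 0 by apply: contraTneq (oner_neq0 Kbar) => e; rewrite -z3 e expr0n eqxx.
have [sg' hsg' [K1 K2]] := galois_inv Kbar_closure hsg.
have [tau' htau' [K3 K4]] := galois_inv Kbar_closure htau.
have hc := galois_comp hsg (galois_comp htau (galois_comp hsg' htau')).
(* The commutator multiplies [al] by z / z^2 = z^2, since [tau] squares the cube root of unity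
   introduced by the inverse of [sg]. *)
exists al, (z ^+ 2), (sg \o (tau \o (sg' \o tau'))), tau.
have z2 : z ^+ 2 + z + 1 = 0.
  apply: (@mulfI _ (z - 1)); first by rewrite subr_eq0.
  by rewrite mulr0; transitivity (z ^+ 3 - 1); [ring | rewrite z3 subrr].
have w2 : (z ^+ 2) ^+ 2 + z ^+ 2 + 1 = 0.
  by rewrite -z2 -exprM; transitivity (z ^+ 3 * z + z ^+ 2 + 1); [ring | rewrite z3; ring].
have sgz3 : sg' z ^+ 3 = 1 by rewrite -rmorphXn z3 rmorph1.
have tau'al : tau' al = al by rewrite -{1}tau_al K3.
have sgz0 : sg' z != 0 by rewrite fmorph_eq0.
have sg'al : sg' al = al / sg' z.
  by apply: (mulIf sgz0); rewrite divfK // mulrC -rmorphM -sgal K1.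
split; split=> //.
- move=> x Vx; rewrite /=; have Vx' : V (tau' x) := galois_V htau' Vx.
  have Vx2 : V (sg' (tau' x)) := galois_V hsg' Vx'.
  by rewrite (res_aut_commute hsg htau Vx2) K2 K4.
- transitivity (sg (tau (sg' (tau' al)))) => //.
  have es : sg ((sg' z) ^+ 2) = z ^+ 2 by rewrite rmorphXn K2.
  rewrite tau'al sg'al fmorph_div tau_al (tau_z _ sgz3) fmorph_div es sgal.
  by rewrite -[z * al]mul1r -z3; field.
by rewrite tau_z // exprAC z3 expr1n.
Qed.

(** Any cube root of a reduces to a cube root of 1; these are the reductions of the powers of omega,
    and one such power corrects the residue. *)
Lemma unit_root_near_one (a : K) : red V (iota a) = 1 -> val_ge v 0 a ->
  exists x, [/\ x ^+ 3 = iota a, V x & red V x = 1].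
Proof.
move=> ra hva; have Va : V (iota a) by apply/V_base.
have [y yE] := cube_root (iota a); have Vy : V y by apply: vO_cube; rewrite yE.
have [om [om2 om3 _ _]] := omega_ex Ql_l iota.
have Vom : V om by apply: vO_cube; rewrite om3; apply: vO1.
have Vom2 : V (om ^+ 2) by apply: vOX.
have rom2 : red V om ^+ 2 + red V om + 1 = 0.
  by rewrite -(redX _ Vom) -(redD Vom2 Vom) -(red1 V) -(redD (vOD Vom2 Vom) (vO1 V)) om2 red0.
have rom3 : red V om ^+ 3 = 1 by rewrite -redX // om3 red1.
have ry3 : red V y ^+ 3 = 1 by rewrite -redX // yE.
case: (cube_roots_of_unity rom2 ry3) => ry.
- by exists y.
- exists (y * om ^+ 2); split; last 1 first.
  + by rewrite redM // ry redX // -exprS.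
  + by rewrite exprMn exprAC om3 expr1n mulr1.
  exact: vOM.
exists (y * om); split; last 1 first.
- by rewrite redM // ry -exprSr.
- by rewrite exprMn om3 mulr1.
exact: vOM.
Qed.

(** B' is B^q c1^3 times a unit of K. The residue of that unit is a cube t^3 because l = 2 mod 3,
    and the factor left over has a cube root [eta] reducing to 1. Thus al' = eta al^q c with c in K,
    and sg eta / eta has residue 1. *)
Lemma cocycle_twist (B B' : K) al (q : nat) (m : int) : B != 0 -> B' != 0 -> al != 0 ->
  al ^+ 3 = iota B -> v B' = q%:Z * v B + 3 * m ->
  exists al', [/\ al' != 0, al' ^+ 3 = iota B' & forall sg, galois_aut iota sg ->
    red V (sg al' / al') = red V (sg al / al) ^+ q].
Proof.
move=> B0 B'0 al0 alE hv; have hm := Defs.valM v_normalized.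
have [c1 c10 vc1] := val_onto v_normalized m.
pose w1 := B' / (B ^+ q * c1 ^+ 3).
have d0 : B ^+ q * c1 ^+ 3 != 0 by rewrite mulf_neq0 ?expf_neq0.
have w10 : w1 != 0 by rewrite mulf_neq0 ?invr_eq0.
have vw1 : v w1 = 0.
  rewrite hm ?invr_eq0 // (val_inv v_normalized) // hm ?expf_neq0 //.
  by rewrite !(val_exp K_quadratic v_normalized l_mod3) // hv vc1 subrr.
have Vw1 : V (iota w1) by apply/V_base; right; rewrite vw1.
have rw1 : red V (iota w1) != 0.
  apply/eqP => /(red_eq0 Vw1)/V_max_base[e|]; first by rewrite e eqxx in w10.
  by rewrite vw1.
have hw1 : val_ge v 0 w1 by right; rewrite vw1.
have [n1 en1] := res_base l_prime Ql_l K_quadratic v_normalized K_ramified Kbar_closure hw1.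
have [t et] := res_cube_root l_prime Ql_l K_quadratic v_normalized K_ramified Kbar_closure l_mod3 n1.
have rt : (t%:R : k) != 0.
  by apply: contraNneq rw1 => e; rewrite en1 et e expr0n.
have rt' : red V (t%:R) = t%:R by rewrite redMn.
have Vt : V t%:R := vO_nat V t.
have rt0 : red V t%:R != 0 by rewrite rt'.
have [Vti rti] := redV Vt rt0.
have t0 : (t%:R : K) != 0.
  apply: contraNneq rt => e; rewrite -rt' -(rmorph_nat iota) e rmorph0.
  exact/eqP/red0.
have [c cE c0] : exists2 c, c = c1 * t%:R & c != 0.
  by exists (c1 * t%:R) => //; rewrite mulf_neq0.
pose w2 := w1 / t%:R ^+ 3.
have ew2 : iota w2 = iota w1 * t%:R^-1 ^+ 3.
  by rewrite fmorph_div rmorphXn rmorph_nat exprVn.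
have Vti3 : V (t%:R^-1 ^+ 3) := vOX 3 Vti.
have Vw2 : V (iota w2) by rewrite ew2; apply: vOM.
have rw2 : red V (iota w2) = 1.
  by rewrite ew2 redM // redX // rti rt' en1 et -exprMn divff ?expr1n.
have hw2 : val_ge v 0 w2 by have /V_base := Vw2.
have [eta [etaE Veta reta]] := unit_root_near_one rw2 hw2.
have eta0 : eta != 0.
  by apply/eqP => e; move: reta; rewrite e red0 => /esym/eqP; rewrite oner_eq0.
pose al' := eta * (al ^+ q * iota c); exists al'.
have al'0 : al' != 0 by rewrite !mulf_neq0 ?expf_neq0 // fmorph_eq0.
split=> //.
  rewrite !exprMn etaE exprAC alE -!rmorphXn -!rmorphM; congr (iota _).
  rewrite /w2 /w1 cE exprMn; field; by rewrite ?t0 ?c10 ?expf_neq0.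
move=> sg hsg; have [_ fix_sg] := hsg.
have -> : sg al' / al' = (sg eta / eta) * (sg al / al) ^+ q.
  rewrite /al' !rmorphM rmorphXn fix_sg expr_div_n.
  have : iota c != 0 by rewrite fmorph_eq0.
  have : al ^+ q != 0 by rewrite expf_neq0.
  move: (al ^+ q) (sg al ^+ q) (iota c) (sg eta) => a b d e a0 d0'; field.
  by rewrite d0' a0 eta0.
have Vsg : V (sg eta) := galois_V hsg Veta.
have rsg : red V (sg eta) = 1.
  by rewrite (galois_red hsg Veta (vO1 V)) ?rmorph1 red1.
have reta0 : red V eta != 0 by rewrite reta oner_neq0.
have [Vei rei] := redV Veta reta0.
have z3 : (sg al / al) ^+ 3 = 1.
  by rewrite expr_div_n -rmorphXn alE fix_sg divff // fmorph_eq0.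
have Vz : V (sg al / al) by apply: vO_cube; rewrite z3; apply: vO1.
have Vzq : V ((sg al / al) ^+ q) := vOX q Vz.
rewrite (redM (vOM Vsg Vei) Vzq) (redM Vsg Vei) rsg rei reta invr1 mulr1 mul1r.
exact: redX.
Qed.

End CubeRoots.

(** * Squares modulo p, valuations modulo 3 and the conclusion *)

Lemma expr_eq_mod (F : fieldType) (p i j : nat) (z : F) : prime p -> z ^+ p = 1 -> z != 1 ->
  z ^+ i = z ^+ j -> i = j %[mod p].
Proof.
move=> p_prime zp z1 e; have [m hm md] := prim_order_exists (prime_gt0 p_prime) zp.
have [m1|m1] := eqVneq m 1%N.
  by have := prim_expr_order hm; rewrite m1 expr1 => z1'; rewrite z1' eqxx in z1.
have em : m = p by apply/eqP; move/primeP: p_prime => [_ /(_ _ md)]; rewrite (negbTE m1).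
by apply/eqP; rewrite -em -(eq_prim_root_expr hm); apply/eqP.
Qed.

Lemma legendre1P (a p : nat) : (0 < p)%N -> ~~ (p %| a)%N ->
  legendre a p = 1 <-> exists x, x ^ 2 = a %[mod p].
Proof.
move=> p0 pa; rewrite /legendre (negbTE pa); case: existsP => [[x /eqP hx]|h]; first by split=> // _; exists x.
split=> // -[x hx]; case: h; exists (Ordinal (ltn_pmod x p0)).
by rewrite /= modnXm hx.
Qed.

Lemma legendre_nonresidue (a p x : nat) : (0 < p)%N -> legendre a p = -1 -> x ^ 2 <> a %[mod p].
Proof.
move=> p0 h e; have pa : ~~ (p %| a)%N by apply/negP => pa; rewrite /legendre pa in h.
have /(legendre1P p0 pa) e1 : exists x, x ^ 2 = a %[mod p] by exists x.
by rewrite e1 in h.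
Qed.

Lemma inverse_mod p x : prime p -> ~~ (p %| x)%N -> exists y, y * x = 1 %[mod p].
Proof.
move=> p_prime px; have x0 : (0 < x)%N by case: x px; rewrite ?dvdn0.
have cop : coprime x p by rewrite coprime_sym prime_coprime.
case: (egcdnP p x0) => a b e _; rewrite (eqP cop) in e.
by exists a; rewrite e modnMDl.
Qed.

(** Neither valuation is 0 modulo 3, so they agree or one is twice the other, and l = 2 mod 3. The
    factors 4 are those of [val_disc]. *)
Lemma twist_valuation (b b' : int) (l : nat) : (l %% 3)%N = 2%N -> (forall m, b <> 3 * m) ->
  (forall m, b' <> 3 * m) -> exists m : int,
  b' = (l ^ (if (4 * b == 4 * b' %[mod 3])%Z then 0 else 1))%N%:Z * b + 3 * m.
Proof.
move=> l3 hb hb'.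
have [r [q [eb hr]]] : exists r q, b = 3 * q + r /\ 0 <= r < 3.
  by exists (b %% 3)%Z, (b %/ 3)%Z; split; lia.
have [r' [q' [eb' hr']]] : exists r q, b' = 3 * q + r /\ 0 <= r < 3.
  by exists (b' %% 3)%Z, (b' %/ 3)%Z; split; lia.
have r0 : r <> 0 by move=> r0; apply: (hb q); lia.
have r0' : r' <> 0 by move=> e; apply: (hb' q'); lia.
have e3 (c : int) : (3 %| c)%Z -> exists m, c = 3 * m by move=> /dvdzP[m ->]; exists m; lia.
case: ifP => [h|/negbT h].
  have [m em] : exists m, 4 * b - 4 * b' = 3 * m by apply: e3; rewrite -eqz_mod_dvd.
  by exists (b - b' - m); lia.
have el : l = (3 * (l %/ 3) + 2)%N by rewrite {1}(divn_eq l 3) l3 mulnC.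
have rr : r <> r'.
  move=> e; move: h; rewrite eqz_mod_dvd => /negP; apply; apply/dvdzP.
  by exists (4 * (q - q')); rewrite eb eb' e; lia.
have e2 : r' = 2 * r - 3 \/ r' = 2 * r by lia.
rewrite expn1 el eb eb' PoszD PoszM.
case: e2 => ->.
  by exists (q' - 1 - (l %/ 3)%N%:Z * (3 * q + r) - 2 * q); ring.
by exists (q' - (l %/ 3)%N%:Z * (3 * q + r) - 2 * q); ring.
Qed.

Section TorsionIsomorphisms.

Variables (K : fieldType) (Kbar : closedFieldType) (iota : {rmorphism K -> Kbar}) (p : nat).
Hypotheses (p_prime : prime p) (p_neq0 : p%:R != 0 :> Kbar).

Lemma torsionP (E : elliptic K) (pt : point Kbar) : torsion (points iota E) p pt <->
  exists2 P : ept (curve_Kbar iota E), tor p P & val P = pt.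
Proof.
split=> [[on e]|[P hP <-]].
  exists (@mkept _ (curve_Kbar iota E) pt on) => //.
  by apply: val_inj; rewrite -mulptE.
split; first exact: (ept_oncurve P).
by rewrite -[points iota E]/(model (curve_Kbar iota E)) mulptE (hP : P *+ p = 0).
Qed.

Variables (E E' : elliptic K).
Local Notation EK := (curve_Kbar iota E).
Local Notation EK' := (curve_Kbar iota E').
Implicit Types (P Q : ept EK) (f : ept EK -> ept EK').

Record torsion_map f : Prop := {
  tmap_tor : forall P, tor p P -> tor p (f P);
  tmapD : forall P Q, tor p P -> tor p Q -> f (P + Q) = f P + f Q;
  tmap_eq0 : forall P, tor p P -> f P = 0 -> P = 0;
  tmap_gal : forall sg P, galois_aut iota sg -> tor p P -> f (gal_pt sg P) = gal_pt sg (f P) }.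

Lemma torsion_map_of_isomorphism phi : galois_isomorphism iota E E' p phi ->
  exists2 f, torsion_map f & forall P, tor p P -> val (f P) = phi (val P).
Proof.
move=> [phi_tor phi_inj _ phiD phi_gal].
have h P : exists Q : ept EK', tor p P -> tor p Q /\ val Q = phi (val P).
  have [hP|nP] := pselect (tor p P); last by exists 0.
  have /phi_tor/torsionP[Q hQ eQ] : torsion (points iota E) p (val P) by apply/torsionP; exists P.
  by exists Q.
have [f hf] := choice h; exists f; last by move=> P /hf[].
have tP P : tor p P -> torsion (points iota E) p (val P) by move=> hP; apply/torsionP; exists P.
have fD P Q : tor p P -> tor p Q -> f (P + Q) = f P + f Q.
  move=> hP hQ; have [_ e] := hf _ (torD hP hQ); have [_ eP] := hf _ hP; have [_ eQ] := hf _ hQ.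
  by apply: val_inj; rewrite [RHS]eptDE e eptDE phiD ?eP ?eQ //; exact: tP.
have f0 : f 0 = 0 := transport0 fD.
have tor0 : tor p (0 : ept EK) by rewrite /tor mul0rn.
split=> //.
- by move=> P /hf[].
- move=> P hP e; apply: val_inj; apply: phi_inj; try exact: tP.
  by have [_ <-] := hf _ hP; have [_ <-] := hf _ tor0; rewrite e f0.
move=> sg P hsg hP; have [hQ eQ] := hf _ hP; have [_ e] := hf _ (gal_pt_tor hsg hP).
apply: val_inj; rewrite e (gal_pt_val hsg hP) (gal_pt_val hsg hQ) eQ.
by apply: phi_gal => //; apply: tP.
Qed.

Lemma isomorphism_of_torsion_map f : torsion_map f ->
  exists2 phi, galois_isomorphism iota E E' p phi & forall P, phi (val P) = val (f P).
Proof.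
move=> [f_tor fD f0 f_gal].
pose phi pt := val (f (insubd (0 : ept EK) pt)).
have phiE P : phi (val P) = val (f P) by rewrite /phi valKd.
exists phi => //; split.
- by move=> _ /torsionP[P hP <-]; rewrite phiE; apply/torsionP; exists (f P) => //; apply: f_tor.
- move=> _ _ /torsionP[P hP <-] /torsionP[Q hQ <-]; rewrite !phiE => /val_inj e.
  by rewrite (transport_inj fD f0 hP hQ e).
- move=> _ /torsionP[Q hQ <-]; have [P hP eP] := transport_surj p_prime p_neq0 p_neq0 fD f0 hQ.
  by exists (val P); rewrite ?phiE ?eP //; apply/torsionP; exists P.
- move=> _ _ /torsionP[P hP <-] /torsionP[Q hQ <-].
  by rewrite -[points iota E]/(model EK) -eptDE !phiE fD.
move=> sg _ hsg /torsionP[P hP <-].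
by rewrite -(gal_pt_val hsg hP) !phiE f_gal // (gal_pt_val hsg (f_tor _ hP)).
Qed.

End TorsionIsomorphisms.

Theorem theorem1p4
  (l : nat) (l_prime : prime l) (l_mod3 : (l %% 3)%N = 2%N)
  (Ql : fieldType) (vl : Ql -> int) (Ql_l : is_Ql l vl)
  (K : fieldExtType Ql) (K_quadratic : \dim {:K} = 2%N)
  (v : K -> int) (v_normalized : normalized_valuation v)
  (K_ramified : ramified vl v)
  (Kbar : closedFieldType) (iota : {rmorphism K -> Kbar})
  (Kbar_closure : is_algebraic_closure iota)
  (p : nat) (p_prime : prime p) (p_neq_l : p <> l) (p_ge5 : (5 <= p)%N)
  (s : nat) (s_nonresidue : legendre s p = -1)
  (E E' : elliptic K)
  (E_3pt : exists P : point K, has_order E P 3)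
  (E'_3pt : exists P : point K, has_order E' P 3)
  (E_potentially_good : potentially_good_reduction v iota E)
  (E'_potentially_good : potentially_good_reduction v iota E')
  (E_defect : defect v iota E 3) (E'_defect : defect v iota E' 3)
  (r : nat)
  (r_def : r = if (v (disc E) == v (disc E') %[mod 3])%Z then 0%N else 1%N)
  (E_E'_isomorphic : torsion_isomorphic iota E E' p) :
  (symplectically_isomorphic iota E E' p <-> legendre l p ^+ r = 1) /\
  ~ (symplectically_isomorphic iota E E' p /\
     anti_symplectically_isomorphic iota E E' p s).
Proof.
have [r1 [s1 [t1 [A [B hAB]]]]] := three_torsion_model E_3pt.
have [r2 [s2 [t2 [A' [B' hAB']]]]] := three_torsion_model E'_3pt.
have B0 := B_neq0 hAB; have B'0 := B_neq0 hAB'.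
have vB := val_B_mod3 l_prime Ql_l K_quadratic v_normalized K_ramified Kbar_closure l_mod3 hAB E_potentially_good E_defect.
have vB' := val_B_mod3 l_prime Ql_l K_quadratic v_normalized K_ramified Kbar_closure l_mod3 hAB' E'_potentially_good E'_defect.
have vd := val_disc l_prime Ql_l K_quadratic v_normalized K_ramified Kbar_closure l_mod3 hAB E_potentially_good E_defect.
have vd' := val_disc l_prime Ql_l K_quadratic v_normalized K_ramified Kbar_closure l_mod3 hAB' E'_potentially_good E'_defect.
have rA := ratio_max l_prime Ql_l K_quadratic v_normalized K_ramified Kbar_closure l_mod3 hAB E_potentially_good E_defect.
have rA' := ratio_max l_prime Ql_l K_quadratic v_normalized K_ramified Kbar_closure l_mod3 hAB' E'_potentially_good E'_defect.
have [m em] : exists m : int, v B' = (l ^ r)%N%:Z * v B + 3 * m.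
  by rewrite r_def vd vd'; apply: twist_valuation.
have [al [w [c [tau [[alE w2 hc htau] [c_red c_al tau_al tau_w]]]]]] :=
  inertia_generator l_prime Ql_l K_quadratic v_normalized K_ramified Kbar_closure l_mod3 B0 vB.
have al0 : al != 0.
  by apply: contraNneq B0 => e; rewrite -(fmorph_eq0 iota) -alE e expr0n.
have [al' [al'0 al'E coc]] :=
  cocycle_twist l_prime Ql_l K_quadratic v_normalized K_ramified Kbar_closure l_mod3 B0 B'0 al0 alE em.
have hA := vm_ratio l_prime Ql_l K_quadratic v_normalized K_ramified Kbar_closure al0 alE rA.
have hA' := vm_ratio l_prime Ql_l K_quadratic v_normalized K_ramified Kbar_closure al'0 al'E rA'.
have ch0 n : (0 < n)%N -> n%:R != 0 :> Kbar := Kbar_char0 Ql_l iota (n := n).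
have p0 := prime_gt0 p_prime; have pK := ch0 _ p0.
have lp : ~~ (l %| p)%N by rewrite dvdn_prime2 //; apply/eqP => e; apply: p_neq_l.
have pl : ~~ (p %| l)%N by rewrite dvdn_prime2 //; apply/eqP.
have gV := @galois_V l l_prime Ql vl Ql_l K K_quadratic v v_normalized K_ramified Kbar iota Kbar_closure.
have gr := @galois_red l l_prime Ql vl Ql_l K K_quadratic v v_normalized K_ramified Kbar iota Kbar_closure.
have r3 := res3 l_prime Ql_l K_quadratic v_normalized K_ramified Kbar_closure l_mod3.
have rl := res_l l_prime Ql_l K_quadratic v_normalized K_ramified Kbar_closure.
have rp := res_nat_neq0 l_prime Ql_l K_quadratic v_normalized K_ramified Kbar_closure lp.
have [f [f_tor fD f0 f_gal f_weil]] :=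
  comparison gV gr ch0 r3 l_prime rl p_prime p_ge5 rp hAB al0 alE hA hAB' al'0 al'E hA' coc.
(* For an isomorphism g, the map M with f M = g commutes with the Galois action, so it is a scalar
   a. Comparing exponents on a pair with nontrivial Weil value gives l^r a^2 = n modulo p. *)
have exponent phi n : galois_isomorphism iota E E' p phi -> raises_weil_pairing iota E E' p n phi ->
    exists a, l ^ r * a ^ 2 = n %[mod p].
  move=> /torsion_map_of_isomorphism[g [g_tor gD g0 g_gal] gE] hphi.
  have ex P : exists Q, tor p P -> tor p Q /\ f Q = g P.
    have [hP|nP] := pselect (tor p P); last by exists 0.
    by have [Q hQ eQ] := transport_surj p_prime pK pK fD f0 (g_tor _ hP); exists Q.
  have [M hM] := choice ex.
  have [a ha] : exists a, forall P, tor p P -> M P = P *+ a.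
    apply: (galois_commutant gV gr ch0 r3 p_prime p_ge5 rp hAB al0 alE hA w2 hc htau c_red c_al tau_al tau_w).
    - by move=> P /hM[].
    - move=> P Q hP hQ; have [hMP eP] := hM _ hP; have [hMQ eQ] := hM _ hQ.
      have [hM' e] := hM _ (torD hP hQ).
      by apply: (transport_inj fD f0 hM' (torD hMP hMQ)); rewrite e fD // eP eQ gD.
    move=> sg P hsg hP; have [hMP eP] := hM _ hP; have [hM' e] := hM _ (gal_pt_tor hsg hP).
    apply: (transport_inj fD f0 hM' (gal_pt_tor hsg hMP)).
    by rewrite e f_gal // eP g_gal.
  have [S [T [hS hT I]]] := torsion_basis (curve_Kbar iota E) p_prime pK.
  have T0 : T != 0.
    apply/eqP => T0; have [] := I 0%N 1%N; first by rewrite T0 mul0rn mulr0n addr0.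
    by move=> _; rewrite gtnNdvd // prime_gt1.
  have [{I}S' hS' w1] := weil_nontrivial ch0 p_prime p_ge5 hT T0.
  exists a; apply: (expr_eq_mod p_prime (weil_exp_p ch0 p_prime hS' hT) w1).
  have tP (P : ept (curve_Kbar iota E)) : tor p P -> torsion (points iota E) p (val P) by move=> hP; apply/torsionP; exists P.
  have := hphi _ _ (tP _ hS') (tP _ hT); rewrite -!gE //.
  have [_ <-] := hM _ hS'; have [_ <-] := hM _ hT.
  rewrite !ha // => h.
  have {h} <- : weil p (f (S' *+ a)) (f (T *+ a)) = weil p S' T ^+ n := h.
  rewrite f_weil; try exact: torMn.
  by rewrite (weil_scale ch0 p_prime p_ge5) // -exprM mulnC mulnn.
split; last first.
  move=> [[phi hphi /(exponent _ _ hphi)[a ea]] [psi hpsi /(exponent _ _ hpsi)[b eb]]].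
  (* With l^r a^2 = 1 and l^r b^2 = s, the non-residue s would be the square of l^r a b. *)
  apply: (legendre_nonresidue p0 s_nonresidue (x := l ^ r * a * b)).
  have -> : ((l ^ r * a * b) ^ 2 = (l ^ r * a ^ 2) * (l ^ r * b ^ 2))%N by ring.
  by rewrite -modnMm ea eb modnMm mul1n.
have er : r = 0%N \/ r = 1%N by rewrite r_def; case: ifP; [left | right].
split=> [[phi hphi /(exponent _ _ hphi)[a ea]]|].
  case: er => er; rewrite er ?expr0 // expr1; apply/(legendre1P p0 pl).
  (* From l a^2 = 1 it follows that (l a)^2 = l. *)
  exists (l * a)%N; move: ea; rewrite er expn1 => ea.
  have -> : ((l * a) ^ 2 = l * (l * a ^ 2))%N by ring.
  by rewrite -modnMmr ea modnMmr muln1.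
(* The comparison map composed with multiplication by a raises the pairing to the power l^r a^2; for
   r = 1, a is the inverse of a square root of l. *)
move=> hl; have [a ea] : exists a, l ^ r * a ^ 2 = 1 %[mod p].
  case: er hl => ->; first by exists 1%N.
  rewrite expr1 => /(legendre1P p0 pl)[x ex].
  have px : ~~ (p %| x)%N.
    by apply: contra pl => px; rewrite /dvdn -ex -/(p %| x ^ 2)%N Euclid_dvdX // px.
  have [y ey] := inverse_mod p_prime px; exists y; rewrite expn1 -modnMml -ex modnMml.
  have -> : (x ^ 2 * y ^ 2 = (y * x) * (y * x))%N by ring.
  by rewrite -modnMm ey modnMm.
have pa : ~~ (p %| a)%N.
  apply/negP => pa; move: ea.
  by rewrite (eqP (dvdn_mull _ (dvdn_exp _ pa))) // modn_small // prime_gt1.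
have aT : torsion_map p (fun P : ept (curve_Kbar iota E) => f (P *+ a)).
  split.
  - by move=> P hP; apply: f_tor; apply: torMn.
  - by move=> P Q hP hQ; rewrite mulrnDl fD //; apply: torMn.
  - move=> P hP /(f0 _ (torMn a hP)) e; apply/eqP/negPn/negP => P0.
    by have := tor_mul_neq0 p_prime hP P0 pa; rewrite e eqxx.
  by move=> sg P hsg hP; rewrite -(gal_ptMn hsg _ hP) f_gal //; apply: torMn.
have [phi hphi ephi] := isomorphism_of_torsion_map p_prime pK aT.
exists phi => // _ _ /torsionP[P hP <-] /torsionP[Q hQ <-].
rewrite !ephi; transitivity (weil p (f (P *+ a)) (f (Q *+ a))) => //.
transitivity (weil p P Q ^+ 1) => //; rewrite f_weil; try exact: torMn.
rewrite (weil_scale ch0 p_prime p_ge5) // -exprM mulnn mulnC.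
have ep := weil_exp_p ch0 p_prime hP hQ.
by rewrite -(expr_mod _ ep) ea (expr_mod _ ep).
Qed.
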